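(* For each integer $m\ge1$, let $$\mathcal T_m=\{(Q,Z)\in\mathbb C^2:\ \operatorname{Re}Q>(\operatorname{Re}Z)^{2m}\}.$$ Then $\mathcal T_m$ is a convex Kobayashi hyperbolic domain. Its boundary is smooth and real analytic, has D'Angelo type at most $2m$ everywhere, and has type exactly $2m$ at the origin. Moreover, $$m\log 2\ \le\ \delta_{\mathrm{loc}}(\mathcal T_m,0)=\delta(\mathcal T_m,K_{\mathcal T_m}).$$
   Context: Kobayashi distance: for a domain $\Omega\subset\mathbb C^n$, $k_\Omega(z;v)=\inf\{|\lambda|:\lambda\in\mathbb C,\ f:\mathbb D\to\Omega \text{ holomorphic},\ f(0)=z,\ \lambda f'(0)=v\}$, and $K_\Omega(x,y)=\inf_\gamma\int k_\Omega(\gamma;\gamma')\,dt$ over absolutely continuous curves in $\Omega$ from $x$ to $y$ (so $k_{\mathbb D}(\zeta;v)=|v|/(1-|\zeta|^2)$). $\Omega$ is Kobayashi hyperbolic if $K_\Omega(x,y)>0$ for $x\ne y$. Hyperbolicity constant: a metric space $(X,d)$ is $\delta$-hyperbolic if $(x\mid z)_o\ge\min\{(x\mid y)_o,(y\mid z)_o\}-\delta$ for all $o,x,y,z\in X$, where $(x\mid y)_o=\frac12(d(x,o)+d(y,o)-d(x,y))$; $\delta(X,d)\in[0,+\infty]$ is the infimum of all such $\delta\ge0$. Local constant: for $p\in\partial\Omega$, $\delta_{\mathrm{loc}}(\Omega,p)=\inf_{V\ni p}\delta(\Omega\cap V,K_\Omega|_{\Omega\cap V})$, with $V$ ranging over Euclidean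 neighborhoods of $p$ and $K_\Omega|_{\Omega\cap V}$ the restriction of the ambient distance $K_\Omega$. D'Angelo type: for a smooth function $g$ near $0\in\mathbb C$, $\mathrm{ord}_0 g=\min\{a+b:\partial_\zeta^a\partial_{\bar\zeta}^b g(0)\ne0\}$ ($+\infty$ if there is none); for a nonconstant holomorphic curve germ $\phi:(\mathbb C,0)\to(\mathbb C^n,\xi)$, $\mathrm{ord}_0\phi=\min_j\mathrm{ord}_0(\phi_j-\xi_j)$; the D'Angelo type of $\partial\Omega$ at $\xi$ is $\sup_\phi \mathrm{ord}_0(\rho\circ\phi)/\mathrm{ord}_0\phi$, with $\rho$ a $C^\infty$ local defining function near $\xi$ and $\phi$ ranging over nonconstant holomorphic curve germs through $\xi$. *)

(* Defs.v *)
From HB Require Import structures.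
From mathcomp Require Import all_boot all_order all_algebra.
From mathcomp Require Import all_classical all_reals all_analysis.
From mathcomp.real_closed Require Import complex.

Set Implicit Arguments.
Unset Strict Implicit.
Unset Printing Implicit Defensive.

Import Order.TTheory GRing.Theory Num.Theory.
Import numFieldNormedType.Exports.

Local Open Scope classical_set_scope.
Local Open Scope ring_scope.

(* Bundling the structure makes the topology and norm of a numFieldType
   available on the complex numbers, and on C^n = 'rV[Cx R]_n. *)
Definition Cx (R : realType) : numClosedFieldType := R[i].

Section Realification.
Variables (R : realType) (n : nat).

(* C^n = R^2n, real parts first, then imaginary parts. *)
Definition to_real (z : 'rV[Cx R]_n) : 'rV[R]_(n + n) :=
  row_mx (map_mx (fun w : Cx R => complex.Re w) z)
         (map_mx (fun w : Cx R => complex.Im w) z).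

Definition of_real (x : 'rV[R]_(n + n)) : 'rV[Cx R]_n :=
  \row_j (Complex (x 0 (lshift n j)) (x 0 (rshift n j)) : Cx R).

End Realification.

Section Sets.
Variables (R : realType) (n : nat).

Definition is_domain (Omega : set 'rV[Cx R]_n) : Prop :=
  [/\ Omega !=set0, open Omega & connected Omega].

(* [convex_set] quantifies over scalars t : Cx R with 0 <= t <= 1; in the
   partial order of the complex numbers these are the reals of [0, 1]. *)
Definition is_convex (Omega : set 'rV[Cx R]_n) : Prop :=
  convex_set (Omega : set (convex_lmodType 'rV[Cx R]_n)).

Definition boundary (Omega : set 'rV[Cx R]_n) : set 'rV[Cx R]_n :=
  closure Omega `\` interior Omega.

End Sets.

Section Kobayashi.
Variables (R : realType) (n : nat).

Definition unit_disc : set (Cx R) := [set zeta | `|zeta| < 1].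

Definition holomorphic_disc (Omega : set 'rV[Cx R]_n)
    (f : Cx R -> 'rV[Cx R]_n) : Prop :=
  forall zeta, unit_disc zeta -> derivable f zeta 1 /\ Omega (f zeta).

Definition kobayashi_metric (Omega : set 'rV[Cx R]_n)
    (z v : 'rV[Cx R]_n) : \bar R :=
  ereal_inf [set (Normc.normc lambda)%:E | lambda in
    [set lambda : Cx R | exists f : Cx R -> 'rV[Cx R]_n,
      [/\ holomorphic_disc Omega f, f 0 = z & lambda *: derive1 f 0 = v]]].

Definition abs_continuous (V : normedModType R) (a b : R) (f : R -> V) : Prop :=
  forall e : R, 0 < e -> exists2 d : R, 0 < d &
    forall (N : nat) (u v : 'I_N -> R),
      (forall i, [/\ a <= u i, u i <= v i & v i <= b]) ->
      (forall i j, i != j -> v i <= u j \/ v j <= u i) ->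
      \sum_(i < N) (v i - u i) < d ->
      \sum_(i < N) `|f (v i) - f (u i)| < e.

Definition curve_in (Omega : set 'rV[Cx R]_n) (a b : R)
    (gamma : R -> 'rV[Cx R]_n) : Prop :=
  [/\ a <= b, abs_continuous a b (@to_real R n \o gamma)
    & forall t, a <= t <= b -> Omega (gamma t)].

(* Meaningful for almost every t when gamma is absolutely continuous. *)
Definition velocity (gamma : R -> 'rV[Cx R]_n) (t : R) : 'rV[Cx R]_n :=
  of_real (derive1 (@to_real R n \o gamma) t).

Definition kobayashi_length (Omega : set 'rV[Cx R]_n) (a b : R)
    (gamma : R -> 'rV[Cx R]_n) : \bar R :=
  (\int[lebesgue_measure]_(t in `[a, b])
     kobayashi_metric Omega (gamma t) (velocity gamma t))%E.

Definition kobayashi (Omega : set 'rV[Cx R]_n) (x y : 'rV[Cx R]_n) : \bar R :=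
  ereal_inf [set l | exists a b gamma,
    [/\ curve_in Omega a b gamma, gamma a = x, gamma b = y
      & l = kobayashi_length Omega a b gamma]].

Definition kobayashi_hyperbolic (Omega : set 'rV[Cx R]_n) : Prop :=
  forall x y, Omega x -> Omega y -> x != y -> (0 < kobayashi Omega x y)%E.

(* [kobayashi] is finite on pairs of points of a domain. *)
Definition kobayashi_dist (Omega : set 'rV[Cx R]_n) (x y : 'rV[Cx R]_n) : R :=
  fine (kobayashi Omega x y).

End Kobayashi.

Section Gromov.
Variables (R : realType) (T : Type).
Implicit Types (X : set T) (d : T -> T -> R).

Definition gromov_product d (o x y : T) : R := (d x o + d y o - d x y) / 2.

Definition gromov_hyperbolic X d (delta : R) : Prop :=
  forall o x y z, X o -> X x -> X y -> X z ->
    Num.min (gromov_product d o x y) (gromov_product d o y z) - delta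
      <= gromov_product d o x z.

Definition gromov_constant X d : \bar R :=
  ereal_inf [set delta%:E | delta in
    [set delta : R | 0 <= delta /\ gromov_hyperbolic X d delta]].

End Gromov.

Definition local_gromov_constant (R : realType) (n : nat)
    (Omega : set 'rV[Cx R]_n) (p : 'rV[Cx R]_n) : \bar R :=
  ereal_inf [set gromov_constant (Omega `&` V) (kobayashi_dist Omega) | V in
    [set V : set 'rV[Cx R]_n | nbhs p V]].

Section Regularity.
Variables (R : realType) (k : nat).
Implicit Types (f : 'rV[R]_k -> R) (x : 'rV[R]_k).

Definition basis_vec (i : 'I_k) : 'rV[R]_k := delta_mx 0 i.

Definition iter_partial (s : seq 'I_k) f : 'rV[R]_k -> R :=
  foldr (fun i g => fun x => 'D_(basis_vec i) g x) f s.

Definition smooth_near f x : Prop :=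
  \forall y \near x, forall s : seq 'I_k,
    {for y, continuous (iter_partial s f)} /\
    forall i : 'I_k, derivable (iter_partial s f) y (basis_vec i).

Definition monomial (alpha : {ffun 'I_k -> nat}) x : R :=
  \prod_(i < k) x 0 i ^+ alpha i.

(* The sum of an absolutely convergent multiple series is the limit of its
   partial sums over the boxes {0, ..., N-1}^k. *)
Definition real_analytic_near f x : Prop :=
  exists c : {ffun 'I_k -> nat} -> R, \forall y \near x,
    summable [set: {ffun 'I_k -> nat}]
      (fun alpha => (c alpha * monomial alpha (y - x))%:E) /\
    (fun N : nat => \sum_(beta : {ffun 'I_k -> 'I_N})
       let alpha := [ffun i => nat_of_ord (beta i)] in
       c alpha * monomial alpha (y - x)) @ \oo --> f y.

End Regularity.

Section Boundaries.
Variables (R : realType) (n : nat).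
Implicit Types (Omega : set 'rV[Cx R]_n) (xi : 'rV[Cx R]_n).

Definition local_defining_function
    (regular : ('rV[R]_(n + n) -> R) -> 'rV[R]_(n + n) -> Prop)
    Omega xi (rho : 'rV[R]_(n + n) -> R) : Prop :=
  [/\ regular rho (to_real xi),
      exists i, 'D_(basis_vec R i) rho (to_real xi) != 0
    & \forall z \near xi, Omega z <-> rho (to_real z) < 0].

Definition smooth_defining_function :=
  local_defining_function (@smooth_near R (n + n)).

Definition smooth_boundary Omega : Prop :=
  forall xi, boundary Omega xi ->
    exists rho, smooth_defining_function Omega xi rho.

Definition real_analytic_boundary Omega : Prop :=
  forall xi, boundary Omega xi ->
    exists rho,
      local_defining_function (@real_analytic_near R (n + n)) Omega xi rho.

End Boundaries.

Section DAngelo.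
Variable R : realType.

(* Derivative of g at z along the real direction w. *)
Definition real_derivative (w : Cx R) (g : Cx R -> Cx R) (z : Cx R) : Cx R :=
  let h (t : R) : Cx R := g (z + (real_complex R t : Cx R) * w) in
  Complex (derive1 (fun t : R => complex.Re (h t)) 0)
          (derive1 (fun t : R => complex.Im (h t)) 0).

Definition imag_unit : Cx R := Complex 0 1.

Definition wirtinger (g : Cx R -> Cx R) (z : Cx R) : Cx R :=
  (real_derivative 1 g z - imag_unit * real_derivative imag_unit g z) / 2.

Definition wirtinger_bar (g : Cx R -> Cx R) (z : Cx R) : Cx R :=
  (real_derivative 1 g z + imag_unit * real_derivative imag_unit g z) / 2.

Definition order0 (g : Cx R -> Cx R) : \bar R :=
  ereal_inf [set (ab.1 + ab.2)%:R%:E | ab in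
    [set ab : nat * nat |
      iter ab.1 wirtinger (iter ab.2 wirtinger_bar g) 0 != 0]].

Variable n : nat.

Definition nonconstant_germ (xi : 'rV[Cx R]_n)
    (phi : Cx R -> 'rV[Cx R]_n) : Prop :=
  [/\ \forall zeta \near (0 : Cx R), derivable phi zeta 1,
      phi 0 = xi
    & ~ (\forall zeta \near (0 : Cx R), phi zeta = xi)].

Definition curve_order0 (xi : 'rV[Cx R]_n)
    (phi : Cx R -> 'rV[Cx R]_n) : \bar R :=
  \big[Order.min/+oo%E]_(j < n) order0 (fun zeta => phi zeta 0 j - xi 0 j).

(* The divisor lies in [1, +oo[ for a nonconstant germ. *)
Definition dangelo_type (rho : 'rV[R]_(n + n) -> R)
    (xi : 'rV[Cx R]_n) : \bar R :=
  ereal_sup [set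
    (order0 (fun zeta => real_complex R (rho (to_real (phi zeta))))
       / curve_order0 xi phi)%E | phi in nonconstant_germ xi].

End DAngelo.

(* The coordinates 0 and 1 are Q and Z. *)
Definition tube_domain (R : realType) (m : nat) : set 'rV[Cx R]_2 :=
  [set w | (complex.Re (w 0 1 : Cx R)) ^+ (2 * m)
             < complex.Re (w 0 0 : Cx R)].
Arguments tube_domain R m%_nat_scope _ : clear implicits.

(* Main.v *)
(* Every supporting line of the convex function x^(2m) gives an affine complex
   functional l with positive real part on the tube, so the Schwarz lemma for
   the half-plane yields |dl(v)| <= 2 Re l(z) k(z; v). Integrated along
   absolutely continuous curves these bounds separate points. They also show,
   with vertical-horizontal-vertical paths for the upper bound, that the
   distance from (1, ic) to (1, i(c + b)) is 2m log b + O(1) for b >= 1. The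
   four-point inequality for (1, iy), at y = 0, 1, sqrt 2, 1 + sqrt 2 times t,
   improves the upper bound by m log 2 - delta each time it is applied, so
   delta >= m log 2. The dilations (Q, Z) |-> (s^(2m) Q, s Z) are isometries
   shrinking any four points into a given neighbourhood of 0: the local
   constant is the global one.

   For the type, a defining function rho is comparable to
   r = (Re Z)^(2m) - Re Q near a boundary point. If rho o phi vanishes to
   order > 2mk along a germ phi of order k, then averaging r o phi over the
   rotations of a regular polygon cancels the harmonic terms up to that order;
   the convex remainder bounds (Re (phi_2 - phi_2(0)))^(2m), hence the k-th
   coefficients of both components of phi vanish, a contradiction. At the
   origin zeta |-> (0, zeta) attains 2m. *)

Require Import Defs.
From HB Require Import structures.
From mathcomp Require Import all_boot all_order all_algebra.
From mathcomp Require Import all_classical all_reals all_analysis.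
From mathcomp.real_closed Require Import complex.
From mathcomp Require Import measurable_realfun ring lra.

Set Implicit Arguments.
Unset Strict Implicit.
Unset Printing Implicit Defensive.

Import Order.TTheory GRing.Theory Num.Theory.
Import numFieldNormedType.Exports.

Local Open Scope classical_set_scope.
Local Open Scope ring_scope.

(** * Absolutely continuous functions *)

(** The Kobayashi length integrates the almost everywhere velocity of a curve, so a pointwise bound
    on the metric bounds the distance only through the fundamental theorem of calculus for
    absolutely continuous functions; total variation and Radon-Nikodym supply it, and integrals of
    the metric are handled as suprema over simple functions. The upper and lower distance bounds
    differ by a constant, so a single four-point inequality would give [m log 2] only up to a
    bounded error. Translation in Im Z makes the distance a function [D] of the difference. With
    [r = sqrt 2], the equation [(r - 1) (r + 1) = 1] gives the competing sums [2 D(t)] and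
    [D((r - 1) t) + D((r + 1) t)] the same main term [4 m log t], while [2 D(r t)] has
    [4 m log t + 2 m log 2]. An upper bound valid on a half-line is thus improved by
    [m log 2 - delta] on a smaller one; if [delta < m log 2], repetition contradicts the lower
    bound. For the type, an arbitrary defining function is comparable to the model only in size, so
    orders are read off from growth: hence the passage between Wirtinger jets and bounds by powers
    of [|z|]. *)

Section AbsoluteContinuity.
Variable R : realType.
Implicit Types (a b e d x y : R) (f g : R -> R) (L : seq (R * R)).

Definition nonoverlapping (I J : R * R) : bool := (I.2 <= J.1) || (J.2 <= I.1).

Definition itv_family a b L : bool :=
  all (fun I => [&& a <= I.1, I.1 <= I.2 & I.2 <= b]) L && pairwise nonoverlapping L.

Definition total_length L : R := \sum_(I <- L) (I.2 - I.1).

Definition total_increment f L : R := \sum_(I <- L) `|f I.2 - f I.1|.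

(** Lists replace indexed families so that one interval can be exchanged for a subdivision, and
    [<= e] is not strict so that it survives the supremum in the total variation. *)
Definition seq_abs_continuous a b f : Prop :=
  forall e, 0 < e -> exists2 d, 0 < d &
    forall L, itv_family a b L -> total_length L < d -> total_increment f L <= e.

Lemma abs_continuous_seq a b f : abs_continuous a b f -> seq_abs_continuous a b f.
Proof.
move=> H e /H [d d0 Hd]; exists d => // L /andP[/allP La /(pairwiseP (0, 0)) Lp] Ll.
pose u (i : 'I_(size L)) := (nth (0,0) L i).1.
pose v (i : 'I_(size L)) := (nth (0,0) L i).2.
have E (F : R * R -> R) : \sum_(I <- L) F I = \sum_(i < size L) F (nth (0,0) L i).
  by rewrite (big_nth (0,0)) big_mkord.
rewrite /total_increment E; apply/ltW; apply: (Hd _ u v).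
- by move=> i; have /and3P[? ? ?] := La _ (mem_nth (0,0) (ltn_ord i)).
- move=> i j ij; have [lt_ij|lt_ji|eq_ij] := ltngtP (i : nat) j.
  + by have /orP := Lp i j (ltn_ord i) (ltn_ord j) lt_ij.
  + by have /orP[|] := Lp j i (ltn_ord j) (ltn_ord i) lt_ji; [right|left].
  + by move/val_inj: eq_ij ij => ->; rewrite eqxx.
- by have := Ll; rewrite /total_length E.
Qed.

Definition cells a (s : seq R) := zip (a :: s) s.

Lemma cells_cons a x s : cells a (x :: s) = (a, x) :: cells x s.
Proof. by []. Qed.

Lemma variation_cells a b f s : itv_partition a b s ->
  variation a b f s = total_increment f (cells a s).
Proof.
move=> H; rewrite variation_zip // /total_increment /cells.
have -> : zip s (a :: s) = [seq (p.2, p.1) | p <- zip (a :: s) s].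
  by elim: s a {H} => //= x s IH a; congr cons; exact: IH.
by rewrite big_map.
Qed.

Lemma cells_bounds a s : path <%R a s ->
  all (fun I => [&& a <= I.1, I.1 <= I.2 & I.2 <= last a s]) (cells a s).
Proof.
elim: s a => // x s IH a /= /andP[ax xs].
rewrite lexx (ltW ax) /= /cells /=.
have xl : x <= last x s.
  have := xs; rewrite lt_path_sortedE => /andP[/allP H _].
  by have := mem_last x s; rewrite inE => /predU1P[->//|/H/ltW].
rewrite xl /=; apply: sub_all (IH x xs) => I /and3P[xI ->].
by rewrite (le_trans (ltW ax) xI).
Qed.

Lemma cells_nonoverlapping a s : path <%R a s -> pairwise nonoverlapping (cells a s).
Proof.
elim: s a => // x s IH a /= /andP[ax xs]; rewrite /cells /= IH // andbT.
apply: sub_all (cells_bounds xs) => I /and3P[xI _ _].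
by rewrite /nonoverlapping xI.
Qed.

Lemma cells_length a s : total_length (cells a s) = last a s - a.
Proof.
rewrite /total_length; elim: s a => [|x s IH] a.
  by rewrite /cells big_nil /= subrr.
by rewrite cells_cons big_cons IH /=; ring.
Qed.

(** The pieces of the head interval are moved behind [L]: the induction in [total_variation_family]
    treats [L] as still to be refined and [L'] as already refined. *)
Lemma itv_family_refine a b x y L L' C :
  itv_family a b ((x, y) :: L ++ L') ->
  all (fun I => [&& x <= I.1, I.1 <= I.2 & I.2 <= y]) C ->
  pairwise nonoverlapping C -> itv_family a b (L ++ (C ++ L')).
Proof.
move=> /andP[/= /andP[/and3P[/= ax xy yb] aLL']] /andP[/allP xLL' pLL'] /allP CxyC pC.
have sub M : {subset M <= L ++ L'} -> forall I J, I \in C -> J \in M -> nonoverlapping I J.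
  move=> sM I J /CxyC /and3P[xI _ Iy] /sM /xLL'; rewrite /nonoverlapping /=.
  by move=> /orP[yJ|Jx]; rewrite ?(le_trans Iy yJ) ?(le_trans Jx xI) // orbT.
have nC I J : nonoverlapping I J = nonoverlapping J I by rewrite /nonoverlapping orbC.
apply/andP; split.
  rewrite !all_cat; move: aLL'; rewrite all_cat => /andP[-> ->]; rewrite andbT /=.
  apply/allP => I /CxyC /and3P[xI -> Iy].
  by rewrite (le_trans ax xI) (le_trans Iy yb).
move: pLL'; rewrite !pairwise_cat => /and3P[LL' -> ->]; rewrite pC !andbT /=.
have -> : allrel nonoverlapping C L'.
  by apply/allrelP => I J; apply: sub => K KL; rewrite mem_cat KL orbT.
rewrite andbT; apply/allrelP => I J IL; rewrite mem_cat => /orP[JC|JL'].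
  by rewrite nC; apply: sub JC IL => K KL; rewrite mem_cat KL.
exact: (allrelP LL').
Qed.

(** Invariant of an induction that trades increments for total variations one interval at a time.
    Subdividing the head interval does not change the total length, so the induction hypothesis
    bounds the increment over every subdivision, and the bound passes to the supremum. *)
Lemma total_variation_family a b f e d :
  (forall L, itv_family a b L -> total_length L < d -> total_increment f L <= e) ->
  forall L L', itv_family a b (L ++ L') -> total_length (L ++ L') < d ->
  (\sum_(I <- L) total_variation I.1 I.2 f + (total_increment f L')%:E <= e%:E)%E.
Proof.
move=> H; elim=> [|[x y] L IH] L' fL lL.
  by rewrite big_nil add0e lee_fin; exact: H.
have /andP[/= /andP[/and3P[/= ax xy yb] aLL'] /andP[/allP xLL' pLL']] := fL.
have lL' : total_length ((x, y) :: L ++ L') = (y - x) + total_length (L ++ L').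
  by rewrite /total_length big_cons.
have tv0 (M : seq (R * R)) : all (fun I => [&& a <= I.1, I.1 <= I.2 & I.2 <= b]) M ->
    (0 <= \sum_(I <- M) total_variation I.1 I.2 f)%E.
  move=> /allP HM; rewrite big_seq; apply: sume_ge0 => I /HM /and3P[_ I12 _].
  exact: total_variation_ge0.
have ti0 M : (0 <= total_increment f M).
  by apply: sumr_ge0.
set S := (\sum_(I <- L) total_variation I.1 I.2 f + (total_increment f L')%:E)%E.
have S0 : (0 <= S)%E.
  by apply: adde_ge0; [apply: tv0; move: aLL'; rewrite all_cat => /andP[]|rewrite lee_fin].
have Se : (S <= e%:E)%E.
  apply: IH; first by rewrite /itv_family aLL' pLL'.
  by move: lL; rewrite cat_cons lL'; lra.
have Sf : S \is a fin_num.
  by rewrite fin_numE; apply/andP; split; rewrite -?ltNye -?ltey;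
    [exact: lt_le_trans S0|exact: le_lt_trans Se (ltry _)].
rewrite big_cons -addeA -/S /= -leeBrDr //.
have [yx|nyx] := eqVneq x y.
  by rewrite yx total_variationxx leeBrDr // add0e.
apply/ereal_supP => _ [_ [s ps <-] <-].
rewrite variation_cells //.
have [pathx /eqP lasty] := ps.
have := IH (cells x s ++ L') (itv_family_refine fL _ (cells_nonoverlapping pathx)).
rewrite -lasty cells_bounds // => /(_ isT).
have -> : total_length (L ++ cells x s ++ L') = total_length ((x, y) :: L ++ L').
  rewrite lL' /total_length !big_cat /= -/(total_length (cells x s)) cells_length lasty.
  by rewrite addrCA.
move=> /(_ lL).
have -> : total_increment f (cells x s ++ L') = total_increment f (cells x s) + total_increment f L'.
  by rewrite /total_increment big_cat.
by rewrite EFinD addeCA leeBrDr.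
Qed.

Lemma itv_family1 a b x y : a <= x -> x <= y -> y <= b -> itv_family a b [:: (x, y)].
Proof. by move=> ax xy yb; rewrite /itv_family /= ax xy yb. Qed.

Lemma seq_abs_continuous_bounded_variation a b f : a <= b ->
  seq_abs_continuous a b f -> bounded_variation a b f.
Proof.
move=> ab /(_ 1 ltr01) [d d0 Hd]; apply/bounded_variationP => //.
have small x y : a <= x -> x <= y -> y <= b -> y - x < d ->
    (total_variation x y f <= 1%:E)%E.
  move=> ax xy yb yxd.
  have := @total_variation_family a b f 1 d Hd [:: (x, y)] [::].
  rewrite /total_increment /total_length cats0 !big_cons !big_nil /= !adde0 addr0.
  by apply => //; exact: itv_family1.
(* Induction on the number of steps of length [d / 2] from [a] to [x]; each step is shorter than [d]
   and adds a variation of at most 1. *)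
suff H n : forall x, a <= x <= b -> x - a <= n%:R * (d / 2) ->
    total_variation a x f \is a fin_num.
  apply: (H (Num.bound ((b - a) / (d / 2)))); first by rewrite ab lexx.
  rewrite -ler_pdivrMr; last by lra.
  apply/ltW/archi_boundP/divr_ge0; lra.
elim: n => [|n IH] x /andP[ax xb] xn.
  have -> : x = a by move: xn; rewrite mul0r; lra.
  by rewrite total_variationxx.
pose z := Num.max a (x - d / 2).
have az : a <= z by rewrite le_max lexx.
have zx : z <= x by rewrite ge_max ax /=; lra.
rewrite (total_variationD f az zx) fin_numD; apply/andP; split.
  apply: IH; first by rewrite az (le_trans zx xb).
  move: xn; rewrite -natr1 mulrDl mul1r /z.
  by case: (leP a (x - d / 2)) => h; [lra|rewrite subrr => _; apply: mulr_ge0 => //; lra].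
rewrite ge0_fin_numE ?total_variation_ge0 //.
apply: le_lt_trans (small z x az zx xb _) (ltry _).
have h : x - d / 2 <= z by rewrite le_max lexx orbT.
lra.
Qed.

Lemma seq_abs_continuousB a b f g : seq_abs_continuous a b f ->
  seq_abs_continuous a b g -> seq_abs_continuous a b (fun x => f x - g x).
Proof.
move=> Hf Hg e e0; have e2 : 0 < e / 2 by lra.
have [d1 d10 H1] := Hf _ e2; have [d2 d20 H2] := Hg _ e2.
exists (Num.min d1 d2); first by rewrite lt_min d10.
move=> L fL; rewrite lt_min => /andP[l1 l2].
apply: le_trans (_ : total_increment f L + total_increment g L <= _).
  rewrite -big_split /=; apply: ler_sum => I _.
  have -> : f I.2 - g I.2 - (f I.1 - g I.1) = (f I.2 - f I.1) - (g I.2 - g I.1) by ring.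
  exact: ler_normB.
by have := H1 _ fL l1; have := H2 _ fL l2; lra.
Qed.

(** The increment of the variation function over an interval is the variation of [f] there, so this
    is [total_variation_family] with an empty second list. *)
Lemma seq_abs_continuous_total_variation a b f : a <= b ->
  seq_abs_continuous a b f ->
  seq_abs_continuous a b (fun x => fine (total_variation a x f)).
Proof.
move=> ab Hf; have bv := seq_abs_continuous_bounded_variation ab Hf.
move=> e e0; have [d d0 Hd] := Hf _ e0; exists d => // L fL lL.
have := @total_variation_family a b f e d Hd L [::].
rewrite cats0 => /(_ fL lL).
rewrite /total_increment big_nil adde0 => H.
rewrite -lee_fin -sumEFin; apply: le_trans H; rewrite le_eqVlt; apply/orP; left; apply/eqP.
rewrite big_seq [RHS]big_seq; apply: eq_bigr => -[x y] /=.
have /andP[/allP al _] := fL => /al /and3P[/= ax xy yb].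
have fx : total_variation a x f \is a fin_num.
  by apply/bounded_variationP => //; exact: (bounded_variationl ax (le_trans xy yb) bv).
have fy : total_variation x y f \is a fin_num.
  by apply/bounded_variationP => //; apply: (bounded_variationl xy yb);
    exact: (bounded_variationr ax (le_trans xy yb) bv).
rewrite (total_variationD f ax xy) fineD // addrAC subrr add0r ger0_norm ?fineK //.
exact/fine_ge0/total_variation_ge0.
Qed.

(** Extending [f] by its end values makes it continuous on the whole line, which is what extreme
    values and Stieltjes measures ask for. *)
Lemma seq_abs_continuous_clamp a b f : a <= b -> seq_abs_continuous a b f ->
  forall x, {for x, continuous (fun t => f (Num.max a (Num.min b t)))}.
Proof.
move=> ab Hf x; apply/cvgrPdist_le => e e0.
have [d d0 Hd] := Hf _ e0.
pose c t := Num.max a (Num.min b t).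
have cb t : a <= c t <= b by rewrite /c le_max lexx /= ge_max ab ge_min lexx.
have cl t s : t <= s -> c t <= c s /\ c s - c t <= s - t.
  rewrite /c !maxEle !minEle => ts.
  by case: (leP b t) => bt; case: (leP b s) => bs; rewrite ?ab;
    try case: (leP a t) => at_; try case: (leP a s) => as_; split; lra.
have cd t s : t <= s -> s - t < d -> `|f (c s) - f (c t)| <= e.
  move=> ts st; have := Hd [:: (c t, c s)].
  have [h1 h2] := cl _ _ ts.
  rewrite /total_increment /total_length !big_cons !big_nil /= !addr0; apply.
    by have /andP[? ?] := cb t; have /andP[? ?] := cb s; exact: itv_family1.
  by lra.
near=> t.
have td : `|x - t| < d by near: t; exact: cvgr_dist_lt.
have [xt|tx] := leP x t.
  by rewrite distrC; apply: cd => //; move: td; rewrite distrC ger0_norm; lra.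
by apply: cd; [lra|move: td; rewrite ger0_norm; lra].
Unshelve. all: by end_near. Qed.

End AbsoluteContinuity.

(** * Exhaustion of an open set by dyadic cells *)

Section DyadicCells.
Variable R : realType.
Variables (a b : R) (ab : a < b).
Local Notation mu := (@lebesgue_measure R).

Definition dyadic_pt (n k : nat) : R := a + (b - a) * k%:R / 2 ^+ n.

Definition dyadic_cell (n k : nat) : set R := `]dyadic_pt n k, dyadic_pt n k.+1].

Lemma dyadic_pt0 n : dyadic_pt n 0 = a.
Proof. by rewrite /dyadic_pt mulr0 mul0r addr0. Qed.

Lemma dyadic_ptX n : dyadic_pt n (2 ^ n) = b.
Proof. by rewrite /dyadic_pt natrX mulfK ?expf_neq0 ?pnatr_eq0 //; lra. Qed.

Lemma le_dyadic_pt n j k : (j <= k)%N -> dyadic_pt n j <= dyadic_pt n k.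
Proof.
move=> jk; rewrite /dyadic_pt lerD2l ler_pM2r ?invr_gt0 ?exprn_gt0 //.
by rewrite ler_pM2l ?subr_gt0 // ler_nat.
Qed.

Lemma dyadic_pt_succ n k : dyadic_pt n k.+1 - dyadic_pt n k = (b - a) / 2 ^+ n.
Proof. by rewrite /dyadic_pt -natr1 mulrDr mulrDl mulr1; ring. Qed.

Lemma dyadic_pt_double n k : dyadic_pt n.+1 k.*2 = dyadic_pt n k.
Proof.
rewrite /dyadic_pt exprS -muln2 natrM invfM.
have h : (2 ^+ n : R) != 0 by rewrite expf_neq0 ?pnatr_eq0.
by field.
Qed.

Lemma dyadic_cell_cover n x : a < x <= b ->
  exists2 k, (k < 2 ^ n)%N & dyadic_cell n k x.
Proof.
move=> /andP[ax xb].
have ex : exists k, x <= dyadic_pt n k by exists (2 ^ n)%N; rewrite dyadic_ptX.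
case: (ex_minnP ex) => -[|k] xk kmin; first by move: xk; rewrite dyadic_pt0; lra.
exists k; first by apply: kmin; rewrite dyadic_ptX.
rewrite /dyadic_cell /= in_itv /= xk andbT ltNge; apply/negP => /kmin.
by rewrite ltnn.
Qed.

Variable U : set R.

(** Cells that leave [U] and indices from [2 ^ n] on give the empty set, so that each generation is
    a disjoint family indexed by all natural numbers. *)
Definition inner_cell (n k : nat) : set R :=
  if (k < 2 ^ n)%N && `[< dyadic_cell n k `<=` U >] then dyadic_cell n k else set0.

Lemma inner_cellP n k x : inner_cell n k x <->
  [/\ (k < 2 ^ n)%N, dyadic_cell n k `<=` U & dyadic_cell n k x].
Proof.
rewrite /inner_cell; case: ifPn => [/andP[-> /asboolP H]|].
  by split=> [?|[]].
by move=> H; split=> // -[k2 kU _]; move/negP: H; apply; rewrite k2; apply/asboolP.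
Qed.

Lemma measurable_inner_cell n k :
  measurable (inner_cell n k : set (measurableTypeR R)).
Proof. by rewrite /inner_cell; case: ifP => _ //; exact: measurable_itv. Qed.

Lemma inner_cell_trivIset n : trivIset [set: nat] (inner_cell n).
Proof.
apply: ltn_trivIset => k j jk; apply/seteqP; split=> // x [/inner_cellP[_ _ /=]].
rewrite /dyadic_cell /= in_itv /= => /andP[_ xj] /inner_cellP[_ _ /=].
rewrite /dyadic_cell /= in_itv /= => /andP[kx _].
by have := le_dyadic_pt n jk; rewrite leNgt (lt_le_trans kx xj).
Qed.

Definition inner_set (n : nat) : set R := \bigcup_k inner_cell n k.

Lemma inner_set_sub n : inner_set n `<=` U.
Proof. by move=> x [k _ /inner_cellP[_ kU /kU]]. Qed.

(** A cell [k] of generation [n] is the union of the cells [k.*2] and [k.*2.+1] of the next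
    generation, and both stay inside [U]. *)
Lemma inner_set_nondecreasing : {homo inner_set : n m / (n <= m)%N >-> (n <= m)%O}.
Proof.
apply: homo_leq; [exact: lexx|by move=> ? ? ?; exact: le_trans|].
move=> n; apply/subsetPset => x [k _ /inner_cellP[k2 kU]] kx.
have E : dyadic_pt n.+1 k.*2.+2 = dyadic_pt n k.+1 by rewrite -doubleS dyadic_pt_double.
have E0 := dyadic_pt_double n k.
have l1 := le_dyadic_pt n.+1 (leqnSn k.*2).
have l2 := le_dyadic_pt n.+1 (leqnSn k.*2.+1).
move: kx; rewrite /dyadic_cell /= in_itv /= => /andP[kx xk].
have [xm|mx] := leP x (dyadic_pt n.+1 k.*2.+1).
  exists k.*2 => //; apply/inner_cellP; split.
  - by rewrite expnS mul2n ltn_double.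
  - move=> y; rewrite /dyadic_cell /= in_itv /= E0 => /andP[ky yk].
    by apply: kU; rewrite /dyadic_cell /= in_itv /= ky -E (le_trans yk l2).
  - by rewrite /dyadic_cell /= in_itv /= E0 kx.
exists k.*2.+1 => //; apply/inner_cellP; split.
- by rewrite expnS mul2n -doubleS leq_double.
- move=> y; rewrite /dyadic_cell /= in_itv /= E => /andP[ky yk].
  by apply: kU; rewrite /dyadic_cell /= in_itv /= yk -E0 (le_lt_trans l1 ky).
- by rewrite /dyadic_cell /= in_itv /= mx E.
Qed.

Lemma inner_set_cover : open U -> U `&` `]a, b] `<=` \bigcup_n inner_set n.
Proof.
move=> oU x [Ux]; rewrite /= in_itv /= => /andP[ax xb].
have [e /= e0 eU] := open_nbhs_nbhs (conj oU Ux).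
pose n := Num.bound ((b - a) / e).
have ne : (b - a) / 2 ^+ n < e.
  rewrite ltr_pdivrMr ?exprn_gt0 // mulrC -ltr_pdivrMr //.
  apply: lt_trans (archi_boundP _) _; first by apply: divr_ge0; lra.
  by rewrite -natrX ltr_nat ltn_expl.
have axb : a < x <= b by rewrite ax.
have [k k2 kx] := dyadic_cell_cover n axb.
exists n => //; exists k => //; apply/inner_cellP; split => // y.
move: kx; rewrite /dyadic_cell /= !in_itv /= => /andP[kx xk] /andP[ky yk].
apply: eU => /=; rewrite /ball_ /=; have := dyadic_pt_succ n k.
by rewrite ltr_norml; lra.
Qed.

Definition inner_family (n : nat) : seq (R * R) :=
  [seq (dyadic_pt n k, dyadic_pt n k.+1) | k <- iota 0 (2 ^ n) & `[< dyadic_cell n k `<=` U >]].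

Lemma inner_family_itv n : itv_family a b (inner_family n).
Proof.
apply/andP; split.
  apply/allP => I /mapP[k]; rewrite mem_filter mem_iota add0n => /and3P[_ _ k2] -> /=.
  have := le_dyadic_pt n (leq0n k); have := le_dyadic_pt n k2.
  by rewrite dyadic_pt0 dyadic_ptX => -> ->; rewrite le_dyadic_pt.
rewrite pairwise_map.
apply: (subseq_pairwise (filter_subseq _ _)).
apply: (@sub_pairwise _ ltn); last by rewrite -sorted_pairwise ?iota_ltn_sorted //; exact: ltn_trans.
by move=> j k jk; rewrite /nonoverlapping /= le_dyadic_pt.
Qed.

(** Used for two measures: with [G = id] for Lebesgue measure, which gives the total length of the
    family, and with a Stieltjes measure, which gives its total increment. Absolute continuity
    compares the two. *)
Lemma measure_inner_set (nu : {measure set (measurableTypeR R) -> \bar R}) (G : R -> R) n :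
  (forall x y, x <= y -> nu `]x, y]%classic = (G y - G x)%:E) ->
  nu (inner_set n) = (\sum_(I <- inner_family n) (G I.2 - G I.1))%:E.
Proof.
move=> nuE; rewrite /inner_family big_map big_filter.
have -> : inner_set n = \big[setU/set0]_(k < 2 ^ n) inner_cell n k.
  apply/seteqP; split=> [x [k _ kx]|x].
    have [k2 _ _] := (inner_cellP n k x).1 kx.
    by rewrite -bigcup_mkord; exists k.
  by rewrite -bigcup_mkord => -[k _ kx]; exists k.
rewrite measure_bigsetU; [|exact: measurable_inner_cell|exact: inner_cell_trivIset].
rewrite -(big_mkord xpredT (fun k => nu (inner_cell n k))) /index_iota subn0.
rewrite big_mkcond -sumEFin [RHS]big_mkcond /= !big_seq.
apply: eq_bigr => k; rewrite mem_iota add0n => /andP[_ k2].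
rewrite /inner_cell k2 /=; case: ifPn => kU; last by rewrite measure0.
by rewrite nuE // le_dyadic_pt.
Qed.

Lemma measurable_inner_set n : measurable (inner_set n : set (measurableTypeR R)).
Proof. by apply: bigcup_measurable => k _; exact: measurable_inner_cell. Qed.

End DyadicCells.

(** * Densities and the fundamental theorem of calculus *)

Section RadonNikodym.
Variable R : realType.
Implicit Types (a b x y : R) (f g : R -> R).
Local Notation mu := (@lebesgue_measure R).

Lemma lebesgue_stieltjes_itv (G : cumulative R R) x y : x <= y ->
  lebesgue_stieltjes_measure G `]x, y]%classic = (G y - G x)%:E.
Proof.
move=> xy; rewrite /lebesgue_stieltjes_measure /measure_extension /=.
by rewrite measurable_mu_extE /= ?wlength_itv_bnd //; exact: is_ocitv.
Qed.

Lemma lebesgue_measure_oc x y : x <= y -> mu `]x, y]%classic = (y - x)%:E.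
Proof.
move=> xy; rewrite lebesgue_measure_itv /= lte_fin.
have [xy'|yx] := ltP x y; first by rewrite EFinB.
have -> : y = x by lra.
by rewrite subrr.
Qed.

(* Cover A by an open set of small measure and exhaust it by finite families of
   dyadic cells, to which absolute continuity applies. *)
Lemma lebesgue_stieltjes_null (G : cumulative R R) a b (A : set R) : a < b ->
  seq_abs_continuous a b G -> measurable (A : set (measurableTypeR R)) -> mu A = 0%E ->
  lebesgue_stieltjes_measure G (A `&` `]a, b]%classic) = 0%E.
Proof.
move=> ab acG mA A0; apply/eqP; rewrite eq_le measure_ge0 andbT.
apply/lee_addgt0Pr => e e0; rewrite add0e.
have [d d0 Hd] := acG _ e0.
have A'0 : ((wlength idfun)^*%mu A = 0)%E by apply/negligible_outer_measure/negligibleP.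
have [U [oU AU Ud]] := @outer_measure_open_le R A (d / 2) ltac:(lra).
rewrite A'0 add0e in Ud.
pose ls : {measure set (measurableTypeR R) -> \bar R} := lebesgue_stieltjes_measure G.
rewrite -[lebesgue_stieltjes_measure G]/(ls : set R -> \bar R).
have mI n := measurable_inner_set a b U n.
have H n : (ls (inner_set a b U n) <= e%:E)%E.
  rewrite (measure_inner_set (nu := ls) ab U n (lebesgue_stieltjes_itv G)) lee_fin.
  have fam := inner_family_itv ab U n.
  apply: le_trans (Hd _ fam _); first by apply: ler_sum => I _; exact: ler_norm.
  rewrite -lte_fin; apply: (@le_lt_trans _ _ (mu U)).
    rewrite /total_length -(@measure_inner_set R a b ab U mu id n lebesgue_measure_oc).
    apply: le_measure; rewrite ?inE //; first exact: measurable_realfun.open_measurable.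
    exact: inner_set_sub.
  by apply: le_lt_trans Ud _; rewrite lte_fin; lra.
apply: (@le_trans _ _ (ls (\bigcup_n inner_set a b U n))).
  apply: le_measure; rewrite ?inE.
  - by apply: measurableI => //; exact: measurable_itv.
  - exact: bigcup_measurable.
  - by move=> x [/AU Ux xab]; have := inner_set_cover oU (conj Ux xab).
have cv := nondecreasing_cvg_mu (mu := ls) mI (bigcup_measurable (fun n _ => mI n))
  (inner_set_nondecreasing ab U).
rewrite -(cvg_lim _ cv) //; apply: lime_le; first by apply/cvg_ex; eexists; exact: cv.
exact: nearW.
Qed.

(** Extended by constants, [f] defines a Stieltjes measure; restricted to the half-open interval it
    is finite, and by [lebesgue_stieltjes_null] it is absolutely continuous with respect to Lebesgue
    measure, so it has a Radon-Nikodym density. *)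
Lemma nondecreasing_density a b f : a < b -> {in `[a, b] &, nondecreasing_fun f} ->
  seq_abs_continuous a b f ->
  exists2 g : R -> R, mu.-integrable setT (EFin \o g) &
    forall x, a <= x <= b -> f x - f a = \int[mu]_(t in `]a, x]) g t.
Proof.
move=> ab ndf acf.
pose G0 t := f (Num.max a (Num.min b t)).
have cl t : a <= Num.max a (Num.min b t) <= b.
  by rewrite le_max lexx /= ge_max (ltW ab) ge_min lexx.
have Gnd : nondecreasing_fun G0.
  move=> x y xy; apply: ndf; rewrite ?in_itv //=.
  have mxy : Num.min b x <= Num.min b y by rewrite le_min ge_min lexx /= ge_min xy orbT.
  by rewrite ge_max le_max lexx /= le_max mxy orbT.
have Grc : right_continuous G0.
  by apply: right_continuousW => x; exact: seq_abs_continuous_clamp (ltW ab) acf x.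
pose G : cumulative R R := HB.pack_for (cumulative R R) G0 (isCumulative.Build R _ R G0 Gnd Grc).
have GE x : a <= x <= b -> G x = f x.
  by move=> /andP[ax xb]; rewrite /= /G0 (min_idPr xb) (max_idPr ax).
have acG : seq_abs_continuous a b G.
  move=> e /acf[d d0 Hd]; exists d => // L fL lL.
  apply: le_trans (Hd _ fL lL); rewrite le_eqVlt; apply/orP; left; apply/eqP.
  rewrite /total_increment big_seq [RHS]big_seq; apply: eq_bigr => I IL.
  have /andP[/allP/(_ _ IL)/and3P[aI I12 Ib] _] := fL.
  by rewrite !GE ?aI ?Ib ?(le_trans aI I12) ?(le_trans I12 Ib).
have mD : measurable (`]a, b]%classic : set (measurableTypeR R)) by exact: measurable_itv.
have Dfin : (lebesgue_stieltjes_measure G `]a, b]%classic < +oo)%E.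
  by rewrite lebesgue_stieltjes_itv ?ltry // ltW.
pose nu : {finite_measure set (measurableTypeR R) -> \bar R} := mfrestr mD Dfin.
have numu : nu `<< mu.
  move=> N N0 A mA AN; rewrite /= /mfrestr /mrestr.
  exact: lebesgue_stieltjes_null ab acG mA (N0 A mA AN).
have [h [h0 hfin hint hE]] := radon_nikodym_sigma_finite numu.
exists (fine \o h).
  by apply: eq_integrable hint => // x _ /=; rewrite fineK.
move=> x /andP[ax xb].
rewrite /Rintegral.
under eq_integral => t _ do rewrite /= fineK //.
rewrite -hE; last exact: measurable_itv.
have -> : nu `]a, x]%classic = lebesgue_stieltjes_measure G `]a, x]%classic.
  rewrite /= /mfrestr /mrestr; congr (lebesgue_stieltjes_measure G _).
  apply/setIidPl => t; rewrite /= !in_itv /= => /andP[-> tx].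
  exact: le_trans tx xb.
rewrite lebesgue_stieltjes_itv // !GE ?lexx ?ax ?xb ?(le_trans ax xb) //.
Qed.

(** Jordan decomposition: the variation [V] and [V - f] are nondecreasing and inherit absolute
    continuity, and the difference of their densities is a density of [f]. Differentiation of
    indefinite integrals, [FTC1], identifies it with the derivative almost everywhere. *)
Lemma abs_continuous_FTC a b f : a < b -> abs_continuous a b f ->
  exists g : R -> R, [/\ mu.-integrable setT (EFin \o g),
    f b - f a = \int[mu]_(t in `]a, b]) g t &
    {ae mu, forall x, a < x < b -> is_derive x 1 f (g x)}].
Proof.
move=> ab /abs_continuous_seq acf.
have bv := seq_abs_continuous_bounded_variation (ltW ab) acf.
pose V x := fine (total_variation a x f).
have acV : seq_abs_continuous a b V := seq_abs_continuous_total_variation (ltW ab) acf.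
have Vd x y : a <= x -> x <= y -> y <= b -> `|f y - f x| <= V y - V x.
  move=> ax xy yb.
  have fx : total_variation a x f \is a fin_num.
    by apply/bounded_variationP => //; exact: (bounded_variationl ax (le_trans xy yb) bv).
  have fy : total_variation x y f \is a fin_num.
    by apply/bounded_variationP => //; apply: (bounded_variationl xy yb);
      exact: (bounded_variationr ax (le_trans xy yb) bv).
  rewrite /V (total_variationD f ax xy) fineD // addrAC subrr add0r.
  by rewrite -lee_fin fineK //; exact: total_variation_ge.
have [g1 g1i g1E] : exists2 g : R -> R, mu.-integrable setT (EFin \o g) &
    forall x, a <= x <= b -> V x - V a = \int[mu]_(t in `]a, x]) g t.
  apply: nondecreasing_density => // x y.
  rewrite !in_itv /= => /andP[ax _] /andP[_ yb] xy.
  by rewrite -subr_ge0; apply: le_trans (Vd x y ax xy yb).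
have [g2 g2i g2E] : exists2 g : R -> R, mu.-integrable setT (EFin \o g) &
    forall x, a <= x <= b -> (V x - f x) - (V a - f a) = \int[mu]_(t in `]a, x]) g t.
  apply: (nondecreasing_density (f := fun x => V x - f x)) => //.
    move=> x y; rewrite !in_itv /= => /andP[ax _] /andP[_ yb] xy.
    have := Vd x y ax xy yb; have := ler_norm (f y - f x); lra.
  exact: seq_abs_continuousB.
pose g t := g1 t - g2 t.
have gi : mu.-integrable setT (EFin \o g).
  by apply: eq_integrable (integrableB _ g1i g2i) => // x _ /=; rewrite EFinB.
have gE x : a <= x <= b -> f x - f a = \int[mu]_(t in `]a, x]) g t.
  move=> axb; rewrite RintegralB; [|exact: measurable_itv|exact: integrableS g1i|exact: integrableS g2i].
  by rewrite -g1E // -g2E //; ring.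
exists g; split => //; first by apply: gE; rewrite lexx ltW.
have giy y : mu.-integrable [set` Interval (BRight a) (BRight y)] (EFin \o g).
  by apply: integrableS gi => //; exact: measurable_itv.
have := FTC1 giy (open_integrable_locally openT gi).
apply: filterS; first exact: (ae_filter_ringOfSetsType mu).
move=> x H /andP[ax xb].
have [dF FE] := H ax.
have dG : is_derive x 1 (fun y => \int[mu]_(t in `]a, y]) g t) (g x).
  by apply: (DeriveDef dF); rewrite -derive1E; exact: FE.
have dfa : is_derive x 1 (cst (f a) : R -> R) 0 by exact: is_derive_cst.
rewrite -[g x]add0r.
apply: (@near_eq_is_derive _ _ _ (fun y => f a + \int[mu]_(t in `]a, y]) g t)).
  near=> y.
  have yab : a <= y <= b.
    by apply/andP; split; near: y; [exact: lt_le_nbhsr|exact: lt_le_nbhsl].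
  by rewrite -gE // addrC subrK.
Unshelve. all: by end_near. Qed.

End RadonNikodym.

(** * Holomorphic functions of one variable *)

Section ComplexModulus.
Variable R : realType.
Implicit Types (z w h d : Cx R) (x y t e : R).

Definition cRe (z : Cx R) : R := complex.Re z.
Definition cIm (z : Cx R) : R := complex.Im z.
(** The norm of [Cx R] takes its values in [Cx R]; this is the real-valued form, to which real order
    and real arithmetic apply. *)
Definition cmod (z : Cx R) : R := Normc.normc z.
Definition ofR (x : R) : Cx R := real_complex R x.
Definition mkC x y : Cx R := Complex x y.

Lemma cReD z w : cRe (z + w) = cRe z + cRe w. Proof. by case: z; case: w. Qed.
Lemma cImD z w : cIm (z + w) = cIm z + cIm w. Proof. by case: z; case: w. Qed.
Lemma cReN z : cRe (- z) = - cRe z. Proof. by case: z. Qed.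
Lemma cImN z : cIm (- z) = - cIm z. Proof. by case: z. Qed.
Lemma cReB z w : cRe (z - w) = cRe z - cRe w. Proof. by rewrite cReD cReN. Qed.
Lemma cImB z w : cIm (z - w) = cIm z - cIm w. Proof. by rewrite cImD cImN. Qed.
Lemma cReM z w : cRe (z * w) = cRe z * cRe w - cIm z * cIm w.
Proof. by case: z; case: w. Qed.
Lemma cImM z w : cIm (z * w) = cRe z * cIm w + cIm z * cRe w.
Proof. by case: z; case: w. Qed.
Lemma cRe_ofR x : cRe (ofR x) = x. Proof. by []. Qed.
Lemma cIm_ofR x : cIm (ofR x) = 0. Proof. by []. Qed.
Lemma cRe_mkC x y : cRe (mkC x y) = x. Proof. by []. Qed.
Lemma cIm_mkC x y : cIm (mkC x y) = y. Proof. by []. Qed.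
Lemma cRe0 : cRe 0 = 0. Proof. by []. Qed.
Lemma cIm0 : cIm 0 = 0. Proof. by []. Qed.
Lemma cRe1 : cRe 1 = 1. Proof. by []. Qed.
Lemma cIm1 : cIm 1 = 0. Proof. by []. Qed.

Definition cE := (cReD, cImD, cReN, cImN, cReM, cImM, cRe_ofR, cIm_ofR,
  cRe_mkC, cIm_mkC, cRe0, cIm0, cRe1, cIm1).

Lemma eqC z w : cRe z = cRe w -> cIm z = cIm w -> z = w.
Proof. by case: z => a b; case: w => c d; rewrite /cRe /cIm /= => -> ->. Qed.

Lemma cmodE z : cmod z = Num.sqrt (cRe z ^+ 2 + cIm z ^+ 2). Proof. by case: z. Qed.

Lemma cmod_sqr z : cmod z ^+ 2 = cRe z ^+ 2 + cIm z ^+ 2.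
Proof. by rewrite cmodE sqr_sqrtr // addr_ge0 // sqr_ge0. Qed.

Lemma cmod_ge0 z : 0 <= cmod z. Proof. by rewrite cmodE sqrtr_ge0. Qed.
Hint Resolve cmod_ge0 : core.

Lemma cmod0 : cmod 0 = 0. Proof. by rewrite cmodE !cE expr0n /= addr0 sqrtr0. Qed.
Lemma cmod1 : cmod 1 = 1. Proof. by rewrite cmodE !cE expr0n /= addr0 expr1n sqrtr1. Qed.
Lemma cmodM z w : cmod (z * w) = cmod z * cmod w. Proof. exact: Normc.normcM. Qed.
Lemma cmodN z : cmod (- z) = cmod z. Proof. by rewrite !cmodE !cE !sqrrN. Qed.
Lemma cmodX z n : cmod (z ^+ n) = cmod z ^+ n.
Proof. by elim: n => [|n IH]; rewrite ?expr0 ?cmod1 // !exprS cmodM IH. Qed.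

Lemma cmodD z w : cmod (z + w) <= cmod z + cmod w.
Proof. exact: le_normcD. Qed.

Lemma cmodB z w : cmod (z - w) <= cmod z + cmod w.
Proof. by rewrite -[cmod w]cmodN cmodD. Qed.

Lemma cmod_sub z w : cmod (z - w) = cmod (w - z).
Proof. by rewrite -cmodN opprB. Qed.

Lemma cmod_eq0 z : (cmod z == 0) = (z == 0).
Proof.
apply/eqP/eqP => [|->]; last exact: cmod0.
exact: Normc.eq0_normc.
Qed.

Lemma cmod_gt0 z : (0 < cmod z) = (z != 0).
Proof. by rewrite lt_def cmod_ge0 andbT cmod_eq0. Qed.

Lemma cmod_ofR x : cmod (ofR x) = `|x|.
Proof. by rewrite cmodE !cE expr0n /= addr0 sqrtr_sqr. Qed.

Lemma cRe_le z : `|cRe z| <= cmod z.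
Proof. by rewrite cmodE -sqrtr_sqr ler_wsqrtr // lerDl sqr_ge0. Qed.

Lemma cIm_le z : `|cIm z| <= cmod z.
Proof. by rewrite cmodE -sqrtr_sqr ler_wsqrtr // lerDr sqr_ge0. Qed.

Lemma cmod_le z : cmod z <= `|cRe z| + `|cIm z|.
Proof.
have h : 0 <= `|cRe z| + `|cIm z| by rewrite addr_ge0.
rewrite -(ger0_norm (cmod_ge0 z)) -(ger0_norm h) -ler_sqr ?nnegrE //.
rewrite !real_normK ?num_real // cmod_sqr sqrrD !real_normK ?num_real //.
by rewrite addrAC lerDl mulrn_wge0 // mulr_ge0.
Qed.

Lemma norm_cmod z : `|z| = ofR (cmod z). Proof. by []. Qed.

Lemma ltC_ofR x y : (ofR x < ofR y) = (x < y). Proof. exact: ltcR. Qed.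
Lemma leC_ofR x y : (ofR x <= ofR y) = (x <= y). Proof. exact: lecR. Qed.

Lemma gt0_ofR z : 0 < z -> exists2 e, 0 < e & z = ofR e.
Proof. by case: z => x y; rewrite ltcE /= => /andP[/eqP -> ?]; exists x. Qed.

Lemma ofRD x y : ofR (x + y) = ofR x + ofR y. Proof. exact: rmorphD. Qed.
Lemma ofRB x y : ofR (x - y) = ofR x - ofR y. Proof. exact: rmorphB. Qed.
Lemma ofRM x y : ofR (x * y) = ofR x * ofR y. Proof. exact: rmorphM. Qed.
Lemma ofRX x n : ofR (x ^+ n) = ofR x ^+ n. Proof. exact: rmorphXn. Qed.
Lemma ofRV x : ofR x^-1 = (ofR x)^-1. Proof. exact: fmorphV. Qed.
Lemma ofR0 : ofR 0 = 0. Proof. by []. Qed.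
Lemma ofR1 : ofR 1 = 1. Proof. by []. Qed.
Lemma ofR_nat n : ofR n%:R = n%:R. Proof. exact: rmorph_nat. Qed.

Lemma nbhs_cmodP z (P : set (Cx R)) :
  nbhs z P <-> exists2 e, 0 < e & forall w, cmod (w - z) < e -> P w.
Proof.
rewrite -filter_from_norm_nbhs; split.
  move=> [e /= e0 H]; have [r r0 er] := gt0_ofR e0.
  exists r => // w zw; apply: H => /=.
  by rewrite /ball_ /= norm_cmod er ltC_ofR cmod_sub.
move=> [e e0 H]; exists (ofR e) => /=; first by rewrite -ofR0 ltC_ofR.
by move=> w /=; rewrite norm_cmod ltC_ofR cmod_sub => /H.
Qed.

(** The difference quotient is cleared of its denominator, so that [h = 0] needs no separate
    treatment. *)
Definition cderiv (f : Cx R -> Cx R) z d : Prop :=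
  forall e, 0 < e -> exists2 r, 0 < r &
    forall h, cmod h < r -> cmod (f (z + h) - f z - d * h) <= e * cmod h.

Lemma cderivP (f : Cx R -> Cx R) z d : is_derive z 1 f d <-> cderiv f z d.
Proof.
have E : ((fun h => h^-1 *: ((f \o shift z) (h *: 1) - f z)) @ 0^' --> d) <-> cderiv f z d.
  rewrite cvgrPdist_le; split.
    move=> H e e0; have oe : 0 < ofR e by rewrite -ofR0 ltC_ofR.
    have /nbhs_cmodP[r r0 Hr] := H _ oe.
    exists r => // h hr; have [->|h0] := eqVneq h 0.
      by rewrite addr0 mulr0 !subrr cmod0 mulr0.
    have hr' : cmod (h - 0) < r by rewrite subr0.
    have := Hr h hr' h0; rewrite norm_cmod leC_ofR /= => Hh.
    have -> : f (z + h) - f z - d * h = - h * (d - h^-1 *: ((f \o shift z) (h *: 1) - f z)).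
      rewrite /= -[h *: 1]/(h * 1) mulr1 -[h^-1 *: _]/(h^-1 * _) [h + z]addrC.
      by field.
    by rewrite cmodM cmodN mulrC ler_wpM2r.
  move=> H _ /gt0_ofR[e e0 ->]; have [r r0 Hr] := H _ e0.
  apply/nbhs_cmodP; exists r => // h; rewrite subr0 => hr h0.
  rewrite norm_cmod leC_ofR /=.
  have := Hr h hr.
  have -> : f (z + h) - f z - d * h = - h * (d - h^-1 *: ((f \o shift z) (h *: 1) - f z)).
    rewrite /= -[h *: 1]/(h * 1) mulr1 -[h^-1 *: _]/(h^-1 * _) [h + z]addrC.
    by field.
  by rewrite cmodM cmodN mulrC ler_pM2r // cmod_gt0.
split.
  by move=> [df dE]; apply/E; rewrite -dE; exact: df.
move=> /E H; split; first by apply/cvg_ex; exists d.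
exact: cvg_lim.
Qed.

Lemma cderiv_derivable (f : Cx R -> Cx R) z d : cderiv f z d -> derivable f z 1 /\ derive1 f z = d.
Proof. by move=> /cderivP[df dE]; split; [exact: df|rewrite derive1E]. Qed.

Lemma cderiv_cst c z : cderiv (fun _ => c) z 0.
Proof. by move=> e e0; exists 1 => // h _; rewrite mul0r subrr subr0 cmod0 mulr_ge0 // ltW. Qed.

Lemma cderiv_id z : cderiv id z 1.
Proof.
move=> e e0; exists 1 => // h _.
have -> : id (z + h) - id z - 1 * h = 0 by rewrite /=; ring.
rewrite cmod0.
by rewrite mulr_ge0 // ltW.
Qed.

Lemma cderivD (f g : Cx R -> Cx R) z d d' : cderiv f z d -> cderiv g z d' ->
  cderiv (fun z => f z + g z) z (d + d').
Proof. by move=> /cderivP H /cderivP H'; apply/cderivP; exact: is_deriveD. Qed.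

Lemma cderivB (f g : Cx R -> Cx R) z d d' : cderiv f z d -> cderiv g z d' ->
  cderiv (fun z => f z - g z) z (d - d').
Proof. by move=> /cderivP H /cderivP H'; apply/cderivP; exact: is_deriveB. Qed.

Lemma cderivM (f g : Cx R -> Cx R) z d d' : cderiv f z d -> cderiv g z d' ->
  cderiv (fun z => f z * g z) z (d * g z + f z * d').
Proof.
move=> /cderivP H /cderivP H'; apply/cderivP.
have -> : d * g z + f z * d' = f z *: d' + g z *: d by rewrite addrC [d * _]mulrC.
exact: is_deriveM.
Qed.

Lemma cderiv_cont (f : Cx R -> Cx R) z d : cderiv f z d ->
  forall e, 0 < e -> exists2 r, 0 < r & forall h, cmod h < r -> cmod (f (z + h) - f z) < e.
Proof.
move=> H e e0; have [r r0 Hr] := H 1 ltr01.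
pose k := cmod d + 2.
have k0 : 0 < k by rewrite /k; have := cmod_ge0 d; lra.
exists (Num.min r (e / k)); first by rewrite lt_min r0 divr_gt0.
move=> h; rewrite lt_min ltr_pdivlMr // => /andP[hr hk].
have -> : f (z + h) - f z = (f (z + h) - f z - d * h) + d * h by rewrite subrK.
apply: le_lt_trans (cmodD _ _) _; rewrite cmodM.
have := Hr h hr; have := cmod_ge0 h; rewrite /k in hk; nra.
Qed.

Lemma cderiv_comp (f g : Cx R -> Cx R) z d d' : cderiv g z d -> cderiv f (g z) d' ->
  cderiv (fun z => f (g z)) z (d' * d).
Proof.
move=> Hg Hf e e0.
pose k := cmod d + 1.
have k0 : 0 < k by rewrite /k; have := cmod_ge0 d; lra.
pose k' := cmod d' + 1.
have k'0 : 0 < k' by rewrite /k'; have := cmod_ge0 d'; lra.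
have [r r0 Hr] := Hf (e / 2 / k) ltac:(by rewrite !divr_gt0).
have [r1 r10 Hr1] := cderiv_cont Hg r0.
have [r2 r20 Hr2] := Hg (e / 2 / k') ltac:(by rewrite !divr_gt0).
have [r3 r30 Hr3] := Hg 1 ltr01.
exists (Num.min r1 (Num.min r2 r3)); first by rewrite !lt_min r10 r20.
move=> h; rewrite !lt_min => /and3P[h1 h2 h3].
pose u := g (z + h) - g z.
have uE : g z + u = g (z + h) by rewrite /u addrC subrK.
have -> : f (g (z + h)) - f (g z) - d' * d * h =
    (f (g z + u) - f (g z) - d' * u) + d' * (u - d * h) by rewrite uE; ring.
apply: le_trans (cmodD _ _) _; rewrite cmodM.
have A1 := Hr u (Hr1 h h1); have A2 := Hr2 h h2; have A3 := Hr3 h h3.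
have uk : cmod u <= k * cmod h.
  rewrite -[u](subrK (d * h)); apply: le_trans (cmodD _ _) _.
  by rewrite cmodM /k mulrDl addrC lerD2l.
have B1 : e / 2 / k * cmod u <= e / 2 * cmod h.
  by rewrite -mulrA ler_pM2l ?divr_gt0 // ler_pdivrMl.
have B2 : cmod d' * cmod (u - d * h) <= e / 2 * cmod h.
  have : k' * cmod (u - d * h) <= e / 2 * cmod h.
    by rewrite -ler_pdivlMl //; apply: le_trans A2 _; rewrite mulrA [k'^-1 * _]mulrC.
  have := cmod_ge0 (u - d * h); rewrite /k' => p; lra.
lra.
Qed.

Lemma is_derive_realP (u : R -> R) (t c : R) : is_derive t 1 u c <->
  forall e, 0 < e -> exists2 r, 0 < r &
    forall s, `|s| < r -> `|u (t + s) - u t - c * s| <= e * `|s|.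
Proof.
have E : ((fun h : R => h^-1 *: ((u \o shift t) (h *: 1) - u t)) @ 0^' --> c) <->
    forall e, 0 < e -> exists2 r, 0 < r &
    forall s, `|s| < r -> `|u (t + s) - u t - c * s| <= e * `|s|.
  have K (h : R) : h != 0 -> u (t + h) - u t - c * h =
      - h * (c - h^-1 *: ((u \o shift t) (h *: 1) - u t)).
    move=> h0; rewrite /= -[h *: 1]/(h * 1) mulr1 -[h^-1 *: _]/(h^-1 * _) [h + t]addrC.
    by field.
  rewrite cvgrPdist_le; split=> H e e0.
    have /nbhs_normP[r /= r0 Hr] := H _ e0.
    exists r => // h hr; have [->|h0] := eqVneq h 0.
      by rewrite addr0 mulr0 !subrr normr0 mulr0.
    have hr' : ball_ [eta Num.Def.normr] 0 r h by rewrite /ball_ /= sub0r normrN.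
    have := Hr h hr' h0; rewrite /= => Hh.
    by rewrite K // normrM normrN mulrC ler_wpM2r.
  have [r r0 Hr] := H _ e0.
  apply/nbhs_normP; exists r => // h; rewrite /ball_ /= sub0r normrN => hr h0.
  have := Hr h hr.
  by rewrite K // normrM normrN mulrC ler_pM2r // normr_gt0.
split.
  by move=> [df dE]; apply/E; rewrite -dE; exact: df.
move=> /E H; split; first by apply/cvg_ex; exists c.
exact: cvg_lim.
Qed.

Lemma cderiv_line (f : Cx R -> Cx R) z h t d : cderiv f (z + ofR t * h) d ->
  is_derive t 1 (fun t => cRe (f (z + ofR t * h))) (cRe (d * h)) /\
  is_derive t 1 (fun t => cIm (f (z + ofR t * h))) (cIm (d * h)).
Proof.
move=> H.
have K e : 0 < e -> exists2 r, 0 < r & forall s, `|s| < r ->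
    cmod (f (z + ofR (t + s) * h) - f (z + ofR t * h) - d * h * ofR s) <= e * `|s|.
  move=> e0; pose k := cmod h + 1.
  have k0 : 0 < k by rewrite /k; have := cmod_ge0 h; lra.
  have [r r0 Hr] := H (e / k) ltac:(by rewrite divr_gt0).
  exists (r / k); first by rewrite divr_gt0.
  move=> s; rewrite ltr_pdivlMr // => sr.
  have sh : cmod (ofR s * h) <= k * `|s|.
    by rewrite cmodM cmod_ofR mulrC ler_wpM2r // /k lerDl.
  have := Hr (ofR s * h) ltac:(by apply: le_lt_trans sh _; rewrite mulrC).
  have -> : z + ofR t * h + ofR s * h = z + ofR (t + s) * h by rewrite ofRD; ring.
  have -> : d * (ofR s * h) = d * h * ofR s by ring.
  move=> Hs; apply: le_trans Hs _; rewrite -mulrA ler_pM2l // ler_pdivrMl //.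
split; apply/is_derive_realP => e /K[r r0 Hr]; exists r => // s /Hr; apply: le_trans.
- by apply: le_trans (cRe_le _); rewrite !cE mulr0 subr0.
- by apply: le_trans (cIm_le _); rewrite !cE mulr0 add0r.
Qed.

Lemma is_derive_le_mean (u : R -> R) (u' : R -> R) k M :
  (forall t, 0 <= t <= 1 -> is_derive t 1 u (u' t)) ->
  (forall t, 0 <= t <= 1 -> `|u' t - k| <= M) -> `|u 1 - u 0 - k| <= M.
Proof.
move=> du bu.
have cu : {within `[0, 1], continuous u}.
  apply: derivable_within_continuous => t; rewrite in_itv /= => /du H.
  exact: ex_derive.
have [t t01 ->] := MVT_segment ler01 (fun t tin => du t ltac:(
  by move: tin; rewrite in_itv /= => /andP[? ?]; rewrite !ltW)) cu.
by rewrite subr0 mulr1; apply: bu; move: t01; rewrite in_itv.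
Qed.

(* The mean value inequality, up to the factor 2 lost by treating the real and
   imaginary parts separately. *)
Lemma cderiv_mean (f : Cx R -> Cx R) (f' : R -> Cx R) z h k M :
  (forall t, 0 <= t <= 1 -> cderiv f (z + ofR t * h) (f' t)) ->
  (forall t, 0 <= t <= 1 -> cmod (f' t * h - k) <= M) ->
  cmod (f (z + h) - f z - k) <= 2 * M.
Proof.
move=> df bf.
have A := @is_derive_le_mean (fun t => cRe (f (z + ofR t * h))) (fun t => cRe (f' t * h)) (cRe k) M
  (fun t tin => (cderiv_line (df t tin)).1).
have B := @is_derive_le_mean (fun t => cIm (f (z + ofR t * h))) (fun t => cIm (f' t * h)) (cIm k) M
  (fun t tin => (cderiv_line (df t tin)).2).
have {}A : `|cRe (f (z + h) - f z - k)| <= M.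
  move: A; rewrite ofR0 ofR1 mul0r mul1r addr0 -!cReB; apply => t tin.
  by rewrite -cReB; apply: le_trans (cRe_le _) (bf t tin).
have {}B : `|cIm (f (z + h) - f z - k)| <= M.
  move: B; rewrite ofR0 ofR1 mul0r mul1r addr0 -!cImB; apply => t tin.
  by rewrite -cImB; apply: le_trans (cIm_le _) (bf t tin).
by apply: le_trans (cmod_le _) _; lra.
Qed.

End ComplexModulus.
#[global] Hint Resolve cmod_ge0 : core.
Arguments ofR {R}.
Arguments cmod {R}.
Arguments cRe {R}.
Arguments cIm {R}.

(** * Integrals of continuous functions over segments *)

Section SegmentIntegral.
Variable R : realType.
Implicit Types (f g : R -> R) (a b c k M : R).
Local Notation mu := (@lebesgue_measure R).

Definition cint f a b : R := \int[mu]_(t in `[a, b]) f t.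

(** Continuity is two-sided even at the end points, so it passes to subsegments without one-sided
    limits. *)
Definition cont_on f a b : Prop := forall x, a <= x <= b -> {for x, continuous f}.

Lemma cont_onS f a b a' b' : a <= a' -> b' <= b -> cont_on f a b -> cont_on f a' b'.
Proof.
by move=> aa bb H x /andP[ax xb]; apply: H; rewrite (le_trans aa ax) (le_trans xb bb).
Qed.

Lemma cont_onD f g a b : cont_on f a b -> cont_on g a b ->
  cont_on (fun x => f x + g x) a b.
Proof. by move=> Hf Hg x xab; apply: cvgD; [exact: Hf|exact: Hg]. Qed.

Lemma cont_onB f g a b : cont_on f a b -> cont_on g a b ->
  cont_on (fun x => f x - g x) a b.
Proof. by move=> Hf Hg x xab; apply: cvgB; [exact: Hf|exact: Hg]. Qed.

Lemma cont_onM f g a b : cont_on f a b -> cont_on g a b ->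
  cont_on (fun x => f x * g x) a b.
Proof. by move=> Hf Hg x xab; apply: cvgM; [exact: Hf|exact: Hg]. Qed.

Lemma cont_on_cst k a b : cont_on (fun _ => k) a b.
Proof. by move=> x _; exact: cvg_cst. Qed.

Lemma cont_on_integrable f a b : cont_on f a b -> mu.-integrable `[a, b] (EFin \o f).
Proof.
move=> H; apply: continuous_compact_integrable; first exact: segment_compact.
by apply: continuous_in_subspaceT => x; rewrite inE /= in_itv /= => /H.
Qed.

Lemma cintD f g a b : cont_on f a b -> cont_on g a b ->
  cint (fun x => f x + g x) a b = cint f a b + cint g a b.
Proof.
by move=> Hf Hg; apply: RintegralD; [exact: measurable_itv|exact: cont_on_integrable..].
Qed.

Lemma cintB f g a b : cont_on f a b -> cont_on g a b ->
  cint (fun x => f x - g x) a b = cint f a b - cint g a b.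
Proof.
by move=> Hf Hg; apply: RintegralB; [exact: measurable_itv|exact: cont_on_integrable..].
Qed.

Lemma cintZ f k a b : cont_on f a b -> cint (fun x => k * f x) a b = k * cint f a b.
Proof.
by move=> Hf; apply: RintegralZl; [exact: measurable_itv|exact: cont_on_integrable].
Qed.

Lemma cint_cst k a b : a <= b -> cint (fun _ => k) a b = k * (b - a).
Proof.
move=> ab; rewrite /cint Rintegral_cst; last exact: measurable_itv.
congr (_ * _); rewrite [X in fine X]lebesgue_measure_itv /= lte_fin.
have [ab'|ba] := ltP a b; first by [].
by rewrite (le_anti (introT andP (conj ab ba))) subrr.
Qed.

Lemma cint_le f g a b : cont_on f a b -> cont_on g a b ->
  (forall x, a <= x <= b -> f x <= g x) -> cint f a b <= cint g a b.
Proof.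
move=> Hf Hg fg; apply: le_Rintegral; [exact: measurable_itv|exact: cont_on_integrable..|].
by move=> x; rewrite /= in_itv /=; exact: fg.
Qed.

Lemma eq_cint f g a b : (forall x, a <= x <= b -> f x = g x) -> cint f a b = cint g a b.
Proof. by move=> fg; apply: eq_Rintegral => x; rewrite inE /= in_itv /= => /fg. Qed.

Lemma cint_near f k M a b : a <= b -> cont_on f a b ->
  (forall x, a <= x <= b -> `|f x - k| <= M) ->
  `|cint f a b - k * (b - a)| <= M * (b - a).
Proof.
move=> ab Hf fk.
have A : cint f a b <= cint (fun _ => k + M) a b.
  apply: cint_le => // [|x /fk]; first exact: cont_on_cst.
  by rewrite ler_norml; lra.
have B : cint (fun _ => k - M) a b <= cint f a b.
  apply: cint_le => // [|x /fk]; first exact: cont_on_cst.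
  by rewrite ler_norml; lra.
by move: A B; rewrite !cint_cst // ler_norml => A B; apply/andP; split; lra.
Qed.

Lemma cint_cat f a c b : a <= c -> c <= b -> cont_on f a b ->
  cint f a b = cint f a c + cint f c b.
Proof.
move=> ac cb Hf; have fi := cont_on_integrable Hf.
have := Rintegral_itvB (x := c) fi.
rewrite !bnd_simp => /(_ ac cb) E.
have H : \int[mu]_(t in `]c, b]) f t = cint f c b.
  apply: Rintegral_itv_obnd_cbnd.
  apply: integrableS fi; [exact: measurable_itv..|].
  by move=> x; rewrite /= !in_itv /= => /andP[/ltW cx ->]; rewrite (le_trans ac cx).
by rewrite -H -E /cint addrC subrK.
Qed.

Lemma cint_derive f (F : R -> R) a b : a < b -> cont_on f a b ->
  (forall x : R, is_derive x 1 F (f x)) -> cint f a b = F b - F a.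
Proof.
move=> ab Hf HF.
have cF x : {for x, continuous F}.
  by apply: differentiable_continuous; apply/derivable1_diffP; exact: ex_derive.
rewrite /cint /Rintegral (@continuous_FTC2 _ f F) //.
- by apply: continuous_in_subspaceT => x; rewrite inE /= in_itv /= => /Hf.
- split; [by move=> x _; exact: ex_derive|exact/cvg_at_right_filter/cF|exact/cvg_at_left_filter/cF].
- by move=> x _; rewrite derive1E; exact: derive_val.
Qed.

End SegmentIntegral.

(** * Circulation of closed forms around rectangles, after Goursat *)

Section GreenGoursat.
Variable R : realType.
Implicit Types (F : R -> R -> R) (x y w h s t p q e : R).

Definition rdiff2 F x y p q : Prop :=
  forall e, 0 < e -> exists2 r, 0 < r & forall s t, `|s| < r -> `|t| < r ->
    `|F (x + s) (y + t) - F x y - p * s - q * t| <= e * (`|s| + `|t|).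

Lemma rdiff2_is_derive F x y p q : rdiff2 F x y p q ->
  is_derive x 1 (F ^~ y) p /\ is_derive y 1 (F x) q.
Proof.
move=> H; split; apply/is_derive_realP => e /H[r r0 Hr]; exists r => // s sr.
  have := Hr s 0 sr; rewrite normr0 => /(_ r0).
  by rewrite addr0 mulr0 subr0 addr0.
have := Hr 0 s; rewrite normr0 => /(_ r0 sr).
by rewrite addr0 mulr0 subr0 add0r.
Qed.

Lemma rdiff2_cont F x y p q : rdiff2 F x y p q ->
  {for x, continuous (F ^~ y)} /\ {for y, continuous (F x)}.
Proof.
by move=> /rdiff2_is_derive[Hx Hy]; split; apply: differentiable_continuous;
  apply/derivable1_diffP; exact: ex_derive.
Qed.

Variables (A B : R -> R -> R) (X Y W H : R).
Hypotheses (W0 : 0 <= W) (H0 : 0 <= H).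
(** The shared value [q] states that the y-derivative of [A] equals the x-derivative of [B], that
    is, [A dx + B dy] is closed at each point. Continuity of the partial derivatives is not assumed,
    which is why bisection takes the place of Fubini. *)
Hypothesis closed_form : forall x y, X <= x <= X + W -> Y <= y <= Y + H ->
  exists p q q', rdiff2 A x y p q /\ rdiff2 B x y q q'.

(** The counterclockwise integral of [A dx + B dy] around the rectangle with lower left corner
    [(x, y)] and sides [w], [h], with opposite sides paired. *)
Definition circulation x y w h : R :=
  cint (fun t => B (x + w) t - B x t) y (y + h) - cint (fun s => A s (y + h) - A s y) x (x + w).

Lemma contA y : Y <= y <= Y + H -> cont_on (A ^~ y) X (X + W).
Proof. by move=> yH x xW; have [p [q [q' [/rdiff2_cont[]]]]] := closed_form xW yH. Qed.

Lemma contB x : X <= x <= X + W -> cont_on (B x) Y (Y + H).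
Proof. by move=> xW y yH; have [p [q [q' [_ /rdiff2_cont[]]]]] := closed_form xW yH. Qed.

Lemma circulation_hsplit x y w1 w2 h : X <= x -> x + w1 + w2 <= X + W ->
  Y <= y -> y + h <= Y + H -> 0 <= w1 -> 0 <= w2 -> 0 <= h ->
  circulation x y (w1 + w2) h = circulation x y w1 h + circulation (x + w1) y w2 h.
Proof.
move=> Xx xW Yy yH w10 w20 h0; rewrite /circulation addrA.
rewrite (@cint_cat _ _ x (x + w1) (x + w1 + w2)); [|lra|lra|]; last first.
  by apply: (@cont_onS _ _ X (X + W)); [lra|lra|]; apply: cont_onB; apply: contA; lra.
have -> : cint (fun t => B (x + w1 + w2) t - B x t) y (y + h) =
    cint (fun t => B (x + w1) t - B x t) y (y + h) +
    cint (fun t => B (x + w1 + w2) t - B (x + w1) t) y (y + h).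
  rewrite -cintD; last 2 first.
  - by apply: (@cont_onS _ _ Y (Y + H)); [lra|lra|]; apply: cont_onB; apply: contB; lra.
  - by apply: (@cont_onS _ _ Y (Y + H)); [lra|lra|]; apply: cont_onB; apply: contB; lra.
  by apply: eq_cint => t _; ring.
ring.
Qed.

Lemma circulation_vsplit x y w h1 h2 : X <= x -> x + w <= X + W ->
  Y <= y -> y + h1 + h2 <= Y + H -> 0 <= w -> 0 <= h1 -> 0 <= h2 ->
  circulation x y w (h1 + h2) = circulation x y w h1 + circulation x (y + h1) w h2.
Proof.
move=> Xx xW Yy yH w0 h10 h20; rewrite /circulation addrA.
rewrite (@cint_cat _ _ y (y + h1) (y + h1 + h2)); [|lra|lra|]; last first.
  by apply: (@cont_onS _ _ Y (Y + H)); [lra|lra|]; apply: cont_onB; apply: contB; lra.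
have -> : cint (fun s => A s (y + h1 + h2) - A s y) x (x + w) =
    cint (fun s => A s (y + h1) - A s y) x (x + w) +
    cint (fun s => A s (y + h1 + h2) - A s (y + h1)) x (x + w).
  rewrite -cintD; last 2 first.
  - by apply: (@cont_onS _ _ X (X + W)); [lra|lra|]; apply: cont_onB; apply: contA; lra.
  - by apply: (@cont_onS _ _ X (X + W)); [lra|lra|]; apply: cont_onB; apply: contA; lra.
  by apply: eq_cint => t _; ring.
ring.
Qed.

(** The linear part of a closed form contributes [q w h - q h w = 0]; the remainder is at most
    [e (w + h)] on paired sides, whose lengths add up to [w + h]. *)
Lemma circulation_small x0 y0 p q q' e : 0 < e ->
  rdiff2 A x0 y0 p q -> rdiff2 B x0 y0 q q' ->
  exists2 r, 0 < r & forall x y w h, X <= x -> x + w <= X + W -> Y <= y -> y + h <= Y + H ->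
    0 <= w -> 0 <= h -> w + h < r -> x <= x0 <= x + w -> y <= y0 <= y + h ->
    `|circulation x y w h| <= e * (w + h) ^+ 2.
Proof.
move=> e0 HA HB.
have [r1 r10 Hr1] := HA (e / 2) ltac:(lra).
have [r2 r20 Hr2] := HB (e / 2) ltac:(lra).
exists (Num.min r1 r2); first by rewrite lt_min r10.
move=> x y w h Xx xW Yy yH w0 h0; rewrite lt_min => /andP[wh1 wh2] /andP[xx xx'] /andP[yy yy'].
have EA s t : x <= s <= x + w -> y <= t <= y + h ->
    `|A s t - A x0 y0 - p * (s - x0) - q * (t - y0)| <= e / 2 * (w + h).
  move=> /andP[s1 s2] /andP[t1 t2].
  have ns : `|s - x0| <= w by rewrite ler_norml; lra.
  have nt : `|t - y0| <= h by rewrite ler_norml; lra.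
  have := Hr1 (s - x0) (t - y0) ltac:(lra) ltac:(lra).
  rewrite !addrA ![_ + s]addrC ![_ + t]addrC !addrK => E; apply: le_trans E _.
  by rewrite ler_pM2l; lra.
have EB s t : x <= s <= x + w -> y <= t <= y + h ->
    `|B s t - B x0 y0 - q * (s - x0) - q' * (t - y0)| <= e / 2 * (w + h).
  move=> /andP[s1 s2] /andP[t1 t2].
  have ns : `|s - x0| <= w by rewrite ler_norml; lra.
  have nt : `|t - y0| <= h by rewrite ler_norml; lra.
  have := Hr2 (s - x0) (t - y0) ltac:(lra) ltac:(lra).
  rewrite !addrA ![_ + s]addrC ![_ + t]addrC !addrK => E; apply: le_trans E _.
  by rewrite ler_pM2l; lra.
have IA : `|cint (fun s => A s (y + h) - A s y) x (x + w) - q * h * (x + w - x)|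
    <= e * (w + h) * (x + w - x).
  apply: cint_near; first lra.
    by apply: (@cont_onS _ _ X (X + W)); [lra|lra|]; apply: cont_onB; apply: contA; lra.
  move=> s sx; have := EA s (y + h) sx ltac:(lra); have := EA s y sx ltac:(lra).
  by rewrite !ler_norml => /andP[? ?] /andP[? ?]; apply/andP; split; lra.
have IB : `|cint (fun t => B (x + w) t - B x t) y (y + h) - q * w * (y + h - y)|
    <= e * (w + h) * (y + h - y).
  apply: cint_near; first lra.
    by apply: (@cont_onS _ _ Y (Y + H)); [lra|lra|]; apply: cont_onB; apply: contB; lra.
  move=> t ty; have := EB (x + w) t ltac:(lra) ty; have := EB x t ltac:(lra) ty.
  by rewrite !ler_norml => /andP[? ?] /andP[? ?]; apply/andP; split; lra.
move: IA IB; rewrite /circulation !ler_norml => /andP[? ?] /andP[? ?].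
by apply/andP; split; lra.
Qed.

(* Goursat's bisection: [quarter] moves the lower left corner to a quarter of the
   rectangle carrying at least a fourth of the circulation. *)
Definition quarter (n : nat) (c : R * R) : R * R :=
  let w := W / 2 ^+ n.+1 in let h := H / 2 ^+ n.+1 in
  let big c' := `|circulation c.1 c.2 (w + w) (h + h)| <= 4 * `|circulation c'.1 c'.2 w h| in
  if big c then c else
  if big (c.1 + w, c.2) then (c.1 + w, c.2) else
  if big (c.1, c.2 + h) then (c.1, c.2 + h) else (c.1 + w, c.2 + h).

Fixpoint corner n : R * R := if n is n'.+1 then quarter n' (corner n') else (X, Y).

Lemma half_pow (a : R) n : a / 2 ^+ n.+1 + a / 2 ^+ n.+1 = a / 2 ^+ n.
Proof.
have h : (2 ^+ n : R) != 0 by rewrite expf_neq0 ?pnatr_eq0.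
by rewrite exprS invfM; field.
Qed.

Lemma cornerP n : let c := corner n in
  [/\ X <= c.1, c.1 + W / 2 ^+ n <= X + W, Y <= c.2, c.2 + H / 2 ^+ n <= Y + H &
   `|circulation X Y W H| <= 4 ^+ n * `|circulation c.1 c.2 (W / 2 ^+ n) (H / 2 ^+ n)| ].
Proof.
elim: n => [|n [IH1 IH2 IH3 IH4 IH5]] /=.
  by rewrite !expr0 !invr1 !mulr1 mul1r; split.
move: IH1 IH2 IH3 IH4 IH5; set c := corner n; rewrite /quarter -/c.
rewrite -(half_pow W n) -(half_pow H n).
have w0 : 0 <= W / 2 ^+ n.+1 by rewrite divr_ge0 // exprn_ge0.
have h0 : 0 <= H / 2 ^+ n.+1 by rewrite divr_ge0 // exprn_ge0.
move: w0 h0; set w := W / _; set h := H / _ => w0 h0 X1 X2 Y1 Y2 K.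
have E : circulation c.1 c.2 (w + w) (h + h) =
    circulation c.1 c.2 w h + circulation (c.1 + w) c.2 w h
    + circulation c.1 (c.2 + h) w h + circulation (c.1 + w) (c.2 + h) w h.
  rewrite circulation_vsplit //; [|lra..].
  rewrite circulation_hsplit //; [|lra..].
  rewrite circulation_hsplit //; [|lra..].
  by rewrite addrA.
have fin x : `|circulation c.1 c.2 (w + w) (h + h)| <= 4 * `|x| ->
    `|circulation X Y W H| <= 4 ^+ n.+1 * `|x|.
  by move=> Hx; apply: le_trans K _; rewrite exprSr -mulrA; apply: ler_wpM2l => //; exact: exprn_ge0.
case: ifP => [b1|/negbT]; first by rewrite /=; split; try lra; exact: fin b1.
case: ifP => [b2 _|/negbT]; first by rewrite /=; split; try lra; exact: fin b2.
case: ifP => [b3 _ _|/negbT]; first by rewrite /=; split; try lra; exact: fin b3.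
(* Three quarters carry less than a fourth each, so the triangle inequality leaves at least a fourth
   to the last one. *)
rewrite -!ltNge /= => b3 b2 b1; split; try lra.
apply: fin; move: b1 b2 b3; rewrite E.
set u1 := circulation c.1 c.2 w h; set u2 := circulation _ c.2 w h.
set u3 := circulation c.1 _ w h; set u4 := circulation _ _ w h => b1 b2 b3.
have T : `|u1 + u2 + u3 + u4| <= `|u1| + `|u2| + `|u3| + `|u4|.
  apply: le_trans (ler_normD _ _) _; rewrite lerD2r.
  apply: le_trans (ler_normD _ _) _; rewrite lerD2r.
  exact: ler_normD.
by lra.
Qed.

Lemma corner_le n k : [/\ (corner n).1 <= (corner (n + k)).1,
  (corner (n + k)).1 + W / 2 ^+ (n + k) <= (corner n).1 + W / 2 ^+ n,
  (corner n).2 <= (corner (n + k)).2 &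
  (corner (n + k)).2 + H / 2 ^+ (n + k) <= (corner n).2 + H / 2 ^+ n].
Proof.
elim: k => [|k [I1 I2 I3 I4]]; first by rewrite addn0; split.
rewrite addnS /= /quarter; set c := corner (n + k).
have w0 : 0 <= W / 2 ^+ (n + k).+1 by rewrite divr_ge0 // exprn_ge0.
have h0 : 0 <= H / 2 ^+ (n + k).+1 by rewrite divr_ge0 // exprn_ge0.
have := half_pow W (n + k); have := half_pow H (n + k).
move: I1 I2 I3 I4; rewrite -/c => I1 I2 I3 I4 EH EW.
by do ![case: ifP => _]; split => /=; lra.
Qed.

(** The lower left corners increase in both coordinates, so their suprema give a point common to all
    the nested rectangles. Near it the circulation is quadratically small in the side lengths, and
    the factor [4 ^+ n] lost by bisection cancels against the square of [2 ^+ n]. *)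
Lemma Green_Goursat : circulation X Y W H = 0.
Proof.
pose xs := sup (range (fun n => (corner n).1)).
pose ys := sup (range (fun n => (corner n).2)).
have pw (a : R) n : 0 <= a -> 0 <= a / 2 ^+ n by move=> a0; rewrite divr_ge0 // exprn_ge0.
have mono n m : (corner n).1 <= (corner m).1 + W / 2 ^+ m /\
    (corner n).2 <= (corner m).2 + H / 2 ^+ m.
  have [nm|/ltnW mn] := leqP n m.
    have [I1 _ I3 _] := corner_le n (m - n); move: I1 I3; rewrite subnKC // => I1 I3.
    by have := pw W m W0; have := pw H m H0; split; lra.
  have [_ I2 _ I4] := corner_le m (n - m); move: I2 I4; rewrite subnKC // => I2 I4.
  by have := pw W n W0; have := pw H n H0; split; lra.
have xsn n : (corner n).1 <= xs <= (corner n).1 + W / 2 ^+ n.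
  apply/andP; split.
    apply: ub_le_sup; last by exists n.
    by exists (X + W) => _ [m _ <-]; have [_ + _ _ _] := cornerP m; have := pw W m W0; lra.
  apply: ge_sup; first by exists X, 0%N.
  by move=> _ [m _ <-]; have [] := mono m n.
have ysn n : (corner n).2 <= ys <= (corner n).2 + H / 2 ^+ n.
  apply/andP; split.
    apply: ub_le_sup; last by exists n.
    by exists (Y + H) => _ [m _ <-]; have [_ _ _ + _] := cornerP m; have := pw H m H0; lra.
  apply: ge_sup; first by exists Y, 0%N.
  by move=> _ [m _ <-]; have [] := mono m n.
have [p [q [q' [HA HB]]]] : exists p q q', rdiff2 A xs ys p q /\ rdiff2 B xs ys q q'.
  by apply: closed_form; [have := xsn 0%N|have := ysn 0%N]; rewrite /= expr0 divr1.
apply/eqP; rewrite -normr_le0; apply/ler_addgt0Pr => e e0; rewrite add0r.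
(* The summand 1 keeps [S] positive for a degenerate rectangle. *)
pose S := W + H + 1.
have S0 : 0 < S by rewrite /S ltr_wpDl // addr_ge0.
have [r r0 Hr] := circulation_small (e := e / S ^+ 2) ltac:(by rewrite divr_gt0 // exprn_gt0) HA HB.
pose n := Num.bound (S / r).
have Sn : S / 2 ^+ n < r.
  rewrite ltr_pdivrMr ?exprn_gt0 // mulrC -ltr_pdivrMr //.
  apply: lt_trans (archi_boundP _) _; first by rewrite divr_ge0 // ltW.
  by rewrite -natrX ltr_nat ltn_expl.
have [C1 C2 C3 C4 C5] := cornerP n.
have WHS : W / 2 ^+ n + H / 2 ^+ n <= S / 2 ^+ n.
  by rewrite -mulrDl ler_pM2r ?invr_gt0 ?exprn_gt0 // /S; lra.
have := Hr _ _ (W / 2 ^+ n) (H / 2 ^+ n) C1 C2 C3 C4 (pw _ _ W0) (pw _ _ H0) ltac:(lra) (xsn n) (ysn n).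
move=> D; apply: le_trans C5 _.
apply: (@le_trans _ _ (4 ^+ n * (e / S ^+ 2 * (S / 2 ^+ n) ^+ 2))).
  rewrite ler_pM2l ?exprn_gt0 //; apply: le_trans D _.
  rewrite ler_pM2l ?divr_gt0 ?exprn_gt0 // lerXn2r ?nnegrE ?addr_ge0 ?pw //.
  exact: ltW.
have -> : (4 : R) ^+ n = (2 ^+ n) ^+ 2 by rewrite -exprM mulnC exprM; congr (_ ^+ _); ring.
have n2 : (2 ^+ n : R) != 0 by rewrite expf_neq0 ?pnatr_eq0.
have Sn0 : S != 0 by rewrite gt_eqF.
rewrite le_eqVlt; apply/orP; left; apply/eqP; field.
by rewrite n2.
Qed.

End GreenGoursat.

(** * The complex exponential *)

Section ComplexExponential.
Variable R : realType.
Implicit Types (z w h : Cx R) (x y t : R).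

Definition unit_pt (y : R) : Cx R := mkC (cos y) (sin y).
Definition unit_conj (y : R) : Cx R := mkC (cos y) (- sin y).
Definition cexp (w : Cx R) : Cx R := ofR (expR (cRe w)) * unit_pt (cIm w).

Lemma cRe_unit y : cRe (unit_pt y) = cos y. Proof. by []. Qed.
Lemma cIm_unit y : cIm (unit_pt y) = sin y. Proof. by []. Qed.
Lemma cRe_unitC y : cRe (unit_conj y) = cos y. Proof. by []. Qed.
Lemma cIm_unitC y : cIm (unit_conj y) = - sin y. Proof. by []. Qed.

Definition uE := (cE, cRe_unit, cIm_unit, cRe_unitC, cIm_unitC).

Lemma cmod_unit y : cmod (unit_pt y) = 1.
Proof. by rewrite cmodE !uE cos2Dsin2 sqrtr1. Qed.

Lemma cmod_unitC y : cmod (unit_conj y) = 1.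
Proof. by rewrite cmodE !uE sqrrN cos2Dsin2 sqrtr1. Qed.

Lemma cexpE x y : cexp (mkC x y) = ofR (expR x) * unit_pt y. Proof. by []. Qed.

Lemma cexpNE x y : cexp (- mkC x y) = ofR (expR x)^-1 * unit_conj y.
Proof. by rewrite /cexp !cE expRN /unit_pt cosN sinN. Qed.

Lemma cexpD w h : cexp (w + h) = cexp w * cexp h.
Proof. by rewrite /cexp !cE expRD; apply: eqC; rewrite !uE cosD sinD; ring. Qed.

Lemma cmod_cexp w : cmod (cexp w) = expR (cRe w).
Proof. by rewrite cmodM cmod_unit mulr1 cmod_ofR ger0_norm // expR_ge0. Qed.

Lemma cexp0 : cexp 0 = 1.
Proof. by rewrite /cexp expR0; apply: eqC; rewrite !uE cos0 sin0; ring. Qed.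

Lemma cexp_period w : cexp (w + mkC 0 (pi *+ 2)) = cexp w.
Proof.
rewrite cexpD -[RHS]mulr1; congr (_ * _).
by apply: eqC; rewrite !uE expR0 cos2pi sin2pi; ring.
Qed.

Lemma cderiv_cexp0 : cderiv cexp 0 1.
Proof.
move=> e e0.
(* The real and the imaginary part each produce an error of at most [3 * (n * cmod h)], whence the
   6; [n <= 1] keeps [expR s] below 2. *)
pose n := Num.min (e / 6) 1.
have n0 : 0 < n by rewrite lt_min ltr01 andbT; lra.
have n1 : n <= 1 by rewrite ge_min lexx orbT.
have ne : n <= e / 6 by rewrite ge_min lexx.
have d1 : is_derive (0 : R) 1 expR 1 by have := is_derive_expR (0 : R); rewrite expR0.
have d2 : is_derive (0 : R) 1 cos 0 by have := is_derive_cos (0 : R); rewrite sin0 oppr0.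
have d3 : is_derive (0 : R) 1 sin 1 by have := is_derive_sin (0 : R); rewrite cos0.
have [r1 r10 H1] := (is_derive_realP _ _ _).1 d1 _ n0.
have [r2 r20 H2] := (is_derive_realP _ _ _).1 d2 _ n0.
have [r3 r30 H3] := (is_derive_realP _ _ _).1 d3 _ n0.
exists (Num.min (n / 2) (Num.min r1 (Num.min r2 r3))); first by rewrite !lt_min r10 r20 r30 divr_gt0.
move=> h; rewrite !lt_min => /and4P[h0 h1 h2 h3].
have sh := cRe_le h; have th := cIm_le h.
have A1 := H1 _ (le_lt_trans sh h1); have A2 := H2 _ (le_lt_trans th h2).
have A3 := H3 _ (le_lt_trans th h3).
move: A1 A2 A3; rewrite !add0r expR0 cos0 sin0 mul1r mul0r !subr0 mul1r => A1 A2 A3.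
rewrite ?add0r cexp0 mul1r; apply: le_trans (cmod_le _) _.
rewrite /cexp !uE.
move: sh th A1 A2 A3; set s := cRe h; set t := cIm h => sh th A1 A2 A3.
have m0 := cmod_ge0 h.
have E1 : `|expR s - 1| <= n.
  have : `|expR s - 1| <= `|expR s - 1 - s| + `|s|.
    by rewrite -[X in `|X| <= _](subrK s) ler_normD.
  have : n * `|s| <= `|s| by rewrite ler_piMl.
  by lra.
have E2 : 0 <= expR s <= 2 by rewrite expR_ge0 /=; move: E1; rewrite ler_norml; lra.
have /andP[E20 E22] := E2.
have B1 : `|expR s * (cos t - 1)| <= 2 * (n * cmod h).
  rewrite normrM (ger0_norm E20); apply: ler_pM => //.
  by apply: le_trans A2 _; rewrite ler_pM2l.
have B2 : `|expR s * (sin t - t)| <= 2 * (n * cmod h).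
  rewrite normrM (ger0_norm E20); apply: ler_pM => //.
  by apply: le_trans A3 _; rewrite ler_pM2l.
have B3 : `|(expR s - 1) * t| <= n * cmod h by rewrite normrM; apply: ler_pM.
have B0 : `|expR s - 1 - s| <= n * cmod h by apply: le_trans A1 _; rewrite ler_pM2l.
have C1 : `|expR s * cos t - 0 * sin t - 1 - s| <= 3 * (n * cmod h).
  have -> : expR s * cos t - 0 * sin t - 1 - s = (expR s - 1 - s) + expR s * (cos t - 1) by ring.
  by apply: le_trans (ler_normD _ _) _; lra.
have C2 : `|expR s * sin t + 0 * cos t - 0 - t| <= 3 * (n * cmod h).
  have -> : expR s * sin t + 0 * cos t - 0 - t = expR s * (sin t - t) + (expR s - 1) * t by ring.
  by apply: le_trans (ler_normD _ _) _; lra.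
have : n * cmod h <= e / 6 * cmod h by rewrite ler_wpM2r.
lra.
Qed.

Lemma cderiv_cexp w : cderiv cexp w (cexp w).
Proof.
have [m0|m0] := eqVneq (cexp w) 0.
  have := cmod_cexp w; rewrite m0 cmod0 => /esym/eqP; rewrite gt_eqF //.
  exact: expR_gt0.
have m1 : 0 < cmod (cexp w) by rewrite cmod_gt0.
move=> e e0; have [r r0 Hr] := cderiv_cexp0 (e := e / cmod (cexp w)) ltac:(by rewrite divr_gt0).
exists r => // h /Hr; rewrite add0r cexp0 mul1r => H.
have -> : cexp (w + h) - cexp w - cexp w * h = cexp w * (cexp h - 1 - h) by rewrite cexpD; ring.
rewrite cmodM -ler_pdivlMl //; apply: le_trans H _.
by rewrite mulrA [_^-1 * _]mulrC.
Qed.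

End ComplexExponential.

(** * Integrals over a period and shifts of the contour *)

Section CircleIntegral.
Variable R : realType.
Implicit Types (f g : R -> Cx R) (x y r M : R).

Definition ccont f := cont_on (fun y => cRe (f y)) 0 (pi *+ 2) /\
  cont_on (fun y => cIm (f y)) 0 (pi *+ 2).

(** An integral in the angle, taken componentwise and not divided by [2 pi]; hence the factors
    [ofR (pi *+ 2)] in the formulas below. *)
Definition circ_int f : Cx R :=
  mkC (cint (fun y => cRe (f y)) 0 (pi *+ 2)) (cint (fun y => cIm (f y)) 0 (pi *+ 2)).

Lemma pi2_gt0 : 0 < (pi : R) *+ 2. Proof. by rewrite mulrn_wgt0 // pi_gt0. Qed.

Lemma eq_circ_int f g : f =1 g -> circ_int f = circ_int g.
Proof. by move=> fg; congr circ_int; apply/funext. Qed.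

Lemma ccontB f g : ccont f -> ccont g -> ccont (fun y => f y - g y).
Proof.
move=> [f1 f2] [g1 g2]; split=> x xp.
  have := cont_onB f1 g1 xp; congr (continuous_at _ _); apply/funext => y; by rewrite cReB.
have := cont_onB f2 g2 xp; congr (continuous_at _ _); apply/funext => y; by rewrite cImB.
Qed.

Lemma ccontM f g : ccont f -> ccont g -> ccont (fun y => f y * g y).
Proof.
move=> [f1 f2] [g1 g2]; split=> x xp.
  have := cont_onB (cont_onM f1 g1) (cont_onM f2 g2) xp.
  by congr (continuous_at _ _); apply/funext => y; rewrite cReM.
have := cont_onD (cont_onM f1 g2) (cont_onM f2 g1) xp.
by congr (continuous_at _ _); apply/funext => y; rewrite cImM.
Qed.

Lemma ccont_cst c : ccont (fun _ => c).
Proof. by split; exact: cont_on_cst. Qed.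

Lemma ccont_unit : ccont (@unit_pt R).
Proof. by split=> x _; [exact: continuous_cos|exact: continuous_sin]. Qed.

Lemma ccont_unitC : ccont (@unit_conj R).
Proof.
split=> x _; first exact: continuous_cos.
by apply: (@cvgN _ _ _ _ _ (sin : R -> R)); exact: continuous_sin.
Qed.

Lemma ccont_lip f L : (forall y t, cmod (f t - f y) <= L * `|t - y|) -> ccont f.
Proof.
move=> H.
have [L0 HL] : 0 < Num.max L 0 + 1 /\ forall y t, cmod (f t - f y) <= (Num.max L 0 + 1) * `|t - y|.
  have m0 : 0 <= Num.max L 0 by rewrite le_max lexx orbT.
  split; first lra.
  move=> y t; apply: le_trans (H y t) _; rewrite ler_wpM2r //.
  have LL : L <= Num.max L 0 by rewrite le_max lexx.
  by lra.
move: (Num.max L 0 + 1) L0 HL => K K0 HK.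
split=> y _; apply/cvgrPdist_le => e e0; near=> t.
  rewrite -cReB; apply: le_trans (cRe_le _) _; apply: le_trans (HK _ _) _.
  rewrite -ler_pdivlMl // mulrC; near: t; apply: cvgr_dist_le => //.
  by rewrite divr_gt0.
rewrite -cImB; apply: le_trans (cIm_le _) _; apply: le_trans (HK _ _) _.
rewrite -ler_pdivlMl // mulrC; near: t; apply: cvgr_dist_le => //.
by rewrite divr_gt0.
Unshelve. all: by end_near. Qed.

Lemma circ_intB f g : ccont f -> ccont g ->
  circ_int (fun y => f y - g y) = circ_int f - circ_int g.
Proof.
move=> [f1 f2] [g1 g2]; apply: eqC; rewrite !cE -cintB //; apply: eq_cint => y _.
  by rewrite cReB.
by rewrite cImB.
Qed.

Lemma circ_intZ c f : ccont f -> circ_int (fun y => c * f y) = c * circ_int f.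
Proof.
move=> [f1 f2].
have zc (k : R) (u : R -> R) : cont_on u 0 (pi *+ 2) -> cont_on (fun y => k * u y) 0 (pi *+ 2).
  by move=> cu; apply: cont_onM => //; exact: cont_on_cst.
apply: eqC; rewrite !cE -!cintZ //.
  by rewrite -cintB; [apply: eq_cint => y _; rewrite cReM|exact: zc|exact: zc].
by rewrite -cintD; [apply: eq_cint => y _; rewrite cImM|exact: zc|exact: zc].
Qed.

(** The factor 2 comes from estimating real and imaginary parts separately; it affects only
    auxiliary constants. *)
Lemma circ_int_near f c M : ccont f -> (forall y, cmod (f y - c) <= M) ->
  cmod (circ_int f - c * ofR (pi *+ 2)) <= 2 * (M * (pi *+ 2)).
Proof.
move=> [f1 f2] fM; apply: le_trans (cmod_le _) _.
have pi2 := ltW pi2_gt0.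
have A : `|cRe (circ_int f - c * ofR (pi *+ 2))| <= M * (pi *+ 2).
  rewrite !cE mulr0 subr0; have := @cint_near _ _ (cRe c) M 0 (pi *+ 2) pi2 f1.
  rewrite !subr0; apply => y _; apply: le_trans (fM y); rewrite -cReB; exact: cRe_le.
have B : `|cIm (circ_int f - c * ofR (pi *+ 2))| <= M * (pi *+ 2).
  rewrite !cE mulr0 add0r; have := @cint_near _ _ (cIm c) M 0 (pi *+ 2) pi2 f2.
  rewrite !subr0; apply => y _; apply: le_trans (fM y); rewrite -cImB; exact: cIm_le.
by lra.
Qed.

Lemma circ_int_le f M : ccont f -> (forall y, cmod (f y) <= M) ->
  cmod (circ_int f) <= 2 * (M * (pi *+ 2)).
Proof.
move=> cf fM; have := @circ_int_near f 0 M cf.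
by rewrite mul0r subr0; apply => y; rewrite subr0.
Qed.

Lemma circ_int_unitC : circ_int (@unit_conj R) = 0.
Proof.
have p0 := pi2_gt0.
apply: eqC; rewrite !cE.
  rewrite (@cint_derive R cos sin) //; first by rewrite sin2pi sin0 subr0.
  by move=> x _; exact: continuous_cos.
rewrite (@cint_derive R (fun y => - sin y) cos) //; first by rewrite cos2pi cos0 subrr.
exact: (ccont_unitC).2.
Qed.

(** The Cauchy-Riemann equations, in the form that supplies closed forms to [Green_Goursat]. *)
Lemma cderiv_rdiff2 (G : Cx R -> Cx R) x y d : cderiv G (mkC x y) d ->
  rdiff2 (fun x y => cRe (G (mkC x y))) x y (cRe d) (- cIm d) /\
  rdiff2 (fun x y => cIm (G (mkC x y))) x y (cIm d) (cRe d).
Proof.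
move=> H.
have K e : 0 < e -> exists2 r, 0 < r & forall s t, `|s| < r -> `|t| < r ->
    cmod (G (mkC (x + s) (y + t)) - G (mkC x y) - d * mkC s t) <= e * (`|s| + `|t|).
  move=> e0; have [r r0 Hr] := H _ e0; exists (r / 2); first by rewrite divr_gt0.
  move=> s t sr tr.
  have st : cmod (mkC s t) <= `|s| + `|t| by exact: cmod_le.
  have := Hr (mkC s t) ltac:(lra).
  have -> : mkC x y + mkC s t = mkC (x + s) (y + t) by apply: eqC; rewrite !cE.
  by move=> h; apply: le_trans h _; rewrite ler_pM2l.
split=> e /K[r r0 Hr]; exists r => // s t sr tr; apply: le_trans (Hr s t sr tr).
  apply: le_trans (cRe_le _); rewrite !cE.
  by rewrite le_eqVlt; apply/orP; left; apply/eqP; congr `|_|; ring.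
apply: le_trans (cIm_le _); rewrite !cE.
by rewrite le_eqVlt; apply/orP; left; apply/eqP; congr `|_|; ring.
Qed.

Lemma cderiv_vcont (G : Cx R -> Cx R) x : (forall y, exists d, cderiv G (mkC x y) d) ->
  ccont (fun y => G (mkC x y)).
Proof.
by move=> H; split=> y _; have [d /cderiv_rdiff2[A B]] := H y;
  [have [] := rdiff2_cont A|have [] := rdiff2_cont B].
Qed.

(* Cauchy's theorem on a period rectangle, whose horizontal sides cancel. *)
Lemma circ_int_shift (G : Cx R -> Cx R) X x1 x2 :
  (forall w, cRe w < X -> exists d, cderiv G w d) ->
  (forall w, G (w + mkC 0 (pi *+ 2)) = G w) -> x1 <= x2 -> x2 < X ->
  circ_int (fun y => G (mkC x1 y)) = circ_int (fun y => G (mkC x2 y)).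
Proof.
move=> HG per x12 x2X.
have per' s : G (mkC s (0 + pi *+ 2)) = G (mkC s 0).
  by rewrite -[RHS]per; congr G; apply: eqC; rewrite !cE; ring.
have p0 := ltW pi2_gt0.
have x2E : x1 + (x2 - x1) = x2 by rewrite addrC subrK.
have cc x : x < X -> ccont (fun y => G (mkC x y)).
  by move=> xX; apply: cderiv_vcont => y; apply: HG; rewrite cE.
have [c1r c1i] := cc x1 (le_lt_trans x12 x2X); have [c2r c2i] := cc x2 x2X.
have x210 : 0 <= x2 - x1 by lra.
apply: eqC; rewrite !cE; apply/esym/eqP; rewrite -subr_eq0 -cintB //; apply/eqP.
  (* The closed form is Im (G dw) here and - Re (G dw) for the imaginary part below. *)
  have := @Green_Goursat R (fun x y => cIm (G (mkC x y))) (fun x y => cRe (G (mkC x y)))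
    x1 0 (x2 - x1) (pi *+ 2) x210 p0.
  rewrite /circulation x2E add0r.
  rewrite (@eq_cint _ (fun s => cIm (G (mkC s (pi *+ 2))) - cIm (G (mkC s 0))) (fun _ => 0)); last first.
    by move=> s _; rewrite -[pi *+ 2]add0r per' subrr.
  rewrite cint_cst // mul0r subr0; apply => x y /andP[_ xx] _.
  have [d /cderiv_rdiff2[A B]] := HG (mkC x y) ltac:(by rewrite cE; exact: le_lt_trans xx x2X).
  by exists (cIm d), (cRe d), (- cIm d).
have := @Green_Goursat R (fun x y => - cRe (G (mkC x y))) (fun x y => cIm (G (mkC x y)))
  x1 0 (x2 - x1) (pi *+ 2) x210 p0.
rewrite /circulation x2E add0r.
rewrite (@eq_cint _ (fun s => - cRe (G (mkC s (pi *+ 2))) - - cRe (G (mkC s 0))) (fun _ => 0)); last first.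
  by move=> s _; rewrite -[pi *+ 2]add0r per' subrr.
rewrite cint_cst // mul0r subr0; apply => x y /andP[_ xx] _.
have [d /cderiv_rdiff2[A B]] := HG (mkC x y) ltac:(by rewrite cE; exact: le_lt_trans xx x2X).
exists (- cRe d), (cIm d), (cRe d); split => //.
move=> e /A[r r0 Hr]; exists r => // s t sr tr.
have := Hr s t sr tr; rewrite -normrN; congr (`|_| <= _); ring.
Qed.

(** The vertical segment is pushed to the left without changing the integral. Under [z = b + exp w]
    this contracts a circle to its centre, so the value of the integral is read off from the limit
    of [G] there. *)
Lemma circ_int_lim (G : Cx R -> Cx R) X c :
  (forall w, cRe w < X -> exists d, cderiv G w d) ->
  (forall w, G (w + mkC 0 (pi *+ 2)) = G w) ->
  (forall e, 0 < e -> exists X0, forall x y, x < X0 -> x < X -> cmod (G (mkC x y) - c) <= e) ->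
  forall x, x < X -> circ_int (fun y => G (mkC x y)) = c * ofR (pi *+ 2).
Proof.
move=> HG per lim x xX; apply/eqP; rewrite -subr_eq0 -cmod_eq0 eq_le cmod_ge0 andbT.
apply/ler_addgt0Pr => e e0; rewrite add0r.
have p0 := pi2_gt0.
have [X0 HX0] := lim (e / 2 / (pi *+ 2)) ltac:(by rewrite !divr_gt0).
pose x1 := Num.min x (X0 - 1).
have x1x : x1 <= x by rewrite ge_min lexx.
have x1X0 : x1 < X0.
  have h : x1 <= X0 - 1 by rewrite ge_min lexx orbT.
  by lra.
rewrite -(circ_int_shift HG per x1x xX).
have x1X := le_lt_trans x1x xX.
have := @circ_int_near (fun y => G (mkC x1 y)) c (e / 2 / (pi *+ 2)).
rewrite divfK ?gt_eqF // [2 * _]mulrC divfK ?pnatr_eq0 //.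
apply; last by move=> y; exact: HX0.
by apply: cderiv_vcont => y; apply: HG; rewrite cE.
Qed.

End CircleIntegral.

(** * Cauchy formulas on circles, in the coordinate w with z = b + exp w *)

Section CauchyFormulas.
Variable R : realType.
Variables (f : Cx R -> Cx R) (b d : Cx R) (rho : R).
Hypothesis rho0 : 0 < rho.
Hypothesis Hf : forall z, cmod (z - b) < rho -> exists d, cderiv f z d.
Hypothesis Hd : cderiv f b d.

Let comp_exp w : cRe w < ln rho -> exists d, cderiv (fun w : Cx R => f (b + cexp w)) w d.
Proof.
move=> wr.
have [|e He] := Hf (z := b + cexp w).
  by rewrite addrAC subrr add0r cmod_cexp -(lnK (x := rho)) // ltr_expR.
exists (e * (0 + cexp w)); apply: (@cderiv_comp _ f (fun w => b + cexp w)) => //.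
by apply: cderivD; [exact: cderiv_cst|exact: cderiv_cexp].
Qed.

Let exp_per w : f (b + cexp (w + mkC 0 (pi *+ 2))) = f (b + cexp w).
Proof. by rewrite cexp_period. Qed.

Let deriv_expN w : cderiv (fun w : Cx R => cexp (- w)) w (cexp (- w) * (0 - 1)).
Proof.
have H : cderiv (fun w : Cx R => - w) w (0 - 1).
  have := cderivB (cderiv_cst 0 w) (cderiv_id w).
  by congr cderiv; apply/funext => v; rewrite sub0r.
by apply: (cderiv_comp H); exact: cderiv_cexp.
Qed.

Let expN_per w : cexp (- (w + mkC 0 (pi *+ 2))) = cexp (- w) :> Cx R.
Proof.
rewrite -[RHS](cexp_period); rewrite -[LHS](cexp_period).
rewrite opprD subrK -[LHS]cexp_period //.
Qed.

Lemma ccont_circle r : 0 < r < rho -> ccont (fun y => f (b + ofR r * unit_pt y)).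
Proof.
move=> /andP[r0 rr].
have -> : (fun y => f (b + ofR r * unit_pt y)) =
    (fun y => (fun w : Cx R => f (b + cexp w)) (mkC (ln r) y)).
  by apply/funext => y /=; rewrite cexpE lnK.
by apply: (@cderiv_vcont R (fun w => f (b + cexp w)) (ln r)) => y; apply: comp_exp; rewrite cE ltr_ln ?posrE.
Qed.

Lemma circle_mean r : 0 < r < rho ->
  circ_int (fun y => f (b + ofR r * unit_pt y)) = f b * ofR (pi *+ 2).
Proof.
move=> /andP[r0 rr].
have lr : ln r < ln rho by rewrite ltr_ln ?posrE.
have := @circ_int_lim R (fun w => f (b + cexp w)) (ln rho) (f b) comp_exp exp_per _ (ln r) lr.
rewrite (eq_circ_int (g := fun y => f (b + ofR r * unit_pt y))); last first.
  by move=> y; rewrite cexpE lnK.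
apply => e e0; have [s s0 Hs] := cderiv_cont Hd e0.
exists (ln s) => x y xs _; apply/ltW/Hs.
by rewrite cmod_cexp cE -(lnK (x := s)) // ltr_expR.
Qed.

(** In the coordinate [w] the quotient of [f z - f b] by [z - b] is holomorphic on the whole
    half-plane; the singularity at [b] has moved to infinity, where the limit is [d]. *)
Lemma circle_deriv r : 0 < r < rho ->
  circ_int (fun y => (f (b + ofR r * unit_pt y) - f b) * unit_conj y) = d * ofR (pi *+ 2) * ofR r.
Proof.
move=> /andP[r0 rr].
have lr : ln r < ln rho by rewrite ltr_ln ?posrE.
pose G w := (f (b + cexp w) - f b) * cexp (- w).
have HG w : cRe w < ln rho -> exists d, cderiv G w d.
  move=> /comp_exp[e He]; eexists; apply: cderivM; last exact: deriv_expN.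
  by apply: cderivB; [exact: He|exact: cderiv_cst].
have HGp w : G (w + mkC 0 (pi *+ 2)) = G w by rewrite /G exp_per expN_per.
have GE y : G (mkC (ln r) y) = (ofR r)^-1 * ((f (b + ofR r * unit_pt y) - f b) * unit_conj y).
  by rewrite /G cexpE cexpNE lnK // ofRV; ring.
have oR0 : ofR r != 0 by rewrite -cmod_eq0 cmod_ofR normr_eq0 gt_eqF.
have cf : ccont (fun y => (f (b + ofR r * unit_pt y) - f b) * unit_conj y).
  apply: ccontM; last exact: ccont_unitC.
  by apply: ccontB; [apply: ccont_circle; rewrite r0|exact: ccont_cst].
have := @circ_int_lim R G (ln rho) d HG HGp _ (ln r) lr.
rewrite (eq_circ_int GE) circ_intZ // => H.
rewrite -H; first by rewrite mulrC mulrA divff // mul1r.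
move=> e e0; have [s s0 Hs] := Hd e0.
exists (ln s) => x y xs _.
have -> : G (mkC x y) - d = (f (b + cexp (mkC x y)) - f b - d * cexp (mkC x y)) * cexp (- mkC x y).
  have E : cexp (mkC x y) * cexp (- mkC x y) = 1 by rewrite -cexpD subrr cexp0.
  by rewrite mulrBl -mulrA E mulr1.
have m : cmod (cexp (mkC x y)) < s by rewrite cmod_cexp cE -(lnK (x := s)) // ltr_expR.
rewrite cmodM; have := Hs _ m; rewrite !cmod_cexp !cE expRN => A.
by rewrite -ler_pdivlMr ?invr_gt0 ?expR_gt0 // invrK.
Qed.

(** The Fourier coefficient of index -1 on the circle vanishes, since [f (b + exp w) * exp w] tends
    to 0 at the left end of the half-plane. *)
Lemma circle_conj r : 0 < r < rho ->
  circ_int (fun y => f (b + ofR r * unit_pt y) * unit_pt y) = 0.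
Proof.
move=> /andP[r0 rr].
have lr : ln r < ln rho by rewrite ltr_ln ?posrE.
pose G w := f (b + cexp w) * cexp w.
have HG w : cRe w < ln rho -> exists d, cderiv G w d.
  by move=> /comp_exp[e He]; eexists; apply: cderivM; [exact: He|exact: cderiv_cexp].
have HGp w : G (w + mkC 0 (pi *+ 2)) = G w by rewrite /G exp_per cexp_period.
have GE y : G (mkC (ln r) y) = ofR r * (f (b + ofR r * unit_pt y) * unit_pt y).
  by rewrite /G cexpE lnK //; ring.
have oR0 : ofR r != 0 by rewrite -cmod_eq0 cmod_ofR normr_eq0 gt_eqF.
have cf : ccont (fun y => f (b + ofR r * unit_pt y) * unit_pt y).
  by apply: ccontM; [apply: ccont_circle; rewrite r0|exact: ccont_unit].
have := @circ_int_lim R G (ln rho) 0 HG HGp _ (ln r) lr.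
rewrite (eq_circ_int GE) circ_intZ // mul0r => H.
have {}H : ofR r * circ_int (fun y => f (b + ofR r * unit_pt y) * unit_pt y) = 0.
  apply: H => e e0; have [s s0 Hs] := cderiv_cont Hd ltr01.
  pose k := cmod (f b) + 1.
  have k0 : 0 < k by rewrite /k; have := cmod_ge0 (f b); lra.
  exists (ln (Num.min s (e / k))) => x y xs _.
  have m0 : 0 < Num.min s (e / k) by rewrite lt_min s0 divr_gt0.
  have : cmod (cexp (mkC x y)) < Num.min s (e / k).
    by rewrite cmod_cexp cE -(lnK (x := Num.min s (e / k))) // ltr_expR.
  rewrite lt_min => /andP[m1 m2].
  rewrite subr0 cmodM; have := Hs _ m1 => F.
  have Fk : cmod (f (b + cexp (mkC x y))) <= k.
    rewrite -[X in cmod X](subrK (f b)); apply: le_trans (cmodD _ _) _; rewrite /k; lra.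
  apply: (@le_trans _ _ (k * (e / k))); first by apply: ler_pM; [exact: cmod_ge0|exact: cmod_ge0|exact: Fk|exact: ltW m2].
  by rewrite mulrC divfK // gt_eqF.
by move/eqP: H; rewrite mulf_eq0 (negbTE oR0) /= => /eqP.
Qed.

End CauchyFormulas.

(** * The Schwarz lemma for the half-plane *)

Section HalfPlane.
Variable R : realType.
Variables (f : Cx R -> Cx R) (d : Cx R).
Hypothesis Hf : forall z, cmod z < 1 -> exists d, cderiv f z d.
Hypothesis Hd : cderiv f 0 d.
Hypothesis fpos : forall z, cmod z < 1 -> 0 < cRe (f z).

(** Because the coefficient of index -1 vanishes, the first Fourier coefficient of the positive
    function [2 Re f] on the circle of radius [r] is [r d]. Positivity bounds it by the mean, which
    is [2 Re f 0]; then [r] tends to 1. *)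
Lemma half_plane_deriv : cmod d <= 2 * cRe (f 0).
Proof.
have Hf0 z : cmod (z - 0) < 1 -> exists d, cderiv f z d by rewrite subr0; exact: Hf.
set u0 := cRe (f 0); set D := cmod d.
have p0 := @pi2_gt0 R.
have key r : 0 < r < 1 -> r * D ^+ 2 <= 2 * D * u0.
  move=> r01; have /andP[r0 r1] := r01.
  pose F y := f (0 + ofR r * unit_pt y).
  have cF : ccont F := ccont_circle ltr01 Hf0 r01.
  have H0 : circ_int F = f 0 * ofR (pi *+ 2) := circle_mean ltr01 Hf0 Hd r01.
  have H1 : circ_int (fun y => F y * unit_conj y) = d * ofR (pi *+ 2) * ofR r.
    rewrite -(circle_deriv ltr01 Hf0 Hd r01) -/F.
    rewrite (eq_circ_int (f := fun y => (F y - f 0) * unit_conj y)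
       (g := fun y => F y * unit_conj y - f 0 * unit_conj y)); last by move=> y; rewrite mulrBl.
    rewrite circ_intB; [|exact: ccontM cF (@ccont_unitC R)|exact: ccontM (ccont_cst _) (@ccont_unitC R)].
    by rewrite circ_intZ ?circ_int_unitC ?mulr0 ?subr0 //; exact: ccont_unitC.
  have H2 : circ_int (fun y => F y * unit_pt y) = 0 := circle_conj ltr01 Hf0 Hd r01.
  have [c1r c1i] := ccontM cF (@ccont_unitC R); have [c2r c2i] := ccontM cF (@ccont_unit R).
  have [cFr cFi] := cF.
  (* This is [2 Re F Re (d exp (i y))], expressed through the integrands of [H1] and [H2] so that
     its integral is known. *)
  pose h y := cRe d * (cRe (F y * unit_conj y) + cRe (F y * unit_pt y))
     + cIm d * (cIm (F y * unit_conj y) - cIm (F y * unit_pt y)).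
  have hE y : h y = 2 * cRe (F y) * cRe (d * unit_pt y) by rewrite /h !uE; ring.
  have zc (k : R) (u : R -> R) : cont_on u 0 (pi *+ 2) -> cont_on (fun y => k * u y) 0 (pi *+ 2).
    by move=> cu; apply: cont_onM => //; exact: cont_on_cst.
  have cA := cont_onD c1r c2r; have cB := cont_onB c1i c2i.
  have Ih : cint h 0 (pi *+ 2) = (pi *+ 2) * r * D ^+ 2.
    rewrite /h cintD; [|exact: zc|exact: zc].
    rewrite !cintZ // cintD // cintB //.
    have := congr1 cRe H1; have := congr1 cIm H1; have := congr1 cRe H2; have := congr1 cIm H2.
    by rewrite !cE => -> -> -> ->; rewrite /D cmod_sqr; ring.
  have IU : cint (fun y => 2 * D * cRe (F y)) 0 (pi *+ 2) = 2 * D * (u0 * (pi *+ 2)).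
    rewrite cintZ //; congr (_ * _); have := congr1 cRe H0; rewrite !cE => ->; rewrite /u0; ring.
  have : cint h 0 (pi *+ 2) <= cint (fun y => 2 * D * cRe (F y)) 0 (pi *+ 2).
    apply: cint_le; [by apply: cont_onD; exact: zc|exact: zc|].
    move=> y _; rewrite hE.
    have Fy : 0 < cRe (F y).
      by apply: fpos; rewrite add0r cmodM cmod_ofR cmod_unit mulr1 gtr0_norm.
    have B : cRe (d * unit_pt y) <= D.
      by apply: le_trans (ler_norm _) _; apply: le_trans (cRe_le _) _; rewrite cmodM cmod_unit mulr1.
    have : cRe (F y) * cRe (d * unit_pt y) <= cRe (F y) * D by rewrite ler_pM2l.
    lra.
  rewrite Ih IU; set P := pi *+ 2; rewrite -/P in p0.
  have -> : P * r * D ^+ 2 = P * (r * D ^+ 2) by ring.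
  have -> : 2 * D * (u0 * P) = P * (2 * D * u0) by ring.
  by rewrite ler_pM2l.
have u0p : 0 < u0 by apply: fpos; rewrite cmod0.
have D0 : 0 <= D := cmod_ge0 d.
rewrite leNgt; apply/negP => lt; have Dp : 0 < D by lra.
(* The midpoint between [2 u0 / D] and 1, whereas [key] allows only radii up to [2 u0 / D]. *)
pose r := (1 + 2 * u0 / D) / 2.
have rE : r * D = (D + 2 * u0) / 2 by rewrite /r; field; rewrite gt_eqF.
have q : 2 * u0 / D < 1 by rewrite ltr_pdivrMr // mul1r.
have q0 : 0 < 2 * u0 / D by rewrite divr_gt0 // mulr_gt0.
have := key r; rewrite expr2 mulrA rE => H.
have {}H := H ltac:(rewrite /r; lra).
have : (D + 2 * u0) / 2 <= 2 * u0 by rewrite -(ler_pM2r Dp); lra.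
lra.
Qed.

End HalfPlane.

(** * Derivatives of holomorphic functions are holomorphic *)

Section DerivativeHolomorphic.
Variable R : realType.
Implicit Types (a b h z : Cx R) (r s rho M : R).

Lemma unit_pt_lip (y t : R) : cmod (unit_pt t - unit_pt y) <= 2 * `|t - y|.
Proof.
have L (u u' : R -> R) : (forall x : R, is_derive x 1 u (u' x)) -> (forall x, `|u' x| <= 1) ->
    `|u t - u y| <= `|t - y|.
  move=> du bu.
  have M (a b : R) : a <= b -> `|u b - u a| <= `|b - a|.
    move=> ab.
    have cu : {within `[a, b], continuous u}.
      by apply: derivable_within_continuous => x _; exact: ex_derive.
    by have [c _ ->] := MVT_segment ab (fun x _ => du x) cu; rewrite normrM ler_piMl.
  by have [/M //|/ltW/M] := leP y t; rewrite distrC [`|y - t|]distrC.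
apply: le_trans (cmod_le _) _; rewrite !uE mulr_natl mulr2n; apply: lerD.
  by apply: (L cos (fun x => - sin x)) => x; rewrite normrN; apply: sin_max.
by apply: (L sin cos) => x; apply: cos_max.
Qed.

Variables (f f' : Cx R -> Cx R).

Lemma circle_deriv_eq a r s : 0 < s < r -> (forall z, cmod (z - a) < r -> cderiv f z (f' z)) ->
  ccont (fun y => f (a + ofR s * unit_pt y)) /\
  circ_int (fun y => f (a + ofR s * unit_pt y) * unit_conj y) = f' a * ofR (pi *+ 2) * ofR s.
Proof.
move=> sr Hf; have /andP[s0 lt_sr] := sr; have r0 := lt_trans s0 lt_sr.
have Hf' z : cmod (z - a) < r -> exists d, cderiv f z d by move=> /Hf; exists (f' z).
have Ha : cderiv f a (f' a) by apply: Hf; rewrite subrr cmod0.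
have cF := ccont_circle r0 Hf' sr; split => //.
rewrite -(circle_deriv r0 Hf' Ha sr).
rewrite [RHS](eq_circ_int (g := fun y => f (a + ofR s * unit_pt y) * unit_conj y - f a * unit_conj y));
  last by move=> y; rewrite mulrBl.
rewrite circ_intB; [|exact: ccontM cF (@ccont_unitC R)|exact: ccontM (ccont_cst _) (@ccont_unitC R)].
by rewrite circ_intZ ?circ_int_unitC ?mulr0 ?subr0 //; exact: ccont_unitC.
Qed.

(** Differentiation of the Cauchy formula under the integral sign. The Cauchy formula and the mean
    value inequality alternate on shrinking discs: a bound for [f'] ([S1]), a Lipschitz bound for
    [f] ([S2]), one for [f'] ([S3]), and a quadratic remainder for [f] ([S4]) that makes the
    exchange uniform on the circle. *)
Lemma cderiv_deriv_local b rho M : 0 < rho -> 0 <= M ->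
  (forall z, cmod (z - b) < rho -> cderiv f z (f' z)) ->
  (forall z, cmod (z - b) < rho -> cmod (f z) <= M) -> exists d, cderiv f' b d.
Proof.
move=> rho0 M0 Hf HM.
pose r := rho / 4; have r0 : 0 < r by rewrite /r; lra.
have rE : rho = 4 * r by rewrite /r; field.
pose s := r / 2; have s0 : 0 < s by rewrite /s; lra.
have p0 := @pi2_gt0 R.
have sr : 0 < s < r by rewrite s0 /s; lra.
have tri a z : cmod (z - b) <= cmod (z - a) + cmod (a - b).
  have -> : z - b = (z - a) + (a - b) by ring.
  exact: cmodD.
have circ a y : cmod (a + ofR s * unit_pt y - a) = s.
  by rewrite addrAC subrr add0r cmodM cmod_unit mulr1 cmod_ofR gtr0_norm.
have Hball a : cmod (a - b) < 3 * r -> forall z, cmod (z - a) < r -> cderiv f z (f' z).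
  by move=> ab z za; apply: Hf; have := tri a z; lra.
have cancel x B : cmod (x * ofR (pi *+ 2) * ofR s) <= 2 * (B * (pi *+ 2)) -> cmod x <= 2 * B / s.
  rewrite !cmodM !cmod_ofR !gtr0_norm // => H.
  rewrite ler_pdivlMr // -(ler_pM2r p0).
  have -> : cmod x * s * (pi *+ 2) = cmod x * (pi *+ 2) * s by ring.
  by have -> : 2 * B * (pi *+ 2) = 2 * (B * (pi *+ 2)) by ring.
pose L1 := 2 * M / s.
have L10 : 0 <= L1 by rewrite divr_ge0 ?mulr_ge0 // ltW.
have S1 a : cmod (a - b) < 3 * r -> cmod (f' a) <= L1.
  move=> ab; have [cF E] := circle_deriv_eq sr (Hball a ab).
  apply: cancel; rewrite -E; apply: circ_int_le; first exact: ccontM cF (@ccont_unitC R).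
  move=> y; rewrite cmodM cmod_unitC mulr1; apply: HM.
  by have := tri a (a + ofR s * unit_pt y); rewrite circ /s; lra.
have seg B a a' t : cmod (a - b) < B -> cmod (a' - b) < B -> 0 <= t <= 1 ->
    cmod (a + ofR t * (a' - a) - b) < B.
  move=> aB a'B /andP[t0 t1].
  have -> : a + ofR t * (a' - a) - b = ofR (1 - t) * (a - b) + ofR t * (a' - b).
    by rewrite ofRB ofR1; ring.
  apply: le_lt_trans (cmodD _ _) _; rewrite !cmodM !cmod_ofR !ger0_norm //; last lra.
  have [->|t0'] := eqVneq t 0; first by rewrite mul0r subr0 mul1r addr0.
  have tp : 0 < t by rewrite lt_def t0'.
  have h1 : t * cmod (a' - b) < t * B by rewrite ltr_pM2l.
  have h2 : (1 - t) * cmod (a - b) <= (1 - t) * B by rewrite ler_wpM2l ?subr_ge0 // ltW.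
  lra.
have S2 a a' : cmod (a - b) < 3 * r -> cmod (a' - b) < 3 * r ->
    cmod (f a' - f a) <= 2 * L1 * cmod (a' - a).
  move=> ab a'b.
  have := @cderiv_mean R f (fun t => f' (a + ofR t * (a' - a))) a (a' - a) 0 (L1 * cmod (a' - a)).
  have -> : a + (a' - a) = a' by rewrite addrC subrK.
  have -> : 2 * L1 * cmod (a' - a) = 2 * (L1 * cmod (a' - a)) by rewrite mulrA.
  rewrite subr0; apply=> t t01.
    by apply: Hf; have := seg _ _ _ t ab a'b t01; lra.
  rewrite subr0 cmodM; apply: ler_wpM2r; first exact: cmod_ge0.
  by apply: S1; exact: seg.
pose L2 := 2 * (2 * L1) / s.
have L20 : 0 <= L2 by apply: divr_ge0; [lra|exact: ltW].
have S3 a a' : cmod (a - b) < 2 * r -> cmod (a' - b) < 2 * r ->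
    cmod (f' a' - f' a) <= L2 * cmod (a' - a).
  move=> ab a'b.
  have [cF E] := circle_deriv_eq sr (Hball a ltac:(lra)).
  have [cF' E'] := circle_deriv_eq sr (Hball a' ltac:(lra)).
  have -> : L2 * cmod (a' - a) = 2 * (2 * L1 * cmod (a' - a)) / s by rewrite /L2; field; rewrite gt_eqF.
  apply: cancel; rewrite !mulrBl -E -E' -circ_intB; last 2 first.
  - exact: ccontM cF' (@ccont_unitC R).
  - exact: ccontM cF (@ccont_unitC R).
  apply: circ_int_le; first by apply: ccontB; apply: ccontM => //; exact: ccont_unitC.
  move=> y; rewrite -mulrBl cmodM cmod_unitC mulr1.
  have -> : a' - a = (a' + ofR s * unit_pt y) - (a + ofR s * unit_pt y) by ring.
  apply: S2.
    by have := tri a (a + ofR s * unit_pt y); rewrite circ /s; lra.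
  by have := tri a' (a' + ofR s * unit_pt y); rewrite circ /s; lra.
have S4 a a' : cmod (a - b) < 2 * r -> cmod (a' - b) < 2 * r ->
    cmod (f a' - f a - f' a * (a' - a)) <= 2 * (L2 * cmod (a' - a) * cmod (a' - a)).
  move=> ab a'b.
  have := @cderiv_mean R f (fun t => f' (a + ofR t * (a' - a))) a (a' - a) (f' a * (a' - a))
    (L2 * cmod (a' - a) * cmod (a' - a)).
  have -> : a + (a' - a) = a' by rewrite addrC subrK.
  apply=> t t01; first by apply: Hf; have := seg _ _ _ t ab a'b t01; lra.
  rewrite -mulrBl cmodM; apply: ler_wpM2r; first exact: cmod_ge0.
  apply: le_trans (S3 _ _ ab (seg _ _ _ t ab a'b t01)) _.
  rewrite addrAC subrr add0r cmodM cmod_ofR ler_wpM2l //.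
  by have /andP[t0 t1] := t01; rewrite ger0_norm // ler_piMl ?cmod_ge0.
have bb : cmod (b - b) < r by rewrite subrr cmod0.
have [cF E] := circle_deriv_eq sr (Hball b ltac:(lra)).
have inr y : cmod (b + ofR s * unit_pt y - b) < r by rewrite circ; case/andP: sr.
have cF1 : ccont (fun y => f' (b + ofR s * unit_pt y)).
  apply: (ccont_lip (L := L2 * (s * 2))) => y t.
  apply: le_trans (S3 _ _ _ _) _; [by have := inr y; lra|by have := inr t; lra|].
  have -> : L2 * (s * 2) * `|t - y| = L2 * (s * (2 * `|t - y|)) by ring.
  apply: ler_wpM2l; first exact: L20.
  have -> : b + ofR s * unit_pt t - (b + ofR s * unit_pt y) = ofR s * (unit_pt t - unit_pt y) by ring.
  rewrite cmodM cmod_ofR (gtr0_norm s0); apply: ler_wpM2l; [exact: ltW|exact: unit_pt_lip].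
have cF2 := ccontM cF1 (@ccont_unitC R).
(* The candidate for the second derivative: the integral formula for [f' b] with the integrand
   differentiated in the centre. *)
pose c := circ_int (fun y => f' (b + ofR s * unit_pt y) * unit_conj y) / (ofR (pi *+ 2) * ofR s).
exists c => e e0.
pose K := 4 * L2 / s; have K0 : 0 <= K by apply: divr_ge0; [lra|exact: ltW].
exists (Num.min s (e / (K + 1))); first by rewrite lt_min s0 divr_gt0 // ltr_wpDl.
move=> h; rewrite lt_min => /andP[hs he].
have bh : cmod (b + h - b) < s by rewrite addrAC subrr add0r.
have [cFh Eh] := circle_deriv_eq sr (Hball (b + h) ltac:(rewrite /s in bh; lra)).
apply: (@le_trans _ _ (2 * (2 * (L2 * cmod h * cmod h)) / s)); last first.
  have -> : 2 * (2 * (L2 * cmod h * cmod h)) / s = K * cmod h * cmod h by rewrite /K; field; rewrite gt_eqF.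
  rewrite ler_wpM2r ?cmod_ge0 //; move: he; rewrite ltr_pdivlMr ?ltr_wpDl // => he.
  by have := cmod_ge0 h; lra.
apply: cancel.
have ps : ofR (pi *+ 2) * ofR s != 0 by rewrite -ofRM -cmod_eq0 cmod_ofR normr_eq0 gt_eqF // mulr_gt0.
have -> : (f' (b + h) - f' b - c * h) * ofR (pi *+ 2) * ofR s =
    f' (b + h) * ofR (pi *+ 2) * ofR s - f' b * ofR (pi *+ 2) * ofR s
    - h * circ_int (fun y => f' (b + ofR s * unit_pt y) * unit_conj y).
  have -> : circ_int (fun y => f' (b + ofR s * unit_pt y) * unit_conj y) =
    c * (ofR (pi *+ 2) * ofR s) by rewrite /c divfK.
  by ring.
have cA := ccontM cFh (@ccont_unitC R); have cB := ccontM cF (@ccont_unitC R).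
have cC : ccont (fun y => h * (f' (b + ofR s * unit_pt y) * unit_conj y)) := ccontM (ccont_cst h) cF2.
have cAB := ccontB cA cB.
rewrite -E -Eh -circ_intZ // -circ_intB // -circ_intB //.
apply: circ_int_le; first exact: ccontB.
move=> y.
have -> : f (b + h + ofR s * unit_pt y) * unit_conj y - f (b + ofR s * unit_pt y) * unit_conj y
   - h * (f' (b + ofR s * unit_pt y) * unit_conj y) =
   (f (b + h + ofR s * unit_pt y) - f (b + ofR s * unit_pt y)
   - f' (b + ofR s * unit_pt y) * ((b + h + ofR s * unit_pt y) - (b + ofR s * unit_pt y))) * unit_conj y.
  by ring.
rewrite cmodM cmod_unitC mulr1.
have -> : cmod h = cmod ((b + h + ofR s * unit_pt y) - (b + ofR s * unit_pt y)).
  by congr cmod; ring.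
apply: S4; first by have := inr y; lra.
have := tri (b + h) (b + h + ofR s * unit_pt y); rewrite circ.
by rewrite /s in bh *; lra.
Qed.

Lemma cderiv_deriv rho : (forall z, cmod z < rho -> cderiv f z (f' z)) ->
  forall z, cmod z < rho -> exists d, cderiv f' z d.
Proof.
move=> Hf b brho.
have [r1 r10 Hr1] := cderiv_cont (Hf b brho) ltr01.
pose r := Num.min r1 (rho - cmod b).
have r0 : 0 < r by rewrite lt_min r10 subr_gt0.
have M0 : 0 <= cmod (f b) + 1 by have := cmod_ge0 (f b); lra.
apply: (@cderiv_deriv_local b r (cmod (f b) + 1) r0 M0).
  move=> z; rewrite lt_min => /andP[_ zb]; apply: Hf.
  by have := cmodD (z - b) b; rewrite subrK; lra.
move=> z; rewrite lt_min => /andP[/Hr1 H _].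
  have zE : b + (z - b) = z by rewrite addrC subrK.
  rewrite zE in H.
by have := cmodD (f z - f b) (f b); rewrite subrK; lra.
Qed.

End DerivativeHolomorphic.

(** * Kobayashi lengths of curves *)

Import HBNNSimple.

Section LowerIntegral.
Context d (T : measurableType d) (R : realType) (mu : {measure set T -> \bar R}).
Implicit Types (D : set T) (f g : T -> \bar R).

(* The integral of a nonnegative function is a supremum over the simple
   functions below it, hence monotone even without measurability. *)
Lemma ge0_integral_mono D f g : (forall x, D x -> (0 <= f x)%E) ->
  (forall x, D x -> (f x <= g x)%E) ->
  (\int[mu]_(x in D) f x <= \int[mu]_(x in D) g x)%E.
Proof.
move=> f0 fg; rewrite integral_mkcond [leRHS]integral_mkcond.
have f0' x : (0 <= (f \_ D) x)%E by rewrite patchE; case: ifPn => // /set_mem/f0.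
have g0' x : (0 <= (g \_ D) x)%E.
  by rewrite patchE; case: ifPn => // /set_mem xD; apply: le_trans (fg _ xD); exact: f0.
rewrite !ge0_integralTE //; apply: ereal_sup_le => _ [h hf <-]; exists h => //= x.
apply: le_trans (hf x) _; rewrite !patchE; case: ifPn => // /set_mem.
exact: fg.
Qed.

Lemma ge0_integral_subset D E f : E `<=` D -> (forall x, D x -> (0 <= f x)%E) ->
  (\int[mu]_(x in E) f x <= \int[mu]_(x in D) f x)%E.
Proof.
move=> ED f0; rewrite integral_mkcond [leRHS]integral_mkcond.
apply: ge0_integral_mono => x _; rewrite !patchE.
  by case: ifPn => // /set_mem/ED/f0.
case: ifPn => [/set_mem/ED xD|_]; first by rewrite mem_set.
by case: ifPn => // /set_mem/f0.
Qed.

(** Only [f] is measurable. The exceptional null set is removed from the integral of [f], which does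
    not change it; what remains is monotonicity of suprema over simple functions. *)
Lemma ae_ge0_integral_lower D f g : measurable D -> mu.-integrable D f ->
  (forall x, D x -> (0 <= f x)%E) -> (forall x, D x -> (0 <= g x)%E) ->
  {ae mu, forall x, D x -> (f x <= g x)%E} ->
  (\int[mu]_(x in D) f x <= \int[mu]_(x in D) g x)%E.
Proof.
move=> mD fi f0 g0 [N [mN N0 HN]].
rewrite (negligible_integral mN mD fi N0).
apply: (@le_trans _ _ (\int[mu]_(x in D `\` N) g x)%E).
  apply: ge0_integral_mono => x [xD xN]; first exact: f0.
  apply: contrapT => H; apply: xN; apply: HN => /=.
  by move=> /(_ xD).
by apply: ge0_integral_subset => // x [].
Qed.

(** Every simple function below [f] is measurable and vanishes off [D], so the almost everywhere
    comparison applies to it, although [f] itself may fail to be measurable. *)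
Lemma ae_integral_le_cst D f (c : R) : measurable D -> 0 <= c ->
  (forall x, D x -> (0 <= f x)%E) -> {ae mu, forall x, D x -> (f x <= c%:E)%E} ->
  (\int[mu]_(x in D) f x <= c%:E * mu D)%E.
Proof.
move=> mD c0 f0 fc.
rewrite integral_mkcond.
have f0' x : (0 <= (f \_ D) x)%E by rewrite patchE; case: ifPn => // /set_mem/f0.
rewrite ge0_integralTE //; apply/ereal_supP => _ [h hf <-].
have hD : (h : T -> R) = h \_ D.
  apply/funext => x; rewrite patchE; case: ifPn => // /negP xD.
  have := hf x; rewrite patchE ifF; last exact/negP.
  move=> hx; have h0 : h x <= 0 by rewrite -lee_fin; exact: hx.
  by apply: (@le_anti _ R (h x) 0); rewrite h0 fun_ge0.
rewrite hD -integral_nnsfun //.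
rewrite -integral_cst //; apply: ae_ge0_le_integral => //.
- by move=> x _; rewrite lee_fin.
- by apply/measurable_EFinP; exact: measurable_funTS.
- apply: filterS fc => x Hx xD; apply: le_trans (Hx xD); have := hf x.
  by rewrite patchE mem_set.
Qed.

End LowerIntegral.

(** * Stability of absolute continuity *)

Section AbsoluteContinuityCalculus.
Variable R : realType.
Implicit Types (a b c s t : R) (f g h : R -> R).

(** The common source of stability under linear combinations, products, maxima, logarithms and
    exponentials: each is Lipschitz on the values taken along the segment. *)
Lemma abs_continuous_lip a b f g h C : abs_continuous a b f -> abs_continuous a b g ->
  (forall s t, a <= s <= b -> a <= t <= b -> `|h t - h s| <= C * (`|f t - f s| + `|g t - g s|)) ->
  abs_continuous a b h.
Proof.
move=> Hf Hg H e e0.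
pose K := Num.max C 0 + 1.
have m0 : 0 <= Num.max C 0 by rewrite le_max lexx orbT.
have K0 : 0 < K by rewrite /K; lra.
have CK : C <= K by have : C <= Num.max C 0 by [rewrite le_max lexx]; rewrite /K; lra.
have [d1 d10 H1] := Hf (e / 2 / K) ltac:(by rewrite !divr_gt0).
have [d2 d20 H2] := Hg (e / 2 / K) ltac:(by rewrite !divr_gt0).
exists (Num.min d1 d2); first by rewrite lt_min d10.
move=> N u v uv dis; rewrite lt_min => /andP[l1 l2].
have A := H1 N u v uv dis l1; have B := H2 N u v uv dis l2.
apply: (@le_lt_trans _ _ (K * (\sum_(i < N) `|f (v i) - f (u i)| + \sum_(i < N) `|g (v i) - g (u i)|))).
  rewrite -big_split /= mulr_sumr; apply: ler_sum => i _.
  have [u1 uv1 v1] := uv i; apply: le_trans (H (u i) (v i) _ _) _.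
  - by rewrite u1 (le_trans uv1 v1).
  - by rewrite v1 andbT (le_trans u1 uv1).
  by apply: ler_wpM2r => //; exact: addr_ge0.
rewrite -ltr_pdivlMl //; have -> : K^-1 * e = e / 2 / K + e / 2 / K by field; rewrite gt_eqF.
exact: ltrD.
Qed.

Lemma abs_continuous_lip1 a b f h C : abs_continuous a b f ->
  (forall s t, a <= s <= b -> a <= t <= b -> `|h t - h s| <= C * `|f t - f s|) ->
  abs_continuous a b h.
Proof.
move=> Hf H; apply: (abs_continuous_lip (C := `|C|) Hf Hf) => s t sab tab.
apply: le_trans (H s t sab tab) _.
apply: (@le_trans _ _ (`|C| * `|f t - f s|)); first by rewrite ler_wpM2r // ler_norm.
by rewrite ler_wpM2l // lerDl.
Qed.

Lemma abs_continuous_clamp a b f : a <= b -> abs_continuous a b f ->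
  forall x, {for x, continuous (fun t => f (Num.max a (Num.min b t)))}.
Proof. by move=> ab /abs_continuous_seq; exact: seq_abs_continuous_clamp. Qed.

Lemma clampE a b t : a <= t <= b -> Num.max a (Num.min b t) = t.
Proof. by move=> /andP[aat tb]; rewrite (min_idPr tb) (max_idPr aat). Qed.

Lemma abs_continuous_gt0 a b f : a <= b -> abs_continuous a b f ->
  (forall t, a <= t <= b -> 0 < f t) -> exists2 c, 0 < c & forall t, a <= t <= b -> c <= f t.
Proof.
move=> ab Hf fp; have cf := abs_continuous_clamp ab Hf.
have [c cab Hc] := @EVT_min R (fun t => f (Num.max a (Num.min b t))) a b ab
  (continuous_subspaceT cf).
move: cab; rewrite in_itv /= => cab.
exists (f c); first exact: fp.
by move=> t tab; have := Hc t; rewrite in_itv /= !clampE // => /(_ tab).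
Qed.

Lemma abs_continuous_bounded a b f : a <= b -> abs_continuous a b f ->
  exists M, forall t, a <= t <= b -> `|f t| <= M.
Proof.
move=> ab Hf; have cf := abs_continuous_clamp ab Hf.
have [c cab Hc] := @EVT_min R (fun t => f (Num.max a (Num.min b t))) a b ab
  (continuous_subspaceT cf).
have [c' c'ab Hc'] := @EVT_max R (fun t => f (Num.max a (Num.min b t))) a b ab
  (continuous_subspaceT cf).
move: cab c'ab; rewrite !in_itv /= => cab c'ab.
exists (`|f c| + `|f c'|) => t tab.
have := Hc t; have := Hc' t; rewrite in_itv /= !clampE // => /(_ tab) A /(_ tab) B.
have := ler_norm (- f c); have := ler_norm (f c'); rewrite normrN.
have := normr_ge0 (f c); have := normr_ge0 (f c').
by rewrite ler_norml; lra.
Qed.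

Lemma ln_lip c s t : 0 < c -> c <= s -> c <= t -> `|ln t - ln s| <= c^-1 * `|t - s|.
Proof.
move=> c0; wlog st : s t / s <= t.
  move=> H cs ct; have [st|/ltW ts] := leP s t; first exact: H.
  by rewrite distrC [`|t - s|]distrC; exact: H.
move=> cs ct; have s0 : 0 < s by lra.
have t0 : 0 < t by lra.
have lst : ln s <= ln t by rewrite ler_ln ?posrE.
rewrite !ger0_norm ?subr_ge0 //.
rewrite -ln_div ?posrE //.
have -> : t / s = 1 + (t - s) / s by field; rewrite gt_eqF.
apply: le_trans (le_ln1Dx _) _.
  by apply: (@lt_le_trans _ _ 0); [lra|apply: divr_ge0; lra].
by rewrite mulrC ler_wpM2r ?subr_ge0 // lef_pV2 ?posrE.
Qed.

End AbsoluteContinuityCalculus.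

(** * Velocities of curves and lower bounds for their length *)

Section Curves.
Variables (R : realType) (n : nat).
Implicit Types (gamma : R -> 'rV[Cx R]_n) (Omega : set 'rV[Cx R]_n) (z v : 'rV[Cx R]_n).

Definition coRe gamma (j : 'I_n) (t : R) : R := cRe (gamma t 0 j).
Definition coIm gamma (j : 'I_n) (t : R) : R := cIm (gamma t 0 j).

Lemma to_real_lshift z j : to_real z 0 (lshift n j) = cRe (z 0 j).
Proof. by rewrite /to_real row_mxEl mxE. Qed.

Lemma to_real_rshift z j : to_real z 0 (rshift n j) = cIm (z 0 j).
Proof. by rewrite /to_real row_mxEr mxE. Qed.

Lemma row_entry_le m (x : 'rV[R]_m) i : `|x 0 i| <= `|x|.
Proof. rewrite [leRHS]mx_normrE; exact: (le_bigmax 0 (fun ij => `|x ij.1 ij.2|) (0, i)). Qed.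

Lemma abs_continuous_entry m a b (f : R -> 'rV[R]_m) i : abs_continuous a b f ->
  abs_continuous a b (fun t => f t 0 i : R).
Proof.
move=> H e /H[d d0 Hd]; exists d => // N u v uv dis luv.
apply: le_lt_trans (Hd N u v uv dis luv); apply: ler_sum => k _.
by have := row_entry_le (f (v k) - f (u k)) i; rewrite !mxE.
Qed.

Lemma curve_coRe a b gamma Omega j : curve_in Omega a b gamma -> abs_continuous a b (coRe gamma j).
Proof.
move=> [_ /(abs_continuous_entry (lshift n j)) H _].
by have -> : coRe gamma j = (fun t => (@to_real R n \o gamma) t 0 (lshift n j))
  by apply/funext => t; rewrite /= to_real_lshift.
Qed.

Lemma curve_coIm a b gamma Omega j : curve_in Omega a b gamma -> abs_continuous a b (coIm gamma j).
Proof.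
move=> [_ /(abs_continuous_entry (rshift n j)) H _].
by have -> : coIm gamma j = (fun t => (@to_real R n \o gamma) t 0 (rshift n j))
  by apply/funext => t; rewrite /= to_real_rshift.
Qed.

Lemma velocityE gamma (t : R) (p q : 'I_n -> R) :
  (forall j, is_derive t 1 (coRe gamma j) (p j)) ->
  (forall j, is_derive t 1 (coIm gamma j) (q j)) ->
  forall j, velocity gamma t 0 j = mkC (p j) (q j).
Proof.
move=> Hp Hq j.
have EL i : (fun s => (@to_real R n \o gamma) s 0 (lshift n i)) = coRe gamma i.
  by apply/funext => s; rewrite /= to_real_lshift.
have ER i : (fun s => (@to_real R n \o gamma) s 0 (rshift n i)) = coIm gamma i.
  by apply/funext => s; rewrite /= to_real_rshift.
have D : derivable (@to_real R n \o gamma) t 1.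
  apply/derivable_mxP => i k; rewrite (ord1 i) -(splitK k); case: (fintype.split k) => l /=.
    by rewrite EL; exact: ex_derive.
  by rewrite ER; exact: ex_derive.
rewrite /velocity /of_real mxE derive1E derive_mx // !mxE EL ER.
by congr mkC; exact: derive_val.
Qed.

Lemma kobayashi_metric_ge0 Omega z v : (0 <= kobayashi_metric Omega z v)%E.
Proof. by apply: le_ereal_inf_tmp => _ [l _ <-]; rewrite lee_fin; exact: cmod_ge0. Qed.

Lemma kobayashi_length_ge0 Omega a b gamma : (0 <= kobayashi_length Omega a b gamma)%E.
Proof. by apply: integral_ge0 => t _; exact: kobayashi_metric_ge0. Qed.

(** The lower bound by a potential: if the speed of [g] is at most the metric, the length is at
    least the increment of [g]. The comparison is asked only at times when [g] and all coordinates
    are differentiable, and almost every time is of this kind. *)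
Lemma kobayashi_length_lower Omega a b gamma (g : R -> R) :
  curve_in Omega a b gamma -> abs_continuous a b g ->
  (forall (t : R) (p q : 'I_n -> R) (g' : R), a < t < b ->
    (forall j, is_derive t 1 (coRe gamma j) (p j)) ->
    (forall j, is_derive t 1 (coIm gamma j) (q j)) -> is_derive t 1 g g' ->
    (`|g'|%:E <= kobayashi_metric Omega (gamma t) (\row_j mkC (p j) (q j)))%E) ->
  (`|g b - g a|%:E <= kobayashi_length Omega a b gamma)%E.
Proof.
move=> cg acg H; have [ab _ _] := cg.
have [<-|nab] := eqVneq a b; first by rewrite subrr normr0 kobayashi_length_ge0.
have {nab}ab : a < b by rewrite lt_def eq_sym nab.
have [G [Gi GE Gd]] := abs_continuous_FTC ab acg.
have P j : exists p : R -> R, {ae (@lebesgue_measure R), forall x, a < x < b -> is_derive x 1 (coRe gamma j) (p x)}.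
  by have [p [_ _ Hp]] := abs_continuous_FTC ab (curve_coRe j cg); exists p.
have Q j : exists p : R -> R, {ae (@lebesgue_measure R), forall x, a < x < b -> is_derive x 1 (coIm gamma j) (p x)}.
  by have [p [_ _ Hp]] := abs_continuous_FTC ab (curve_coIm j cg); exists p.
have [p Hp] := choice P; have [q Hq] := choice Q.
have aeP : {ae (@lebesgue_measure R), forall x, forall j, a < x < b -> is_derive x 1 (coRe gamma j) (p j x)}.
  exact: (filter_forall (ae_filter_ringOfSetsType _) Hp).
have aeQ : {ae (@lebesgue_measure R), forall x, forall j, a < x < b -> is_derive x 1 (coIm gamma j) (q j x)}.
  exact: (filter_forall (ae_filter_ringOfSetsType _) Hq).
have mI : measurable (`]a, b[%classic : set (measurableTypeR R)) by exact: measurable_itv.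
have GiI : (@lebesgue_measure R).-integrable `]a, b[ (EFin \o G).
  by apply: integrableS Gi.
have GiI' : (@lebesgue_measure R).-integrable `]a, b] (EFin \o G).
  by apply: integrableS Gi => //; exact: measurable_itv.
apply: (@le_trans _ _ (\int[@lebesgue_measure R]_(t in `]a, b[) `|(EFin \o G) t|)%E).
  rewrite GE -(Rintegral_itv_bndo_bndc GiI) EFin_normr_Rintegral //.
  by apply: le_abse_integral => //; exact: measurable_int GiI.
apply: (@le_trans _ _ (\int[@lebesgue_measure R]_(t in `]a, b[)
    kobayashi_metric Omega (gamma t) (velocity gamma t))%E); last first.
  apply: ge0_integral_subset => [t|t _]; last exact: kobayashi_metric_ge0.
  by rewrite /= !in_itv /= => /andP[/ltW -> /ltW ->].
apply: ae_ge0_integral_lower => //.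
- exact: integrable_abse.
- by move=> t _; exact: kobayashi_metric_ge0.
have aeF : Filter (nbhs (almost_everywhere (@lebesgue_measure R))) := ae_filter_ringOfSetsType _.
apply: (@filterS _ _ aeF _ _ _ (filterI Gd (filterI aeP aeQ))) => t [Gt [Pt Qt]]; rewrite /= in_itv /= => tab.
have -> : velocity gamma t = \row_j mkC (p j t) (q j t).
  apply/rowP => j; rewrite [RHS]mxE.
  by apply: (velocityE (p := p ^~ t) (q := q ^~ t)) => i; [exact: Pt|exact: Qt].
by apply: H => //; [move=> i; exact: Pt|move=> i; exact: Qt|exact: Gt].
Qed.

End Curves.

Section RowCurves.
Variables (R : realType) (n : nat).
Implicit Types (f : Cx R -> 'rV[Cx R]_n).

Lemma derivable_entry f z j : derivable f z 1 ->
  cderiv (fun w => f w 0 j) z (derive1 f z 0 j).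
Proof.
move=> df; rewrite derive1E; apply/cderivP.
have H : (fun h => h^-1 *: ((f \o shift z) (h *: 1) - f z)) @ 0^' --> 'D_1 f z by exact: df.
have K : (fun h => h^-1 *: (((fun w => f w 0 j) \o shift z) (h *: 1) - f z 0 j)) @ 0^' -->
    ('D_1 f z) 0 j.
  have -> : (fun h => h^-1 *: (((fun w => f w 0 j) \o shift z) (h *: 1) - f z 0 j)) =
      (fun x : 'rV[Cx R]_n => x 0 j) \o (fun h => h^-1 *: ((f \o shift z) (h *: 1) - f z)).
    by apply/funext => h; rewrite /= !mxE.
  by apply: cvg_comp H _; exact: coord_continuous.
split; first by apply/cvg_ex; eexists; exact: K.
exact: cvg_lim K.
Qed.

Lemma metric_lower Omega (z v : 'rV[Cx R]_n) r :
  (forall lambda f, holomorphic_disc Omega f -> f 0 = z -> lambda *: derive1 f 0 = v ->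
     r <= cmod lambda) ->
  (r%:E <= kobayashi_metric Omega z v)%E.
Proof.
move=> H; apply: le_ereal_inf_tmp => _ [l [f [hf f0 fv]] <-]; rewrite lee_fin.
exact: H hf f0 fv.
Qed.

End RowCurves.

Lemma eq_ler (R : realType) (x y : R) : x = y -> x <= y.
Proof. by move->. Qed.

(** * Kobayashi geometry of the tube *)

Section Tube.
Variables (R : realType) (m' : nat).
Let m := m'.+1.
Let T := tube_domain R m.
Implicit Types (z v : 'rV[Cx R]_2) (a x y : R).

(** For [f x = x ^+ (2 * m)] the supporting line at [a] is [tangent_slope a * x - tangent_const a],
    so [tangent a] is [Q - f a - f' a (Z - a)], the affine function with positive real part on the
    tube. *)
Definition tangent_slope a : R := (2 * m)%:R * a ^+ (2 * m).-1.
Definition tangent_const a : R := (2 * m).-1%:R * a ^+ (2 * m).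
Definition tangent a z : Cx R := z 0 0 - ofR (tangent_slope a) * z 0 1 + ofR (tangent_const a).

(** Bernoulli is applied to [(1 + x) ^+ 2 = 1 + (2 * x + x ^+ 2)], whose increment is at least -1
    for every real [x]; this also retains a quadratic term. *)
Lemma even_bernoulli x : 1 + (2 * m)%:R * x + m%:R * x ^+ 2 <= (1 + x) ^+ (2 * m).
Proof.
have B k (s : R) : -1 <= s -> 1 + k%:R * s <= (1 + s) ^+ k.
  move=> s1; elim: k => [|k IH]; first by rewrite mul0r addr0 expr0.
  rewrite exprS; apply: (@le_trans _ _ ((1 + s) * (1 + k%:R * s))).
    have : 0 <= k%:R * s ^+ 2 by rewrite mulr_ge0 ?sqr_ge0.
    by rewrite -natr1 expr2; lra.
  by apply: ler_wpM2l => //; lra.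
rewrite exprM.
have -> : (1 + x) ^+ 2 = 1 + (2 * x + x ^+ 2) by ring.
apply: le_trans (B m _ _); first by rewrite natrM; lra.
have := sqr_ge0 (x + 1); rewrite (_ : (x + 1) ^+ 2 = x ^+ 2 + 2 * x + 1); last by ring.
by lra.
Qed.

(** The homogeneous form of [even_bernoulli], with [x = u / a]. The quadratic gain measures the
    curvature of the boundary away from [a = 0]. *)
Lemma tangent_ineq a u : a ^+ (2 * m) + tangent_slope a * u + m%:R * a ^+ (2 * m') * u ^+ 2
  <= (a + u) ^+ (2 * m).
Proof.
have [->|a0] := eqVneq a 0.
  rewrite add0r /tangent_slope /m mulnS !expr0n /= mulr0 mul0r !add0r.
  (* Since [0 ^+ 0 = 1], the quadratic term survives at [a = 0] exactly for [m = 1], where the claim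
     is an equality. *)
  case: m' => [|k] /=; last by rewrite mulr0n mulr0 mul0r -[X in _ ^+ X]/(2 + 2 * k.+1)%N exprD mulr_ge0 ?sqr_ge0 // exprM exprn_ge0 ?sqr_ge0.
  by rewrite mulr1 mul1r.
have -> : a + u = a * (1 + u / a) by field.
rewrite exprMn.
have p0 : 0 < a ^+ (2 * m) by rewrite exprM exprn_gt0 // lt_def sqrf_eq0 a0 sqr_ge0.
apply: (le_trans _ (ler_wpM2l (ltW p0) (even_bernoulli (u / a)))).
apply: eq_ler; rewrite /tangent_slope /m mulnS !addSn add0n /= !exprS.
by field.
Qed.

Lemma even_power_ge0 a k : 0 <= a ^+ (2 * k).
Proof. by rewrite exprM exprn_ge0 // sqr_ge0. Qed.

Lemma tangent_le a x : tangent_slope a * x - tangent_const a <= x ^+ (2 * m).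
Proof.
have := tangent_ineq a (x - a).
have -> : a + (x - a) = x by ring.
apply: le_trans.
have : 0 <= m%:R * a ^+ (2 * m') * (x - a) ^+ 2 by rewrite mulr_ge0 ?sqr_ge0 // mulr_ge0 // even_power_ge0.
have -> : tangent_const a = tangent_slope a * a - a ^+ (2 * m).
  rewrite /tangent_slope /tangent_const /m mulnS /= add1n -mulrA -exprSr.
  rewrite (_ : (2 * m').+2 = (2 + 2 * m')%N) // natrD -addn1 natrD; ring.
by lra.
Qed.

Lemma tangent_gt0 a z : T z -> 0 < cRe (tangent a z).
Proof.
rewrite /T /tube_domain /= -/(cRe (z 0 0)) -/(cRe (z 0 1)) => h.
rewrite /tangent !cE mul0r subr0; have := tangent_le a (cRe (z 0 1)); lra.
Qed.

Lemma tangent_metric a z v lambda f : holomorphic_disc T f -> f 0 = z ->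
  lambda *: derive1 f 0 = v ->
  cmod (v 0 0 - ofR (tangent_slope a) * v 0 1) <= 2 * cRe (tangent a z) * cmod lambda.
Proof.
move=> hf <- <-; rewrite !mxE.
have D w : cmod w < 1 -> cderiv (fun w => tangent a (f w)) w
    (derive1 f w 0 0 - ofR (tangent_slope a) * derive1 f w 0 1 + 0).
  move=> w1; have [df _] : derivable f w 1 /\ T (f w).
    by apply: hf; rewrite /unit_disc /= norm_cmod -ofR1 ltC_ofR.
  apply: cderivD; last exact: cderiv_cst.
  apply: cderivB; first exact: derivable_entry.
  rewrite -[_ * _]addr0 -(mul0r (f w 0 1)) addrC.
  by apply: cderivM; [exact: cderiv_cst|exact: derivable_entry].
have P w : cmod w < 1 -> 0 < cRe (tangent a (f w)).
  move=> w1; apply: tangent_gt0.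
  by apply: (hf w _).2; rewrite /unit_disc /= norm_cmod -ofR1 ltC_ofR.
have c0 : cmod (0 : Cx R) < 1 by rewrite cmod0.
have := half_plane_deriv (fun (w : Cx R) w1 => ex_intro _ _ (D w w1)) (D 0 c0) P.
set d := _ + 0 => H.
have -> : lambda * derive1 f 0 0 0 - ofR (tangent_slope a) * (lambda * derive1 f 0 0 1) = lambda * d.
  by rewrite /d; ring.
by rewrite cmodM mulrC ler_wpM2r ?cmod_ge0.
Qed.

(** All supporting lines constrain the same [k], the modulus of the multiplier of a competing disc,
    so several Schwarz inequalities may be combined before the infimum is taken. *)
Lemma tangent_metric_lower z v r :
  (forall k, 0 <= k -> (forall a, cmod (v 0 0 - ofR (tangent_slope a) * v 0 1) <= 2 * cRe (tangent a z) * k) ->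
    r <= k) -> (r%:E <= kobayashi_metric T z v)%E.
Proof.
move=> H; apply: metric_lower => l f hf f0 fv; apply: H; first exact: cmod_ge0.
by move=> a; apply: tangent_metric hf f0 fv.
Qed.

(* [wid h] = h^(1/(2m)), the half-width in Re Z of the tube over Re Q = h. *)
Definition wid (h : R) : R := expR (ln h / (2 * m)%:R).

Lemma wid_gt0 h : 0 < wid h. Proof. exact: expR_gt0. Qed.

Lemma widX h : 0 < h -> wid h ^+ (2 * m) = h.
Proof.
move=> h0; rewrite /wid -expRM_natl mulrC -mulrA mulVf ?mulr1 ?pnatr_eq0 ?muln_eq0 //.
by rewrite lnK ?posrE.
Qed.

Lemma tube_re_gt0 z : T z -> 0 < cRe (z 0 0).
Proof. by apply: le_lt_trans; exact: even_power_ge0. Qed.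

(** The supporting line at 0 is horizontal, so its functional is [Q] itself. *)
Lemma vertical_bound z v k :
  (forall a, cmod (v 0 0 - ofR (tangent_slope a) * v 0 1) <= 2 * cRe (tangent a z) * k) ->
  cmod (v 0 0) <= 2 * cRe (z 0 0) * k.
Proof.
move=> /(_ 0); rewrite /tangent /tangent_slope /tangent_const /m mulnS !expr0n /= !mulr0 ofR0 !mul0r.
by rewrite !subr0 addr0.
Qed.

(** At the two ends of the section over [Re Q = h] the supporting lines have opposite slopes.
    Subtracting the functionals eliminates [v 0 0], and adding their real parts eliminates Re Z. *)
Lemma horizontal_bound z v k : T z -> 0 <= k ->
  (forall a, cmod (v 0 0 - ofR (tangent_slope a) * v 0 1) <= 2 * cRe (tangent a z) * k) ->
  cmod (v 0 1) <= 2 * wid (cRe (z 0 0)) * k.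
Proof.
move=> Tz k0 H; have h0 := tube_re_gt0 Tz.
set h := cRe (z 0 0) in h0 *; set w := wid h.
have w0 : 0 < w := wid_gt0 h.
have M0 : 0 < m%:R :> R by rewrite ltr0n.
have sN : tangent_slope (- w) = - tangent_slope w.
  by rewrite /tangent_slope /m mulnS /= exprNn -signr_odd /= mul2n odd_double /= expr1; ring.
have cN : tangent_const (- w) = tangent_const w.
  by rewrite /tangent_const exprNn -signr_odd mul2n odd_double expr0 mul1r.
have A := H w; have B := H (- w).
have S : tangent_slope w * cmod (v 0 1) * 2 <= 2 * (2 * h + 2 * tangent_const w) * k.
  have -> : tangent_slope w * cmod (v 0 1) * 2 = cmod ((v 0 0 - ofR (tangent_slope (-w)) * v 0 1) -
      (v 0 0 - ofR (tangent_slope w) * v 0 1)).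
    rewrite sN.
    have -> : v 0 0 - ofR (- tangent_slope w) * v 0 1 - (v 0 0 - ofR (tangent_slope w) * v 0 1) =
        ofR (2 * tangent_slope w) * v 0 1 by rewrite ofRM ofR_nat; rewrite /ofR rmorphN; ring.
    rewrite cmodM cmod_ofR ger0_norm; first by ring.
    by rewrite !mulr_ge0 // exprn_ge0 // ltW.
  apply: le_trans (cmodB _ _) _.
  apply: le_trans (lerD B A) _; apply: eq_ler.
  by rewrite /tangent sN cN !cE; ring.
have E : tangent_slope w * w = (2 * m)%:R * h.
  rewrite /tangent_slope -mulrA -exprSr prednK ?muln_gt0 // widX //.
have C : tangent_const w = ((2 * m)%:R - 1) * h.
  rewrite /tangent_const widX //; congr (_ * _).
  by rewrite -subn1 natrB.
rewrite C in S.
have s0 : 0 < tangent_slope w * 2.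
  by rewrite !mulr_gt0 ?exprn_gt0 ?ltr0n ?muln_gt0.
rewrite -(ler_pM2l s0).
have -> : tangent_slope w * 2 * cmod (v 0 1) = tangent_slope w * cmod (v 0 1) * 2 by ring.
apply: le_trans S _; apply: eq_ler.
have -> : tangent_slope w * 2 * (2 * w * k) = (tangent_slope w * w) * 4 * k by ring.
by rewrite E; ring.
Qed.

End Tube.

Section RealDerivatives.
Variable R : realType.
Implicit Types (f g : R -> R) (t a b c : R).

Lemma real_derivD f g t a b : is_derive t 1 f a -> is_derive t 1 g b ->
  is_derive t 1 (fun s : R => f s + g s) (a + b).
Proof. exact: is_deriveD. Qed.

Lemma real_derivB f g t a b : is_derive t 1 f a -> is_derive t 1 g b ->
  is_derive t 1 (fun s : R => f s - g s) (a - b).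
Proof. exact: is_deriveB. Qed.

Lemma real_derivM f g t a b : is_derive t 1 f a -> is_derive t 1 g b ->
  is_derive t 1 (fun s : R => f s * g s) (f t * b + g t * a).
Proof. exact: is_deriveM. Qed.

Lemma real_derivZ c f t a : is_derive t 1 f a ->
  is_derive t 1 (fun s : R => c * f s) (c * a).
Proof. exact: is_deriveZ. Qed.

Lemma real_deriv_cst c t : is_derive t 1 (fun _ : R => c) 0.
Proof. exact: is_derive_cst. Qed.

Lemma real_deriv_ln f t a : 0 < f t -> is_derive t 1 f a ->
  is_derive t 1 (fun s : R => ln (f s)) (a / f t).
Proof. by move=> f0 df; rewrite mulrC; exact: is_derive1_comp (is_derive1_ln f0) df. Qed.

Lemma real_deriv_expR f t a : is_derive t 1 f a ->
  is_derive t 1 (fun s : R => expR (f s)) (expR (f t) * a).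
Proof. by move=> df; exact: is_derive1_comp (is_derive_expR (f t)) df. Qed.

Lemma real_deriv_unique f t a b : is_derive t 1 f a -> is_derive t 1 f b -> a = b.
Proof. by move=> [_ <-] [_ <-]. Qed.

Lemma real_deriv_cont f t a e : is_derive t 1 f a -> 0 < e ->
  exists2 r, 0 < r & forall s, `|s| < r -> `|f (t + s) - f t| < e.
Proof.
move=> df e0; have [r r0 Hr] := (is_derive_realP _ _ _).1 df 1 ltr01.
have a1 : 0 < `|a| + 2 by have := normr_ge0 a; lra.
exists (Num.min r (e / (`|a| + 2))); first by rewrite lt_min r0 divr_gt0.
move=> s; rewrite lt_min => /andP[/Hr A]; rewrite ltr_pdivlMr // => B.
have : `|f (t + s) - f t| <= `|f (t + s) - f t - a * s| + `|a * s|.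
  by apply: le_trans (ler_normD _ _); rewrite subrK.
by rewrite normrM; have := normr_ge0 s; lra.
Qed.

(* Fermat: the difference of two functions that touch has a local minimum. *)
Lemma touching_deriv f g t a b : is_derive t 1 f a -> is_derive t 1 g b -> f t = g t ->
  (exists2 r, 0 < r & forall s, `|s| < r -> g (t + s) <= f (t + s)) -> a = b.
Proof.
move=> df dg fg [r r0 H]; have := real_derivB df dg.
move=> /is_derive_realP D; apply/eqP; rewrite -subr_eq0; apply/negPn/negP => ab.
have ab0 : 0 < `|a - b| by rewrite normr_gt0.
have [r1 r10 Hr] := D (`|a - b| / 2) ltac:(by rewrite divr_gt0).
pose p := Num.min r r1 / 2.
have m0 : 0 < Num.min r r1 by rewrite lt_min r0.
have p0 : 0 < p by rewrite divr_gt0.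
have [pr pr1] : p < r /\ p < r1.
  have : Num.min r r1 <= r by rewrite ge_min lexx.
  have : Num.min r r1 <= r1 by rewrite ge_min lexx orbT.
  by rewrite /p; lra.
pose s := if 0 < a - b then - p else p.
have sp : `|s| = p by rewrite /s; case: ifP => _; rewrite ?normrN gtr0_norm.
have abs : (a - b) * s = - (`|a - b| * p).
  rewrite /s; case: ifPn => [h|]; first by rewrite gtr0_norm // mulrN.
  by rewrite -leNgt => h; rewrite ler0_norm // mulNr opprK.
have A := H s ltac:(by rewrite sp).
have := Hr s ltac:(by rewrite sp).
rewrite sp abs fg subrr subr0 ler_norml => /andP[_].
have : 0 < `|a - b| * p by rewrite mulr_gt0.
by lra.
Qed.

Lemma abs_continuous_cst (a b c : R) : abs_continuous a b (fun _ : R => c).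
Proof.
move=> e e0; exists 1 => // N u v _ _ _; rewrite big1 // => i _.
by rewrite subrr normr0.
Qed.

Lemma abs_continuousD a b f g k l : abs_continuous a b f -> abs_continuous a b g ->
  abs_continuous a b (fun t : R => k * f t + l * g t).
Proof.
move=> Hf Hg; apply: (abs_continuous_lip (C := `|k| + `|l|) Hf Hg) => s t _ _.
have -> : k * f t + l * g t - (k * f s + l * g s) = k * (f t - f s) + l * (g t - g s) by ring.
apply: le_trans (ler_normD _ _) _; rewrite !normrM.
have := mulr_ge0 (normr_ge0 k) (normr_ge0 (g t - g s)).
have := mulr_ge0 (normr_ge0 l) (normr_ge0 (f t - f s)).
by lra.
Qed.

Lemma abs_continuous_ln a b f : a <= b -> abs_continuous a b f ->
  (forall t, a <= t <= b -> 0 < f t) -> abs_continuous a b (fun t => ln (f t)).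
Proof.
move=> ab Hf fp; have [c c0 Hc] := abs_continuous_gt0 ab Hf fp.
apply: (abs_continuous_lip1 (C := c^-1) Hf) => s t sab tab.
by apply: ln_lip => //; exact: Hc.
Qed.

Lemma abs_continuous_expR a b f : a <= b -> abs_continuous a b f ->
  abs_continuous a b (fun t => expR (f t)).
Proof.
move=> ab Hf; have [M HM] := abs_continuous_bounded ab Hf.
have E (x y : R) : x <= y -> y <= M -> expR y - expR x <= expR M * (y - x).
  move=> xy yM; have h : expR y - expR x <= expR y * (y - x).
    have := expR_ge1Dx (x - y); rewrite expRB.
    have e0 := expR_gt0 y; rewrite ler_pdivlMr // => H; lra.
  apply: le_trans h _; rewrite ler_wpM2r ?subr_ge0 // ler_expR //.
apply: (abs_continuous_lip1 (C := expR M) Hf) => s t sab tab.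
have Bs : f s <= M by apply: le_trans (ler_norm _) (HM s sab).
have Bt : f t <= M by apply: le_trans (ler_norm _) (HM t tab).
have [st|/ltW st] := leP (f s) (f t).
  by rewrite !ger0_norm ?subr_ge0 ?ler_expR //; exact: E.
by rewrite distrC [`|f t - _|]distrC !ger0_norm ?subr_ge0 ?ler_expR //; exact: E.
Qed.

Lemma abs_continuousM a b f g : a <= b -> abs_continuous a b f -> abs_continuous a b g ->
  abs_continuous a b (fun t : R => f t * g t).
Proof.
move=> ab Hf Hg; have [M HM] := abs_continuous_bounded ab Hf.
have [N HN] := abs_continuous_bounded ab Hg.
apply: (abs_continuous_lip (C := `|M| + `|N|) Hf Hg) => s t sab tab.
have -> : f t * g t - f s * g s = f t * (g t - g s) + g s * (f t - f s) by ring.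
apply: le_trans (ler_normD _ _) _; rewrite !normrM.
have A : `|f t| * `|g t - g s| <= `|M| * `|g t - g s|.
  by rewrite ler_wpM2r //; apply: le_trans (HM t tab) (ler_norm _).
have B : `|g s| * `|f t - f s| <= `|N| * `|f t - f s|.
  by rewrite ler_wpM2r //; apply: le_trans (HN s sab) (ler_norm _).
have := mulr_ge0 (normr_ge0 M) (normr_ge0 (f t - f s)).
have := mulr_ge0 (normr_ge0 N) (normr_ge0 (g t - g s)).
by lra.
Qed.

Lemma abs_continuous_max a b f g : abs_continuous a b f -> abs_continuous a b g ->
  abs_continuous a b (fun t : R => Num.max (f t) (g t)).
Proof.
move=> Hf Hg; apply: (abs_continuous_lip (C := 1) Hf Hg) => s t _ _.
rewrite mul1r; have := normr_ge0 (f t - f s); have := normr_ge0 (g t - g s).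
have := ler_norm (f t - f s); have := ler_norm (g t - g s).
have := ler_norm (f s - f t); have := ler_norm (g s - g t).
rewrite [`|f s - _|]distrC [`|g s - _|]distrC ler_norml.
by case: (leP (f t) (g t)) => ?; case: (leP (f s) (g s)) => ? *; apply/andP; split; lra.
Qed.

End RealDerivatives.

(** * Hyperbolicity and lower bounds for the distance *)

Section TubeHyperbolic.
Variables (R : realType) (m' : nat).
Let m := m'.+1.
Let T := tube_domain R m.
Implicit Types (z v x y : 'rV[Cx R]_2) (a tau : R).

(* log |1 + l - i tau|^2 / 4 has speed at most k along curves; the values at
   tau = 0 and tau = 1 determine l. *)
Lemma separating_lower a tau x y :
  ((`|ln ((1 + cRe (tangent m' a y)) ^+ 2 + (cIm (tangent m' a y) - tau) ^+ 2) -
      ln ((1 + cRe (tangent m' a x)) ^+ 2 + (cIm (tangent m' a x) - tau) ^+ 2)| / 4)%:E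
   <= kobayashi T x y)%E.
Proof.
apply: le_ereal_inf_tmp => _ [c [d [gamma [cg <- <- ->]]]].
pose sl := tangent_slope m' a; pose k0 := tangent_const m' a.
pose P t := coRe gamma 0 t - sl * coRe gamma 1 t + k0.
pose S t := coIm gamma 0 t - sl * coIm gamma 1 t.
have PE t : cRe (tangent m' a (gamma t)) = P t.
  by rewrite /tangent !cE /P /coRe /sl /k0; ring.
have SE t : cIm (tangent m' a (gamma t)) = S t.
  by rewrite /tangent !cE /S /coIm /sl; ring.
rewrite !PE !SE.
have [cd _ Tg] := cg.
have P0 t : c <= t <= d -> 0 < P t by move=> /Tg/(tangent_gt0 a); rewrite PE.
pose N t := (1 + P t) * (1 + P t) + (S t - tau) * (S t - tau).
have NE t : (1 + P t) ^+ 2 + (S t - tau) ^+ 2 = N t by rewrite !expr2.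
rewrite !NE.
have N0 t : c <= t <= d -> (1 + P t) ^+ 2 <= N t.
  by move=> _; rewrite -NE lerDl sqr_ge0.
have N1 t : c <= t <= d -> 0 < N t.
  by move=> ct; apply: lt_le_trans (N0 t ct); rewrite exprn_gt0 //; have := P0 t ct; lra.
have acP : abs_continuous c d (fun t => 1 + P t).
  have -> : (fun t => 1 + P t) = (fun t => 1 * (1 * coRe gamma 0 t + (- sl) * coRe gamma 1 t) + 1 * (1 + k0)).
    by apply/funext => t; rewrite /P; ring.
  apply: abs_continuousD; last exact: abs_continuous_cst.
  by apply: abs_continuousD; exact: curve_coRe cg.
have acS : abs_continuous c d (fun t => S t - tau).
  have -> : (fun t => S t - tau) = (fun t => 1 * (1 * coIm gamma 0 t + (- sl) * coIm gamma 1 t) + 1 * (- tau)).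
    by apply/funext => t; rewrite /S; ring.
  apply: abs_continuousD; last exact: abs_continuous_cst.
  by apply: abs_continuousD; exact: curve_coIm cg.
have acN : abs_continuous c d N.
  have -> : N = (fun t => 1 * ((1 + P t) * (1 + P t)) + 1 * ((S t - tau) * (S t - tau))).
    by apply/funext => t; rewrite /N; ring.
  by apply: abs_continuousD; exact: abs_continuousM.
(* The function is written in the shape [k * f t + l * g t] of [abs_continuousD]; terms with
   coefficient 0 or 1 have this origin throughout. *)
have acL : abs_continuous c d (fun t => 1 * (4^-1 * ln (N t)) + 0 * ln (N t)).
  have -> : (fun t => 1 * (4^-1 * ln (N t)) + 0 * ln (N t)) = (fun t => 4^-1 * ln (N t) + 0 * ln (N t)).
    by apply/funext => t; rewrite mul1r.
  by apply: abs_continuousD; exact: abs_continuous_ln.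
have -> : `|ln (N d) - ln (N c)| / 4 =
    `|(1 * (4^-1 * ln (N d)) + 0 * ln (N d)) - (1 * (4^-1 * ln (N c)) + 0 * ln (N c))|.
  rewrite !mul0r !addr0 !mul1r -mulrBr normrM ger0_norm //; first by rewrite mulrC.
apply: kobayashi_length_lower cg acL _ => t p q g' ctd dp dq dg.
have ct : c <= t <= d by case/andP: ctd => /ltW -> /ltW ->.
pose P' := p 0 - sl * p 1; pose S' := q 0 - sl * q 1.
have dP : is_derive t 1 (fun s : R => 1 + P s) P'.
  rewrite (_ : P' = 0 + (P' + 0)); last by ring.
  exact: (real_derivD (real_deriv_cst 1 t) (real_derivD (real_derivB (dp 0) (real_derivZ sl (dp 1))) (real_deriv_cst k0 t))).
have dS : is_derive t 1 (fun s : R => S s - tau) S'.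
  rewrite (_ : S' = S' - 0); last by ring.
  exact: (real_derivB (real_derivB (dq 0) (real_derivZ sl (dq 1))) (real_deriv_cst tau t)).
have dN : is_derive t 1 N (((1 + P t) * P' + (1 + P t) * P') + ((S t - tau) * S' + (S t - tau) * S')).
  exact: (real_derivD (real_derivM dP dP) (real_derivM dS dS)).
have dL := real_derivD (real_derivZ 1 (real_derivZ 4^-1 (real_deriv_ln (N1 t ct) dN)))
  (real_derivZ 0 (real_deriv_ln (N1 t ct) dN)).
rewrite (real_deriv_unique dg dL).
apply: (@tangent_metric_lower R m' (gamma t)) => k kp /(_ a).
rewrite !mxE PE => H.
rewrite mul0r addr0 mul1r.
have E2 : cmod (mkC (p 0) (q 0) - ofR sl * mkC (p 1) (q 1)) ^+ 2 = P' ^+ 2 + S' ^+ 2.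
  by rewrite cmod_sqr !cE /P' /S' !mul0r subr0 addr0.
have {}H : P' ^+ 2 + S' ^+ 2 <= (2 * P t * k) ^+ 2.
  by rewrite -E2 lerXn2r // nnegrE ?cmod_ge0 // !mulr_ge0 // ltW // P0.
set X := _ + _ in H *.
set D := (1 + P t) * P' + (S t - tau) * S'.
(* Cauchy-Schwarz gives [D ^+ 2 <= N t * X]. The Schwarz lemma bounds [X] by [(2 * P t * k) ^+ 2],
   and [P t ^+ 2 <= (1 + P t) ^+ 2 <= N t] because [P t] is positive. *)
have D2 : D ^+ 2 <= (N t * (2 * k)) ^+ 2.
  have CS : D ^+ 2 <= N t * X.
    have -> : N t * X = D ^+ 2 + ((1 + P t) * S' - (S t - tau) * P') ^+ 2.
      by rewrite /N /X /D; ring.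
    by rewrite lerDl sqr_ge0.
  apply: le_trans CS _.
  apply: (@le_trans _ _ (N t * (2 * P t * k) ^+ 2)); first by rewrite ler_wpM2l // ltW // N1.
  have -> : (N t * (2 * k)) ^+ 2 = N t * (N t * (2 * k) ^+ 2) by ring.
  rewrite ler_wpM2l //; first by rewrite ltW // N1.
  have -> : (2 * P t * k) ^+ 2 = P t ^+ 2 * (2 * k) ^+ 2 by ring.
  rewrite ler_wpM2r ?sqr_ge0 //; apply: le_trans (N0 t ct).
  by rewrite lerXn2r // ?nnegrE; have := P0 t ct; lra.
have ND := N1 t ct.
have aD : `|D| <= N t * (2 * k).
  rewrite -(@ler_pXn2r _ 2) // ?nnegrE ?mulr_ge0 ?(ltW ND) //.
  by rewrite -normrX ger0_norm // sqr_ge0.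
have -> : 4^-1 * (((1 + P t) * P' + (1 + P t) * P' + ((S t - tau) * S' + (S t - tau) * S')) / N t) =
   (2 * N t)^-1 * D.
  by rewrite /D; field; rewrite gt_eqF.
have N20 : 0 < 2 * N t by rewrite mulr_gt0.
rewrite normrM gtr0_norm ?invr_gt0 // mulrC ler_pdivrMr //; lra.
Qed.

(** At distance 0 every [tangent a] takes equal values at both points. The slope is 0 at [a = 0],
    which recovers [Q], and [2 m] at [a = 1], which then recovers [Z]. *)
Lemma tube_hyperbolic : kobayashi_hyperbolic T.
Proof.
move=> x y Tx Ty xy; rewrite ltNge; apply/negP => K0.
have E a tau : (1 + cRe (tangent m' a y)) ^+ 2 + (cIm (tangent m' a y) - tau) ^+ 2 =
    (1 + cRe (tangent m' a x)) ^+ 2 + (cIm (tangent m' a x) - tau) ^+ 2.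
  have := le_trans (separating_lower a tau x y) K0; rewrite lee_fin.
  rewrite pmulr_lle0 ?invr_gt0 // normr_le0 subr_eq0 => /eqP.
  have p z : T z -> 0 < (1 + cRe (tangent m' a z)) ^+ 2 + (cIm (tangent m' a z) - tau) ^+ 2.
    by move=> /(tangent_gt0 a) h; rewrite ltr_wpDr ?sqr_ge0 // exprn_gt0 //; lra.
  by apply: ln_inj; rewrite posrE p.
have {}E a : tangent m' a y = tangent m' a x.
  have A := E a 0; have B := E a 1.
  have pX := tangent_gt0 a Tx; have pY := tangent_gt0 a Ty.
  have I : cIm (tangent m' a y) = cIm (tangent m' a x).
    by move: A B; rewrite !expr2; lra.
  apply: eqC => //; move: A; rewrite I => /addIr /eqP.
  rewrite eqrXn2 //; [|lra|lra].
  by move=> /eqP; lra.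
have s0 : tangent_slope m' (0 : R) = 0 by rewrite /tangent_slope /m mulnS expr0n /= mulr0.
have E0 : y 0 0 = x 0 0.
  by have := E 0; rewrite /tangent s0 ofR0 !mul0r !subr0 => /addIr.
have E1 : y 0 1 = x 0 1.
  have := E 1; rewrite /tangent E0 => /addIr/addrI/oppr_inj.
  have c0 : ofR (tangent_slope m' (1 : R)) != 0.
    rewrite -cmod_gt0 cmod_ofR normr_gt0 /tangent_slope expr1n mulr1.
    by rewrite pnatr_eq0 muln_eq0.
  exact: mulfI.
move/eqP: xy; apply; apply/rowP => j.
by have [->|->] : j = 0 \/ j = 1 by case: j => -[|[|//]] h; [left|right]; apply: val_inj.
Qed.

Definition ptT (q c : R) : 'rV[Cx R]_2 := \row_j (if j == 0 then ofR q else mkC 0 c).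

Lemma ptT0 q c : ptT q c 0 0 = ofR q. Proof. by rewrite mxE. Qed.
Lemma ptT1 q c : ptT q c 0 1 = mkC 0 c. Proof. by rewrite mxE. Qed.

(* The potential is 2m log (max(Y, eu) + eu) - (log h)/2, with h = Re Q,
   Y = Im Z - c, u = h^(1/(2m)) and e = 2m. Where Y <= eu it is (log h)/2 + const,
   and elsewhere e is exactly large enough for its speed to be at most k. *)
Lemma tube_growth c b : 0 < b ->
  (((2 * m)%:R * ln b - (2 * m)%:R * ln (4 * m)%:R)%:E
    <= kobayashi T (ptT 1 c) (ptT 1 (c + b)))%E.
Proof.
move=> b0; pose M : R := m%:R.
have M0 : 0 < M by rewrite ltr0n.
have M2 : (2 * m)%:R = 2 * M by rewrite natrM.
apply: le_ereal_inf_tmp => _ [t0 [t1 [gamma [cg g0 g1 ->]]]].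
pose h t := coRe gamma 0 t; pose Y t := coIm gamma 1 t - c.
have [t01 _ Tg] := cg.
have h0 t : t0 <= t <= t1 -> 0 < h t by move=> /Tg/tube_re_gt0.
pose u t := expR ((2 * M)^-1 * ln (h t) + 0 * ln (h t)).
have uE t : u t = wid m' (h t) by rewrite /u /wid mul0r addr0 -M2 mulrC.
pose ep := 2 * M.
have ep0 : 0 < ep by rewrite mulr_gt0.
have u0 t : 0 < u t by exact: expR_gt0.
pose W t := Num.max (Y t) (ep * u t + 0 * u t) + ep * u t.
have W0 t : 0 < W t.
  have : ep * u t + 0 * u t <= Num.max (Y t) (ep * u t + 0 * u t) by rewrite le_max lexx orbT.
  by rewrite /W; have := mulr_gt0 ep0 (u0 t); lra.
pose g t := 2 * M * ln (W t) + (- 2^-1) * ln (h t).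
have ach : abs_continuous t0 t1 h by exact: curve_coRe cg.
have acl : abs_continuous t0 t1 (fun t => ln (h t)) by exact: abs_continuous_ln.
have acu : abs_continuous t0 t1 u.
  by apply: abs_continuous_expR => //; exact: abs_continuousD.
have acY : abs_continuous t0 t1 Y.
  have -> : Y = (fun t => 1 * coIm gamma 1 t + 1 * (- c)) by apply/funext => t; rewrite /Y; ring.
  by apply: abs_continuousD; [exact: curve_coIm cg|exact: abs_continuous_cst].
have acW : abs_continuous t0 t1 W.
  have -> : W = (fun t => 1 * Num.max (Y t) (ep * u t + 0 * u t) + ep * u t).
    by apply/funext => t; rewrite /W mul1r.
  apply: abs_continuousD => //; apply: abs_continuous_max => //; exact: abs_continuousD.
have acg : abs_continuous t0 t1 g.
  by apply: abs_continuousD => //; apply: abs_continuous_ln.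
apply: (@le_trans _ _ (`|g t1 - g t0|%:E)).
  rewrite lee_fin; apply: le_trans (ler_norm _).
  have hh t : gamma t = ptT 1 c \/ gamma t = ptT 1 (c + b) -> h t = 1.
    by rewrite /h /coRe => -[] ->; rewrite ptT0.
  have h1 : h t1 = 1 by apply: hh; right.
  have h00 : h t0 = 1 by apply: hh; left.
  have Y1 : Y t1 = b by rewrite /Y /coIm g1 ptT1 !cE; ring.
  have Y0 : Y t0 = 0 by rewrite /Y /coIm g0 ptT1 !cE; ring.
  have uu t : h t = 1 -> u t = 1 by move=> e; rewrite /u e ln1 !mulr0 addr0 expR0.
  rewrite /g h1 h00 ln1 mulr0 !addr0 M2 -!mulrBr ler_pM2l ?mulr_gt0 //.
  (* At the start [Y = 0] and [u = 1], so [W] equals [2 * ep]: this is the constant in the bound. *)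
  have -> : W t0 = (4 * m)%:R.
    rewrite /W (uu _ h00) Y0 mul0r addr0 mulr1 (max_idPr (ltW ep0)) /ep natrM -/M; ring.
  rewrite lerD2r ler_ln ?posrE // /W Y1 uu // mulr1.
  have : b <= Num.max b (ep + 0 * 1) by rewrite le_max lexx.
  lra.
apply: kobayashi_length_lower cg acg _ => t p q g' tt dp dq dg.
have ct : t0 <= t <= t1 by case/andP: tt => /ltW -> /ltW ->.
have hp := h0 t ct; have up := u0 t.
pose lam := p 0 / h t; pose kap := (2 * M)^-1 * lam.
have dh : is_derive t 1 h (p 0) by exact: dp.
have dl : is_derive t 1 (fun s : R => ln (h s)) lam by exact: real_deriv_ln.
have du : is_derive t 1 u (u t * kap).
  rewrite (_ : kap = (2 * M)^-1 * lam + 0 * lam); last by rewrite mul0r addr0.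
  by apply: real_deriv_expR; apply: real_derivD; exact: real_derivZ.
have dY : is_derive t 1 Y (q 1).
  rewrite -[q 1]subr0; exact: (real_derivB (dq 1) (real_deriv_cst c t)).
apply: (@tangent_metric_lower R m' (gamma t)) => k kp B.
have V := vertical_bound B; have H := horizontal_bound (Tg t ct) kp B.
rewrite !mxE -/(coRe gamma 0 t) -/(h t) in V H.
rewrite -uE in H.
have {}V : `|lam| <= 2 * k.
  have := le_trans (cRe_le _) V; rewrite cRe_mkC /lam normrM normfV (gtr0_norm hp) => h1.
  by rewrite ler_pdivrMr //; lra.
have {}H : `|q 1| <= 2 * u t * k by apply: le_trans (cIm_le _) H.
have kapM : M * kap = lam / 2 by rewrite /kap; field; rewrite gt_eqF.
have lu s : ln (2 * ep * u s) = ln (2 * ep) + (2 * M)^-1 * ln (h s).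
  by rewrite lnM ?posrE ?mulr_gt0 // /u expRK mul0r addr0.
(* The maximum is never differentiated. The branch active at [t] stays below [g] near [t] and meets
   it there, so [touching_deriv] identifies [g'], including the case where both branches agree. *)
have [Yu|Yu] := leP (Y t) (ep * u t).
  have -> : g' = 2^-1 * lam.
    have dH : is_derive t 1 (fun s : R => 2 * M * ln (2 * ep) + 2^-1 * ln (h s)) (0 + 2^-1 * lam).
      exact: (real_derivD (real_deriv_cst _ t) (real_derivZ _ dl)).
    rewrite -[RHS]add0r; apply: (touching_deriv dg dH).
      rewrite /g /W mul0r addr0 (max_idPr Yu).
      have -> : ep * u t + ep * u t = 2 * ep * u t by ring.
      by rewrite lu; field; rewrite gt_eqF.
    exists 1 => // s _; rewrite /g.
    have -> : 2 * M * ln (2 * ep) + 2^-1 * ln (h (t + s)) =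
        2 * M * ln (2 * ep * u (t + s)) + - 2^-1 * ln (h (t + s)).
      by rewrite lu; field; rewrite gt_eqF.
    rewrite lerD2r ler_pM2l ?mulr_gt0 // ler_ln ?posrE ?mulr_gt0 //.
    have : ep * u (t + s) + 0 * u (t + s) <= Num.max (Y (t + s)) (ep * u (t + s) + 0 * u (t + s)).
      by rewrite le_max lexx orbT.
    by rewrite /W; lra.
  by rewrite normrM gtr0_norm ?invr_gt0 //; lra.
pose V0 s := Y s + ep * u s.
have V00 : 0 < V0 t by rewrite /V0; have := mulr_gt0 ep0 up; lra.
have dV : is_derive t 1 V0 (q 1 + ep * (u t * kap)).
  exact: (real_derivD dY (real_derivZ ep du)).
have [r r0 Hr] := real_deriv_cont dV V00.
have -> : g' = 2 * M * ((q 1 + ep * (u t * kap)) / V0 t) + (- 2^-1) * lam.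
  apply: (touching_deriv dg (real_derivD (real_derivZ (2 * M) (real_deriv_ln V00 dV)) (real_derivZ (- 2^-1) dl))).
    by rewrite /g /W mul0r addr0 (max_idPl (ltW Yu)).
  exists r => // s /Hr; rewrite ltr_norml => /andP[s1 _].
  have Vs : 0 < V0 (t + s) by lra.
  rewrite /g lerD2r ler_pM2l ?mulr_gt0 // ler_ln ?posrE //.
  have : Y (t + s) <= Num.max (Y (t + s)) (ep * u (t + s) + 0 * u (t + s)) by rewrite le_max lexx.
  by rewrite /W /V0; lra.
(* In this region [rr] is at most [1 / (2 * ep)]. The horizontal part contributes [4 M rr k] and the
   vertical part [(1 - 2 ep rr) k]; with [ep = 2 M] they add up to exactly [k]. *)
pose rr := u t / V0 t.
have rr0 : 0 < rr by rewrite divr_gt0.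
have rr1 : rr * (2 * ep) <= 1.
  by rewrite /rr mulrAC ler_pdivrMr // mul1r /V0; lra.
have -> : 2 * M * ((q 1 + ep * (u t * kap)) / V0 t) + - 2^-1 * lam =
   2 * M * rr * (q 1 / u t) + (2 * ep * rr - 1) * (lam / 2).
  rewrite -kapM /rr /kap.
  have M0' := gt_eqF M0; have u0' := gt_eqF up; have V0' := gt_eqF V00.
  by field; rewrite M0' u0' V0'.
apply: le_trans (ler_normD _ _) _.
have c0 : 0 < 2 * M * rr by rewrite mulr_gt0 // mulr_gt0.
have B1 : `|2 * M * rr * (q 1 / u t)| <= 2 * M * rr * (2 * k).
  rewrite normrM (gtr0_norm c0) ler_pM2l // normrM normfV (gtr0_norm up) ler_pdivrMr //; lra.
have B2 : `|(2 * ep * rr - 1) * (lam / 2)| <= (1 - 2 * ep * rr) * k.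
  rewrite normrM; apply: ler_pM => //.
    by rewrite ler0_norm; lra.
  rewrite normrM normfV (gtr0_norm (ltr0Sn _ 1)) ler_pdivrMr //; lra.
have -> : k = 2 * M * rr * (2 * k) + (1 - 2 * ep * rr) * k by rewrite /ep; ring.
exact: lerD.
Qed.

End TubeHyperbolic.

(** * Explicit discs and upper bounds for the metric *)

Section AnalyticDiscs.
Variable R : realType.

Lemma derivable_line n (v : 'rV[Cx R]_n) (g : Cx R -> Cx R) z d : cderiv g z d ->
  is_derive z 1 (fun w => g w *: v) (d *: v).
Proof.
move=> /cderivP [dg gE].
have H : (fun h => h^-1 *: ((g \o shift z) (h *: 1) - g z)) @ 0^' --> d by rewrite -gE; exact: dg.
have K : (fun h => h^-1 *: (((fun w => g w *: v) \o shift z) (h *: 1) - g z *: v)) @ 0^' --> d *: v.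
  have -> : (fun h => h^-1 *: (((fun w => g w *: v) \o shift z) (h *: 1) - g z *: v)) =
      (fun h => (h^-1 *: ((g \o shift z) (h *: 1) - g z)) *: v).
    by apply/funext => h; rewrite /= -scalerBl scalerA.
  exact: cvgZr_tmp.
split; first by apply/cvg_ex; eexists; exact: K.
exact: cvg_lim K.
Qed.

Lemma is_derive_row n (F : Cx R -> 'rV[Cx R]_n) z (d : 'I_n -> Cx R) :
  (forall j, cderiv (fun w => F w 0 j) z (d j)) -> is_derive z 1 F (\row_j d j).
Proof.
move=> H.
have -> : F = \sum_(j < n) (fun w => F w 0 j *: delta_mx 0 j).
  by apply/funext => w; rewrite fct_sumE -row_sum_delta.
have -> : \row_j d j = \sum_(j < n) d j *: delta_mx 0 j.
  by rewrite [LHS]row_sum_delta; apply: eq_bigr => j _; rewrite mxE.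
by apply: is_derive_sum => j; exact: derivable_line.
Qed.

Lemma cderiv_inv (f : Cx R -> Cx R) z d : cderiv f z d -> f z != 0 ->
  cderiv (fun w => (f w)^-1) z (- (f z) ^- 2 * d).
Proof.
move=> /cderivP[df dE] f0; apply/cderivP; split; first exact: derivableV.
by rewrite deriveV // dE.
Qed.

Lemma metric_upper n Omega (z v : 'rV[Cx R]_n) lambda f :
  holomorphic_disc Omega f -> f 0 = z -> lambda *: derive1 f 0 = v ->
  (kobayashi_metric Omega z v <= (cmod lambda)%:E)%E.
Proof. by move=> hf f0 fv; apply: ereal_inf_lbound; exists lambda => //; exists f. Qed.

Lemma row2P (x y : 'rV[Cx R]_2) : x 0 0 = y 0 0 -> x 0 1 = y 0 1 -> x = y.
Proof.
move=> e0 e1; apply/rowP => j.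
by have [->|->] : j = 0 \/ j = 1 by case: j => -[|[|//]] h; [left|right]; apply: val_inj.
Qed.

Lemma disc_unit (w : Cx R) : unit_disc w <-> cmod w < 1.
Proof. by rewrite /unit_disc /= norm_cmod -ofR1 ltC_ofR. Qed.

Lemma tube_disc m (A B : Cx R -> Cx R) A' B' lambda (z v : 'rV[Cx R]_2) :
  (forall w, cmod w < 1 -> exists d, cderiv A w d) ->
  (forall w, cmod w < 1 -> exists d, cderiv B w d) ->
  (forall w, cmod w < 1 -> cRe (B w) ^+ (2 * m) < cRe (A w)) ->
  cderiv A 0 A' -> cderiv B 0 B' -> A 0 = z 0 0 -> B 0 = z 0 1 ->
  lambda * A' = v 0 0 -> lambda * B' = v 0 1 ->
  (kobayashi_metric (tube_domain R m) z v <= (cmod lambda)%:E)%E.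
Proof.
move=> dA dB AB dA0 dB0 zA zB vA vB.
pose F w : 'rV[Cx R]_2 := \row_j (if j == 0 then A w else B w).
have D w a b : cderiv A w a -> cderiv B w b ->
    is_derive w 1 F (\row_(j < 2) (if j == 0 then a else b)).
  move=> Ha Hb; apply: is_derive_row => j.
  have -> : (fun w => F w 0 j) = (fun w => if j == 0 then A w else B w).
    by apply/funext => x; rewrite mxE.
  by case: eqP.
apply: (@metric_upper _ _ _ _ _ F).
- move=> w /disc_unit w1; have [a Ha] := dA w w1; have [b Hb] := dB w w1; split.
    by have [] := D w a b Ha Hb.
  by rewrite /tube_domain /= !mxE; exact: AB.
- by apply: row2P; rewrite mxE.
- by rewrite derive1E; have [_ ->] := D 0 A' B' dA0 dB0; apply: row2P; rewrite !mxE.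
Qed.

(** The quotient is nearer to 1 than to -1, because its distances to them are [|2 w / (1 - w)|] and
    [|2 / (1 - w)|]. *)
Lemma cayley_re_gt0 (w : Cx R) : cmod w < 1 -> 0 < cRe ((1 + w) / (1 - w)).
Proof.
move=> w1.
have y0 : 1 - w != 0 by apply/negP => /eqP e; move: w1; rewrite (_ : w = 1) ?cmod1 ?ltxx // -(subrK w 1) e add0r.
set r := _ / _.
have E1 : r - 1 = 2 * w / (1 - w) by rewrite /r; field.
have E2 : r + 1 = 2 / (1 - w) by rewrite /r; field.
have A : cmod (r + 1) ^+ 2 - cmod (r - 1) ^+ 2 = 4 * cRe r.
  by rewrite !cmod_sqr !cE; ring.
have B : cmod (r - 1) < cmod (r + 1).
  rewrite E1 E2 !cmodM -mulrA mulrCA -[ltRHS]mul1r ltr_pM2r //.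
  by rewrite mulr_gt0 ?cmod_gt0 ?invr_eq0 // pnatr_eq0.
have : cmod (r - 1) ^+ 2 < cmod (r + 1) ^+ 2.
  by rewrite ltr_pXn2r // nnegrE cmod_ge0.
by lra.
Qed.

(** The competitor is the half-plane Re Q > 0 in the slice [Z = i y], parametrised by the Cayley
    map; its derivative at 0 is [2 q], and the sign [s] is the multiplier. *)
Lemma vertical_metric m (q y s : R) (v : 'rV[Cx R]_2) : (0 < m)%N -> 0 < q -> `|s| = 1 ->
  v 0 0 = ofR (s * (2 * q)) -> v 0 1 = 0 ->
  (kobayashi_metric (tube_domain R m) (ptT q y) v <= 1%:E)%E.
Proof.
move=> m0 q0 s1 v0 v1.
have w1 (w : Cx R) : cmod w < 1 -> 1 - w != 0.
  by move=> w1; apply/negP => /eqP e; move: w1; rewrite (_ : w = 1) ?cmod1 ?ltxx // -(subrK w 1) e add0r.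
have D w : cmod w < 1 -> cderiv (fun w => ofR q * ((1 + w) / (1 - w))) w
    (0 * ((1 + w) / (1 - w)) + ofR q * ((0 + 1) / (1 - w) + (1 + w) * (- (1 - w) ^- 2 * (0 - 1)))).
  move=> /w1 h; exact: (cderivM (cderiv_cst (ofR q) w) (cderivM (cderivD (cderiv_cst 1 w) (cderiv_id w))
    (cderiv_inv (cderivB (cderiv_cst 1 w) (cderiv_id w)) h))).
have c0 : cmod (0 : Cx R) < 1 by rewrite cmod0.
have <- : cmod (ofR s) = 1 by rewrite cmod_ofR.
apply: (tube_disc _ _ _ (D 0 c0) (cderiv_cst (mkC 0 y) 0)).
- by move=> w /D dw; eexists; exact: dw.
- by move=> w _; exists 0; exact: cderiv_cst.
- move=> w h; rewrite cRe_mkC expr0n muln_eq0 /= eqn0Ngt m0 /=.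
  by rewrite cReM cRe_ofR cIm_ofR mul0r subr0 mulr_gt0 // cayley_re_gt0.
- by rewrite ptT0 addr0 subr0 divr1 mulr1.
- by rewrite ptT1.
- rewrite v0 !ofRM ofR_nat subr0 expr1n invr1; ring.
- by rewrite v1 mulr0.
Qed.

(** The competitor is the flat disc of radius [b] about [i y] in the slice [Q = b ^+ (2 * m)], where
    the tube has half-width [b]; the multiplier i turns the real direction into the imaginary
    one. *)
Lemma horizontal_metric m (b y : R) (v : 'rV[Cx R]_2) : (0 < m)%N -> 0 < b ->
  v 0 0 = 0 -> v 0 1 = mkC 0 b ->
  (kobayashi_metric (tube_domain R m) (ptT (b ^+ (2 * m)) y) v <= 1%:E)%E.
Proof.
move=> m0 b0 v0 v1.
have <- : cmod (mkC 0 1 : Cx R) = 1.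
  by rewrite cmodE !cE expr0n expr1n /= add0r sqrtr1.
have D w : cderiv (fun w => mkC 0 y + ofR b * w) w (0 + (0 * w + ofR b * 1)).
  exact: (cderivD (cderiv_cst (mkC 0 y) w) (cderivM (cderiv_cst (ofR b) w) (cderiv_id w))).
apply: (tube_disc _ _ _ (cderiv_cst (ofR (b ^+ (2 * m))) 0) (D 0)).
- by move=> w _; exists 0; exact: cderiv_cst.
- by move=> w _; eexists; exact: D.
- move=> w h; rewrite !cE mul0r subr0 add0r.
  rewrite exprM -real_normK ?num_real // -exprM ltr_pXn2r ?nnegrE ?(ltW b0) ?muln_gt0 //.
  rewrite normrM gtr0_norm // -[ltRHS]mulr1 ltr_pM2l //.
  exact: le_lt_trans (cRe_le w) h.
- by rewrite ptT0.
- by rewrite ptT1 mulr0 addr0.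
- by rewrite v0 mulr0.
- by rewrite v1; apply: eqC; rewrite !cE; ring.
Qed.

End AnalyticDiscs.

Section RowContinuity.
Variable R : realType.

Lemma real_deriv_near (f g : R -> R) (t a r : R) : 0 < r ->
  (forall s, `|s| < r -> f (t + s) = g (t + s)) -> is_derive t 1 g a -> is_derive t 1 f a.
Proof.
move=> r0 H /is_derive_realP dg; apply/is_derive_realP => e /dg[r1 r10 H1].
exists (Num.min r r1); first by rewrite lt_min r0.
move=> s; rewrite lt_min => /andP[sr sr1]; rewrite H // -[f t](_ : g t = _); first exact: H1.
by have := H 0; rewrite addr0 normr0 => ->.
Qed.

Lemma abs_continuous_id (a b : R) : abs_continuous a b (fun t : R => t).
Proof.
move=> e e0; exists e => // N u v uv _; apply: le_lt_trans; apply: ler_sum => i _.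
by have [_ h _] := uv i; rewrite ger0_norm ?subr_ge0.
Qed.

Lemma abs_continuous_min (a b : R) (f g : R -> R) : abs_continuous a b f -> abs_continuous a b g ->
  abs_continuous a b (fun t : R => Num.min (f t) (g t)).
Proof.
move=> Hf Hg.
have -> : (fun t => Num.min (f t) (g t)) = (fun t => 1 * (1 * f t + 1 * g t) + (-1) * Num.max (f t) (g t)).
  by apply/funext => t; have := addr_min_max (f t) (g t); lra.
by apply: abs_continuousD; [exact: abs_continuousD|exact: abs_continuous_max].
Qed.

Lemma abs_continuous_row N (a b : R) (f : R -> 'rV[R]_N) :
  (forall i, abs_continuous a b (fun t => f t 0 i : R)) -> abs_continuous a b f.
Proof.
move=> H e e0.
have e1 : 0 < e / N.+1%:R by rewrite divr_gt0.
have P i : exists d : R, 0 < d /\ forall (M : nat) (u v : 'I_M -> R),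
      (forall k, [/\ a <= u k, u k <= v k & v k <= b]) ->
      (forall k l, k != l -> v k <= u l \/ v l <= u k) ->
      \sum_(k < M) (v k - u k) < d ->
      \sum_(k < M) `|f (v k) 0 i - f (u k) 0 i| < e / N.+1%:R.
  by have [d d0 Hd] := H i _ e1; exists d.
have [d Hd] := choice P.
exists (\big[Num.min/1]_(i < N) d i).
  by apply: lt_bigmin => // i _; exact: (Hd i).1.
move=> M u v uv dis l.
apply: (@le_lt_trans _ _ (\sum_(k < M) \sum_(i < N) `|f (v k) 0 i - f (u k) 0 i|)).
  apply: ler_sum => k _; rewrite [leLHS]mx_normrE; apply: bigmax_le.
    by apply: sumr_ge0.
  move=> [j i] _ /=; rewrite (ord1 j) !mxE (bigD1 i) //= lerDl.
  by apply: sumr_ge0.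
rewrite exchange_big /=.
apply: (@le_lt_trans _ _ (\sum_(i < N) e / N.+1%:R)).
  apply: ler_sum => i _; apply/ltW; apply: (Hd i).2 => //.
  by apply: lt_le_trans l _; exact: bigmin_le_cond.
rewrite sumr_const card_ord -[X in X < _]mulr_natr mulrAC ltr_pdivrMr //.
by rewrite ltr_pM2l // ltr_nat.
Qed.

Lemma ae_neq (p : R) : {ae (@lebesgue_measure R), forall x, x != p}.
Proof.
exists [set p]; split; [exact: measurable_set1|exact: lebesgue_measure_set1|].
by move=> x /= /negP; rewrite negbK => /eqP.
Qed.

End RowContinuity.

(** * A path realising the upper bound *)

Section UpperBound.
Variables (R : realType) (m : nat).
Hypothesis m0 : (0 < m)%N.
Variables (b c : R).
Hypothesis b1 : 1 <= b.

(** The path has metric speed at most 1: [Q = exp (2 t)] rises for the time [T0], until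
    [Q = b ^+ (2 * m)]; there Im Z advances by [b] in time 1; then [Q] descends again. The minima
    and maxima in [q] and [y] paste the three pieces, and the total time is [L = 2 m log b + 1]. *)
Let T0 := m%:R * ln b.
Let L := 2 * T0 + 1.
Let q (t : R) := expR (2 * Num.min t (Num.min T0 (L - t)) + 0 * t).
Let y (t : R) := c * 1 + b * Num.max 0 (Num.min 1 (1 * t + - T0 * 1)).
Let gamma t := ptT (q t) (y t).

Let T00 : 0 <= T0. Proof. by rewrite mulr_ge0 ?ln_ge0. Qed.

Let path_curve : curve_in (tube_domain R m) 0 L gamma.
Proof.
have L0 : 0 <= L by have := T00; rewrite /L; lra.
split => //; last first.
  move=> t _; rewrite /tube_domain /= ptT0 ptT1 /= -/(cRe (mkC 0 _)).
  by rewrite expr0n muln_eq0 /= eqn0Ngt m0 /= expR_gt0.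
have acq : abs_continuous 0 L q.
  apply: abs_continuous_expR => //; apply: abs_continuousD; last exact: abs_continuous_id.
  apply: abs_continuous_min; first exact: abs_continuous_id.
  apply: abs_continuous_min; first exact: abs_continuous_cst.
  have -> : (fun t => L - t) = (fun t => L * 1 + (-1) * t) by apply/funext => t; ring.
  by apply: abs_continuousD; [exact: abs_continuous_cst|exact: abs_continuous_id].
have acy : abs_continuous 0 L y.
  apply: abs_continuousD; first exact: abs_continuous_cst.
  apply: abs_continuous_max; first exact: abs_continuous_cst.
  apply: abs_continuous_min; first exact: abs_continuous_cst.
  by apply: abs_continuousD; [exact: abs_continuous_id|exact: abs_continuous_cst].
apply: abs_continuous_row => i; rewrite -(splitK i); case: (fintype.split i) => j /=.
  have -> : (fun t => to_real (gamma t) 0 (lshift 2 j)) = (if j == 0 then q else fun _ => 0).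
    by apply/funext => t; rewrite to_real_lshift mxE; case: eqP.
  by case: eqP => // _; exact: abs_continuous_cst.
have -> : (fun t => to_real (gamma t) 0 (rshift 2 j)) = (if j == 0 then fun _ => 0 else y).
  by apply/funext => t; rewrite to_real_rshift mxE; case: eqP.
by case: eqP => // _; exact: abs_continuous_cst.
Qed.

Let path_velocity (t q' y' : R) : is_derive t 1 q q' -> is_derive t 1 y y' ->
  velocity gamma t 0 0 = ofR q' /\ velocity gamma t 0 1 = mkC 0 y'.
Proof.
move=> dq dy.
have P (j : 'I_2) : is_derive t 1 (coRe gamma j) (if j == 0 then q' else 0).
  have -> : coRe gamma j = (if j == 0 then q else fun _ => 0).
    by apply/funext => s; rewrite /coRe mxE; case: eqP.
  by case: eqP => // _; exact: real_deriv_cst.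
have Q (j : 'I_2) : is_derive t 1 (coIm gamma j) (if j == 0 then 0 else y').
  have -> : coIm gamma j = (if j == 0 then fun _ => 0 else y).
    by apply/funext => s; rewrite /coIm mxE; case: eqP.
  by case: eqP => // _; exact: real_deriv_cst.
by rewrite !(velocityE P Q).
Qed.

Let path_speed t : 0 < t < L -> t != T0 -> t != T0 + 1 ->
  (kobayashi_metric (tube_domain R m) (gamma t) (velocity gamma t) <= 1%:E)%E.
Proof.
move=> /andP[t0 tL] tT tT1.
have [h1|h1] := ltP t T0.
  have dq : is_derive t 1 q (1 * (2 * q t)).
    have -> : 1 * (2 * q t) = expR (2 * t) * (2 * 1).
      rewrite /q mul0r addr0 min_l; first by ring.
      by rewrite le_min /L; apply/andP; split; lra.
    apply: (real_deriv_near (r := T0 - t) _ _ (real_deriv_expR (real_derivZ 2 (is_derive_id _ _)))).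
      by rewrite subr_gt0.
    move=> s; rewrite ltr_norml => /andP[s1 s2]; rewrite /q mul0r addr0 min_l // le_min.
    by rewrite /L; apply/andP; split; lra.
  have dy : is_derive t 1 y 0.
    apply: (real_deriv_near (r := T0 - t) _ _ (real_deriv_cst (c * 1 + b * 0) t)).
      by rewrite subr_gt0.
    move=> s; rewrite ltr_norml => /andP[s1 s2]; rewrite /y max_l //.
    by rewrite ge_min; apply/orP; right; lra.
  have [v0 v1] := path_velocity dq dy.
  have q0 : 0 < q t by exact: expR_gt0.
  apply: (vertical_metric (y t) m0 q0 _ v0 v1); exact: normr1.
have {}h1 : T0 < t by rewrite lt_def tT.
have [h2|h2] := ltP t (T0 + 1).
  have qE s : T0 <= s <= T0 + 1 -> q s = b ^+ (2 * m).
    move=> /andP[s0 s1]; rewrite /q mul0r addr0 min_r; last by rewrite ge_min s0.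
    rewrite min_l; last by rewrite /L; lra.
    by rewrite /T0 mulrA -natrM expRM_natl lnK // posrE (lt_le_trans ltr01 b1).
  pose r := Num.min (t - T0) (T0 + 1 - t).
  have r0 : 0 < r by rewrite lt_min !subr_gt0 h1.
  have dq : is_derive t 1 q 0.
    apply: (real_deriv_near r0 _ (real_deriv_cst (b ^+ (2 * m)) t)) => s;
     rewrite lt_min !ltr_norml => /andP[/andP[? ?] /andP[? ?]]; rewrite qE //.
    by apply/andP; split; lra.
  have dy : is_derive t 1 y b.
    have E : 0 + b * (1 * 1 + 0) = b by ring.
    rewrite -[X in is_derive _ _ _ X]E.
    apply: (real_deriv_near r0 _ (real_derivD (real_deriv_cst (c * 1) t) (real_derivZ b (real_derivD
      (real_derivZ 1 (is_derive_id _ _)) (real_deriv_cst (- T0 * 1) t))))) => s.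
    rewrite lt_min !ltr_norml => /andP[/andP[? ?] /andP[? ?]].
    by rewrite /y min_r ?max_r //; lra.
  have [v0 v1] := path_velocity dq dy.
  rewrite /gamma qE; last by rewrite (ltW h1) (ltW h2).
  by apply: (horizontal_metric _ m0 _ v0 v1); exact: lt_le_trans ltr01 b1.
have {}h2 : T0 + 1 < t by rewrite lt_def tT1.
have dq : is_derive t 1 q ((-1) * (2 * q t)).
  have -> : (-1) * (2 * q t) = expR (2 * (L - t)) * (2 * (0 - 1)).
    rewrite /q mul0r addr0 min_r; last by rewrite ge_min /L; apply/orP; left; lra.
    rewrite min_r; first by ring.
    by rewrite /L; lra.
  apply: (real_deriv_near (r := t - (T0 + 1)) _ _
    (real_deriv_expR (real_derivZ 2 (real_derivB (real_deriv_cst L t) (is_derive_id _ _))))).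
    by rewrite subr_gt0.
  move=> s; rewrite ltr_norml => /andP[s1 s2]; rewrite /q mul0r addr0.
  rewrite min_r; last by rewrite ge_min /L; apply/orP; left; lra.
  by rewrite min_r // /L; lra.
have dy : is_derive t 1 y 0.
  apply: (real_deriv_near (r := t - (T0 + 1)) _ _ (real_deriv_cst (c * 1 + b * 1) t)).
    by rewrite subr_gt0.
  move=> s; rewrite ltr_norml => /andP[s1 s2]; rewrite /y min_l; last by lra.
  by rewrite max_r.
have [v0 v1] := path_velocity dq dy.
have q0 : 0 < q t by exact: expR_gt0.
apply: (vertical_metric (y t) m0 q0 _ v0 v1); exact: normrN1.
Qed.

Lemma tube_upper :
  (kobayashi (tube_domain R m) (ptT 1 c) (ptT 1 (c + b)) <= ((2 * m)%:R * ln b + 1)%:E)%E.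
Proof.
have L0 : 0 <= L by have := T00; rewrite /L; lra.
have gE : gamma 0 = ptT 1 c.
  rewrite /gamma /q /y mulr0 addr0 min_l; last by rewrite le_min T00 subr0 L0.
  rewrite mulr0 expR0 max_l ?mulr0 ?mulr1 ?addr0 //.
  by rewrite ge_min; apply/orP; right; have := T00; lra.
have gL : gamma L = ptT 1 (c + b).
  rewrite /gamma /q /y subrr (min_r T00) min_r // mul0r mulr0 addr0 expR0 min_l; last by have := T00; rewrite /L; lra.
  by rewrite max_r // !mulr1.
apply: (@le_trans _ _ (kobayashi_length (tube_domain R m) 0 L gamma)).
  by apply: ereal_inf_lbound; exists 0, L, gamma; split => //; exact: path_curve.
have mI : measurable (`[0, L]%classic : set (measurableTypeR R)) by exact: measurable_itv.
have := @ae_integral_le_cst _ _ R (@lebesgue_measure R) `[0, L]%classic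
   (fun t => kobayashi_metric (tube_domain R m) (gamma t) (velocity gamma t)) 1 mI ler01.
have -> : (1%:E * @lebesgue_measure R `[0%R, L])%E = ((2 * m)%:R * ln b + 1)%:E.
  rewrite mul1e lebesgue_measure_itv /= lte_fin.
  have -> : 0 < L by have := T00; rewrite /L; lra.
  by rewrite oppr0 -EFinD addr0 /L /T0 natrM mulrA.
apply; first by move=> t _; exact: kobayashi_metric_ge0.
have aeF : Filter (nbhs (almost_everywhere (@lebesgue_measure R))) := ae_filter_ringOfSetsType _.
apply: (@filterS _ _ aeF _ _ _ (filterI (filterI (ae_neq 0) (ae_neq L)) (filterI (ae_neq T0) (ae_neq (T0 + 1))))).
move=> t [[t0 tL] [tT tT1]]; rewrite /= in_itv /= => /andP[t0' tL'].
apply: path_speed => //; rewrite lt_def t0 t0' /= lt_def eq_sym tL tL' //.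
Qed.

End UpperBound.

(** * Invariance under dilations and translations *)

Section Scaling.
Variables (R : realType).

(** Valid at every [t]: nonzero factors preserve both differentiability and its failure, and where
    it fails both sides have the default value 0. Hence lengths can be compared at all times, not
    just at almost all. *)
Lemma derive1_diagonal N (k : 'I_N -> R) (f : R -> 'rV[R]_N) t : (forall i, k i != 0) ->
  derive1 (fun s => \row_i (k i * f s 0 i)) t = \row_i (k i * derive1 f t 0 i).
Proof.
move=> k0; set g := fun s => _.
have gE i : (fun s => g s 0 i) = (fun s => k i * f s 0 i) by apply/funext => s; rewrite mxE.
have fE i : (fun s => f s 0 i) = (fun s => (k i)^-1 * g s 0 i).
  by apply/funext => s; rewrite /g mxE mulKf.
have fg : derivable f t 1 <-> derivable g t 1.
  split=> /derivable_mxP H; apply/derivable_mxP => j i; rewrite (ord1 j).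
    by rewrite gE; have := H 0 i => /derivableP h; have [] := real_derivZ (k i) h.
  by rewrite fE; have := H 0 i => /derivableP h; have [] := real_derivZ (k i)^-1 h.
have [df|ndf] := pselect (derivable f t 1).
  have dg := fg.1 df; rewrite !derive1E (derive_mx dg) (derive_mx df).
  apply/rowP => i; rewrite !mxE gE.
  have := (derivable_mxP _ _ _).1 df 0 i => /derivableP h.
  by have [_ ->] := real_derivZ (k i) h.
have ndg : ~ derivable g t 1 by move=> /fg.2.
have Z (h : R -> 'rV[R]_N) : ~ derivable h t 1 -> derive1 h t = 0.
  move=> nd; rewrite derive1E; have -> : 'D_1 h t = point := dvgP nd.
  by apply/rowP => i; rewrite !mxE.
by rewrite !Z //; apply/rowP => i; rewrite !mxE mulr0.
Qed.

Variable m : nat.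
Variable s : R.
Hypothesis s0 : 0 < s.

Definition dilate (z : 'rV[Cx R]_2) : 'rV[Cx R]_2 :=
  \row_j (ofR (if j == 0 then s ^+ (2 * m) else s) * z 0 j).

Let k (j : 'I_2) : R := if j == 0 then s ^+ (2 * m) else s.
Let k0 j : 0 < k j. Proof. by rewrite /k; case: eqP => // _; exact: exprn_gt0. Qed.
Let dilateE z j : dilate z 0 j = ofR (k j) * z 0 j. Proof. by rewrite mxE. Qed.

Lemma dilate_tube z : tube_domain R m z -> tube_domain R m (dilate z).
Proof.
rewrite /tube_domain /= !dilateE -!/(cRe _) !cE !mul0r !subr0 /k /= exprMn.
by rewrite ltr_pM2l // exprn_gt0.
Qed.

Let kk (i : 'I_(2 + 2)) : R := match fintype.split i with inl j => k j | inr j => k j end.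

Let to_real_dilate z : to_real (dilate z) = \row_i (kk i * to_real z 0 i).
Proof.
apply/rowP => i; rewrite -(splitK i) [RHS]mxE /kk unsplitK; case: (fintype.split i) => j /=.
  by rewrite !to_real_lshift dilateE !cE mul0r subr0.
by rewrite !to_real_rshift dilateE !cE mul0r addr0.
Qed.

Lemma velocity_dilate gamma t : velocity (dilate \o gamma) t = dilate (velocity gamma t).
Proof.
rewrite /velocity.
have -> : @to_real R 2 \o (dilate \o gamma) = fun t => \row_i (kk i * (@to_real R 2 \o gamma) t 0 i).
  by apply/funext => x; rewrite /= to_real_dilate.
rewrite derive1_diagonal; last first.
  by move=> i; rewrite /kk; case: (fintype.split i) => j; rewrite gt_eqF.
apply/rowP => j; rewrite dilateE !mxE /kk.
rewrite (_ : fintype.split (lshift 2 j) = inl j); last exact: (unsplitK (inl j)).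
rewrite (_ : fintype.split (rshift 2 j) = inr j); last exact: (unsplitK (inr j)).
by apply: eqC; rewrite !cE mul0r ?subr0 ?addr0.
Qed.

Lemma metric_dilate z v : (kobayashi_metric (tube_domain R m) (dilate z) (dilate v)
  <= kobayashi_metric (tube_domain R m) z v)%E.
Proof.
apply: le_ereal_inf_tmp => _ [l [f [hf f0 fv]] <-];
have D w : unit_disc w -> is_derive w 1 (dilate \o f) (\row_j (ofR (k j) * derive1 f w 0 j)).
  move=> /hf[df _]; apply: is_derive_row => j.
  have -> : (fun w => (dilate \o f) w 0 j) = (fun w => ofR (k j) * f w 0 j).
    by apply/funext => x; rewrite /= dilateE.
  have := cderivM (cderiv_cst (ofR (k j)) w) (derivable_entry j df).
  by rewrite mul0r add0r.
apply: (@metric_upper _ _ _ _ _ _ (dilate \o f)).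
- by move=> w w1; split; [have [] := D w w1|apply: dilate_tube; have [] := hf w w1].
- by rewrite /= f0.
- have u0 : unit_disc (0 : Cx R) by apply/disc_unit; rewrite cmod0.
  rewrite derive1E; have [_ ->] := D 0 u0; rewrite -fv.
  by apply/rowP => j; rewrite dilateE !mxE mulrCA.
Qed.

Lemma kobayashi_dilate_le x y :
  (kobayashi (tube_domain R m) (dilate x) (dilate y) <= kobayashi (tube_domain R m) x y)%E.
Proof.
apply: le_ereal_inf_tmp => _ [a [b [gamma [cg <- <- ->]]]].
apply: (@le_trans _ _ (kobayashi_length (tube_domain R m) a b (dilate \o gamma))).
  apply: ereal_inf_lbound; exists a, b, (dilate \o gamma); split => //.
  have [ab acg Tg] := cg; split => //; last by move=> t /Tg/dilate_tube.
  have -> : @to_real R 2 \o (dilate \o gamma) = fun t => \row_i (kk i * (@to_real R 2 \o gamma) t 0 i).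
    by apply/funext => x0; rewrite /= to_real_dilate.
  apply: abs_continuous_row => i.
  have -> : (fun t => (\row_i0 (kk i0 * (@to_real R 2 \o gamma) t 0 i0)) 0 i) =
     (fun t => kk i * (@to_real R 2 \o gamma) t 0 i + 0 * (@to_real R 2 \o gamma) t 0 i).
    by apply/funext => t; rewrite mxE mul0r addr0.
  by apply: abs_continuousD; exact: abs_continuous_entry.
apply: ge0_integral_mono => t _; first exact: kobayashi_metric_ge0.
by rewrite velocity_dilate; exact: metric_dilate.
Qed.

End Scaling.

Section ScalingInvariance.
Variables (R : realType) (m : nat) (s : R).
Hypothesis s0 : 0 < s.

Lemma dilateK : cancel (@dilate R m s) (@dilate R m s^-1).
Proof.
move=> z; apply/rowP => j; rewrite !mxE mulrA -ofRM; case: eqP => _.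
  by rewrite exprVn mulVf ?ofR1 ?mul1r // expf_neq0 // gt_eqF.
by rewrite mulVf ?ofR1 ?mul1r // gt_eqF.
Qed.

Lemma kobayashi_dilate x y :
  kobayashi (tube_domain R m) (dilate m s x) (dilate m s y) = kobayashi (tube_domain R m) x y.
Proof.
apply/eqP; rewrite eq_le kobayashi_dilate_le //=.
have := @kobayashi_dilate_le R m s^-1 _ (dilate m s x) (dilate m s y).
by rewrite !dilateK; apply; rewrite invr_gt0.
Qed.

End ScalingInvariance.

Section Translation.
Variables (R : realType) (n : nat) (Omega : set 'rV[Cx R]_n) (v : 'rV[Cx R]_n).
Hypothesis Ov : forall z, Omega z -> Omega (z + v).

Lemma derive1_translate (K : numFieldType) (V : normedModType K) (f : K -> V) (w : V) t :
  derive1 (fun s => f s + w) t = derive1 f t.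
Proof.
have E : (fun h : K => h^-1 *: (f (h + t) + w - (f t + w))) = (fun h => h^-1 *: (f (h + t) - f t)).
  by apply/funext => h; rewrite opprD addrACA subrr addr0.
by rewrite /derive1 E.
Qed.

Lemma kobayashi_translate_le x y :
  (kobayashi Omega (x + v) (y + v) <= kobayashi Omega x y)%E.
Proof.
apply: le_ereal_inf_tmp => _ [a [b [gamma [[ab acg Og] <- <- ->]]]].
have to_realD : @to_real R n \o (fun t => gamma t + v) = fun t => (@to_real R n \o gamma) t + to_real v.
  apply/funext => t; apply/rowP => i; rewrite -(splitK i) [RHS]mxE /=; case: (fintype.split i) => j /=.
    by rewrite !to_real_lshift mxE cReD.
  by rewrite !to_real_rshift mxE cImD.
apply: (@le_trans _ _ (kobayashi_length Omega a b (fun t => gamma t + v))).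
  apply: ereal_inf_lbound; exists a, b, (fun t => gamma t + v); split => //.
  split => //; last by move=> t /Og/Ov.
  rewrite to_realD => e /acg[d d0 Hd]; exists d => // N u w uw dis l.
  apply: le_lt_trans (Hd N u w uw dis l); apply: ler_sum => i _.
  by rewrite opprD addrACA subrr addr0.
apply: ge0_integral_mono => t _; first exact: kobayashi_metric_ge0.
rewrite /velocity to_realD derive1_translate.
apply: le_ereal_inf_tmp => _ [l [f [hf f0 <-]] <-].
apply: (@metric_upper _ _ _ _ _ _ (fun w => f w + v)).
- move=> w /hf[df Of]; split; last exact: Ov.
  exact: (derivableD df (derivable_cst v w 1)).
- by rewrite f0.
- by rewrite derive1_translate.
Qed.

End Translation.

Lemma kobayashi_translate (R : realType) (m : nat) (c p q : R) :
  kobayashi (tube_domain R m) (ptT 1 (p + c)) (ptT 1 (q + c)) =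
  kobayashi (tube_domain R m) (ptT 1 p) (ptT 1 q).
Proof.
have H (a p' q' : R) : (kobayashi (tube_domain R m) (ptT 1 (p' + a)) (ptT 1 (q' + a)) <=
    kobayashi (tube_domain R m) (ptT 1 p') (ptT 1 q'))%E.
  have E r : ptT 1 (r + a) = ptT 1 r + ptT 0 a.
    apply: row2P; rewrite !mxE /= ?ofR0 ?addr0 //.
    by apply: eqC; rewrite !cE ?addr0.
  rewrite !E; apply: kobayashi_translate_le => z.
  by rewrite /tube_domain /= !mxE /= -!/(cRe _) !cE !addr0.
apply/eqP; rewrite eq_le H /=.
by have := H (- c) (p + c) (q + c); rewrite !addrK.
Qed.

Section RowNbhs.
Variables (R : realType) (n : nat).

Lemma nbhs_rowP (z : 'rV[Cx R]_n) (V : set 'rV[Cx R]_n) : nbhs z V <->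
  exists2 e : R, 0 < e & forall w : 'rV[Cx R]_n, (forall j, cmod (w 0 j - z 0 j) < e) -> V w.
Proof.
rewrite -nbhs_ballE; split.
  move=> [e /= e0 H]; have [r r0 er] := gt0_ofR e0.
  exists r => // w zw; apply: H; split => // i j; rewrite (ord1 i).
  by rewrite /ball /= norm_cmod er ltC_ofR cmod_sub.
move=> [e e0 H]; exists (ofR e) => /=; first by rewrite -ofR0 ltC_ofR.
move=> w [_ zw]; apply: H => j; have := zw 0 j.
by rewrite /ball /= norm_cmod ltC_ofR cmod_sub.
Qed.

Lemma nbhs_real_rowP (z : 'rV[R]_n) (V : set 'rV[R]_n) : nbhs z V <->
  exists2 e : R, 0 < e & forall w : 'rV[R]_n, (forall j, `|w 0 j - z 0 j| < e) -> V w.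
Proof.
rewrite -nbhs_ballE; split.
  move=> [e /= e0 H]; exists e => // w zw; apply: H; split => // i j; rewrite (ord1 i).
  by rewrite /ball /= distrC.
move=> [e e0 H]; exists e => //= w [_ zw]; apply: H => j; have := zw 0 j.
by rewrite /ball /= distrC.
Qed.

End RowNbhs.

(** * Gromov constants: the lower bound and localisation *)

Section GromovConstant.
Variables (R : realType) (m' : nat).
Let m := m'.+1.
Let T := tube_domain R m.
Let d := @kobayashi_dist R 2 T.
Let M : R := (2 * m)%:R.
Let C : R := M * ln (4 * m)%:R.
Let pt (y : R) : 'rV[Cx R]_2 := ptT 1 y.

Let ptP y : T (pt y).
Proof. by rewrite /T /tube_domain /= ptT0 ptT1 /= expr0n /= ltr01. Qed.

Let dist_bounds c b : 1 <= b -> M * ln b - C <= d (pt c) (pt (c + b)) <= M * ln b + 1.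
Proof.
move=> b1; have b0 : 0 < b by exact: lt_le_trans ltr01 b1.
have := tube_growth m' c b0; have := @tube_upper R m isT b c b1.
rewrite /d /kobayashi_dist -/m -/T -/(pt _) -/(pt _) -/M -/C => U L.
have F : kobayashi T (pt c) (pt (c + b)) \is a fin_num.
  rewrite fin_numE; apply/andP; split; apply/eqP => E.
    by move: L; rewrite E.
  by move: U; rewrite E.
by rewrite -(fineK F) !lee_fin in L U; rewrite L U.
Qed.

(** Doubling the Gromov products and cancelling the distances to the base point gives the symmetric
    four-point condition; the doubling is the origin of [2 * delta]. *)
Lemma gromov_four_points delta (o x y z : 'rV[Cx R]_2) :
  gromov_hyperbolic T d delta -> T o -> T x -> T y -> T z ->
  d x z + d y o <= Num.max (d x y + d z o) (d y z + d x o) + 2 * delta.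
Proof.
move=> H To Tx Ty Tz; have := H o x y z To Tx Ty Tz; rewrite /gromov_product.
have A : d x y + d z o <= Num.max (d x y + d z o) (d y z + d x o) by rewrite le_max lexx.
have B : d y z + d x o <= Num.max (d x y + d z o) (d y z + d x o) by rewrite le_max lexx orbT.
by rewrite lerBlDr ge_min => /orP[] h; lra.
Qed.

Lemma hyperbolic_constant_ge delta : gromov_hyperbolic T d delta -> m%:R * ln 2 <= delta.
Proof.
move=> H; rewrite leNgt; apply/negP => dl.
pose eta := m%:R * ln 2 - delta.
have eta0 : 0 < eta by rewrite subr_gt0.
pose r := Num.sqrt (2 : R).
have r2 : r * r = 2 by rewrite -expr2 sqr_sqrtr.
have r0 : 0 < r by rewrite sqrtr_gt0.
have r1 : 1 < r.
  by rewrite -(sqrtr1 R) ltr_sqrt ?ltr1n // ltr0n.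
(* To improve the bound at [b = r t], the previous stage is needed at [t], [(r - 1) t] and
   [(r + 1) t]. The smallest is [(r - 1) t = b / k], because [(r - 1) (r + 1) = 1]; so each stage
   moves the threshold up by the factor [k]. *)
pose k := (r + 1) * r.
have k1 : 1 <= k by rewrite /k mulrDl r2 mul1r; lra.
have lr : ln (2 : R) = 2 * ln r.
  have -> : ln (2 : R) = ln (r * r) by rewrite r2.
  by rewrite lnM ?posrE //; ring.
have MM : M = 2 * m%:R by rewrite /M natrM.
have Ft c b : d (pt c) (pt (c + b)) = d (pt 0) (pt b).
  by rewrite /d /kobayashi_dist -{1}[c]add0r [c + b]addrC kobayashi_translate.
have key n : forall b, k ^+ n <= b -> d (pt 0) (pt b) <= M * ln b + 1 - n%:R * eta.
  elim: n => [|n IH] b kb.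
    by have /andP[_] := dist_bounds 0 kb; rewrite add0r mul0r subr0.
  have kn : 1 <= k ^+ n by exact: exprn_ege1.
  pose t := b / r.
  have br : b = r * t by rewrite /t mulrCA divff ?mulr1 // gt_eqF.
  have ts : k ^+ n <= t * (r - 1).
    have : (r + 1) * r * k ^+ n <= r * t by rewrite -br -exprS.
    have -> : (r + 1) * r * k ^+ n = r * ((r + 1) * k ^+ n) by ring.
    rewrite ler_pM2l // => h.
    have rm : 0 < r - 1 by lra.
    have := ler_wpM2r (ltW rm) h.
    have -> : (r + 1) * k ^+ n * (r - 1) = k ^+ n * (r * r - 1) by ring.
    by rewrite r2; lra.
  have t0 : 0 < t.
    rewrite /t divr_gt0 //; apply: lt_le_trans kb; apply: exprn_gt0; lra.
  have tk : k ^+ n <= t.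
    have : t * (r - 1) <= t * 1.
      apply: ler_wpM2l; first exact: ltW.
      have : r < r * r by rewrite ltr_pMr.
      by lra.
    by lra.
  have tc : k ^+ n <= t * (r + 1) by lra.
  have := @gromov_four_points delta (pt ((r + 1) * t)) (pt 0) (pt t) (pt (r * t)) H
    (ptP _) (ptP _) (ptP _) (ptP _).
  have E1 : (r + 1) * t = t + r * t by ring.
  have E2 : (r + 1) * t = r * t + t by ring.
  have E3 : r * t = t + t * (r - 1) by ring.
  have E4 : (r + 1) * t = t * (r + 1) by ring.
  have F1 : d (pt t) (pt ((r + 1) * t)) = d (pt 0) (pt (r * t)) by rewrite E1 Ft.
  have F2 : d (pt (r * t)) (pt ((r + 1) * t)) = d (pt 0) (pt t) by rewrite E2 Ft.
  have F3 : d (pt t) (pt (r * t)) = d (pt 0) (pt (t * (r - 1))) by rewrite E3 Ft.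
  rewrite F1 F2 F3 E4 -br.
  have A1 := IH _ tk; have A2 := IH _ ts; have A3 := IH _ tc.
  have lb : ln b = ln r + ln t by rewrite br lnM ?posrE.
  have ls : ln (t * (r - 1)) + ln (t * (r + 1)) = 2 * ln t.
    rewrite -lnM ?posrE; [|lra|lra].
    have -> : t * (r - 1) * (t * (r + 1)) = t * t * (r * r - 1) by ring.
    rewrite r2 (_ : 2 - 1 = 1); last by ring.
    by rewrite mulr1 lnM ?posrE //; ring.
  have lsM : M * ln (t * (r - 1)) + M * ln (t * (r + 1)) = 2 * (M * ln t).
    by rewrite -mulrDr ls; ring.
  have lbM : M * ln b = M * ln t + m%:R * ln 2 by rewrite lb lr MM; ring.
  set X := Num.max _ _ => h.
  have Xle : X <= 2 * (M * ln t + 1 - n%:R * eta).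
    by rewrite ge_max; apply/andP; split; lra.
  have -> : n.+1%:R * eta = n%:R * eta + eta by rewrite -natr1 mulrDl mul1r.
  by rewrite lbM; have : eta = m%:R * ln 2 - delta by []; lra.
(* At this stage the improved upper bound at the distance [k ^+ n] falls below the lower bound
   [M * ln b - C]. *)
have [n Hn] : exists n : nat, 1 + C < n%:R * eta.
  exists (Num.truncn ((1 + C) / eta)).+1; rewrite -ltr_pdivrMr //.
  exact: truncnS_gt.
have kn : 1 <= k ^+ n by exact: exprn_ege1.
have /andP[A _] := dist_bounds 0 kn.
by have := key n _ (lexx _); rewrite add0r in A; lra.
Qed.

Lemma gromov_constant_ge : ((m%:R * ln 2)%:E <= gromov_constant T d)%E.
Proof.
apply: le_ereal_inf_tmp => _ [delta [_ H] <-]; rewrite lee_fin.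
exact: hyperbolic_constant_ge.
Qed.

Lemma dilate_small e (z : 'rV[Cx R]_2) s : 0 < s -> s <= 1 ->
  s * (cmod (z 0 0) + cmod (z 0 1)) < e -> forall j, cmod (dilate m s z 0 j - 0) < e.
Proof.
move=> s0 s1 h j; apply: le_lt_trans h; rewrite subr0 mxE cmodM cmod_ofR.
have p0 := cmod_ge0 (z 0 0); have p1 := cmod_ge0 (z 0 1).
have [->|->] : j = 0 \/ j = 1 by case: j => -[|[|//]] h; [left|right]; apply: val_inj.
  rewrite /= gtr0_norm ?exprn_gt0 // ler_pM ?exprn_ge0 ?(ltW s0) //; last by lra.
  by rewrite /m mulnS addSn exprS ler_piMr ?(ltW s0) // exprn_ile1 // ltW.
by rewrite /= gtr0_norm // ler_pM2l //; lra.
Qed.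

Lemma local_gromov_constantE : local_gromov_constant T 0 = gromov_constant T d.
Proof.
apply/eqP; rewrite eq_le; apply/andP; split.
  apply: ereal_inf_lbound; exists setT; first exact: filterT.
  by rewrite setIT.
apply: le_ereal_inf_tmp => _ [V /nbhs_rowP[e e0 HV] <-].
apply: le_ereal_inf_tmp => _ [delta [d0 H] <-].
apply: ereal_inf_lbound; exists delta => //; split => // o x y z To Tx Ty Tz.
pose N (z : 'rV[Cx R]_2) := cmod (z 0 0) + cmod (z 0 1).
have N0 w : 0 <= N w by rewrite addr_ge0 ?cmod_ge0.
(* The summand 1 makes [S] strictly larger than each of the four sizes, so that one dilation factor
   serves all four points. *)
pose S := 1 + N o + N x + N y + N z.
have S0 : 0 < S by rewrite /S; have := N0 o; have := N0 x; have := N0 y; have := N0 z; lra.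
pose s := Num.min 1 (e / S).
have s0 : 0 < s by rewrite lt_min ltr01 divr_gt0.
have s1 : s <= 1 by rewrite ge_min lexx.
have sS : s * S <= e.
  rewrite -ler_pdivlMr //; rewrite /s ge_min lexx orbT //.
have D w : T w -> N w < S -> (T `&` V) (dilate m s w).
  move=> Tw Nw; split; first exact: dilate_tube.
  apply: HV => j; rewrite [X in _ - X]mxE; apply: dilate_small => //.
  by apply: lt_le_trans sS; rewrite ltr_pM2l.
have dE a b : kobayashi_dist T (dilate m s a) (dilate m s b) = kobayashi_dist T a b.
  by rewrite /kobayashi_dist kobayashi_dilate.
have No := N0 o; have Nx := N0 x; have Ny := N0 y; have Nz := N0 z.
have := H (dilate m s o) (dilate m s x) (dilate m s y) (dilate m s z) (D _ To _) (D _ Tx _) (D _ Ty _) (D _ Tz _).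
by rewrite /d /gromov_product !dE; apply; rewrite /S; lra.
Qed.

End GromovConstant.

(** * The tube as a convex domain with smooth boundary *)

Section TubeDomain.
Variables (R : realType) (m' : nat).
Let m := m'.+1.
Let T := tube_domain R m.
Implicit Types (z : 'rV[Cx R]_2) (a : R).

Lemma power_cont k (x e : R) : 0 < e ->
  exists2 r, 0 < r & forall y, `|y - x| < r -> `|y ^+ k - x ^+ k| < e.
Proof.
move=> e0; have := @exprn_continuous R k x; rewrite /= => /cvgrPdist_lt/(_ e e0).
move=> /nbhs_normP[r /= r0 H]; exists r => // y yx; rewrite distrC; apply: H.
by rewrite /ball_ /= distrC.
Qed.

(** The tube is the intersection of its supporting half-spaces, and the one at [a = cRe (z 0 1)]
    returns the defining inequality. Convexity then needs only that each [tangent a] is affine. *)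
Lemma tube_tangentP z : T z <-> forall a, 0 < cRe (tangent m' a z).
Proof.
split=> [Tz a|H]; first exact: tangent_gt0.
have := H (cRe (z 0 1)); set a := cRe (z 0 1).
rewrite /tangent !cE mul0r subr0 -/a => h.
rewrite /T /tube_domain /= -/(cRe (z 0 1)) -/(cRe (z 0 0)) -/a.
have E : tangent_const m' a = tangent_slope m' a * a - a ^+ (2 * m).
  rewrite /tangent_slope /tangent_const -mulrA -exprSr prednK ?muln_gt0 //.
  by rewrite -subn1 natrB ?muln_gt0 //; ring.
by lra.
Qed.

Lemma tube_combination (x y : 'rV[Cx R]_2) (t : R) : 0 <= t -> t <= 1 -> T x -> T y ->
  T (ofR t *: x + ofR (1 - t) *: y).
Proof.
move=> t0 t1 Tx Ty; apply/tube_tangentP => a.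
have px := tangent_gt0 a Tx; have py := tangent_gt0 a Ty.
have -> : tangent m' a (ofR t *: x + ofR (1 - t) *: y) =
    ofR t * tangent m' a x + ofR (1 - t) * tangent m' a y.
  by rewrite /tangent !mxE ofRB ofR1; ring.
rewrite cReD !cReM !cRe_ofR !cIm_ofR !mul0r !subr0.
have [->|tn] := eqVneq t 0; first by rewrite mul0r add0r subr0 mul1r.
apply: ltr_wpDr; first by rewrite mulr_ge0 ?subr_ge0 // ltW.
by rewrite mulr_gt0 // lt_def tn.
Qed.

Lemma tube_convex : is_convex T.
Proof.
move=> x y l /set_mem Tx /set_mem Ty; apply/mem_set.
have [l0 l1] : 0 <= l%:inum /\ l%:inum <= 1 by split; [exact: ge0|exact: le1].
have lE : l%:inum = ofR (cRe l%:inum).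
  by apply: eqC => //; move: l0; rewrite lecE /= => /andP[/eqP].
have t0 : 0 <= cRe l%:inum by rewrite -leC_ofR -lE.
have t1 : cRe l%:inum <= 1 by rewrite -leC_ofR -lE.
have -> : conv l x y = (ofR (cRe l%:inum) *: (x : 'rV[Cx R]_2) + ofR (1 - cRe l%:inum) *: (y : 'rV[Cx R]_2)).
  by rewrite ofRB -lE.
exact: tube_combination.
Qed.

Lemma tube_open : open T.
Proof.
rewrite openE => z Tz; apply/nbhs_rowP.
move: (Tz); rewrite /T /tube_domain /= -!/(cRe _) => h.
pose e := cRe (z 0 0) - cRe (z 0 1) ^+ (2 * m).
have e0 : 0 < e / 2 by rewrite divr_gt0 // subr_gt0.
have [r r0 Hr] := power_cont (2 * m) (cRe (z 0 1)) e0.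
exists (Num.min r (e / 2)); first by rewrite lt_min r0.
move=> w Hw; rewrite -!/(cRe _).
have := Hw 0; have := Hw 1; rewrite !lt_min => /andP[w1 _] /andP[_ w0].
have A : `|cRe (w 0 1) ^+ (2 * m) - cRe (z 0 1) ^+ (2 * m)| < e / 2.
  by apply: Hr; rewrite -cReB; exact: le_lt_trans (cRe_le _) w1.
have B := le_lt_trans (cRe_le (w 0 0 - z 0 0)) w0.
move: A B; rewrite cReB !ltr_norml /e => /andP[? ?] /andP[? ?]; lra.
Qed.

Lemma tube_connected : connected T.
Proof.
have T1 : T (ptT 1 0) by rewrite /T /tube_domain /= ptT0 ptT1 /= expr0n /= ltr01.
pose seg z := [set ofR t *: z + ofR (1 - t) *: ptT 1 0 | t in `[0, 1]%classic : set R].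
have -> : T = \bigcup_(z in T) seg z.
  apply/seteqP; split=> [z Tz|_ [z Tz [t /= t01 <-]]].
    by exists z => //; exists 1; rewrite ?subrr ?scale0r ?ofR1 ?scale1r ?addr0 //= in_itv /= ler01 lexx.
  by move: t01; rewrite in_itv /= => /andP[t0 t1]; exact: tube_combination.
apply: bigcup_connected.
  exists (ptT 1 0) => z Tz; exists 0; last by rewrite scale0r add0r subr0 ofR1 scale1r.
  by rewrite /= in_itv /= lexx ler01.
move=> z Tz; apply: connected_continuous_connected; first exact: segment_connected.
apply: continuous_subspaceT => t V /nbhs_rowP[e e0 HV].
pose S := 1 + \sum_j cmod (z 0 j - ptT 1 0 0 j).
have S0 : 0 < S by rewrite ltr_wpDr // sumr_ge0 // => j _; exact: cmod_ge0.
apply/nbhs_normP; exists (e / S) => /=; first by rewrite divr_gt0.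
move=> s st.
have {}st : `|t - s| < e / S by exact: st.
have E a k : (ofR a *: z + ofR (1 - a) *: ptT 1 0) 0 k = ofR a * z 0 k + ofR (1 - a) * ptT 1 0 0 k.
  by rewrite mxE mxE [X in _ + X]mxE.
have H := HV (ofR s *: z + ofR (1 - s) *: ptT 1 0).
apply: H => j.
rewrite (E s j) (E t j).
set w := ptT 1 0 0 j.
have -> : ofR s * z 0 j + ofR (1 - s) * w - (ofR t * z 0 j + ofR (1 - t) * w) =
    ofR (s - t) * (z 0 j - w) by rewrite !ofRB ofR1; ring.
rewrite cmodM cmod_ofR.
have wS : cmod (z 0 j - w) < S.
  rewrite /S (bigD1 j) //= -/w.
  have : 0 <= \sum_(i < 2 | i != j) cmod (z 0 i - ptT 1 0 0 i) by rewrite sumr_ge0 // => i _; exact: cmod_ge0.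
  by lra.
apply: (@le_lt_trans _ _ (`|s - t| * S)); first by rewrite ler_wpM2l // ltW.
by rewrite -ltr_pdivlMr // distrC.
Qed.

Lemma tube_is_domain : is_domain T.
Proof.
split; [|exact: tube_open|exact: tube_connected].
by exists (ptT 1 0); rewrite /T /tube_domain /= ptT0 ptT1 /= expr0n /= ltr01.
Qed.

Lemma tube_boundary z : boundary T z -> cRe (z 0 0) = cRe (z 0 1) ^+ (2 * m).
Proof.
move=> [cz iz]; apply/eqP; rewrite eq_le; apply/andP; split.
  by rewrite leNgt; apply/negP => h; apply: iz; have := tube_open; rewrite openE; exact.
rewrite leNgt; apply/negP => h.
pose e := cRe (z 0 1) ^+ (2 * m) - cRe (z 0 0).
have e0 : 0 < e / 2 by rewrite divr_gt0 // subr_gt0.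
have [r r0 Hr] := power_cont (2 * m) (cRe (z 0 1)) e0.
have /cz[w [Tw Vw]] : nbhs z [set w : 'rV[Cx R]_2 | forall j, cmod (w 0 j - z 0 j) < Num.min r (e / 2)].
  by apply/nbhs_rowP; exists (Num.min r (e / 2)) => //; rewrite lt_min r0.
have := Vw 0; have := Vw 1; rewrite !lt_min => /andP[w1 _] /andP[_ w0].
have A : `|cRe (w 0 1) ^+ (2 * m) - cRe (z 0 1) ^+ (2 * m)| < e / 2.
  by apply: Hr; rewrite -cReB; exact: le_lt_trans (cRe_le _) w1.
have B := le_lt_trans (cRe_le (w 0 0 - z 0 0)) w0.
move: Tw; rewrite /T /tube_domain /= -!/(cRe _) => Tw.
move: A B; rewrite cReB !ltr_norml /e => /andP[? ?] /andP[? ?]; lra.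
Qed.

Lemma tube_boundary0 : boundary T 0.
Proof.
split=> [V /nbhs_rowP[e e0 HV]|].
  exists (ptT (e / 2) 0); split.
    by rewrite /T /tube_domain /= ptT0 ptT1 /= expr0n /= divr_gt0.
  apply: HV => j; rewrite !mxE subr0; case: eqP => _.
    by rewrite cmod_ofR gtr0_norm ?divr_gt0 // ltr_pdivrMr // ltr_pMr // ltr1n.
  by rewrite (_ : mkC 0 0 = 0) // cmod0.
move=> /interior_subset; rewrite /T /tube_domain /= !mxE /= expr0n /=.
by rewrite ltxx.
Qed.

End TubeDomain.

Section Directional.
Variables (R : realType) (N : nat).
Implicit Types (f : 'rV[R]_N -> R) (x v : 'rV[R]_N).

Lemma is_derive_directional f x v d :
  is_derive (0 : R) 1 (fun t : R => f (x + t *: v)) d <-> is_derive x v f d.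
Proof.
have E : (fun h : R => h^-1 *: (((fun t : R => f (x + t *: v)) \o shift 0) (h *: 1) - f (x + 0 *: v))) =
    (fun h : R => h^-1 *: ((f \o shift x) (h *: v) - f x)).
  apply/funext => h /=; rewrite scale0r addr0 addr0 [x + _]addrC.
  by rewrite -[h *: 1]/(h * 1) mulr1.
by split=> -[D V]; split; move: D V; rewrite /derivable /derive E.
Qed.

Lemma directionalP f x v d : is_derive x v f d <-> forall e, 0 < e -> exists2 r, 0 < r &
  forall h, `|h| < r -> `|f (x + h *: v) - f x - d * h| <= e * `|h|.
Proof.
rewrite -is_derive_directional is_derive_realP.
by split=> H e /H[r r0 Hr]; exists r => // h /Hr; rewrite add0r scale0r addr0.
Qed.

End Directional.

(** * Smoothness and real analyticity of the boundary *)

Section TubeBoundary.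
Variables (R : realType) (m' : nat).
Let m := m'.+1.
Let T := tube_domain R m.

Definition reQ : 'I_(2 + 2) := lshift 2 0.
Definition reZ : 'I_(2 + 2) := lshift 2 1.

Definition tube_rho (x : 'rV[R]_(2 + 2)) : R := x 0 reZ ^+ (2 * m) - x 0 reQ.

Lemma tube_rhoE z : tube_rho (to_real z) = cRe (z 0 1) ^+ (2 * m) - cRe (z 0 0).
Proof. by rewrite /tube_rho !to_real_lshift. Qed.

Lemma tube_rhoP z : T z <-> tube_rho (to_real z) < 0.
Proof. by rewrite tube_rhoE subr_lt0. Qed.

(** A class that contains [tube_rho] and is stable under partial derivatives, so that one
    differentiability and one continuity lemma cover all orders. *)
Let pol (p : {poly R}) (c : R) (x : 'rV[R]_(2 + 2)) : R := p.[x 0 reZ] + c * x 0 reQ.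

Let dpol (p : {poly R}) c (i : 'I_(2 + 2)) : {poly R} :=
  (if i == reZ then p^`() else 0) + (if i == reQ then c else 0)%:P.

Let polD p c i x : is_derive x (basis_vec R i) (pol p c) (pol (dpol p c i) 0 x).
Proof.
apply/is_derive_directional.
have -> : (fun t : R => pol p c (x + t *: basis_vec R i)) =
   (fun t : R => p.[(i == reZ)%:R * t + x 0 reZ] + c * ((i == reQ)%:R * t + x 0 reQ)).
  apply/funext => t; rewrite /pol !mxE eqxx /= ![_ == i]eq_sym.
  by rewrite ![_ + x 0 _]addrC ![t * _]mulrC.
have D (k y : R) : is_derive (0 : R) 1 (fun t : R => k * t + y) (k * 1 + 0).
  exact: (real_derivD (real_derivZ k (is_derive_id _ _)) (real_deriv_cst y _)).
have -> : pol (dpol p c i) 0 x =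
   p^`().[(i == reZ)%:R * 0 + x 0 reZ] * ((i == reZ)%:R * 1 + 0) + c * ((i == reQ)%:R * 1 + 0).
  rewrite /pol /dpol hornerD hornerC mul0r !mulr0 add0r !addr0 !mulr1.
  by do 2 (case: eqP => _); rewrite ?horner0 ?mulr1 ?mulr0.
have dp := @is_derive1_comp R (horner p) (fun t => (i == reZ)%:R * t + x 0 reZ) 0 _ _ (is_derive_poly _ _) (D _ _).
exact: (real_derivD dp (real_derivZ c (D _ _))).
Qed.

Let pol_continuous p c : continuous (pol p c).
Proof.
move=> x.
have A : (fun y : 'rV[R]_(2 + 2) => y 0 reZ) @ x --> x 0 reZ by exact: coord_continuous.
have B : horner p @ (x 0 reZ) --> p.[x 0 reZ] by exact: continuous_horner.
have AB : (fun y : 'rV[R]_(2 + 2) => p.[y 0 reZ]) @ x --> p.[x 0 reZ].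
  exact: (@cvg_comp _ _ _ (fun y : 'rV[R]_(2 + 2) => y 0 reZ) (horner p) _ _ _ A B).
have C : (fun y : 'rV[R]_(2 + 2) => y 0 reQ) @ x --> x 0 reQ by exact: coord_continuous.
have D : (fun y : 'rV[R]_(2 + 2) => c * y 0 reQ) @ x --> c * x 0 reQ by exact: (cvgM (cvg_cst c) C).
exact: cvgD AB D.
Qed.

Let pol_iter p c s : exists q k, iter_partial s (pol p c) = pol q k.
Proof.
elim: s => [|i s [q [k IH]]] /=; first by exists p, c.
exists (dpol q k i), 0; rewrite IH; apply/funext => x.
by have [_ ->] := polD q k i x.
Qed.

Let rho_pol : tube_rho = pol ('X^(2 * m)) (-1).
Proof. by apply/funext => x; rewrite /tube_rho /pol hornerXn mulN1r. Qed.

Lemma tube_rho_smooth x : smooth_near tube_rho x.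
Proof.
apply: filterE => y s; rewrite rho_pol; have [q [k ->]] := pol_iter 'X^(2 * m) (-1) s.
by split=> [|i]; [exact: pol_continuous|have [] := polD q k i y].
Qed.

Lemma tube_rho_deriv x : 'D_(basis_vec R reQ) tube_rho x = -1.
Proof.
rewrite rho_pol; have [_ ->] := polD 'X^(2 * m) (-1) reQ x.
by rewrite /pol /dpol eqxx /= mul0r addr0 add0r hornerC.
Qed.

Lemma tube_smooth_boundary : smooth_boundary T.
Proof.
move=> xi _; exists tube_rho; split; first exact: tube_rho_smooth.
  by exists reQ; rewrite tube_rho_deriv oppr_eq0 oner_eq0.
by apply: filterE => z; exact: tube_rhoP.
Qed.

(** Taylor coefficients at [x] of the two terms of [tube_rho]. Each term is a product of
    one-variable expansions, a variable that does not occur giving the constant series 1, that is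
    [(k == 0)%:R]; sums over boxes of exponents then factor by distributivity. *)
Let gz (x : 'rV[R]_(2 + 2)) (i : 'I_(2 + 2)) (k : nat) : R :=
  if i == reZ then 'C(2 * m, k)%:R * x 0 reZ ^+ (2 * m - k) else (k == 0)%:R.
Let gq (x : 'rV[R]_(2 + 2)) (i : 'I_(2 + 2)) (k : nat) : R :=
  if i == reQ then (if k == 0 then x 0 reQ else (k == 1)%:R) else (k == 0)%:R.

Let coef (x : 'rV[R]_(2 + 2)) (alpha : {ffun 'I_(2 + 2) -> nat}) : R :=
  \prod_i gz x i (alpha i) - \prod_i gq x i (alpha i).

Let coef_support x (alpha : {ffun 'I_(2 + 2) -> nat}) i : (2 * m < alpha i)%N -> coef x alpha = 0.
Proof.
move=> h; have a0 : alpha i == 0 = false by case: (alpha i) h.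
have a1 : alpha i == 1 = false.
  by apply/eqP => e; move: h; rewrite e ltnNge /m mulnS addSn.
rewrite /coef (bigD1 i) //= [X in _ - X](bigD1 i) //=.
have -> : gz x i (alpha i) = 0.
  by rewrite /gz a0 bin_small // mul0r; case: ifP.
have -> : gq x i (alpha i) = 0 by rewrite /gq a0 a1; case: ifP.
by rewrite !mul0r subrr.
Qed.

Let sum_delta (F : nat -> R) n : (0 < n)%N -> \sum_(k < n) (val k == 0)%:R * F k = F 0.
Proof.
case: n => // n _; rewrite big_ord_recl /= mul1r big1 ?addr0 // => i _.
by rewrite mul0r.
Qed.

(** A box with [n > 2 * m] contains all exponents that occur, so the partial sums of the Taylor
    series are eventually constant. *)
Let box_sum x (u : 'rV[R]_(2 + 2)) n : (2 * m < n)%N ->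
  \sum_(beta : {ffun 'I_(2 + 2) -> 'I_n})
    coef x [ffun i => nat_of_ord (beta i)] * monomial [ffun i => nat_of_ord (beta i)] u
  = tube_rho (x + u).
Proof.
move=> mn; have n1 : (1 < n)%N by apply: leq_trans mn; rewrite /m mulnS.
have P (g : 'I_(2 + 2) -> nat -> R) :
    \sum_(beta : {ffun 'I_(2 + 2) -> 'I_n}) (\prod_i g i (beta i)) * monomial [ffun i => nat_of_ord (beta i)] u
    = \prod_i \sum_(k < n) g i k * u 0 i ^+ k.
  rewrite bigA_distr_bigA; apply: eq_bigr => beta _; rewrite /monomial -big_split.
  by apply: eq_bigr => i _; rewrite ffunE.
have -> : \sum_(beta : {ffun 'I_(2 + 2) -> 'I_n})
    coef x [ffun i => nat_of_ord (beta i)] * monomial [ffun i => nat_of_ord (beta i)] u =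
    \prod_i (\sum_(k < n) gz x i k * u 0 i ^+ k) - \prod_i (\sum_(k < n) gq x i k * u 0 i ^+ k).
  rewrite -!P -sumrB; apply: eq_bigr => beta _; rewrite /coef mulrBl; congr (_ * _ - _ * _);
    by apply: eq_bigr => i _; rewrite ffunE.
have S i (H : i != reZ) : \sum_(k < n) gz x i k * u 0 i ^+ k = 1.
  under eq_bigr => k _ do rewrite /gz (negbTE H).
  by rewrite (sum_delta (fun k => u 0 i ^+ k)) // ltnW.
have S' i (H : i != reQ) : \sum_(k < n) gq x i k * u 0 i ^+ k = 1.
  under eq_bigr => k _ do rewrite /gq (negbTE H).
  by rewrite (sum_delta (fun k => u 0 i ^+ k)) // ltnW.
rewrite (bigD1 reZ) //= [X in _ * X]big1 ?mulr1 => [|i H]; last exact: S.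
rewrite [X in _ - X](bigD1 reQ) //= [X in _ - _ * X]big1 ?mulr1 => [|i H]; last exact: S'.
rewrite /tube_rho !mxE; congr (_ - _).
  rewrite exprDn (big_ord_widen n (fun k => x 0 reZ ^+ (2 * m - k) * u 0 reZ ^+ k *+ 'C(2 * m, k))) //.
  rewrite [RHS]big_mkcond; apply: eq_bigr => k _; rewrite /gz eqxx.
  case: ifPn => [_|]; first by rewrite -[RHS]mulr_natl mulrA.
  by rewrite -leqNgt => h; rewrite bin_small // !mul0r.
have [n' nE] : exists n', n = n'.+2 by case: (n) n1 => [|[|k]] // _; exists k.
rewrite nE !big_ord_recl /= big1 => [|i _].
  by rewrite /gq eqxx /= expr0 expr1 mulr1 mul1r addr0.
by rewrite /gq eqxx /= mul0r.
Qed.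

Lemma tube_rho_analytic x : real_analytic_near tube_rho x.
Proof.
exists (coef x); apply: filterE => y; split.
  rewrite /summable.
  pose S : set {ffun 'I_(2 + 2) -> nat} := [set alpha | forall i, (alpha i < (2 * m).+1)%N].
  have finS : finite_set S.
    have -> : S = [set ([ffun i => nat_of_ord (beta i)] : {ffun 'I_(2 + 2) -> nat}) |
        beta in [set: {ffun 'I_(2 + 2) -> 'I_(2 * m).+1}]].
      apply/seteqP; split=> [alpha Ha|_ [beta _ <-] i]; last by rewrite ffunE.
      by exists [ffun i => inord (alpha i)] => //; apply/ffunP => i; rewrite !ffunE inordK.
    exact: finite_image finite_finset.
  rewrite (_ : \esum_(i in _) _ = \esum_(i in S) (`|coef x i * monomial i (y - x)|%:E)%E).
    by rewrite esum_fset // fsumEFin // ltry.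
  rewrite [RHS]esum_mkcond; apply: eq_esum => alpha _.
  case: ifPn => [//|/negP aS]; have [i hi] : exists i, (2 * m < alpha i)%N.
    apply: contrapT => H; apply: aS; apply/mem_set => i; rewrite ltnS leqNgt; apply/negP => h.
    by apply: H; exists i.
  by rewrite (coef_support x hi) mul0r /= normr0.
apply: cvg_near_cst; exists (2 * m).+1 => // n /= mn.
by rewrite box_sum // addrC subrK.
Qed.

Lemma tube_analytic_boundary : real_analytic_boundary T.
Proof.
move=> xi _; exists tube_rho; split; first exact: tube_rho_analytic.
  by exists reQ; rewrite tube_rho_deriv oppr_eq0 oner_eq0.
by apply: filterE => z; exact: tube_rhoP.
Qed.

End TubeBoundary.

(** * D'Angelo type *)

Section PlaneCalculus.
Variable R : realType.
Implicit Types (F G : Cx R -> R) (z w h : Cx R) (a b p q e : R).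

Definition frechet F z a b : Prop := forall e, 0 < e -> exists2 r, 0 < r &
  forall h, cmod h < r -> `|F (z + h) - F z - a * cRe h - b * cIm h| <= e * cmod h.

Lemma frechet_line F z w (t : R) a b : frechet F (z + ofR t * w) a b ->
  is_derive t 1 (fun t : R => F (z + ofR t * w)) (a * cRe w + b * cIm w).
Proof.
move=> H; apply/is_derive_realP => e e0.
have k0 : 0 < cmod w + 1 by have := cmod_ge0 w; lra.
have [r r0 Hr] := H (e / (cmod w + 1)) ltac:(by rewrite divr_gt0).
exists (r / (cmod w + 1)); first by rewrite divr_gt0.
move=> s; rewrite ltr_pdivlMr // => sr.
have sw : cmod (ofR s * w) <= `|s| * (cmod w + 1) by rewrite cmodM cmod_ofR ler_wpM2l // lerDl.
have := Hr _ (le_lt_trans sw sr).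
have -> : z + ofR t * w + ofR s * w = z + ofR (t + s) * w by rewrite ofRD; ring.
rewrite !cE !mul0r subr0 addr0 => A.
have -> : F (z + ofR (t + s) * w) - F (z + ofR t * w) - (a * cRe w + b * cIm w) * s =
   F (z + ofR (t + s) * w) - F (z + ofR t * w) - a * (s * cRe w) - b * (s * cIm w) by ring.
apply: le_trans A _; rewrite -mulrA ler_pM2l // ler_pdivrMl //; lra.
Qed.

Lemma frechet_cont F z a b e : frechet F z a b -> 0 < e ->
  exists2 r, 0 < r & forall h, cmod h < r -> `|F (z + h) - F z| < e.
Proof.
move=> H e0; have [r r0 Hr] := H 1 ltr01.
pose k := `|a| + `|b| + 2.
have k0 : 0 < k by rewrite /k; have := normr_ge0 a; have := normr_ge0 b; lra.
exists (Num.min r (e / k)); first by rewrite lt_min r0 divr_gt0.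
move=> h; rewrite lt_min ltr_pdivlMr // => /andP[/Hr A B].
have E : F (z + h) - F z = (F (z + h) - F z - a * cRe h - b * cIm h) + (a * cRe h + b * cIm h) by ring.
rewrite E; apply: le_lt_trans (ler_normD _ _) _.
have C : `|a * cRe h + b * cIm h| <= (`|a| + `|b|) * cmod h.
  apply: le_trans (ler_normD _ _) _; rewrite !normrM mulrDl.
  by apply: lerD; apply: ler_wpM2l => //; [exact: cRe_le|exact: cIm_le].
have := cmod_ge0 h; rewrite /k in B *; lra.
Qed.

Lemma frechet_lin F G z a b p q (k l : R) : frechet F z a b -> frechet G z p q ->
  frechet (fun z => k * F z + l * G z) z (k * a + l * p) (k * b + l * q).
Proof.
move=> HF HG e e0; pose K := `|k| + `|l| + 1.
have K0 : 0 < K by rewrite /K; have := normr_ge0 k; have := normr_ge0 l; lra.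
have [r r0 Hr] := HF (e / K) ltac:(by rewrite divr_gt0).
have [s s0 Hs] := HG (e / K) ltac:(by rewrite divr_gt0).
exists (Num.min r s); first by rewrite lt_min r0.
move=> h; rewrite lt_min => /andP[/Hr A /Hs B].
set X := F _ - _ - _ - _ in A; set Y := G _ - _ - _ - _ in B.
have -> : k * F (z + h) + l * G (z + h) - (k * F z + l * G z) - (k * a + l * p) * cRe h -
   (k * b + l * q) * cIm h = k * X + l * Y by rewrite /X /Y; ring.
apply: le_trans (ler_normD _ _) _; rewrite !normrM.
have A' := ler_wpM2l (normr_ge0 k) A; have B' := ler_wpM2l (normr_ge0 l) B.
apply: le_trans (lerD A' B') _; rewrite -mulrDl.
have -> : e * cmod h = K * (e / K * cmod h) by field; rewrite gt_eqF.
by apply: ler_wpM2r; [rewrite mulr_ge0 ?cmod_ge0 // ltW // divr_gt0|rewrite /K lerDl].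
Qed.

Lemma frechet_cst (k : R) z : frechet (fun _ => k) z 0 0.
Proof.
by move=> e e0; exists 1 => // h _; rewrite subrr !mul0r !subr0 normr0 mulr_ge0 ?cmod_ge0 // ltW.
Qed.

Lemma frechetM F G z a b p q : frechet F z a b -> frechet G z p q ->
  frechet (fun z => F z * G z) z (a * G z + F z * p) (b * G z + F z * q).
Proof.
move=> HF HG e e0.
pose K := `|F z| + `|G z| + `|a| + `|b| + 3.
have K0 : 0 < K.
  rewrite /K; have := normr_ge0 (F z); have := normr_ge0 (G z).
  by have := normr_ge0 a; have := normr_ge0 b; lra.
pose e1 := Num.min 1 (e / K).
have e10 : 0 < e1 by rewrite lt_min ltr01 divr_gt0.
have [r r0 Hr] := HF e1 e10; have [s s0 Hs] := HG e1 e10.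
have [u u0 Hu] := frechet_cont HG e10.
exists (Num.min (Num.min r s) u); first by rewrite !lt_min r0 s0.
move=> h; rewrite !lt_min => /andP[/andP[/Hr A /Hs B] /Hu C].
set X := F _ - _ - _ - _ in A; set Y := G _ - _ - _ - _ in B; set D := G _ - _ in C.
set L := a * cRe h + b * cIm h.
have -> : F (z + h) * G (z + h) - F z * G z - (a * G z + F z * p) * cRe h -
   (b * G z + F z * q) * cIm h = X * (G z + D) + L * D + F z * Y.
  by rewrite /X /Y /D /L; ring.
have h0 := cmod_ge0 h.
have LL : `|L| <= (`|a| + `|b|) * cmod h.
  apply: le_trans (ler_normD _ _) _; rewrite !normrM mulrDl.
  by apply: lerD; apply: ler_wpM2l => //; [exact: cRe_le|exact: cIm_le].
have e11 : e1 <= 1 by rewrite /e1 ge_min lexx.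
have e1K : e1 * K <= e by rewrite -ler_pdivlMr // /e1 ge_min lexx orbT.
have D1 : `|G z + D| <= `|G z| + 1 by apply: le_trans (ler_normD _ _) _; lra.
have T1 : `|X * (G z + D)| <= e1 * cmod h * (`|G z| + 1) by rewrite normrM; exact: ler_pM.
have T2 : `|L * D| <= (`|a| + `|b|) * cmod h * e1 by rewrite normrM; apply: ler_pM => //; exact: ltW.
have T3 : `|F z * Y| <= `|F z| * (e1 * cmod h) by rewrite normrM ler_wpM2l.
apply: le_trans (ler_normD _ _) _; apply: le_trans (lerD (ler_normD _ _) (lexx _)) _.
apply: (@le_trans _ _ (e1 * K * cmod h)); last by rewrite ler_wpM2r.
have := mulr_ge0 (ltW e10) h0; rewrite /K; lra.
Qed.

Lemma frechet_cderiv (f : Cx R -> Cx R) z d : cderiv f z d ->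
  frechet (fun z => cRe (f z)) z (cRe d) (- cIm d) /\
  frechet (fun z => cIm (f z)) z (cIm d) (cRe d).
Proof.
move=> H; split=> e /H[r r0 Hr]; exists r => // h /Hr; apply: le_trans.
  apply: le_trans (cRe_le _); rewrite !cE; apply: eq_ler; congr (`| _ |); ring.
by apply: le_trans (cIm_le _); rewrite !cE; apply: eq_ler; congr (`| _ |); ring.
Qed.

End PlaneCalculus.

(** * Symmetry of second derivatives *)

Section Clairaut.
Variables (R : realType) (eps : R) (F A B : Cx R -> R).
Hypothesis FAB : forall z, cmod z < eps -> frechet F z (A z) (B z).

(** Young's form of the theorem: the first derivatives are only assumed differentiable at [z]. The
    second difference of [F] over a square of side [t] equals both [q t^2] and [q' t^2] up to
    [3 e t^2], by the mean value inequality in either direction. *)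
Lemma clairaut z p q q' r : cmod z < eps -> frechet A z p q -> frechet B z q' r -> q = q'.
Proof.
move=> zeps HA HB; apply/eqP; rewrite -subr_eq0; apply/negPn/negP => qq.
(* The two errors add up to [6 e t^2], so any divisor above 6 contradicts the assumption. *)
pose e := `|q - q'| / 7.
have e0 : 0 < e by rewrite divr_gt0 // normr_gt0.
have [r1 r10 H1] := HA e e0; have [r2 r20 H2] := HB e e0.
pose s := Num.min (Num.min r1 r2) (eps - cmod z).
have s0 : 0 < s by rewrite !lt_min r10 r20 subr_gt0.
have [sr1 sr2 sz] : [/\ s <= r1, s <= r2 & s <= eps - cmod z].
  by split; rewrite !ge_min lexx ?orbT.
have [t t0 t3] : exists2 t, 0 < t & s = 3 * t.
  by exists (s / 3); [rewrite divr_gt0|field].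
pose i := mkC 0 1 : Cx R.
have i1 : cmod i = 1 by rewrite cmodE !cE expr0n expr1n /= add0r sqrtr1.
have ii : cRe i = 0 /\ cIm i = 1 by [].
have small x y : 0 <= x <= 1 -> 0 <= y <= 1 -> cmod (ofR (x * t) + ofR (y * t) * i) <= 2 * t.
  move=> /andP[x0 x1] /andP[y0 y1]; apply: le_trans (cmodD _ _) _.
  rewrite cmodM i1 mulr1 !cmod_ofR !ger0_norm ?mulr_ge0 ?(ltW t0) //.
  have := ler_wpM2r (ltW t0) x1; have := ler_wpM2r (ltW t0) y1; lra.
have inU x y : 0 <= x <= 1 -> 0 <= y <= 1 -> cmod (z + (ofR (x * t) + ofR (y * t) * i)) < eps.
  by move=> hx hy; apply: le_lt_trans (cmodD _ _) _; have := small x y hx hy; lra.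
have u01 : (0 : R) <= 1 <= (1 : R) by apply/andP; split; lra.
have u00 : (0 : R) <= 0 <= (1 : R) by apply/andP; split; lra.
pose D := F (z + ofR t + ofR t * i) - F (z + ofR t) - F (z + ofR t * i) + F z.
have DA : `|D - q * t * t| <= 3 * e * t * t.
  pose u x := F (z + ofR t * i + ofR x * ofR t) - F (z + ofR x * ofR t).
  have -> : D = u 1 - u 0.
    rewrite /u /D ofR0 ofR1 !mul1r !mul0r !addr0 (addrAC z).
    by ring.
  apply: (is_derive_le_mean (u' := fun x => (A (z + ofR t * i + ofR x * ofR t) * cRe (ofR t) +
    B (z + ofR t * i + ofR x * ofR t) * cIm (ofR t)) - (A (z + ofR x * ofR t) * cRe (ofR t) +
    B (z + ofR x * ofR t) * cIm (ofR t)))).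
    move=> x x01; apply: real_derivB; apply: frechet_line; apply: FAB.
      have := inU x 1 x01 u01; congr (cmod _ < _); rewrite mul1r ofRM; ring.
    by have := inU x 0 x01 u00; congr (cmod _ < _); rewrite mul0r ofR0 ofRM; ring.
  move=> x x01; rewrite cRe_ofR cIm_ofR !mulr0 !addr0.
  have B1 := H1 (ofR (x * t) + ofR (1 * t) * i) ltac:(by have := small x 1 x01 u01; lra).
  have B2 := H1 (ofR (x * t) + ofR (0 * t) * i) ltac:(by have := small x 0 x01 u00; lra).
  have C1 := small x 1 x01 u01.
  have C2 : cmod (ofR (x * t) + ofR (0 * t) * i) <= t.
    rewrite mul0r ofR0 mul0r addr0 cmod_ofR; move: x01 => /andP[x0 x1].
    rewrite ger0_norm ?mulr_ge0 ?(ltW t0) // -[leRHS]mul1r; exact: ler_wpM2r (ltW t0) _ _ x1.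
  have E1 : z + (ofR (x * t) + ofR (1 * t) * i) = z + ofR t * i + ofR x * ofR t.
    by rewrite mul1r ofRM; ring.
  have E2 : z + (ofR (x * t) + ofR (0 * t) * i) = z + ofR x * ofR t.
    by rewrite mul0r ofR0 ofRM; ring.
  rewrite E1 in B1; rewrite E2 in B2.
  have F1 : cRe (ofR (x * t) + ofR (1 * t) * i) = x * t by rewrite !cE; ring.
  have F2 : cIm (ofR (x * t) + ofR (1 * t) * i) = t by rewrite !cE; ring.
  have F3 : cRe (ofR (x * t) + ofR (0 * t) * i) = x * t by rewrite !cE; ring.
  have F4 : cIm (ofR (x * t) + ofR (0 * t) * i) = 0 by rewrite !cE; ring.
  rewrite F1 F2 in B1; rewrite F3 F4 in B2.
  have {}B1 := le_trans B1 (ler_wpM2l (ltW e0) C1); have {}B2 := le_trans B2 (ler_wpM2l (ltW e0) C2).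
  have -> : A (z + ofR t * i + ofR x * ofR t) * t - A (z + ofR x * ofR t) * t - q * t * t =
     t * ((A (z + ofR t * i + ofR x * ofR t) - A z - p * (x * t) - q * t) -
     (A (z + ofR x * ofR t) - A z - p * (x * t) - q * 0)) by ring.
  rewrite normrM gtr0_norm // [leRHS]mulrC ler_pM2l //.
  by apply: le_trans (ler_normB _ _) _; lra.
have DB : `|D - q' * t * t| <= 3 * e * t * t.
  pose u y := F (z + ofR t + ofR y * (ofR t * i)) - F (z + ofR y * (ofR t * i)).
  have -> : D = u 1 - u 0.
    by rewrite /u /D ofR0 ofR1 !mul1r !mul0r !addr0; ring.
  have ti : cRe (ofR t * i) = 0 /\ cIm (ofR t * i) = t by rewrite !cE; split; ring.
  apply: (is_derive_le_mean (u' := fun y => (A (z + ofR t + ofR y * (ofR t * i)) * cRe (ofR t * i) +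
    B (z + ofR t + ofR y * (ofR t * i)) * cIm (ofR t * i)) - (A (z + ofR y * (ofR t * i)) * cRe (ofR t * i) +
    B (z + ofR y * (ofR t * i)) * cIm (ofR t * i)))).
    move=> y y01; apply: real_derivB; apply: frechet_line; apply: FAB.
      have := inU 1 y u01 y01; congr (cmod _ < _); rewrite mul1r ofRM; ring.
    by have := inU 0 y u00 y01; congr (cmod _ < _); rewrite mul0r ofR0 ofRM; ring.
  move=> y y01; rewrite ti.1 ti.2 !mulr0 !add0r.
  have B1 := H2 (ofR (1 * t) + ofR (y * t) * i) ltac:(by have := small 1 y u01 y01; lra).
  have B2 := H2 (ofR (0 * t) + ofR (y * t) * i) ltac:(by have := small 0 y u00 y01; lra).
  have C1 := small 1 y u01 y01.
  have C2 : cmod (ofR (0 * t) + ofR (y * t) * i) <= t.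
    rewrite mul0r ofR0 add0r cmodM i1 mulr1 cmod_ofR; move: y01 => /andP[y0 y1].
    rewrite ger0_norm ?mulr_ge0 ?(ltW t0) // -[leRHS]mul1r; exact: ler_wpM2r (ltW t0) _ _ y1.
  have E1 : z + (ofR (1 * t) + ofR (y * t) * i) = z + ofR t + ofR y * (ofR t * i).
    by rewrite mul1r ofRM; ring.
  have E2 : z + (ofR (0 * t) + ofR (y * t) * i) = z + ofR y * (ofR t * i).
    by rewrite mul0r ofR0 ofRM; ring.
  rewrite E1 in B1; rewrite E2 in B2.
  have F1 : cRe (ofR (1 * t) + ofR (y * t) * i) = t by rewrite !cE; ring.
  have F2 : cIm (ofR (1 * t) + ofR (y * t) * i) = y * t by rewrite !cE; ring.
  have F3 : cRe (ofR (0 * t) + ofR (y * t) * i) = 0 by rewrite !cE; ring.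
  have F4 : cIm (ofR (0 * t) + ofR (y * t) * i) = y * t by rewrite !cE; ring.
  rewrite F1 F2 in B1; rewrite F3 F4 in B2.
  have {}B1 := le_trans B1 (ler_wpM2l (ltW e0) C1); have {}B2 := le_trans B2 (ler_wpM2l (ltW e0) C2).
  have -> : B (z + ofR t + ofR y * (ofR t * i)) * t - B (z + ofR y * (ofR t * i)) * t - q' * t * t =
     t * ((B (z + ofR t + ofR y * (ofR t * i)) - B z - q' * t - r * (y * t)) -
     (B (z + ofR y * (ofR t * i)) - B z - q' * 0 - r * (y * t))) by ring.
  rewrite normrM gtr0_norm // [leRHS]mulrC ler_pM2l //.
  by apply: le_trans (ler_normB _ _) _; lra.
have : `|q - q'| * (t * t) <= 6 * e * (t * t).
  have tt : 0 < t * t by rewrite mulr_gt0.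
  rewrite -{1}(gtr0_norm tt) -normrM.
  have -> : (q - q') * (t * t) = (D - q' * t * t) - (D - q * t * t) by ring.
  by apply: le_trans (ler_normB _ _) _; lra.
rewrite ler_pM2r ?mulr_gt0 // /e; have : 0 < `|q - q'| by rewrite normr_gt0.
by lra.
Qed.

End Clairaut.

(** * Wirtinger derivatives and jets *)

Section WirtingerCalculus.
Variables (R : realType) (eps : R) (S : set (Cx R -> R)).
Hypothesis eps0 : 0 < eps.
(** Smoothness is membership in a class [S] stable under partial derivatives and, by [SL], under
    real linear combinations. No order of differentiability has to be tracked when operators are
    iterated. *)
Hypothesis SD : forall F, S F -> exists A B,
  [/\ S A, S B & forall z, cmod z < eps -> frechet F z (A z) (B z)].
Hypothesis SL : forall F G (k l : R), S F -> S G -> S (fun z => k * F z + l * G z).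
Implicit Types (g : Cx R -> Cx R) (F G : Cx R -> R) (z w : Cx R).

Definition represents g G1 G2 : Prop := [/\ S G1, S G2 &
  forall z, cmod z < eps -> g z = mkC (G1 z) (G2 z)].

Definition smooth_cfun g : Prop := exists G1 G2, represents g G1 G2.

Let line_in (z w : Cx R) : cmod z < eps -> exists2 r, 0 < r &
  forall t : R, `|t| < r -> cmod (z + ofR t * w) < eps.
Proof.
move=> zU; have k0 : 0 < cmod w + 1 by have := cmod_ge0 w; lra.
exists ((eps - cmod z) / (cmod w + 1)); first by rewrite divr_gt0 // subr_gt0.
move=> t; rewrite ltr_pdivlMr // => h; apply: le_lt_trans (cmodD _ _) _.
rewrite cmodM cmod_ofR; have := mulr_ge0 (normr_ge0 t) (cmod_ge0 w).
by have := normr_ge0 t; lra.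
Qed.

Lemma real_derivativeE g G1 G2 z w a1 b1 a2 b2 :
  (forall z, cmod z < eps -> g z = mkC (G1 z) (G2 z)) -> cmod z < eps ->
  frechet G1 z a1 b1 -> frechet G2 z a2 b2 ->
  real_derivative w g z = mkC (a1 * cRe w + b1 * cIm w) (a2 * cRe w + b2 * cIm w).
Proof.
move=> gE zU H1 H2; have [r r0 Hr] := line_in w zU.
rewrite -[z]addr0 -(mul0r w) -ofR0 in H1 H2.
have D1 : is_derive (0 : R) 1 (fun t : R => cRe (g (z + ofR t * w))) (a1 * cRe w + b1 * cIm w).
  apply: (real_deriv_near r0 _ (frechet_line H1)) => s sr; rewrite add0r gE //.
  exact: Hr.
have D2 : is_derive (0 : R) 1 (fun t : R => cIm (g (z + ofR t * w))) (a2 * cRe w + b2 * cIm w).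
  apply: (real_deriv_near r0 _ (frechet_line H2)) => s sr; rewrite add0r gE //.
  exact: Hr.
rewrite /real_derivative !derive1E.
by have [_ <-] := D1; have [_ <-] := D2.
Qed.

Let represents_partials g G1 G2 : represents g G1 G2 -> exists A1 B1 A2 B2,
  [/\ S A1, S B1, S A2 & S B2] /\ forall z, cmod z < eps ->
  [/\ frechet G1 z (A1 z) (B1 z), frechet G2 z (A2 z) (B2 z)
    & forall w, real_derivative w g z =
        mkC (A1 z * cRe w + B1 z * cIm w) (A2 z * cRe w + B2 z * cIm w)].
Proof.
move=> [S1 S2 gE]; have [A1 [B1 [SA1 SB1 H1]]] := SD S1; have [A2 [B2 [SA2 SB2 H2]]] := SD S2.
exists A1, B1, A2, B2; split => // z zU; split; [exact: H1|exact: H2|move=> w].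
exact: real_derivativeE gE zU (H1 z zU) (H2 z zU).
Qed.

Definition eq_on g1 g2 := forall z, cmod z < eps -> g1 z = g2 z.

Lemma smooth_real_derivative g w : smooth_cfun g -> smooth_cfun (real_derivative w g).
Proof.
move=> [G1 [G2 /represents_partials[A1 [B1 [A2 [B2 [[SA1 SB1 SA2 SB2] H]]]]]]].
exists (fun z => cRe w * A1 z + cIm w * B1 z), (fun z => cRe w * A2 z + cIm w * B2 z).
split; [exact: SL|exact: SL|move=> z /H[_ _ ->]].
by congr mkC; ring.
Qed.

Lemma eq_real_derivative g1 g2 w : eq_on g1 g2 -> smooth_cfun g1 ->
  eq_on (real_derivative w g1) (real_derivative w g2).
Proof.
move=> E [G1 [G2 H]] z zU.
have [S1 S2 gE] := H; have [A1 [B1 [A2 [B2 [_ P]]]]] := represents_partials H.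
have [F1 F2 ->] := P z zU.
by rewrite (real_derivativeE _ _ zU F1 F2) // => y yU; rewrite -E // gE.
Qed.

Let DX := @real_derivative R 1.
Let DY := @real_derivative R (@imag_unit R).

Lemma smooth_comb g1 g2 (c d : Cx R) : smooth_cfun g1 -> smooth_cfun g2 ->
  smooth_cfun (fun z => c * g1 z + d * g2 z).
Proof.
move=> [G1 [G2 [S1 S2 H]]] [K1 [K2 [T1 T2 H']]].
exists (fun z => 1 * (cRe c * G1 z + (- cIm c) * G2 z) + 1 * (cRe d * K1 z + (- cIm d) * K2 z)).
exists (fun z => 1 * (cRe c * G2 z + cIm c * G1 z) + 1 * (cRe d * K2 z + cIm d * K1 z)).
split; [by do !apply: SL|by do !apply: SL|move=> z zU].
by rewrite H // H' //; apply: eqC; rewrite !cE; ring.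
Qed.

Lemma real_derivative_comb g1 g2 (c d : Cx R) w : smooth_cfun g1 -> smooth_cfun g2 ->
  eq_on (real_derivative w (fun z => c * g1 z + d * g2 z))
    (fun z => c * real_derivative w g1 z + d * real_derivative w g2 z).
Proof.
move=> [G1 [G2 H]] [K1 [K2 H']] z zU.
have [S1 S2 gE] := H; have [T1 T2 kE] := H'.
have [A1 [B1 [A2 [B2 [_ P]]]]] := represents_partials H.
have [A1' [B1' [A2' [B2' [_ P']]]]] := represents_partials H'.
have [F1 F2 ->] := P z zU; have [F1' F2' ->] := P' z zU.
have X1 := frechet_lin 1 1 (frechet_lin (cRe c) (- cIm c) F1 F2) (frechet_lin (cRe d) (- cIm d) F1' F2').
have X2 := frechet_lin 1 1 (frechet_lin (cRe c) (cIm c) F2 F1) (frechet_lin (cRe d) (cIm d) F2' F1').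
rewrite (real_derivativeE _ _ zU X1 X2); first by apply: eqC; rewrite !cE; ring.
by move=> y yU; rewrite gE // kE //; apply: eqC; rewrite !cE; ring.
Qed.

(** Both iterated derivatives expand bilinearly in the two directions, and [clairaut] matches the
    mixed coefficients of each component. *)
Lemma real_derivativeC g w w' : smooth_cfun g ->
  eq_on (real_derivative w (real_derivative w' g)) (real_derivative w' (real_derivative w g)).
Proof.
move=> [G1 [G2 H]] z zU.
have [A1 [B1 [A2 [B2 [[SA1 SB1 SA2 SB2] P]]]]] := represents_partials H.
have [A11 [A12 [_ _ HA1]]] := SD SA1; have [B11 [B12 [_ _ HB1]]] := SD SB1.
have [A21 [A22 [_ _ HA2]]] := SD SA2; have [B21 [B22 [_ _ HB2]]] := SD SB2.
have C1 : A12 z = B11 z.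
  have P1 y : cmod y < eps -> frechet G1 y (A1 y) (B1 y) by move=> /P[].
  exact: (@clairaut R eps G1 A1 B1 P1 z _ _ _ _ zU (HA1 z zU) (HB1 z zU)).
have C2 : A22 z = B21 z.
  have P2 y : cmod y < eps -> frechet G2 y (A2 y) (B2 y) by move=> /P[].
  exact: (@clairaut R eps G2 A2 B2 P2 z _ _ _ _ zU (HA2 z zU) (HB2 z zU)).
have D v : real_derivative v (real_derivative w g) z =
  mkC ((cRe w * A11 z + cIm w * B11 z) * cRe v + (cRe w * A12 z + cIm w * B12 z) * cIm v)
      ((cRe w * A21 z + cIm w * B21 z) * cRe v + (cRe w * A22 z + cIm w * B22 z) * cIm v).
  apply: real_derivativeE zU (frechet_lin (cRe w) (cIm w) (HA1 z zU) (HB1 z zU))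
    (frechet_lin (cRe w) (cIm w) (HA2 z zU) (HB2 z zU)).
  by move=> y /P[_ _ ->]; congr mkC; ring.
have D' v : real_derivative v (real_derivative w' g) z =
  mkC ((cRe w' * A11 z + cIm w' * B11 z) * cRe v + (cRe w' * A12 z + cIm w' * B12 z) * cIm v)
      ((cRe w' * A21 z + cIm w' * B21 z) * cRe v + (cRe w' * A22 z + cIm w' * B22 z) * cIm v).
  apply: real_derivativeE zU (frechet_lin (cRe w') (cIm w') (HA1 z zU) (HB1 z zU))
    (frechet_lin (cRe w') (cIm w') (HA2 z zU) (HB2 z zU)).
  by move=> y /P[_ _ ->]; congr mkC; ring.
by rewrite D D' C1 C2; congr mkC; ring.
Qed.

Let W := @wirtinger R.
Let Wb := @wirtinger_bar R.
Let ci := @imag_unit R.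

Let WE g : W g = (fun z => 2^-1 * DX g z + (- (ci / 2)) * DY g z).
Proof. by apply/funext => z; rewrite /W /wirtinger -/DX -/DY -/ci; field. Qed.

Let WbE g : Wb g = (fun z => 2^-1 * DX g z + (ci / 2) * DY g z).
Proof. by apply/funext => z; rewrite /Wb /wirtinger_bar -/DX -/DY -/ci; field. Qed.

Let smoothW g : smooth_cfun g -> smooth_cfun (W g).
Proof. by move=> H; rewrite WE; apply: smooth_comb; exact: smooth_real_derivative. Qed.

Let smoothWb g : smooth_cfun g -> smooth_cfun (Wb g).
Proof. by move=> H; rewrite WbE; apply: smooth_comb; exact: smooth_real_derivative. Qed.

Let eqW g1 g2 : eq_on g1 g2 -> smooth_cfun g1 -> eq_on (W g1) (W g2).
Proof. by move=> E H z zU; rewrite !WE /DX /DY !(eq_real_derivative _ E H zU). Qed.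

Let eqWb g1 g2 : eq_on g1 g2 -> smooth_cfun g1 -> eq_on (Wb g1) (Wb g2).
Proof. by move=> E H z zU; rewrite !WbE /DX /DY !(eq_real_derivative _ E H zU). Qed.

Let rdW g w : smooth_cfun g -> eq_on (real_derivative w (W g)) (W (real_derivative w g)).
Proof.
move=> H z zU; rewrite !WE.
rewrite (real_derivative_comb _ _ w (smooth_real_derivative 1 H) (smooth_real_derivative ci H) zU).
by rewrite (real_derivativeC w 1 H zU) (real_derivativeC w ci H zU).
Qed.

Let rdWb g w : smooth_cfun g -> eq_on (real_derivative w (Wb g)) (Wb (real_derivative w g)).
Proof.
move=> H z zU; rewrite !WbE.
rewrite (real_derivative_comb _ _ w (smooth_real_derivative 1 H) (smooth_real_derivative ci H) zU).
by rewrite (real_derivativeC w 1 H zU) (real_derivativeC w ci H zU).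
Qed.

Let WWb g : smooth_cfun g -> eq_on (Wb (W g)) (W (Wb g)).
Proof.
move=> H z zU; rewrite (WbE (W g)) (WE (Wb g)) /DX /DY (rdW 1 H zU) (rdW ci H zU) (rdWb 1 H zU) (rdWb ci H zU).
rewrite !WE !WbE /DX /DY (real_derivativeC ci 1 H zU) -/ci.
move: (real_derivative 1 (real_derivative 1 g) z) (real_derivative 1 (real_derivative ci g) z)
  (real_derivative ci (real_derivative ci g) z) (2^-1) (ci / 2) => a b c d e.
by ring.
Qed.

Let smooth_iter (op : (Cx R -> Cx R) -> (Cx R -> Cx R)) n g :
  (forall g, smooth_cfun g -> smooth_cfun (op g)) -> smooth_cfun g -> smooth_cfun (iter n op g).
Proof. by move=> H; elim: n => //= n IH /IH/H. Qed.

Let eq_iter (op : (Cx R -> Cx R) -> (Cx R -> Cx R)) n g1 g2 :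
  (forall g, smooth_cfun g -> smooth_cfun (op g)) ->
  (forall g1 g2, eq_on g1 g2 -> smooth_cfun g1 -> eq_on (op g1) (op g2)) ->
  eq_on g1 g2 -> smooth_cfun g1 -> eq_on (iter n op g1) (iter n op g2).
Proof.
move=> H E g12 s1; elim: n => //= n IH; apply: E => //; exact: smooth_iter.
Qed.

Let iter_comm (op op' : (Cx R -> Cx R) -> (Cx R -> Cx R)) n g :
  (forall g, smooth_cfun g -> smooth_cfun (op g)) ->
  (forall g, smooth_cfun g -> smooth_cfun (op' g)) ->
  (forall g1 g2, eq_on g1 g2 -> smooth_cfun g1 -> eq_on (op g1) (op g2)) ->
  (forall g, smooth_cfun g -> eq_on (op (op' g)) (op' (op g))) ->
  smooth_cfun g -> eq_on (iter n op (op' g)) (op' (iter n op g)).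
Proof.
move=> H H' E C sg; elim: n => //= n IH z zU.
rewrite (E _ _ IH (smooth_iter n H (H' _ sg)) z zU).
by apply: C => //; exact: smooth_iter.
Qed.

Definition jet_vanishes n g : Prop := forall a b, (a + b < n)%N ->
  iter a W (iter b Wb g) 0 = 0.

Let zero_in : cmod (0 : Cx R) < eps. Proof. by rewrite cmod0. Qed.

(** In the jet the operators [Wb] act before the operators [W], so for [W g] the two kinds have to
    be interchanged. *)
Lemma jet_vanishesW n g : smooth_cfun g -> jet_vanishes n.+1 g ->
  jet_vanishes n (W g) /\ jet_vanishes n (Wb g).
Proof.
move=> sg H; split=> a b ab; last first.
  by rewrite -iterSr; apply: H; rewrite addnS ltnS.
have E : eq_on (iter b Wb (W g)) (W (iter b Wb g)).
  by exact: (iter_comm b smoothWb smoothW eqWb WWb sg).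
rewrite (eq_iter a smoothW eqW E _ zero_in); last by apply: smooth_iter => //; exact: smoothW.
by rewrite -iterSr; apply: H; rewrite addSn ltnS.
Qed.

Let smooth_bounded g : smooth_cfun g -> exists2 r, 0 < r &
  exists M, forall z, cmod z < r -> cmod (g z) <= M.
Proof.
move=> [G1 [G2 [S1 S2 gE]]].
have [A1 [B1 [_ _ H1]]] := SD S1; have [A2 [B2 [_ _ H2]]] := SD S2.
have [r1 r10 C1] := frechet_cont (H1 0 zero_in) ltr01.
have [r2 r20 C2] := frechet_cont (H2 0 zero_in) ltr01.
exists (Num.min eps (Num.min r1 r2)); first by rewrite !lt_min eps0 r10.
exists (`|G1 0| + `|G2 0| + 2) => z; rewrite !lt_min => /andP[zU /andP[/C1 z1 /C2 z2]].
rewrite add0r in z1 z2; rewrite gE //; apply: le_trans (cmod_le _) _; rewrite cRe_mkC cIm_mkC.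
have := ler_normD (G1 z - G1 0) (G1 0); have := ler_normD (G2 z - G2 0) (G2 0).
by rewrite !subrK; lra.
Qed.

(* The differential of [g] is [w |-> w (W g) + conj w (Wb g)]. *)
Let real_derivative_le g z w : cmod (real_derivative w g z) <=
   cmod w * (cmod (W g z) + cmod (Wb g z)) \/ ~ smooth_cfun g \/ ~ cmod z < eps.
Proof.
have [sg|] := pselect (smooth_cfun g); last by right; left.
have [zU|] := pselect (cmod z < eps : Prop); last by right; right.
left; case: sg => G1 [G2 H].
have [A1 [B1 [A2 [B2 [_ P]]]]] := represents_partials H.
have [_ _ D] := P z zU; rewrite D WE WbE /DX /DY !D.
set a := A1 z; set b := B1 z; set c := A2 z; set d := B2 z.
rewrite /ci /imag_unit !cRe_mkC !cIm_mkC.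
set X := _ + - _ * _; set Y := _ + _ / _ * _.
have -> : mkC (a * cRe w + b * cIm w) (c * cRe w + d * cIm w) =
    w * X + mkC (cRe w) (- cIm w) * Y.
  have -> : X = mkC ((a + d) / 2) ((c - b) / 2).
    rewrite /X; have -> : (2 : Cx R)^-1 = ofR 2^-1 by rewrite ofRV ofR_nat.
    by apply: eqC; rewrite !cE; field.
  have -> : Y = mkC ((a - d) / 2) ((c + b) / 2).
    rewrite /Y; have -> : (2 : Cx R)^-1 = ofR 2^-1 by rewrite ofRV ofR_nat.
    by apply: eqC; rewrite !cE; field.
  by apply: eqC; rewrite !cE; field.
apply: le_trans (cmodD _ _) _; rewrite !cmodM mulrDr.
have -> : cmod (mkC (cRe w) (- cIm w)) = cmod w by rewrite !cmodE !cE sqrrN.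
by [].
Qed.

(** Induction on [n]: along the radius to [z] the derivative of [g] is at most
    [|z| (|W g| + |Wb g|)], where both summands are of order [|z|^n] by induction; the mean value
    inequality integrates this, once for each component. *)
Lemma jet_bound n g : smooth_cfun g -> jet_vanishes n g ->
  exists2 r, 0 < r & exists M, forall z, cmod z < r -> cmod (g z) <= M * cmod z ^+ n.
Proof.
elim: n g => [|n IH] g sg Hg.
  have [r r0 [M HM]] := smooth_bounded sg; exists r => //; exists M => z /HM.
  by rewrite expr0 mulr1.
have [HW HWb] := jet_vanishesW sg Hg.
have [r1 r10 [M1 H1]] := IH _ (smoothW sg) HW.
have [r2 r20 [M2 H2]] := IH _ (smoothWb sg) HWb.
have g0 : g 0 = 0 by have := Hg 0 0 isT.
case: (sg) => G1 [G2 H].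
have [S1 S2 gE] := H; have [A1 [B1 [A2 [B2 [_ P]]]]] := represents_partials H.
exists (Num.min eps (Num.min r1 r2)); first by rewrite !lt_min eps0 r10.
exists (2 * (`|M1| + `|M2|)) => z; rewrite !lt_min => /andP[zU /andP[z1 z2]].
set M := (`|M1| + `|M2|) * cmod z ^+ n.+1.
have tz t : 0 <= t <= (1 : R) -> cmod (ofR t * z) <= cmod z.
  by move=> /andP[t0 t1]; rewrite cmodM cmod_ofR ger0_norm // ler_piMl ?cmod_ge0.
have bound t : 0 <= t <= (1 : R) -> cmod (real_derivative z g (ofR t * z)) <= M.
  move=> /tz tzz.
  have tU : cmod (ofR t * z) < eps by exact: le_lt_trans tzz zU.
  have [D|[//|//]] := real_derivative_le g (ofR t * z) z; apply: le_trans D _.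
  rewrite /M exprS mulrCA; apply: ler_wpM2l; first exact: cmod_ge0.
  have st M0 : M0 * cmod (ofR t * z) ^+ n <= `|M0| * cmod z ^+ n.
    apply: (@le_trans _ _ (`|M0| * cmod (ofR t * z) ^+ n)).
      by apply: ler_wpM2r; [exact: exprn_ge0 (cmod_ge0 _)|exact: ler_norm].
    by apply: ler_wpM2l => //; rewrite lerXn2r ?nnegrE ?cmod_ge0.
  rewrite mulrDl; apply: lerD.
    exact: le_trans (H1 _ (le_lt_trans tzz z1)) (st M1).
  exact: le_trans (H2 _ (le_lt_trans tzz z2)) (st M2).
have h0 : ofR 0 * z = 0 by rewrite ofR0 mul0r.
have h1 : ofR 1 * z = z by rewrite ofR1 mul1r.
have tU t : 0 <= t <= (1 : R) -> cmod (ofR t * z) < eps by move=> /tz h; exact: le_lt_trans h zU.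
have B1' : `|G1 z - G1 0| <= M.
  have := @is_derive_le_mean R (fun t => G1 (0 + ofR t * z))
    (fun t => A1 (0 + ofR t * z) * cRe z + B1 (0 + ofR t * z) * cIm z) 0 M.
  rewrite !add0r h0 h1 subr0; apply.
    by move=> t t01; apply: frechet_line; rewrite add0r; have [] := P _ (tU t t01).
  move=> t t01; rewrite subr0 add0r; have [_ _ D] := P _ (tU t t01).
  by apply: le_trans (bound t t01); rewrite D; exact: cRe_le (mkC _ _).
have B2' : `|G2 z - G2 0| <= M.
  have := @is_derive_le_mean R (fun t => G2 (0 + ofR t * z))
    (fun t => A2 (0 + ofR t * z) * cRe z + B2 (0 + ofR t * z) * cIm z) 0 M.
  rewrite !add0r h0 h1 subr0; apply.
    by move=> t t01; apply: frechet_line; rewrite add0r; have [] := P _ (tU t t01).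
  move=> t t01; rewrite subr0 add0r; have [_ _ D] := P _ (tU t t01).
  by apply: le_trans (bound t t01); rewrite D; exact: cIm_le (mkC _ _).
have [G10 G20] : G1 0 = 0 /\ G2 0 = 0 by have := gE 0 zero_in; rewrite g0 => -[].
rewrite gE //; apply: le_trans (cmod_le _) _; rewrite cRe_mkC cIm_mkC.
by rewrite G10 subr0 in B1'; rewrite G20 subr0 in B2'; rewrite -mulrA -/M; lra.
Qed.

(** Suited to functions of the size of a power of Re z: these have vanishing x-derivatives along a
    whole segment of the imaginary axis, which replaces control of the mixed derivatives at 0. *)
Let axis_vanishes r n g : Prop := forall j (y : R), (j < n)%N -> `|y| < r ->
  iter j DX g (mkC 0 y) = 0.

Let axis_in r y : r <= eps -> `|y| < r -> cmod (mkC 0 y) < eps.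
Proof.
move=> re yr; apply: le_lt_trans (cmod_le _) _; rewrite cRe_mkC cIm_mkC normr0 add0r.
exact: lt_le_trans yr re.
Qed.

(** A first-order operator costs one order: its x-part raises the number of x-derivatives by one,
    and its y-part differentiates along the axis a function that vanishes there. *)
Let axis_vanishes_op r n g (op : (Cx R -> Cx R) -> (Cx R -> Cx R)) c : r <= eps ->
  (forall g, smooth_cfun g -> smooth_cfun (op g)) ->
  (forall g1 g2, eq_on g1 g2 -> smooth_cfun g1 -> eq_on (op g1) (op g2)) ->
  (forall g, smooth_cfun g -> eq_on (DX (op g)) (op (DX g))) ->
  (forall g, op g = (fun z => 2^-1 * DX g z + c * DY g z)) ->
  smooth_cfun g -> axis_vanishes r n.+1 g -> axis_vanishes r n (op g).
Proof.
move=> re sop eop DXop opE sg H j y jn yr; have yU := axis_in re yr.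
have sDX g' : smooth_cfun g' -> smooth_cfun (DX g') by exact: smooth_real_derivative.
have eDX g1 g2 : eq_on g1 g2 -> smooth_cfun g1 -> eq_on (DX g1) (DX g2) by exact: eq_real_derivative.
rewrite (iter_comm j sDX sop eDX DXop sg yU).
rewrite opE -[DX (iter j DX g)]/(iter j.+1 DX g) H // mulr0 add0r.
have [G1 [G2 Hr]] := smooth_iter j sDX sg.
have [S1 S2 gE] := Hr; have [A1 [B1 [A2 [B2 [_ P]]]]] := represents_partials Hr.
have [F1 F2 D] := P _ yU; rewrite /DY D.
have Z s : `|s| < r - `|y| -> G1 (mkC 0 y + ofR s * imag_unit R) = 0 /\ G2 (mkC 0 y + ofR s * imag_unit R) = 0.
  move=> sr; have E : mkC 0 y + ofR s * imag_unit R = mkC 0 (y + s).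
    by apply: eqC; rewrite !cE /imag_unit; ring.
  have ysr : `|y + s| < r by apply: le_lt_trans (ler_normD _ _) _; lra.
  have := gE _ (axis_in re ysr); rewrite H //; last exact: ltnW.
  by rewrite E => -[<- <-].
have ry : 0 < r - `|y| by rewrite subr_gt0.
have C a b (G : Cx R -> R) : frechet G (mkC 0 y) a b ->
    (forall s, `|s| < r - `|y| -> G (mkC 0 y + ofR s * imag_unit R) = 0) ->
    a * cRe (imag_unit R) + b * cIm (imag_unit R) = 0.
  move=> FG GZ; have FG' : frechet G (mkC 0 y + ofR 0 * imag_unit R) a b.
    by rewrite ofR0 mul0r addr0.
  have := frechet_line FG' => L.
  have L0 := real_deriv_near (f := fun _ => 0) (g := fun t => G (mkC 0 y + ofR t * imag_unit R)) ry _ L.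
  apply: (real_deriv_unique (L0 _) (real_deriv_cst 0 0)) => s sr.
  by rewrite add0r GZ.
rewrite (C _ _ _ F1 (fun s sr => (Z s sr).1)) (C _ _ _ F2 (fun s sr => (Z s sr).2)).
by rewrite (_ : mkC 0 0 = 0) ?mulr0.
Qed.

Lemma axis_jet_vanishes r n g : 0 < r -> r <= eps -> smooth_cfun g ->
  (forall j (y : R), (j < n)%N -> `|y| < r -> iter j (@real_derivative R 1) g (mkC 0 y) = 0) ->
  jet_vanishes n g.
Proof.
move=> r0 re sg H a b.
have OW n' g' := @axis_vanishes_op r n' g' W (- (ci / 2)) re smoothW eqW (fun g sg => rdW 1 sg) WE.
have OWb n' g' := @axis_vanishes_op r n' g' Wb (ci / 2) re smoothWb eqWb (fun g sg => rdWb 1 sg) WbE.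
have ib b' k g' : smooth_cfun g' -> axis_vanishes r (b' + k) g' -> axis_vanishes r k (iter b' Wb g').
  elim: b' k => // b' IH k sg' Hk; apply: OWb; first exact: smooth_iter.
  by apply: IH => //; rewrite addnS.
have ia a' k g' : smooth_cfun g' -> axis_vanishes r (a' + k) g' -> axis_vanishes r k (iter a' W g').
  elim: a' k => // a' IH k sg' Hk; apply: OW; first exact: smooth_iter.
  by apply: IH => //; rewrite addnS.
move=> ab.
have V : axis_vanishes r 1 (iter a W (iter b Wb g)).
  apply: ia; first exact: smooth_iter.
  apply: ib => // j y jn yr; apply: H => //; apply: leq_trans jn _.
  by rewrite addn1 addnS addnC.
have := V 0 0 isT; rewrite normr0 => /(_ r0) /=.
by rewrite (_ : mkC 0 0 = 0).
Qed.

Lemma smooth_cfun_line g (x y : R) : smooth_cfun g -> cmod (mkC x y) < eps ->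
  is_derive x 1 (fun s : R => cRe (g (mkC s y))) (cRe (real_derivative 1 g (mkC x y))) /\
  is_derive x 1 (fun s : R => cIm (g (mkC s y))) (cIm (real_derivative 1 g (mkC x y))).
Proof.
move=> [G1 [G2 H]] zU; have [S1 S2 gE] := H.
have [A1 [B1 [A2 [B2 [_ P]]]]] := represents_partials H.
have [F1 F2 ->] := P _ zU; have [r r0 Hr] := line_in 1 zU.
have E (s : R) : mkC s y = mkC 0 y + ofR s * 1 by apply: eqC; rewrite !cE; ring.
rewrite [in frechet G1 _](E x) in F1; rewrite [in frechet G2 _](E x) in F2.
have U s : `|s| < r -> cmod (mkC (x + s) y) < eps.
  by move=> /Hr; congr (cmod _ < _); apply: eqC; rewrite !cE; ring.
split; [apply: (real_deriv_near r0 _ (frechet_line F1))|apply: (real_deriv_near r0 _ (frechet_line F2))].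
  by move=> s /U sU; rewrite gE // -E.
by move=> s /U sU; rewrite gE // -E.
Qed.

End WirtingerCalculus.

(** * Differentials in several real variables *)

Section FrechetRows.
Variables (R : realType) (N : nat).
Implicit Types (f : 'rV[R]_N -> R) (x y h : 'rV[R]_N).

Definition box x (d : R) y : Prop := forall j, `|y 0 j - x 0 j| < d.

Definition row_frechet f x (g : 'I_N -> R) : Prop := forall e : R, 0 < e -> exists2 r : R, 0 < r &
  forall h, (forall j, `|h 0 j| < r) ->
    `|f (x + h) - f x - \sum_i g i * h 0 i| <= e * \sum_i `|h 0 i|.

Lemma directional_line f p (v : 'rV[R]_N) (t d : R) : is_derive (p + t *: v) v f d ->
  is_derive t 1 (fun t : R => f (p + t *: v)) d.
Proof.
move=> /directionalP H; apply/is_derive_realP => e /H[r r0 Hr]; exists r => // s /Hr.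
by have -> : p + t *: v + s *: v = p + (t + s) *: v by rewrite -addrA -scalerDl.
Qed.

(** The entries of [h] are switched on one at a time: [hk k] keeps the first [k] of them, and each
    step is a mean value estimate along one coordinate direction inside the box. *)
Lemma C1_row_frechet f x d : 0 < d ->
  (forall y i, box x d y -> derivable f y (basis_vec R i)) ->
  (forall i, {for x, continuous (fun y => 'D_(basis_vec R i) f y)}) ->
  row_frechet f x (fun i => 'D_(basis_vec R i) f x).
Proof.
move=> d0 df cf e e0.
have P i : exists r : R, 0 < r /\ forall y, box x r y ->
    `|'D_(basis_vec R i) f y - 'D_(basis_vec R i) f x| <= e.
  have /cvgrPdist_le/(_ e e0)/nbhs_real_rowP[r r0 Hr] := cf i.
  by exists r; split => // y yx; rewrite distrC; apply: Hr.
have [r Hr] := choice P.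
pose s := Num.min d (\big[Num.min/1]_i r i).
have s0 : 0 < s.
  by rewrite lt_min d0; apply: lt_bigmin => // i _; exact: (Hr i).1.
exists s => // h hs.
pose hk k : 'rV[R]_N := \row_j (if (j < k)%N then h 0 j else 0).
have h0 : hk 0%N = 0 by apply/rowP => j; rewrite !mxE.
have hN : hk N = h by apply/rowP => j; rewrite !mxE ltn_ord.
have step (i : 'I_N) : `|f (x + hk i.+1) - f (x + hk i) - 'D_(basis_vec R i) f x * h 0 i| <= e * `|h 0 i|.
  pose u (t : R) := f (x + hk i + (t * h 0 i) *: basis_vec R i).
  have E1 : u 1 = f (x + hk i.+1).
    rewrite /u mul1r -addrA; congr (f (x + _)); apply/rowP => j; rewrite !mxE eqxx /=.
    rewrite ltnS [(j <= i)%N]leq_eqVlt -val_eqE /=.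
    case: eqP => [E|_]; last by rewrite mulr0 addr0.
    by rewrite E ltnn add0r mulr1; congr (h 0 _); apply: val_inj.
  have E0 : u 0 = f (x + hk i) by rewrite /u mul0r scale0r addr0.
  have inb t : 0 <= t <= (1 : R) -> box x s (x + hk i + (t * h 0 i) *: basis_vec R i).
    move=> /andP[t0 t1] j; rewrite !mxE eqxx /= -val_eqE /=.
    case: eqP => [E|_].
      rewrite E ltnn.
      rewrite addr0 (_ : true%:R = 1 :> R) // mulr1 (_ : x 0 j + t * h 0 i - x 0 j = t * h 0 i); last by ring.
      rewrite normrM ger0_norm //.
      by apply: le_lt_trans (hs i); rewrite ler_piMl.
    set X := (if _ then _ else _).
    rewrite mulr0 addr0 (_ : x 0 j + X - x 0 j = X); last by ring.
    rewrite /X; case: ifP => _; first exact: hs.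
    by rewrite normr0.
  rewrite -E1 -E0.
  apply: (is_derive_le_mean (u' := fun t => 'D_(basis_vec R i) f (x + hk i + (t * h 0 i) *: basis_vec R i) * h 0 i)).
    move=> t t01.
    have D : derivable f (x + hk i + (t * h 0 i) *: basis_vec R i) (basis_vec R i).
      by apply: df => j; apply: lt_le_trans (inb t t01 j) _; rewrite ge_min lexx.
    have L := directional_line (derivableP D).
    have M : is_derive t 1 (fun t : R => t * h 0 i) (h 0 i).
      have := real_derivM (is_derive_id t (1 : R)) (real_deriv_cst (h 0 i) t).
      by rewrite mulr0 add0r mulr1.
    exact: (@is_derive1_comp R (fun t => f (x + hk i + t *: basis_vec R i)) (fun t => t * h 0 i) t _ _ L M).
  move=> t t01; rewrite -mulrBl normrM ler_wpM2r //; apply: (Hr i).2 => j.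
  apply: lt_le_trans (inb t t01 j) _; rewrite ge_min; apply/orP; right.
  exact: bigmin_le_cond.
have -> : f (x + h) - f x = \sum_(i < N) (f (x + hk i.+1) - f (x + hk i)).
  rewrite -(big_mkord xpredT (fun k => f (x + hk k.+1) - f (x + hk k))).
  by rewrite telescope_sumr // hN h0 addr0.
rewrite -sumrB; apply: le_trans (ler_norm_sum _ _ _) _.
by rewrite mulr_sumr; apply: ler_sum => i _.
Qed.

Lemma frechet_chain f (y : Cx R -> 'rV[R]_N) z g (a b : 'I_N -> R) :
  row_frechet f (y z) g -> (forall i, frechet (fun z => y z 0 i) z (a i) (b i)) ->
  frechet (fun z => f (y z)) z (\sum_i g i * a i) (\sum_i g i * b i).
Proof.
move=> Hf Hy e e0.
pose K := 1 + \sum_i (`|a i| + `|b i| + 1).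
have Ki i : `|a i| + `|b i| + 1 <= K.
  rewrite /K (bigD1 i) //=; have : 0 <= \sum_(j < N | j != i) (`|a j| + `|b j| + 1).
    by apply: sumr_ge0 => j _; rewrite !addr_ge0.
  by lra.
pose G := 1 + \sum_i `|g i|.
have G0 : 0 < G by rewrite ltr_wpDr // sumr_ge0.
have K0 : 0 < K.
  by rewrite /K ltr_wpDr // sumr_ge0 // => j _; rewrite !addr_ge0.
pose e1 := e / 2 / (N%:R * K + 1).
have NK0 : 0 < N%:R * K + 1 by rewrite ltr_wpDl // mulr_ge0 // ltW.
have e10 : 0 < e1 by rewrite !divr_gt0.
have [r r0 Hr] := Hf e1 e10.
pose e2 := Num.min 1 (e / 2 / G).
have e20 : 0 < e2 by rewrite lt_min ltr01 !divr_gt0.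
have P i : exists s : R, 0 < s /\ forall h : Cx R, cmod h < s ->
    `|y (z + h) 0 i - y z 0 i - a i * cRe h - b i * cIm h| <= e2 * cmod h.
  by have [s s0 Hs] := Hy i e2 e20; exists s.
have [s Hs] := choice P.
exists (Num.min (r / K) (\big[Num.min/1]_i s i)).
  by rewrite lt_min divr_gt0 //; apply: lt_bigmin => // i _; exact: (Hs i).1.
move=> h; rewrite lt_min ltr_pdivlMr // => /andP[hr hs].
have hsi i : cmod h < s i by apply: lt_le_trans hs _; exact: bigmin_le_cond.
pose D := y (z + h) - y z.
have Di i : D 0 i = y (z + h) 0 i - y z 0 i by rewrite !mxE.
have h0 := cmod_ge0 h.
have e21 : e2 <= 1 by rewrite ge_min lexx.
have Dle i : `|D 0 i| <= K * cmod h.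
  rewrite Di.
  have -> : y (z + h) 0 i - y z 0 i = (y (z + h) 0 i - y z 0 i - a i * cRe h - b i * cIm h) +
     (a i * cRe h + b i * cIm h) by ring.
  apply: le_trans (ler_normD _ _) _.
  have A := (Hs i).2 h (hsi i).
  have C : `|a i * cRe h + b i * cIm h| <= (`|a i| + `|b i|) * cmod h.
    apply: le_trans (ler_normD _ _) _; rewrite !normrM mulrDl.
    by apply: lerD; apply: ler_wpM2l => //; [exact: cRe_le|exact: cIm_le].
  have E2 := ler_wpM2r h0 e21; have E3 := ler_wpM2r h0 (Ki i); lra.
have yD : y z + D = y (z + h) by rewrite /D addrC subrK.
have hr' : K * cmod h < r by rewrite mulrC.
have A := Hr D (fun j => le_lt_trans (Dle j) hr').
rewrite yD in A.
have A' : `|f (y (z + h)) - f (y z) - \sum_i g i * D 0 i| <= e / 2 * cmod h.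
  apply: le_trans A _.
  apply: (@le_trans _ _ (e1 * (N%:R * (K * cmod h)))).
    rewrite ler_pM2l //; apply: le_trans (ler_sum _ (fun i _ => Dle i)) _.
    by rewrite sumr_const card_ord -[leLHS]mulr_natl.
  rewrite (_ : e1 * (N%:R * (K * cmod h)) = e1 * (N%:R * K) * cmod h); last by ring.
  apply: ler_wpM2r => //.
  by rewrite /e1 mulrAC ler_pdivrMr // ler_pM2l ?divr_gt0 // lerDl.
have B : `|\sum_i g i * D 0 i - (\sum_i g i * a i) * cRe h - (\sum_i g i * b i) * cIm h| <= e / 2 * cmod h.
  have -> : \sum_i g i * D 0 i - (\sum_i g i * a i) * cRe h - (\sum_i g i * b i) * cIm h =
     \sum_i g i * (D 0 i - a i * cRe h - b i * cIm h).
    rewrite !mulr_suml -!sumrB; apply: eq_bigr => i _; ring.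
  apply: le_trans (ler_norm_sum _ _ _) _.
  apply: (@le_trans _ _ (\sum_i `|g i| * (e2 * cmod h))).
    by apply: ler_sum => i _; rewrite normrM Di ler_wpM2l // (Hs i).2.
  rewrite -mulr_suml mulrA ler_wpM2r //.
  apply: (@le_trans _ _ (G * e2)); first by rewrite ler_wpM2r ?(ltW e20) // /G lerDr.
  rewrite -ler_pdivlMl // mulrC /e2 ge_min lexx orbT //.
have -> : f (y (z + h)) - f (y z) - (\sum_i g i * a i) * cRe h - (\sum_i g i * b i) * cIm h =
  (f (y (z + h)) - f (y z) - \sum_i g i * D 0 i) +
  (\sum_i g i * D 0 i - (\sum_i g i * a i) * cRe h - (\sum_i g i * b i) * cIm h) by ring.
by apply: le_trans (ler_normD _ _) _; lra.
Qed.

End FrechetRows.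

(** * Smoothness of a defining function along a holomorphic curve *)

Section CompositionAlgebra.
Variables (R : realType) (n : nat) (rho : 'rV[R]_(n + n) -> R) (phi : Cx R -> 'rV[Cx R]_n).
Variables (der : nat -> 'I_n -> Cx R -> Cx R) (eps d : R) (x0 : 'rV[R]_(n + n)).
Hypothesis d0 : 0 < d.
Hypothesis rho_smooth : forall y, box x0 d y -> forall s,
  {for y, continuous (iter_partial s rho)} /\
  forall i, derivable (iter_partial s rho) y (basis_vec R i).
Hypothesis phi_box : forall z, cmod z < eps -> box x0 d (to_real (phi z)).
Hypothesis der0 : forall j z, der 0 j z = phi z 0 j.
Hypothesis derS : forall k j z, cmod z < eps -> cderiv (der k j) z (der k.+1 j z).

(** By the chain rule, the derivatives of [rho] along [phi] are polynomials in the partial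
    derivatives of [rho] along [phi] and in the derivatives of [phi]. The algebra generated by these
    is the class [S] for the Wirtinger calculus. *)
Inductive composition_algebra : (Cx R -> R) -> Prop :=
| comp_partial s : composition_algebra (fun z => iter_partial s rho (to_real (phi z)))
| comp_re k j : composition_algebra (fun z => cRe (der k j z))
| comp_im k j : composition_algebra (fun z => cIm (der k j z))
| comp_cst (c : R) : composition_algebra (fun _ => c)
| comp_lin F G (k l : R) : composition_algebra F -> composition_algebra G ->
    composition_algebra (fun z => k * F z + l * G z)
| comp_mul F G : composition_algebra F -> composition_algebra G ->
    composition_algebra (fun z => F z * G z).

Let comp_sum k (F : 'I_k -> Cx R -> R) : (forall i, composition_algebra (F i)) ->
  composition_algebra (fun z => \sum_i F i z).
Proof.
elim: k F => [|k IH] F H.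
  have -> : (fun z => \sum_(i < 0) F i z) = (fun _ => 0) by apply/funext => z; rewrite big_ord0.
  exact: comp_cst.
have -> : (fun z => \sum_i F i z) = (fun z => 1 * (\sum_(i < k) F (widen_ord (leqnSn k) i) z) + 1 * F ord_max z).
  by apply/funext => z; rewrite big_ord_recr /= !mul1r.
by apply: comp_lin => //; apply: IH.
Qed.

Lemma smooth_row_frechet s y : box x0 d y ->
  row_frechet (iter_partial s rho) y (fun i => iter_partial (i :: s) rho y).
Proof.
move=> yx.
pose S := \big[Num.min/1]_j (d - `|y 0 j - x0 0 j|).
have S0 : 0 < S by apply: lt_bigmin => // j _; rewrite subr_gt0.
apply: (C1_row_frechet S0) => [w i wy|i]; last exact: (rho_smooth yx (i :: s)).1.
apply: (rho_smooth _ s).2 => j.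
have -> : w 0 j - x0 0 j = (w 0 j - y 0 j) + (y 0 j - x0 0 j) by ring.
apply: le_lt_trans (ler_normD _ _) _.
have := wy j; have : S <= d - `|y 0 j - x0 0 j| by exact: bigmin_le_cond.
by lra.
Qed.

(** [ca] and [cb] are the x- and y-derivatives of the real coordinate [i] of [phi], by the
    Cauchy-Riemann equations, written in the shape of [comp_lin]. *)
Let ca (i : 'I_(n + n)) z : R :=
  match fintype.split i with inl j => 1 * cRe (der 1 j z) + 0 * cRe (der 1 j z)
    | inr j => 1 * cIm (der 1 j z) + 0 * cRe (der 1 j z) end.
Let cb (i : 'I_(n + n)) z : R :=
  match fintype.split i with inl j => (-1) * cIm (der 1 j z) + 0 * cRe (der 1 j z)
    | inr j => 1 * cRe (der 1 j z) + 0 * cRe (der 1 j z) end.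

Lemma composition_closed F : composition_algebra F -> exists A B,
  [/\ composition_algebra A, composition_algebra B
    & forall z, cmod z < eps -> frechet F z (A z) (B z)].
Proof.
elim=> {F} [s|k j|k j|c|F G k l SF [A [B [SA SB HF]]] SG [P [Q [SP SQ HG]]]
  |F G SF [A [B [SA SB HF]]] SG [P [Q [SP SQ HG]]]].
- exists (fun z => \sum_i iter_partial (i :: s) rho (to_real (phi z)) * ca i z).
  exists (fun z => \sum_i iter_partial (i :: s) rho (to_real (phi z)) * cb i z); split.
  + apply: comp_sum => i; apply: comp_mul; first exact: comp_partial.
    by rewrite /ca; case: (fintype.split i) => j; apply: comp_lin;
      [exact: comp_re|exact: comp_re|exact: comp_im|exact: comp_re].
  + apply: comp_sum => i; apply: comp_mul; first exact: comp_partial.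
    by rewrite /cb; case: (fintype.split i) => j; apply: comp_lin;
      [exact: comp_im|exact: comp_re|exact: comp_re|exact: comp_re].
  + move=> z zU; apply: (frechet_chain (smooth_row_frechet s (phi_box zU))) => i.
    rewrite -(splitK i); case: (fintype.split i) => j /=; rewrite /ca /cb.
      rewrite (unsplitK (inl j)) !mul0r !addr0 mul1r mulN1r.
      have -> : (fun z => to_real (phi z) 0 (lshift n j)) = (fun z => cRe (der 0 j z)).
        by apply/funext => w; rewrite to_real_lshift der0.
      exact: (frechet_cderiv (derS 0 j zU)).1.
    rewrite (unsplitK (inr j)) !mul0r !addr0 !mul1r.
    have -> : (fun z => to_real (phi z) 0 (rshift n j)) = (fun z => cIm (der 0 j z)).
      by apply/funext => w; rewrite to_real_rshift der0.
    exact: (frechet_cderiv (derS 0 j zU)).2.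
- exists (fun z => cRe (der k.+1 j z)), (fun z => (-1) * cIm (der k.+1 j z) + 0 * cRe (der k.+1 j z)).
  split; [exact: comp_re|by apply: comp_lin; [exact: comp_im|exact: comp_re]|move=> z zU].
  by rewrite mul0r addr0 mulN1r; exact: (frechet_cderiv (derS k j zU)).1.
- exists (fun z => cIm (der k.+1 j z)), (fun z => cRe (der k.+1 j z)).
  split; [exact: comp_im|exact: comp_re|move=> z zU].
  exact: (frechet_cderiv (derS k j zU)).2.
- exists (fun _ => 0), (fun _ => 0); split; [exact: comp_cst|exact: comp_cst|].
  by move=> z _; exact: frechet_cst.
- exists (fun z => k * A z + l * P z), (fun z => k * B z + l * Q z).
  split; [exact: comp_lin|exact: comp_lin|move=> z zU].
  by apply: frechet_lin; [exact: HF|exact: HG].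
exists (fun z => 1 * (A z * G z) + 1 * (F z * P z)), (fun z => 1 * (B z * G z) + 1 * (F z * Q z)).
split; [by apply: comp_lin; exact: comp_mul|by apply: comp_lin; exact: comp_mul|move=> z zU].
by rewrite !mul1r; apply: frechetM; [exact: HF|exact: HG].
Qed.

End CompositionAlgebra.

(** * Taylor expansion of holomorphic functions *)

Section ComplexTaylor.
Variable R : realType.

Lemma cderiv_horner (p : {poly Cx R}) z : cderiv (horner p) z (p^`()).[z].
Proof.
elim/poly_ind: p => [|p c IH].
  have -> : horner (0 : {poly Cx R}) = (fun _ => 0) by apply/funext => w; rewrite horner0.
  by rewrite deriv0 horner0; exact: cderiv_cst.
have -> : horner (p * 'X + c%:P) = (fun w => p.[w] * w + c) by apply/funext => w; rewrite hornerMXaddC.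
rewrite derivMXaddC hornerD hornerMX [p.[z] + _]addrC.
have := cderivD (cderivM IH (cderiv_id z)) (cderiv_cst c z).
by rewrite addr0 mulr1.
Qed.

Definition taylor_poly (f : nat -> Cx R -> Cx R) n : {poly Cx R} :=
  \poly_(l < n) (f l 0 / l`!%:R).

Lemma taylor_poly_deriv f n : (taylor_poly f n.+1)^`() = taylor_poly (fun k => f k.+1) n.
Proof.
apply/polyP => i; rewrite coef_deriv !coef_poly ltnS; case: ifP => _; last by rewrite mul0rn.
rewrite factS natrM -[LHS]mulr_natr.
have a0 : (i.+1%:R : Cx R) != 0 by rewrite pnatr_eq0.
have b0 : (i`!%:R : Cx R) != 0 by rewrite pnatr_eq0 -lt0n fact_gt0.
move: (i.+1%:R : Cx R) a0 (i`!%:R : Cx R) b0 => p p0 q q0.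
by field; rewrite p0 q0.
Qed.

(** [f] lists a function and its successive derivatives. The Taylor remainder of [f] has the
    remainder of the shifted list as derivative and vanishes at 0, so the mean value inequality
    raises the order by one. *)
Lemma complex_taylor (f : nat -> Cx R -> Cx R) eps n : 0 < eps ->
  (forall k z, cmod z < eps -> cderiv (f k) z (f k.+1 z)) ->
  exists2 r, 0 < r & exists2 C, 0 <= C & forall z, cmod z < r ->
    cmod (f 0%N z - (taylor_poly f n).[z]) <= C * cmod z ^+ n.
Proof.
move=> eps0; elim: n f => [|n IH] f df.
  have z0 : cmod (0 : Cx R) < eps by rewrite cmod0.
  have [r r0 Hr] := cderiv_cont (df 0%N 0 z0) ltr01.
  exists r => //; exists (cmod (f 0%N 0) + 1); first by have := cmod_ge0 (f 0%N 0); lra.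
  move=> z zr; rewrite expr0 mulr1 (_ : taylor_poly f 0 = 0); last first.
    by apply/polyP => i; rewrite coef_poly coef0.
  rewrite horner0 subr0.
  have := Hr z zr; rewrite add0r => H.
  have -> : f 0%N z = (f 0%N z - f 0%N 0) + f 0%N 0 by rewrite subrK.
  by apply: le_trans (cmodD _ _) _; lra.
have [r r0 [C C0 HC]] := IH (fun k => f k.+1) (fun k => df k.+1).
exists (Num.min r eps); first by rewrite lt_min r0.
exists (2 * C); first by rewrite mulr_ge0.
move=> z; rewrite lt_min => /andP[zr zU].
pose g w := f 0%N w - (taylor_poly f n.+1).[w].
have dg w : cmod w < eps -> cderiv g w (f 1%N w - (taylor_poly (fun k => f k.+1) n).[w]).
  by move=> wU; rewrite -taylor_poly_deriv; apply: cderivB; [exact: df|exact: cderiv_horner].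
have g0 : g 0 = 0.
  by rewrite /g horner_coef0 coef_poly /= fact0 divr1 subrr.
have tz t : 0 <= t <= (1 : R) -> cmod (0 + ofR t * z) <= cmod z.
  by move=> /andP[t0 t1]; rewrite add0r cmodM cmod_ofR ger0_norm // ler_piMl ?cmod_ge0.
have := @cderiv_mean R g (fun t => f 1%N (0 + ofR t * z) - (taylor_poly (fun k => f k.+1) n).[0 + ofR t * z])
  0 z 0 (C * cmod z ^+ n.+1).
rewrite add0r g0 !subr0 mulrA; apply.
  by move=> t t01; apply: dg; exact: le_lt_trans (tz t t01) zU.
move=> t t01; rewrite subr0 cmodM exprSr mulrA ler_wpM2r ?cmod_ge0 //.
apply: le_trans (HC _ (le_lt_trans (tz t t01) zr)) _.
by rewrite ler_wpM2l // lerXn2r ?nnegrE ?cmod_ge0 ?tz.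
Qed.

Lemma wirtinger_holomorphic eps (g f f' : Cx R -> Cx R) : 0 < eps ->
  (forall z, cmod z < eps -> g z = f z) -> (forall z, cmod z < eps -> cderiv f z (f' z)) ->
  forall z, cmod z < eps -> wirtinger g z = f' z /\ wirtinger_bar g z = 0.
Proof.
move=> eps0 gf df z zU; have [F1 F2] := frechet_cderiv (df z zU).
have gE y : cmod y < eps -> g y = mkC (cRe (f y)) (cIm (f y)).
  by move=> yU; rewrite gf //; apply: eqC.
have D w := real_derivativeE w gE zU F1 F2.
rewrite /wirtinger /wirtinger_bar !D.
have h2 : (2 : Cx R)^-1 = ofR 2^-1 by rewrite ofRV ofR_nat.
by split; rewrite h2; apply: eqC; rewrite !cE; field.
Qed.

(** This turns [order0] of a holomorphic function into its usual vanishing order, as in [order0_ge]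
    and [order0_le]. *)
Lemma wirtinger_iter_holomorphic eps (f : nat -> Cx R -> Cx R) a b : 0 < eps ->
  (forall k z, cmod z < eps -> cderiv (f k) z (f k.+1 z)) ->
  iter a (@wirtinger R) (iter b (@wirtinger_bar R) (f 0%N)) 0 = (if b == 0%N then f a 0 else 0).
Proof.
move=> eps0 df.
have z0 : cmod (0 : Cx R) < eps by rewrite cmod0.
have Wn (h : nat -> Cx R -> Cx R) g : (forall k z, cmod z < eps -> cderiv (h k) z (h k.+1 z)) ->
    (forall z, cmod z < eps -> g z = h 0%N z) ->
    forall z, cmod z < eps -> iter a (@wirtinger R) g z = h a z.
  move=> dh gh; elim: a => //= k IH z zU.
  exact: (wirtinger_holomorphic eps0 IH (dh k) zU).1.
case: b => [|b]; first by rewrite (Wn f).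
have Z z : cmod z < eps -> iter b.+1 (@wirtinger_bar R) (f 0%N) z = 0.
  elim: b z => [|b IH] z zU.
    exact: (wirtinger_holomorphic eps0 (fun _ _ => erefl) (df 0%N) zU).2.
  apply: (wirtinger_holomorphic (f := fun _ => 0) (f' := fun _ => 0) eps0 IH _ zU).2 => w _.
  exact: cderiv_cst.
have dh (k : nat) z : cmod z < eps -> cderiv (fun _ => 0 : Cx R) z (0 : Cx R).
  by move=> _; exact: cderiv_cst.
by rewrite (Wn (fun _ _ => 0) _ dh Z 0 z0).
Qed.

End ComplexTaylor.

(** * Vanishing derivatives from power bounds *)

Section OneVariable.
Variable R : realType.

Let power_lower (u v : R -> R) (a r : R) (k : nat) : 0 <= a ->
  (forall x : R, 0 <= x <= r -> is_derive x 1 u (v x)) -> u 0 = 0 ->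
  (forall x : R, 0 <= x <= r -> a * x ^+ k <= v x) ->
  forall x : R, 0 <= x <= r -> a / k.+1%:R * x ^+ k.+1 <= u x.
Proof.
move=> a0 du u0 vl x /andP[x0 xr].
pose w t := u t - a / k.+1%:R * t ^+ k.+1.
have dw t : 0 <= t <= r -> is_derive t 1 w (v t - a * t ^+ k).
  move=> tr; apply: real_derivB; first exact: du.
  have E : a / k.+1%:R * (k.+1%:R * t ^+ k) = a * t ^+ k.
    have : (k.+1%:R : R) != 0 by rewrite pnatr_eq0.
    by move: (k.+1%:R : R) => p p0; field.
  rewrite -E; apply: real_derivZ.
  have -> : (fun s : R => s ^+ k.+1) = id ^+ k.+1 by apply/funext => s; rewrite exprfctE.
  rewrite -[X in is_derive _ _ _ X]mulr1.
  exact: (is_deriveX k.+1 (is_derive_id t (1 : R))).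
have cw : {within `[0, x], continuous w}.
  apply: derivable_within_continuous => t; rewrite in_itv /= => /andP[t0 tx].
  by have [] := dw t ltac:(by rewrite t0 (le_trans tx xr)).
have [t] := MVT_segment x0 (fun t tin => dw t ltac:(
  by move: tin; rewrite in_itv /= => /andP[/ltW -> /ltW tx]; exact: le_trans tx xr)) cw.
rewrite in_itv /= => /andP[t0 tx] E.
have w0 : w 0 = 0 by rewrite /w u0 expr0n /= mulr0 subrr.
have : 0 <= w x.
  rewrite w0 !subr0 in E; rewrite E; apply: mulr_ge0 => //.
  by rewrite subr_ge0 vl // t0 (le_trans tx xr).
by rewrite /w subr_ge0.
Qed.

(** Otherwise the first nonzero derivative, of order [j.+1 < n], keeps its sign near 0; integrating
    it [j.+1] times makes [u 0] at least a multiple of [x ^+ j.+1], which exceeds [C * x ^+ n] for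
    small [x]. *)
Lemma power_bound_derivatives (u : nat -> R -> R) (r : R) n (C : R) : 0 < r ->
  (forall j (x : R), `|x| < r -> is_derive x 1 (u j) (u j.+1 x)) ->
  (forall x : R, `|x| < r -> `|u 0%N x| <= C * `|x| ^+ n) ->
  forall j, (j < n)%N -> u j 0 = 0.
Proof.
move=> r0 du ub j; move: {-2}j (leqnn j) => i; elim: j i => [|j IH] i.
  rewrite leqn0 => /eqP -> n0; have := ub 0; rewrite normr0 => /(_ r0).
  by rewrite expr0n eqn0Ngt n0 mulr0 normr_le0 => /eqP.
rewrite leq_eqVlt ltnS => /orP[/eqP ->{i}|]; last exact: IH.
move=> jn; apply/eqP/negPn/negP => c0.
have [sg sgE] : exists sg : R, `|sg| = 1 /\ 0 < sg * u j.+1 0.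
  have [p|p] := ltP 0 (u j.+1 0); first by exists 1; rewrite normr1 mul1r.
  by exists (-1); rewrite normrN1 mulN1r oppr_gt0 lt_def eq_sym c0.
have [sg1 c1] := sgE.
pose c := sg * u j.+1 0.
have [s s0 Hs] := real_deriv_cont (du j.+1 0 ltac:(by rewrite normr0)) (divr_gt0 c1 (ltr0Sn R 1)).
pose q := Num.min r s / 2.
have m0 : 0 < Num.min r s by rewrite lt_min r0.
have q0 : 0 < q by rewrite divr_gt0.
have [qr qs] : q < r /\ q < s.
  have : Num.min r s <= r by rewrite ge_min lexx.
  have : Num.min r s <= s by rewrite ge_min lexx orbT.
  by rewrite /q; lra.
have inr x : 0 <= x <= q -> `|x| < r.
  by move=> /andP[x0 xq]; rewrite ger0_norm //; lra.
have low k : (k <= j.+1)%N -> forall x, 0 <= x <= q ->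
    c / 2 / k`!%:R * x ^+ k <= sg * u (j.+1 - k)%N x.
  elim: k => [_ x /andP[x0 xq]|k IHk kj x xq].
    rewrite fact0 divr1 expr0 mulr1 subn0.
    have := Hs x; rewrite add0r ger0_norm // => /(_ ltac:(lra)) A.
    have : `|sg * (u j.+1 x - u j.+1 0)| < c / 2 by rewrite normrM sg1 mul1r.
    by rewrite ltr_norml mulrBr -/c => /andP[]; lra.
  have -> : c / 2 / (k.+1)`!%:R = c / 2 / k`!%:R / k.+1%:R.
    rewrite factS natrM.
    have a0 : (k.+1%:R : R) != 0 by rewrite pnatr_eq0.
    have b0 : (k`!%:R : R) != 0 by rewrite pnatr_eq0 -lt0n fact_gt0.
    move: (k.+1%:R : R) a0 (k`!%:R : R) b0 => p p0 e e0.
    by field; rewrite p0 e0.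
  have jk : (j.+1 - k)%N = (j.+1 - k.+1).+1 by rewrite subnSK.
  apply: (power_lower (u := fun x => sg * u (j.+1 - k.+1)%N x) (v := fun x => sg * u (j.+1 - k)%N x) (r := q)) => //.
  - by rewrite !divr_ge0 // ltW.
  - by move=> y yq; rewrite jk; apply: real_derivZ; apply: du; exact: inr.
  - by rewrite IH ?mulr0 //; [rewrite subSS leq_subr|apply: leq_ltn_trans (ltnW jn); rewrite subSS leq_subr].
  - by apply: IHk; exact: ltnW.
have := low j.+1 (leqnn _); rewrite subnn => L.
have C0 : 0 <= `|C| by exact: normr_ge0.
pose a := c / 2 / (j.+1)`!%:R.
have a0 : 0 < a by rewrite !divr_gt0 // ltr0n fact_gt0.
pose x := Num.min (Num.min q 1) (a / (`|C| + 1) / 2).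
have C1 : 0 < `|C| + 1 by lra.
have x0 : 0 < x by rewrite !lt_min q0 ltr01 !divr_gt0.
have xq : x <= q by rewrite !ge_min lexx.
have x1 : x <= 1 by rewrite !ge_min lexx orbT.
have xa : x <= a / (`|C| + 1) / 2 by rewrite ge_min lexx orbT.
have A := L x ltac:(by rewrite (ltW x0) xq).
have B := ub x (inr x ltac:(by rewrite (ltW x0) xq)).
rewrite -/a in A.
have D : sg * u 0%N x <= `|C| * x ^+ j.+2.
  apply: le_trans (ler_norm _) _; rewrite normrM sg1 mul1r; apply: le_trans B _.
  rewrite (gtr0_norm x0); apply: (@le_trans _ _ (`|C| * x ^+ n)).
    by apply: ler_wpM2r; [exact: exprn_ge0 (ltW x0)|exact: ler_norm].
  by apply: ler_wpM2l => //; apply: ler_wiXn2l => //; exact: ltW.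
have {D}A := le_trans A D; move: A.
rewrite [x ^+ j.+2]exprS mulrA ler_pM2r ?exprn_gt0 //.
move: xa; rewrite ler_pdivlMr // ler_pdivlMr // => xa A.
have : 0 <= x by exact: ltW.
by lra.
Qed.

End OneVariable.

(** * Comparison of defining functions *)

Lemma shift_entry (R : realType) N (x : 'rV[R]_N) (c : R) (i j : 'I_N) :
  (x + c *: basis_vec R i) 0 j = x 0 j + c * (j == i)%:R.
Proof. by rewrite !mxE eqxx. Qed.

Section LocalDefiningFunction.
Variables (R : realType) (m' : nat).
Let m := m'.+1.
Let T := tube_domain R m.
Notation trho := (@tube_rho R m').
Variables (xi : 'rV[Cx R]_2) (rho : 'rV[R]_(2 + 2) -> R).
Hypothesis bxi : boundary T xi.
Hypothesis Hrho : smooth_defining_function T xi rho.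
Let x0 := to_real xi.
Let eQ := basis_vec R reQ.

Lemma boxS N (x : 'rV[R]_N) d d' y : d <= d' -> box x d y -> box x d' y.
Proof. by move=> dd H j; exact: lt_le_trans (H j) dd. Qed.

Lemma to_realK : cancel (@of_real R 2) (@to_real R 2).
Proof.
move=> x; apply/rowP => i; rewrite -(splitK i); case: (fintype.split i) => j /=.
  by rewrite to_real_lshift mxE.
by rewrite to_real_rshift mxE.
Qed.

Lemma defining_function_local : exists2 d, 0 < d &
  (forall y, box x0 d y -> forall s, {for y, continuous (iter_partial s rho)} /\
     forall i, derivable (iter_partial s rho) y (basis_vec R i)) /\
  (forall y, box x0 d y -> (trho y < 0) = (rho y < 0)).
Proof.
have [/nbhs_real_rowP[d1 d10 H1] _ /nbhs_rowP[d2 d20 H2]] := Hrho.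
exists (Num.min d1 (d2 / 2)); first by rewrite lt_min d10 divr_gt0.
split=> y yx; first by apply: H1 => j; apply: lt_le_trans (yx j) _; rewrite ge_min lexx.
have yj j : `|y 0 j - x0 0 j| < d2 / 2 by apply: lt_le_trans (yx j) _; rewrite ge_min lexx orbT.
have := H2 (of_real y); rewrite to_realK => E.
have {}E : T (of_real y) <-> rho y < 0.
  apply: E => j; apply: le_lt_trans (cmod_le _) _; rewrite !cE.
  have := yj (lshift 2 j); have := yj (rshift 2 j).
  by rewrite /x0 to_real_lshift to_real_rshift !mxE -/(mkC _ _) cRe_mkC cIm_mkC; lra.
have := tube_rhoP m' (of_real y); rewrite to_realK => E'.
by apply/idP/idP => h; [apply/E/E'|apply/E'/E].
Qed.

Lemma tube_rho_boundary : trho x0 = 0.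
Proof. by rewrite /x0 tube_rhoE (tube_boundary bxi) subrr. Qed.

Lemma tube_rho_shift y (c : R) : trho (y + c *: eQ) = trho y - c.
Proof.
rewrite /tube_rho !shift_entry eqxx (_ : (reZ == reQ) = false) // mulr0 addr0 mulr1.
by rewrite opprD addrA.
Qed.

(* Moving along Re Q from a point to the graph, where rho vanishes. *)
Lemma defining_function_mvt d2 : 0 < d2 -> exists2 d1, 0 < d1 & forall x, box x0 d1 x ->
  exists2 th, box x0 d2 th & rho x = - 'D_eQ rho th * trho x.
Proof.
move=> d20; have [d d0 [sm sgn]] := defining_function_local.
pose d3 := Num.min d d2; have d30 : 0 < d3 by rewrite lt_min d0.
have [d3d d3d2] : d3 <= d /\ d3 <= d2 by rewrite !ge_min !lexx orbT.
have [r r0 Hr] := power_cont (2 * m) (x0 0 reZ) (divr_gt0 d30 (ltr0Sn R 3)).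
pose d1 := Num.min r (d3 / 4).
have d10 : 0 < d1 by rewrite lt_min r0 divr_gt0.
have [d1r d14] : d1 <= r /\ d1 <= d3 / 4 by rewrite !ge_min !lexx orbT.
exists d1 => // x xx; pose s := trho x.
have s2 : `|s| < d3 / 2.
  have A := Hr (x 0 reZ) (lt_le_trans (xx reZ) d1r).
  have B := lt_le_trans (xx reQ) d14.
  have E0 := tube_rho_boundary; rewrite /tube_rho in E0.
  have -> : s = (x 0 reZ ^+ (2 * m) - x0 0 reZ ^+ (2 * m)) - (x 0 reQ - x0 0 reQ).
    by rewrite /s /tube_rho -/m; move: E0; rewrite -/m; lra.
  by apply: le_lt_trans (ler_normB _ _) _; lra.
have inb (c : R) : `|c| < d3 / 2 -> box x0 d3 (x + c *: eQ).
  move=> cs j; rewrite shift_entry.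
  have -> : x 0 j + c * (j == reQ)%:R - x0 0 j = (x 0 j - x0 0 j) + c * (j == reQ)%:R by ring.
  apply: le_lt_trans (ler_normD _ _) _; have := xx j.
  case: eqP => _; first by rewrite mulr1; lra.
  by rewrite mulr0 normr0; lra.
pose xs := x + s *: eQ.
have xs0 : trho xs = 0 by rewrite tube_rho_shift subrr.
have der c : `|c| < d3 / 2 -> is_derive (x + c *: eQ) eQ rho ('D_eQ rho (x + c *: eQ)).
  by move=> /inb /(boxS d3d) /sm /(_ [::])[_ /(_ reQ)] /derivableP.
(* [rho xs] is not negative, as [xs] lies outside the open tube; it is not positive, as raising Re Q
   by any small amount enters the tube, where [rho] is negative. *)
have rxs : rho xs = 0.
  apply/eqP; rewrite eq_le; apply/andP; split; last first.
    by rewrite leNgt -sgn ?xs0 ?ltxx //; apply: boxS d3d _; exact: inb.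
  rewrite leNgt; apply/negP => p.
  have L := directional_line (der s s2).
  have [r1 r10 Hr1] := real_deriv_cont L p.
  pose h := Num.min r1 (d3 / 2 - `|s|) / 2.
  have m0 : 0 < Num.min r1 (d3 / 2 - `|s|) by rewrite lt_min r10 subr_gt0.
  have h0 : 0 < h by rewrite divr_gt0.
  have [hr1 hs] : h < r1 /\ h < d3 / 2 - `|s|.
    have : Num.min r1 (d3 / 2 - `|s|) <= r1 by rewrite ge_min lexx.
    have : Num.min r1 (d3 / 2 - `|s|) <= d3 / 2 - `|s| by rewrite ge_min lexx orbT.
    by rewrite /h; lra.
  have := Hr1 h; rewrite gtr0_norm // => /(_ hr1).
  have : rho (x + (s + h) *: eQ) < 0.
    rewrite -sgn; first by rewrite tube_rho_shift -/s; lra.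
    apply: boxS d3d _; apply: inb; apply: le_lt_trans (ler_normD _ _) _.
    by rewrite (gtr0_norm h0); lra.
  by rewrite -/xs ltr_norml => A /andP[B _]; lra.
pose u t := rho (x + (t * s) *: eQ).
have ts t : 0 <= t <= (1 : R) -> `|t * s| < d3 / 2.
  by move=> /andP[t0 t1]; apply: le_lt_trans s2; rewrite normrM ger0_norm // ler_piMl.
have du t : 0 <= t <= (1 : R) -> is_derive t 1 u ('D_eQ rho (x + (t * s) *: eQ) * s).
  move=> t01; have L := directional_line (der _ (ts t t01)).
  have M : is_derive t 1 (fun t : R => t * s) s.
    have := real_derivM (is_derive_id t (1 : R)) (real_deriv_cst s t).
    by rewrite mulr0 add0r mulr1.
  exact: (@is_derive1_comp R (fun t => rho (x + t *: eQ)) (fun t => t * s) t _ _ L M).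
have cu : {within `[0, 1], continuous u}.
  apply: derivable_within_continuous => t; rewrite in_itv /= => t01.
  by have [] := du t t01.
have [t] := MVT_segment ler01 (fun t tin => du t ltac:(
  by move: tin; rewrite in_itv /= => /andP[/ltW -> /ltW ->])) cu.
rewrite in_itv /= => t01; rewrite /u mul1r mul0r scale0r addr0 -/xs rxs subr0 mulr1 sub0r => E.
exists (x + (t * s) *: eQ); first by apply: boxS d3d2 _; apply: inb; exact: ts.
by rewrite -/s mulNr -E opprK.
Qed.

(** If this derivative vanished, [defining_function_mvt] would make [rho] small compared with
    [tube_rho], which is at most linear along coordinate lines; then all partial derivatives of
    [rho] at the point would vanish, against regularity. *)
Lemma defining_function_DQ_neq0 : 'D_eQ rho x0 != 0.
Proof.
apply/negP => /eqP D0.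
have [d d0 [sm sgn]] := defining_function_local.
have x0d e : 0 < e -> box x0 e x0 by move=> e0 j; rewrite subrr normr0.
have rx0 : rho x0 = 0.
  have [d1 d10 H] := defining_function_mvt d0; have [th _ ->] := H x0 (x0d _ d10).
  by rewrite tube_rho_boundary mulr0.
have [_ [i /negP Di] _] := Hrho; apply: Di; rewrite -/x0; apply/eqP.
have dt : derivable trho x0 (basis_vec R i).
  by have [] := nbhs_singleton (tube_rho_smooth m' x0) [::].
have /directionalP/(_ 1 ltr01)[r r0 Hr] := derivableP dt.
pose k := `|'D_(basis_vec R i) trho x0| + 1.
have k0 : 0 < k by rewrite /k; have := normr_ge0 ('D_(basis_vec R i) trho x0); lra.
suff [_ ->] : is_derive x0 (basis_vec R i) rho 0 by [].
apply/directionalP => e e0.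
have ek : 0 < e / k by rewrite divr_gt0.
have cD : {for x0, continuous ('D_eQ rho)} by have [] := sm x0 (x0d _ d0) [:: reQ].
have /cvgrPdist_le/(_ _ ek)/nbhs_real_rowP[d2 d20 H2] := cD.
have [d1 d10 H1] := defining_function_mvt d20.
exists (Num.min r d1); first by rewrite lt_min r0.
move=> h; rewrite lt_min => /andP[hr hd].
have bx : box x0 d1 (x0 + h *: basis_vec R i).
  move=> j; rewrite shift_entry.
  have -> : x0 0 j + h * (j == i)%:R - x0 0 j = h * (j == i)%:R by ring.
  by case: eqP; rewrite ?mulr1 ?mulr0 ?normr0.
have [th thd ->] := H1 _ bx.
have := H2 th thd; rewrite D0 sub0r normrN => Dth.
have := Hr h hr; rewrite tube_rho_boundary subr0 mul1r => A.
have B : `|trho (x0 + h *: basis_vec R i)| <= k * `|h|.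
  have -> : trho (x0 + h *: basis_vec R i) = (trho (x0 + h *: basis_vec R i) -
    'D_(basis_vec R i) trho x0 * h) + 'D_(basis_vec R i) trho x0 * h by rewrite subrK.
  by apply: le_trans (ler_normD _ _) _; rewrite normrM /k; lra.
rewrite rx0 mul0r !subr0 normrM normrN.
apply: (@le_trans _ _ (e / k * (k * `|h|))); first exact: ler_pM.
by rewrite mulrA divfK // gt_eqF.
Qed.

(** The factor relating [rho] to [tube_rho] is a value of the Re Q-derivative near the boundary
    point, between [k / 2] and [2 k] in modulus; [2 k + 2 / k] serves both directions. *)
Lemma defining_function_compare : exists2 d1, 0 < d1 & exists2 C, 0 < C & forall x, box x0 d1 x ->
  `|trho x| <= C * `|rho x| /\ `|rho x| <= C * `|trho x|.
Proof.
have [d d0 [sm sgn]] := defining_function_local.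
have x0d e : 0 < e -> box x0 e x0 by move=> e0 j; rewrite subrr normr0.
pose k := `|'D_eQ rho x0|; have k0 : 0 < k by rewrite normr_gt0 defining_function_DQ_neq0.
have cD : {for x0, continuous ('D_eQ rho)} by have [] := sm x0 (x0d _ d0) [:: reQ].
have /cvgrPdist_le/(_ _ (divr_gt0 k0 (ltr0Sn R 1)))/nbhs_real_rowP[d2 d20 H2] := cD.
have [d1 d10 H1] := defining_function_mvt d20.
exists d1 => //; exists (2 * k + 2 / k); first by apply: addr_gt0; [exact: mulr_gt0|exact: divr_gt0].
move=> x /H1[th thd ->].
have := H2 th thd => A; rewrite normrM normrN.
have Dl : k / 2 <= `|'D_eQ rho th|.
  have : k <= `|'D_eQ rho x0 - 'D_eQ rho th| + `|'D_eQ rho th|.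
    by rewrite /k -[X in `|X|](subrK ('D_eQ rho th)); exact: ler_normD.
  by lra.
have Du : `|'D_eQ rho th| <= 2 * k.
  have : `|'D_eQ rho th| <= `|'D_eQ rho th - 'D_eQ rho x0| + k.
    by rewrite /k -[X in `|X| <= _](subrK ('D_eQ rho x0)); exact: ler_normD.
  by rewrite distrC; lra.
set D := `|_| in Dl Du *; set t := `|_|; have t0 : 0 <= t by exact: normr_ge0.
have kk : 0 < 2 / k by rewrite divr_gt0.
split.
  have : t <= 2 / k * (D * t).
    have -> : 2 / k * (D * t) = 2 * D / k * t by ring.
    rewrite -[leLHS]mul1r ler_wpM2r // ler_pdivlMr //; lra.
  have D0 : 0 <= D by lra.
  have : 0 <= 2 * k * (D * t) by apply: mulr_ge0; [apply: mulr_ge0 => //; exact: ltW|exact: mulr_ge0].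
  by rewrite mulrDl; lra.
apply: ler_wpM2r => //; lra.
Qed.

End LocalDefiningFunction.

(** * Averages over rotations *)

Section RotationMeans.
Variable R : realType.

(** A root of -1 of degree [2 ^ s] has order dividing [2 ^ s.+1] but not [2 ^ s]; among powers of
    two this leaves only [2 ^ s.+1]. *)
Lemma two_power_root s : exists2 w : Cx R, cmod w = 1 & (2 ^ s.+1)%N.-primitive_root w.
Proof.
pose w : Cx R := (2 ^ s)%N.-root (-1).
have n0 : (0 < 2 ^ s)%N by rewrite expn_gt0.
have ws : w ^+ (2 ^ s) = -1 by exact: rootCK.
have wM : w ^+ (2 ^ s.+1) = 1 by rewrite expnS mulnC exprM ws sqrrN expr1n.
exists w.
  have : cmod w ^+ (2 ^ s) = 1 by rewrite -cmodX ws cmodN cmod1.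
  by move/eqP; rewrite pexpr_eq1 ?cmod_ge0 // => /eqP.
have M0 : (0 < 2 ^ s.+1)%N by rewrite expn_gt0.
have [d dw dM] := prim_order_exists M0 wM.
have /(dvdn_pfactor _ _ (isT : prime 2))[e es de] := dM.
move: es; rewrite leq_eqVlt ltnS => /orP[/eqP <-|es]; first by rewrite -de.
have : (d %| 2 ^ s)%N by rewrite de dvdn_exp2l.
rewrite (prim_order_dvd dw) ws eqr_oppLR => /eqP h.
have := congr1 (@cRe R) h; rewrite cReN cRe1 => h1.
by exfalso; move: h1 (@ltr01 R); clear; lra.
Qed.

Lemma primitive_root_sum M (w : Cx R) l : M.-primitive_root w -> (0 < l < M)%N ->
  \sum_(j < M) (w ^+ j) ^+ l = 0.
Proof.
move=> pw /andP[l0 lM].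
have x1 : w ^+ l - 1 != 0.
  rewrite subr_eq0 -(prim_order_dvd pw); apply/negP => /(dvdn_leq l0).
  by rewrite leqNgt lM.
apply: (mulfI x1); rewrite mulr0.
have -> : \sum_(j < M) (w ^+ j) ^+ l = \sum_(j < M) (w ^+ l) ^+ j.
  by apply: eq_bigr => j _; rewrite -!exprM mulnC.
by rewrite -subrX1 -exprM mulnC exprM (prim_expr_order pw) expr1n subrr.
Qed.

Variables (f : nat -> Cx R -> Cx R) (eps : R).
Hypothesis eps0 : 0 < eps.
Hypothesis df : forall k z, cmod z < eps -> cderiv (f k) z (f k.+1 z).

(* Averaging over the vertices of a regular polygon kills the low order part
   of the Taylor expansion. *)
Lemma rotation_sum N : f 0%N 0 = 0 -> exists M w, [/\ (0 < M)%N, cmod w = 1 :> R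
  & exists2 r, 0 < r & exists2 C, 0 <= C & forall z, cmod z < r ->
    cmod (\sum_(j < M) f 0%N (w ^+ j * z)) <= C * cmod z ^+ N].
Proof.
move=> f00; have [w w1 pw] := two_power_root N.
pose M := (2 ^ N.+1)%N.
have NM : (N < M)%N by apply: ltn_trans (ltn_expl N (isT : (1 < 2)%N)) _; rewrite ltn_exp2l.
have M0 : (0 < M)%N by exact: leq_ltn_trans NM.
exists M, w; split => //.
have [r r0 [C C0 HC]] := complex_taylor M eps0 df.
exists (Num.min r 1); first by rewrite lt_min r0 ltr01.
exists (M%:R * C); first by rewrite mulr_ge0.
move=> z; rewrite lt_min => /andP[zr z1].
have wz j : cmod (w ^+ j * z) = cmod z by rewrite cmodM cmodX w1 expr1n mul1r.
have T0 : \sum_(j < M) (taylor_poly f M).[w ^+ j * z] = 0.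
  under eq_bigr => j _ do rewrite /taylor_poly horner_poly.
  rewrite exchange_big /= big1 // => l _.
  under eq_bigr => j _ do rewrite exprMn [_ * z ^+ l]mulrC mulrA.
  rewrite -mulr_sumr.
  (* Degrees strictly between 0 and [M] cancel over the polygon; degree 0 drops out because [f]
     vanishes at 0. *)
  have [l0|l0] := posnP l; last by rewrite primitive_root_sum ?mulr0 // l0 ltn_ord.
  by rewrite l0 f00 !mul0r.
have -> : \sum_(j < M) f 0%N (w ^+ j * z) =
    \sum_(j < M) (f 0%N (w ^+ j * z) - (taylor_poly f M).[w ^+ j * z]).
  by rewrite sumrB T0 subr0.
have S k (g : 'I_k -> Cx R) : cmod (\sum_i g i) <= \sum_i cmod (g i).
  elim: k g => [|k IH] g; first by rewrite !big_ord0 cmod0.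
  rewrite !big_ord_recr /=; apply: le_trans (cmodD _ _) _.
  by rewrite lerD2r IH.
apply: le_trans (S _ _) _.
apply: (@le_trans _ _ (\sum_(j < M) C * cmod z ^+ N)).
  apply: ler_sum => j _; apply: (@le_trans _ _ (C * cmod z ^+ M)).
    by have := HC (w ^+ j * z); rewrite wz => /(_ zr).
  by apply: ler_wpM2l => //; apply: ler_wiXn2l; rewrite ?cmod_ge0 ?(ltW z1) // ltnW.
by rewrite sumr_const card_ord -[leLHS]mulr_natl mulrA.
Qed.

Lemma leading_term k : (forall l, (l < k)%N -> f l 0 = 0) ->
  exists2 r, 0 < r & exists2 C, 0 <= C & forall z, cmod z < r ->
    cmod (f 0%N z - f k 0 / k`!%:R * z ^+ k) <= C * cmod z ^+ k.+1.
Proof.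
move=> H; have [r r0 [C C0 HC]] := complex_taylor k.+1 eps0 df.
exists r => //; exists C => // z /HC.
rewrite /taylor_poly horner_poly big_ord_recr /= big1 ?add0r // => i _.
by rewrite H // !mul0r.
Qed.

Lemma order0_ge k : (forall l, (l < k)%N -> f l 0 = 0) -> (k%:R%:E <= order0 (f 0%N))%E.
Proof.
move=> H; apply: le_ereal_inf_tmp => _ [[a b] /= ab <-]; rewrite lee_fin ler_nat.
move: ab; rewrite (wirtinger_iter_holomorphic a b eps0 df).
case: b => [|b] /= fa; last by rewrite eqxx in fa.
by rewrite addn0 leqNgt; apply/negP => /H h; rewrite h eqxx in fa.
Qed.

Lemma order0_le k : f k 0 != 0 -> (order0 (f 0%N) <= k%:R%:E)%E.
Proof.
move=> fk; apply: ereal_inf_lbound; exists (k, 0%N) => /=; last by rewrite addn0.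
by rewrite (wirtinger_iter_holomorphic k 0 eps0 df).
Qed.

Lemma order0_eqy : (forall l, f l 0 = 0) -> order0 (f 0%N) = +oo%E.
Proof.
move=> H; apply/eqP; rewrite eq_le leey /=.
apply: le_ereal_inf_tmp => _ [[a b] /= ab <-].
by move: ab; rewrite (wirtinger_iter_holomorphic a b eps0 df) H if_same eqxx.
Qed.

End RotationMeans.

(** * Order of contact of a germ with the boundary *)

Section Contact.
Variables (R : realType) (m' : nat).
Let m := m'.+1.

(** By homogeneity the real part vanishes identically; its values at 1 and at a [k]-th root of i are
    [Re c] and [- Im c]. *)
Lemma real_part_monomial (c : Cx R) k : (0 < k)%N ->
  (forall e : R, 0 < e -> exists2 r : R, 0 < r & forall z, cmod z < r ->
     `|cRe (c * z ^+ k)| <= e * cmod z ^+ k) -> c = 0.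
Proof.
move=> k0 H.
have P (w : Cx R) : cRe (c * w ^+ k) = 0.
  apply/eqP/negPn/negP => n0; have p : 0 < `|cRe (c * w ^+ k)| by rewrite normr_gt0.
  have q0 : 0 <= cmod w ^+ k by rewrite exprn_ge0 // cmod_ge0.
  pose e := `|cRe (c * w ^+ k)| / 2 / (cmod w ^+ k + 1).
  have e0 : 0 < e by rewrite !divr_gt0 // ltr_wpDl.
  have [r r0 Hr] := H e e0.
  have w0 := cmod_ge0 w.
  have [t t0 tE] : exists2 t, 0 < t & t * (cmod w + 1) = r / 2.
    by exists (r / 2 / (cmod w + 1)); rewrite ?divr_gt0 ?ltr_wpDl // divfK // gt_eqF // ltr_wpDl.
  have tw : cmod (ofR t * w) < r by rewrite cmodM cmod_ofR gtr0_norm //; lra.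
  have := Hr _ tw.
  have -> : c * (ofR t * w) ^+ k = ofR (t ^+ k) * (c * w ^+ k) by rewrite exprMn ofRX; ring.
  rewrite cReM cRe_ofR cIm_ofR mul0r subr0 normrM cmodM cmod_ofR exprMn.
  have tk : 0 < t ^+ k by rewrite exprn_gt0.
  rewrite (gtr0_norm t0) (gtr0_norm tk) mulrCA ler_pM2l //.
  rewrite /e mulrAC ler_pdivlMr ?ltr_wpDl //.
  have : 0 <= `|cRe (c * w ^+ k)| * cmod w ^+ k by rewrite mulr_ge0.
  by lra.
have := P 1; rewrite expr1n mulr1 => re.
have := P (k.-root (mkC 0 1)); rewrite rootCK // !cE mulr0 mulr1 sub0r => /eqP.
by rewrite oppr_eq0 => /eqP im; apply: eqC.
Qed.

Let F (a u : R) := (a + u) ^+ (2 * m) - a ^+ (2 * m) - tangent_slope m' a * u.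

(** [F a u] is the height of the graph above its tangent at [a]. For [a = 0] it is [u ^+ (2 * m)];
    otherwise the curvature term of [tangent_ineq] gives a multiple of [u ^+ 2], which is larger on
    the unit interval. *)
Lemma tangent_gap_lower a : exists2 c, 0 < c & forall u, `|u| <= 1 -> c * u ^+ (2 * m) <= F a u.
Proof.
have [->|a0] := eqVneq a 0.
  exists 1 => // u _; rewrite /F add0r /tangent_slope /m mulnS !expr0n /= mulr0 mul0r !subr0.
  by rewrite mul1r.
have c0 : 0 < m%:R * a ^+ (2 * m') by rewrite mulr_gt0 // exprM exprn_gt0 // lt_def sqrf_eq0 a0 sqr_ge0.
exists (m%:R * a ^+ (2 * m')) => // u u1.
have := tangent_ineq m' a u; rewrite -/m /F => I.
have : m%:R * a ^+ (2 * m') * u ^+ (2 * m) <= m%:R * a ^+ (2 * m') * u ^+ 2.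
  rewrite ler_pM2l // /m mulnS exprD ler_piMr ?sqr_ge0 // exprM -(real_normK (num_real u)).
  by rewrite -exprM exprn_ile1.
by lra.
Qed.

Lemma tangent_gap_upper a : exists2 r, 0 < r & forall u, `|u| < r -> `|F a u| <= `|u|.
Proof.
have D : is_derive a 1 (fun x : R => x ^+ (2 * m)) (tangent_slope m' a).
  have -> : (fun s : R => s ^+ (2 * m)) = id ^+ (2 * m) by apply/funext => s; rewrite exprfctE.
  rewrite -[tangent_slope m' a]mulr1; exact: (is_deriveX (2 * m) (is_derive_id a (1 : R))).
have [r r0 Hr] := (is_derive_realP _ _ _).1 D 1 ltr01.
by exists r => // u /Hr; rewrite mul1r.
Qed.

Variables (p q : nat -> Cx R -> Cx R) (a eps : R) (k : nat).
Hypothesis eps0 : 0 < eps.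
Hypothesis dp : forall k z, cmod z < eps -> cderiv (p k) z (p k.+1 z).
Hypothesis dq : forall k z, cmod z < eps -> cderiv (q k) z (q k.+1 z).
Hypothesis k0 : (0 < k)%N.
Hypothesis pk : forall l, (l < k)%N -> p l 0 = 0.
Hypothesis qk : forall l, (l < k)%N -> q l 0 = 0.

(** [p] and [q] are the increments of Z and Q along a germ through a boundary point with Re Z equal
    to [a], both vanishing to order [k] at least. Contact beyond [2 * m * k] forces both to vanish
    to higher order. *)
Lemma contact_order C r : 0 < r -> (forall z, cmod z < r ->
    `|(a + cRe (p 0%N z)) ^+ (2 * m) - a ^+ (2 * m) - cRe (q 0%N z)|
      <= C * cmod z ^+ (2 * m * k).+1) ->
  p k 0 = 0 /\ q k 0 = 0.
Proof.
move=> r0 HC; pose N := (2 * m * k).+1; pose sl := tangent_slope m' a.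
(* The contact defect is [F a (Re p) - Re H]: all harmonic terms are collected in the holomorphic
   [H], which the rotation average makes small, and the nonnegative convex part remains. *)
pose H n z := q n z + (- ofR sl) * p n z.
have dH n z : cmod z < eps -> cderiv (H n) z (H n.+1 z).
  move=> zU; have := cderivD (dq n zU) (cderivM (cderiv_cst (- ofR sl) z) (dp n zU)).
  by rewrite mul0r add0r.
have HE z : cRe (H 0%N z) = cRe (q 0%N z) - sl * cRe (p 0%N z).
  by rewrite /H !cE; ring.
have H0 : H 0%N 0 = 0 by rewrite /H pk // qk // mulr0 addr0.
have C1 : 0 <= `|C| by [].
have gap z : cmod z < r -> `|F a (cRe (p 0%N z)) - cRe (H 0%N z)| <= `|C| * cmod z ^+ N.
  move=> zr; have -> : F a (cRe (p 0%N z)) - cRe (H 0%N z) =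
     (a + cRe (p 0%N z)) ^+ (2 * m) - a ^+ (2 * m) - cRe (q 0%N z) by rewrite HE /F -/sl; ring.
  apply: le_trans (HC z zr) _; apply: ler_wpM2r; last exact: ler_norm.
  by rewrite exprn_ge0 // cmod_ge0.
have [cl cl0 Hlow] := tangent_gap_lower a.
have [ru ru0 Hup] := tangent_gap_upper a.
have z0 : cmod (0 : Cx R) < eps by rewrite cmod0.
have m1 : 0 < Num.min 1 ru by rewrite lt_min ltr01.
have [r1 r10 Hr1] := cderiv_cont (dp 0%N z0) m1.
have psmall z : cmod z < r1 -> `|cRe (p 0%N z)| < Num.min 1 ru.
  move=> /Hr1; rewrite add0r (pk (l := 0%N)) // subr0; exact: le_lt_trans (cRe_le _).
have F0 z : cmod z < r1 -> 0 <= F a (cRe (p 0%N z)).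
  move=> /psmall; rewrite lt_min => /andP[/ltW h _]; apply: le_trans (Hlow _ h).
  by rewrite mulr_ge0 ?(ltW cl0) // exprM exprn_ge0 // sqr_ge0.
have [M [w [M0 w1 [r2 r20 [C2 C20 HM]]]]] := rotation_sum eps0 dH N H0.
pose C3 := C2 + M%:R * `|C|.
have C30 : 0 <= C3 by rewrite addr_ge0 // mulr_ge0.
have [r3 r30 r3E] : exists2 r3, 0 < r3 & r3 = Num.min (Num.min r r1) (Num.min r2 1).
  by exists (Num.min (Num.min r r1) (Num.min r2 1)); rewrite // !lt_min r0 r10 r20 ltr01.
(* All terms of the rotated sum are nonnegative, so the sum bounds its term of index 0, the value at
   [z] itself. *)
have Fsmall z : cmod z < r3 -> F a (cRe (p 0%N z)) <= C3 * cmod z ^+ N.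
  rewrite r3E !lt_min => /andP[/andP[zr zr1] /andP[zr2 z1]].
  have wz j : cmod (w ^+ j * z) = cmod z by rewrite cmodM cmodX w1 expr1n mul1r.
  have S : \sum_(j < M) F a (cRe (p 0%N (w ^+ j * z))) <= C3 * cmod z ^+ N.
    have A : \sum_(j < M) F a (cRe (p 0%N (w ^+ j * z))) <=
       \sum_(j < M) (cRe (H 0%N (w ^+ j * z)) + `|C| * cmod z ^+ N).
      apply: ler_sum => j _; have := gap (w ^+ j * z); rewrite wz => /(_ zr).
      by rewrite ler_norml => /andP[_]; lra.
    apply: le_trans A _; rewrite big_split /= sumr_const card_ord -[X in _ + X]mulr_natl.
    have -> : \sum_(j < M) cRe (H 0%N (w ^+ j * z)) = cRe (\sum_(j < M) H 0%N (w ^+ j * z)).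
      by elim/big_rec2: _ => // j x y _ ->; rewrite cReD.
    have B := HM z zr2; have D := le_trans (ler_norm _) (cRe_le (\sum_(j < M) H 0%N (w ^+ j * z))).
    by rewrite /C3 mulrDl mulrA lerD2r; exact: le_trans D B.
  apply: le_trans S; case: (M) M0 wz => // M1 _ wz; rewrite big_ord_recl expr0 mul1r lerDl.
  by apply: sumr_ge0 => j _; apply: F0; rewrite wz.
have psq z : cmod z < r3 -> cl * cRe (p 0%N z) ^+ (2 * m) <= C3 * cmod z ^+ N.
  move=> zr3; apply: le_trans (Fsmall z zr3); apply: Hlow.
  have : cmod z < r1 by move: zr3; rewrite r3E !lt_min => /andP[/andP[]].
  by move=> /psmall; rewrite lt_min => /andP[/ltW].
have kf : (k`!%:R : Cx R) != 0 by rewrite pnatr_eq0 -lt0n fact_gt0.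
have coef0 (x : Cx R) : x / k`!%:R = 0 -> x = 0.
  by move/eqP; rewrite mulf_eq0 invr_eq0 (negbTE kf) orbF => /eqP.
have [r4 r40 [C4 C40 H4]] := leading_term eps0 dp pk.
(* [cl * (Re p) ^+ (2 * m)] is of order [2 * m * k + 1], one more than the power [2 * m] of [|z|^k];
   so Re p is small compared with [|z|^k], and so is the real part of the leading monomial. *)
have p0 : p k 0 = 0.
  apply: coef0; apply: (real_part_monomial k0) => e e0.
  have e2 : 0 < e / 2 by rewrite divr_gt0.
  pose E := (e / 2) ^+ (2 * m) * cl / (C3 + 1).
  have E0 : 0 < E by rewrite divr_gt0 ?mulr_gt0 ?exprn_gt0 // ltr_wpDl.
  pose s := Num.min (Num.min r3 r4) (Num.min E (e / 2 / (C4 + 1))).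
  exists s; first by rewrite !lt_min r30 r40 E0 divr_gt0 // ltr_wpDl.
  move=> z; rewrite !lt_min => /andP[/andP[zr3 zr4] /andP[zE ze]].
  have z0' := cmod_ge0 z; have zk : 0 <= cmod z ^+ k by rewrite exprn_ge0.
  have A : `|cRe (p 0%N z)| <= e / 2 * cmod z ^+ k.
    have n1 : 0 <= e / 2 * cmod z ^+ k by apply: mulr_ge0 => //; exact: ltW.
    rewrite -(@ler_pXn2r _ (2 * m)) ?nnegrE // ?muln_gt0 //.
    rewrite exprMn -exprM [(k * _)%N]mulnC.
    have -> : `|cRe (p 0%N z)| ^+ (2 * m) = cRe (p 0%N z) ^+ (2 * m).
      by rewrite [LHS]exprM real_normK ?num_real // -exprM.
    rewrite -(ler_pM2l cl0); apply: le_trans (psq z zr3) _.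
    rewrite /N exprS.
    have zz : 0 <= cmod z ^+ (2 * m * k) by rewrite exprn_ge0.
    rewrite !mulrA ler_wpM2r //.
    move: zE; rewrite ltr_pdivlMr ?ltr_wpDl // => zE.
    by have := mulr_ge0 z0' C30; lra.
  have B := H4 z zr4.
  have D := le_trans (cRe_le _) B; rewrite cReB in D.
  have G : C4 * cmod z ^+ k.+1 <= e / 2 * cmod z ^+ k.
    rewrite exprS mulrA ler_wpM2r //; move: ze; rewrite ltr_pdivlMr ?ltr_wpDl // => ze.
    by lra.
  have -> : cRe (p k 0 / k`!%:R * z ^+ k) = cRe (p 0%N z) -
     (cRe (p 0%N z) - cRe (p k 0 / k`!%:R * z ^+ k)) by ring.
  by apply: le_trans (ler_normB _ _) _; lra.
(* Now [p] is of order [k.+1], hence so is [F a (Re p)] by [tangent_gap_upper]; the contact bound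
   passes this on to Re H and from there to Re q. *)
split => //; apply: coef0; apply: (real_part_monomial k0) => e e0.
have [r5 r50 [C5 C50 H5]] := leading_term eps0 dq qk.
pose C6 := (1 + `|sl|) * C4 + `|C| + C5.
have C60 : 0 <= C6 by rewrite !addr_ge0 // mulr_ge0 // addr_ge0.
pose s := Num.min (Num.min r3 r4) (Num.min r5 (e / (C6 + 1))).
exists s; first by rewrite !lt_min r30 r40 r50 divr_gt0 // ltr_wpDl.
move=> z; rewrite !lt_min => /andP[/andP[zr3 zr4] /andP[zr5 ze]].
have z0' := cmod_ge0 z; have zk : 0 <= cmod z ^+ k.+1 by rewrite exprn_ge0.
move: (zr3); rewrite r3E !lt_min => /andP[/andP[zr zr1] /andP[_ z1]].
have P1 : `|cRe (p 0%N z)| <= C4 * cmod z ^+ k.+1.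
  by have := H4 z zr4; rewrite p0 !mul0r subr0; exact: le_trans (cRe_le _).
have P2 : `|F a (cRe (p 0%N z))| <= C4 * cmod z ^+ k.+1.
  by apply: le_trans (Hup _ _) P1; have := psmall z zr1; rewrite lt_min => /andP[].
have P3 : `|C| * cmod z ^+ N <= `|C| * cmod z ^+ k.+1.
  apply: ler_wpM2l => //; apply: ler_wiXn2l => //; first exact: ltW.
  by rewrite ltnS leq_pmull // muln_gt0.
have P4 := gap z zr.
have P5 := le_trans (cRe_le _) (H5 z zr5); rewrite cReB in P5.
have -> : cRe (q k 0 / k`!%:R * z ^+ k) =
   (F a (cRe (p 0%N z)) - (F a (cRe (p 0%N z)) - cRe (H 0%N z)) + sl * cRe (p 0%N z)) -
   (cRe (q 0%N z) - cRe (q k 0 / k`!%:R * z ^+ k)) by rewrite HE; ring.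
have P6 : `|sl * cRe (p 0%N z)| <= `|sl| * (C4 * cmod z ^+ k.+1) by rewrite normrM ler_wpM2l.
apply: (@le_trans _ _ (C6 * cmod z ^+ k.+1)); last first.
  rewrite exprS mulrA; apply: ler_wpM2r; first by rewrite exprn_ge0.
  by move: ze; rewrite ltr_pdivlMr ?ltr_wpDl // => ze; lra.
apply: le_trans (ler_normB _ _) _; apply: le_trans (lerD (ler_normD _ _) (lexx _)) _.
apply: le_trans (lerD (lerD (ler_normB _ _) (lexx _)) (lexx _)) _.
by rewrite /C6; lra.
Qed.

End Contact.

(** * Holomorphic germs and their D'Angelo quotients *)

Section Germs.
Variables (R : realType) (n : nat).

Lemma holomorphic_derivatives (f : Cx R -> Cx R) eps :
  (forall z, cmod z < eps -> exists d, cderiv f z d) ->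
  forall k z, cmod z < eps ->
    cderiv (iter k (fun g => derive1 g) f) z (iter k.+1 (fun g => derive1 g) f z).
Proof.
move=> Hf; elim=> [|k IH] z zU /=.
  by have [d df] := Hf z zU; have [_ ->] := cderiv_derivable df.
have [d dd] := cderiv_deriv IH zU.
by have [_ ->] := cderiv_derivable dd.
Qed.

Lemma germ_data (xi : 'rV[Cx R]_n) (phi : Cx R -> 'rV[Cx R]_n) (d : R) : 0 < d ->
  (\forall zeta \near (0 : Cx R), derivable phi zeta 1) -> phi 0 = xi ->
  exists2 eps : R, 0 < eps & exists der : nat -> 'I_n -> Cx R -> Cx R,
    [/\ forall j z, der 0%N j z = phi z 0 j,
        forall k j z, cmod z < eps -> cderiv (der k j) z (der k.+1 j z)
      & forall z, cmod z < eps -> box (to_real xi) d (to_real (phi z))].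
Proof.
move=> d0 /nbhs_cmodP[e e0 He] phi0.
have dphi j z : cmod z < e -> exists c, cderiv (fun w => phi w 0 j) z c.
  move=> ze; exists (derive1 phi z 0 j); apply: derivable_entry; apply: He.
  by rewrite subr0.
have P (j : 'I_n) : exists r : R, 0 < r /\ forall z, cmod z < r -> cmod (phi z 0 j - xi 0 j) < d.
  have [c dc] := dphi j 0 ltac:(by rewrite cmod0).
  have [r r0 Hr] := cderiv_cont dc d0; exists r; split => // z /Hr.
  by rewrite add0r phi0.
have [r Hr] := choice P.
exists (Num.min e (\big[Num.min/1]_j r j)).
  by rewrite lt_min e0; apply: lt_bigmin => // j _; exact: (Hr j).1.
exists (fun k j => iter k (fun g => derive1 g) (fun z => phi z 0 j)); split => //.
  move=> k j z; rewrite lt_min => /andP[ze _].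
  exact: (holomorphic_derivatives (fun w we => dphi j w we)).
move=> z; rewrite lt_min => /andP[_ zr].
have zj j : cmod (phi z 0 j - xi 0 j) < d.
  by apply: (Hr j).2; apply: lt_le_trans zr _; exact: bigmin_le_cond.
move=> i; rewrite -(splitK i); case: (fintype.split i) => j /=.
  by rewrite !to_real_lshift -cReB; exact: le_lt_trans (cRe_le _) (zj j).
by rewrite !to_real_rshift -cImB; exact: le_lt_trans (cIm_le _) (zj j).
Qed.

End Germs.

Section TypeOfTube.
Variables (R : realType) (m' : nat).
Let m := m'.+1.
Let T := tube_domain R m.

Lemma curve_order0_2 (xi : 'rV[Cx R]_2) phi : curve_order0 xi phi =
  Order.min (order0 (fun z => phi z 0 0 - xi 0 0)) (order0 (fun z => phi z 0 1 - xi 0 1)).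
Proof.
rewrite /curve_order0 !big_ord_recl big_ord0.
have -> : lift ord0 ord0 = 1 :> 'I_2 by apply: val_inj.
by rewrite [X in Order.min _ X]min_l // leey.
Qed.

Variables (xi : 'rV[Cx R]_2) (rho : 'rV[R]_(2 + 2) -> R).
Hypothesis bxi : boundary T xi.
Hypothesis Hrho : smooth_defining_function T xi rho.

Let pullback (phi : Cx R -> 'rV[Cx R]_2) zeta : Cx R := real_complex R (rho (to_real (phi zeta))).

(** Collects on one disc what both bounds for the type use: the derivatives of the germ, the class
    for the Wirtinger calculus, and the comparison of the pullbacks of [rho] and [tube_rho]. *)
Lemma germ_pullback (phi : Cx R -> 'rV[Cx R]_2) : (\forall zeta \near (0 : Cx R), derivable phi zeta 1) -> phi 0 = xi ->
  exists2 eps : R, 0 < eps & exists der : nat -> 'I_2 -> Cx R -> Cx R, exists S : set (Cx R -> R),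
   [/\ forall j z, der 0%N j z = phi z 0 j,
       forall k j z, cmod z < eps -> cderiv (der k j) z (der k.+1 j z),
       forall F, S F -> exists A B, [/\ S A, S B & forall z, cmod z < eps -> frechet F z (A z) (B z)],
       forall F G (k l : R), S F -> S G -> S (fun z => k * F z + l * G z)
     & smooth_cfun eps S (pullback phi) /\ exists2 C : R, 0 < C & forall z, cmod z < eps ->
         `|tube_rho m' (to_real (phi z))| <= C * cmod (pullback phi z) /\
         cmod (pullback phi z) <= C * `|tube_rho m' (to_real (phi z))|].
Proof.
move=> dphi phi0.
have [d1 d10 [C C0 cmp]] := defining_function_compare bxi Hrho.
have [d2 d20 [sm _]] := defining_function_local Hrho.
pose d := Num.min d1 d2; have d0 : 0 < d by rewrite lt_min d10.
have [dd1 dd2] : d <= d1 /\ d <= d2 by rewrite !ge_min !lexx orbT.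
have [eps eps0 [der [der0 derS inb]]] := germ_data d0 dphi phi0.
exists eps => //; exists der, (composition_algebra rho phi der); split => //.
- apply: (composition_closed _ inb der0 derS) => y yb; apply: sm.
  exact: boxS dd2 yb.
- by move=> F G k l; exact: comp_lin.
split.
  exists (fun z => rho (to_real (phi z))), (fun _ => 0); split => //.
    exact: (comp_partial rho phi der [::]).
  exact: comp_cst.
exists C => // z /inb /(boxS dd1) /cmp.
by rewrite -[cmod _]/(cmod (ofR _)) cmod_ofR.
Qed.

Lemma dangelo_upper : (dangelo_type rho xi <= (2 * m)%:R%:E)%E.
Proof.
apply/ereal_supP => _ [phi [dphi phi0 nc] <-].
have [eps eps0 [der [S [der0 derS SD SL [sg [C C0 cmp]]]]]] := germ_pullback dphi phi0.
pose fs j k z := der k j z - (if k == 0%N then xi 0 j else 0).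
have dfs j k z : cmod z < eps -> cderiv (fs j k) z (fs j k.+1 z).
  by move=> zU; apply: cderivB; [exact: derS|exact: cderiv_cst].
have fs0 j : fs j 0%N = (fun z => phi z 0 j - xi 0 j).
  by apply/funext => z; rewrite /fs eqxx der0.
have fs00 j : fs j 0%N 0 = 0 by rewrite fs0 phi0 subrr.
rewrite curve_order0_2 -!fs0.
pose P (a : nat) := (fs 0 a 0 != 0) || (fs 1 a 0 != 0).
(* If all derivatives at 0 vanish, the divisor is [+oo] and the quotient is 0 by convention, so the
   bound holds without appeal to the identity theorem. *)
have [ex|nex] := pselect (exists a, P a); last first.
  have Z j a : fs j a 0 = 0.
    apply: contrapT => /eqP h; apply: nex; exists a; rewrite /P.
    have [jE|jE] : j = 0 \/ j = 1 by case: j h => -[|[|//]] h _; [left|right]; apply: val_inj.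
      by rewrite -jE h.
    by rewrite -jE h orbT.
  rewrite !(order0_eqy eps0 (dfs _)) //; try exact: Z.
  by rewrite minxx invey mule0 lee_fin.
have [k Pk kmin] := ex_minnP ex.
have low j l : (l < k)%N -> fs j l 0 = 0.
  move=> lk; apply/eqP/negPn/negP => h; have : P l.
    have [jE|jE] : j = 0 \/ j = 1 by case: j h => -[|[|//]] h _; [left|right]; apply: val_inj.
      by rewrite /P -jE h.
    by rewrite /P -jE h orbT.
  by move=> /kmin; rewrite leqNgt lk.
have k0 : (0 < k)%N.
  by rewrite lt0n; apply/eqP => kE; move: Pk; rewrite kE /P !fs00 eqxx.
have -> : Order.min (order0 (fs 0 0%N)) (order0 (fs 1 0%N)) = k%:R%:E.
  apply/eqP; rewrite eq_le le_min ge_min; apply/andP; split.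
    move: Pk => /orP[] h.
      by rewrite (order0_le eps0 (dfs 0)).
    by rewrite (order0_le eps0 (dfs 1)) // orbT.
  by rewrite !(order0_ge eps0 (dfs _)) //; exact: low.
rewrite inver pnatr_eq0 eqn0Ngt k0 /= lee_pdivrMr ?ltr0n //.
rewrite -EFinM -natrM leNgt; apply/negP => lt.
(* An order above [2 * m * k] kills all derivatives of total order up to and including [2 * m * k],
   which accounts for the successor. *)
have jv : jet_vanishes (2 * m * k).+1 (pullback phi).
  move=> a b; rewrite ltnS => ab; apply/eqP/negPn/negP => h.
  have : (order0 (pullback phi) <= (a + b)%:R%:E)%E by apply: ereal_inf_lbound; exists (a, b).
  by move=> /(lt_le_trans lt); rewrite lte_fin ltr_nat ltnNge ab.
have [r r0 [M HM]] := jet_bound eps0 SD SL sg jv.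
pose a := cRe (xi 0 1).
have xQ : cRe (xi 0 0) = a ^+ (2 * m) by exact: tube_boundary bxi.
have m0 : 0 < Num.min r eps by rewrite lt_min r0.
have [] := @contact_order R m' (fs 1) (fs 0) a eps k eps0 (dfs 1) (dfs 0) k0 (low 1) (low 0)
  (C * M) (Num.min r eps) m0.
  move=> z; rewrite lt_min => /andP[zr zU].
  have -> : (a + cRe (fs 1 0%N z)) ^+ (2 * m'.+1) - a ^+ (2 * m'.+1) - cRe (fs 0 0%N z) =
      tube_rho m' (to_real (phi z)).
    rewrite tube_rhoE !fs0 !cReB xQ -/a (_ : a + (cRe (phi z 0 1) - a) = cRe (phi z 0 1)).
      by rewrite -/m; ring.
    by ring.
  apply: le_trans (cmp z zU).1 _; rewrite -mulrA ler_pM2l //; exact: HM.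
by move=> h1 h0; move: Pk; rewrite /P h1 h0 eqxx.
Qed.

End TypeOfTube.

(** * The type at the origin *)

Section TypeAtOrigin.
Variables (R : realType) (m' : nat).
Let m := m'.+1.
Let T := tube_domain R m.
Variable rho : 'rV[R]_(2 + 2) -> R.
Hypothesis Hrho : smooth_defining_function T 0 rho.

Let phi (z : Cx R) : 'rV[Cx R]_2 := \row_j (if j == 0 then 0 else z).

Let phi_derivable z : derivable phi z 1.
Proof.
have [] := @is_derive_row R 2 phi z (fun j => if j == 0 then 0 else 1); last by [].
move=> j; have -> : (fun w => phi w 0 j) = (fun w => if j == 0 then 0 else w).
  by apply/funext => w; rewrite mxE.
by case: eqP => _; [exact: cderiv_cst|exact: cderiv_id].
Qed.

Let phi0 : phi 0 = 0.
Proof. by apply/rowP => j; rewrite !mxE; case: eqP. Qed.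

Let phi_germ : nonconstant_germ 0 phi.
Proof.
split => //; first by apply: filterE => z; exact: phi_derivable.
move=> /nbhs_cmodP[e e0 He].
have h : cmod (ofR (e / 2) - 0) < e.
  by rewrite subr0 cmod_ofR gtr0_norm ?divr_gt0 // ltr_pdivrMr // ltr_pMr // ltr1n.
have := congr1 (fun v : 'rV[Cx R]_2 => cRe (v 0 1)) (He _ h).
by rewrite !mxE /= => /eqP; rewrite gt_eqF // divr_gt0.
Qed.

Let phi_order : curve_order0 0 phi = 1%:E.
Proof.
have z1 : (0 : R) < 1 by exact: ltr01.
rewrite curve_order0_2.
have -> : (fun z => phi z 0 0 - (0 : 'rV[Cx R]_2) 0 0) = (fun _ => 0).
  by apply/funext => z; rewrite !mxE eqxx subr0.
have -> : (fun z => phi z 0 1 - (0 : 'rV[Cx R]_2) 0 1) = id.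
  by apply/funext => z; rewrite !mxE subr0.
have dz (k : nat) z : cmod z < 1 -> cderiv (fun _ => 0 : Cx R) z (0 : Cx R).
  by move=> _; exact: cderiv_cst.
rewrite (order0_eqy (f := fun _ _ => 0) z1 dz) // min_r ?leey //.
pose f (k : nat) (z : Cx R) : Cx R := if k is k'.+1 then (k' == 0%N)%:R else z.
have df k z : cmod z < 1 -> cderiv (f k) z (f k.+1 z).
  by move=> _; case: k => [|k]; [exact: cderiv_id|exact: cderiv_cst].
apply/eqP; rewrite eq_le; apply/andP; split.
  by apply: (order0_le (f := f) (k := 1) z1 df); rewrite /f /= oner_eq0.
by apply: (order0_ge (f := f) (k := 1) z1 df) => -[].
Qed.

Let phi_rho z : tube_rho m' (to_real (phi z)) = cRe z ^+ (2 * m).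
Proof. by rewrite tube_rhoE !mxE /= subr0. Qed.

(** Along [zeta |-> (0, zeta)] the pullback is bounded by a multiple of [(Re zeta) ^+ (2 * m)]. On
    each horizontal line [power_bound_derivatives] makes the x-derivatives of order below [2 * m]
    vanish on the imaginary axis, and [axis_jet_vanishes] extends this to all Wirtinger derivatives
    at 0. *)
Lemma dangelo_lower : ((2 * m)%:R%:E <= dangelo_type rho (0 : 'rV[Cx R]_2))%E.
Proof.
have dphi : \forall zeta \near (0 : Cx R), derivable phi zeta 1.
  by apply: filterE => z; exact: phi_derivable.
have [eps eps0 [der [S [der0 derS SD SL [sg [C C0 cmp]]]]]] :=
  germ_pullback (tube_boundary0 R m') Hrho dphi phi0.
set g := fun zeta : Cx R => _ in sg cmp.
apply: (@le_trans _ _ (order0 g / curve_order0 0 phi)%E); last first.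
  by apply: ereal_sup_ubound; exists phi => //; exact: phi_germ.
rewrite phi_order inve1 mule1.
have jv : jet_vanishes (2 * m) g.
  (* Half the radius keeps the square where [|x|] and [|y|] are below [eps / 2] inside the disc. *)
  have e20 : 0 < eps / 2 by rewrite divr_gt0.
  have ee : eps / 2 <= eps by lra.
  apply: (axis_jet_vanishes SD SL e20 ee sg) => j y jm ye.
  have inU (x : R) : `|x| < eps / 2 -> cmod (mkC x y) < eps.
    by move=> xe; apply: le_lt_trans (cmod_le _) _; rewrite cRe_mkC cIm_mkC; lra.
  have sI k : smooth_cfun eps S (iter k (@real_derivative R 1) g).
    by elim: k => // k IH; exact: smooth_real_derivative.
  have D k (x : R) : `|x| < eps / 2 -> _ :=
    fun xe => smooth_cfun_line SD (sI k) (inU x xe).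
  apply: eqC.
    apply: (power_bound_derivatives (u := fun k x => cRe (iter k (@real_derivative R 1) g (mkC x y)))
      (C := C) e20 _ _ jm) => [k x xe|x xe]; first exact: (D k x xe).1.
    apply: le_trans (cRe_le _) _; apply: le_trans (cmp _ (inU x xe)).2 _.
    by rewrite phi_rho cRe_mkC normrX.
  apply: (power_bound_derivatives (u := fun k x => cIm (iter k (@real_derivative R 1) g (mkC x y)))
    (C := C) e20 _ _ jm) => [k x xe|x xe]; first exact: (D k x xe).2.
  apply: le_trans (cIm_le _) _; apply: le_trans (cmp _ (inU x xe)).2 _.
  by rewrite phi_rho cRe_mkC normrX.
apply: le_ereal_inf_tmp => _ [[a b] /= ab <-]; rewrite lee_fin ler_nat leqNgt.
by apply/negP => /jv h; rewrite h eqxx in ab.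
Qed.

Lemma dangelo_origin : dangelo_type rho (0 : 'rV[Cx R]_2) = (2 * m)%:R%:E.
Proof.
apply/eqP; rewrite eq_le dangelo_lower andbT.
exact: dangelo_upper (tube_boundary0 R m') Hrho.
Qed.

End TypeAtOrigin.

Theorem theorem1p4 (R : realType) (m : nat) (hm : (1 <= m)%N) :
  [/\ is_domain (tube_domain R m), is_convex (tube_domain R m)
    & kobayashi_hyperbolic (tube_domain R m)] /\
  [/\ smooth_boundary (tube_domain R m),
      real_analytic_boundary (tube_domain R m),
      forall (xi : 'rV[Cx R]_2) (rho : 'rV[R]_(2 + 2) -> R),
        boundary (tube_domain R m) xi ->
        smooth_defining_function (tube_domain R m) xi rho ->
        (dangelo_type rho xi <= (2 * m)%:R%:E)%E,
      boundary (tube_domain R m) 0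
    & forall rho : 'rV[R]_(2 + 2) -> R,
        smooth_defining_function (tube_domain R m) 0 rho ->
        dangelo_type rho (0 : 'rV[Cx R]_2) = (2 * m)%:R%:E] /\
  ((m%:R * ln 2)%:E <= local_gromov_constant (tube_domain R m) 0)%E /\
  local_gromov_constant (tube_domain R m) 0 =
    gromov_constant (tube_domain R m) (kobayashi_dist (tube_domain R m)).
Proof.
case: m hm => // m' _; split; [|split; [|split]].
- by split; [exact: tube_is_domain|exact: tube_convex|exact: tube_hyperbolic].
- split.
  + exact: tube_smooth_boundary.
  + exact: tube_analytic_boundary.
  + by move=> xi rho; exact: dangelo_upper.
  + exact: tube_boundary0.
  + by move=> rho; exact: dangelo_origin.
- by rewrite local_gromov_constantE gromov_constant_ge.
- exact: local_gromov_constantE.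
Qed.
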